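(* For every $\bm{f}\in\bm{L}^1(\mathbb{S})$, $\bm{u}=\bm{P}_e\bm{f}$ converges non-tangentially to $\bm{f}$ almost everywhere on $\mathbb{S}$, i.e. $\lim_{x\in\Gamma_\xi,\,x\to\xi}\bm{u}(x)=\bm{f}(\xi)$ for $\sigma$-a.e. $\xi\in\mathbb{S}$. In particular this holds for every $\bm{u}\in\bm{h}^p_e(\mathbb{B})$, $1<p\le\infty$ (with $\bm{f}$ the function such that $\bm{u}=\bm{P}_e\bm{f}$). Moreover, every $\bm{u}\in\bm{h}^1_e(\mathbb{B})$ has non-tangential limits $\sigma$-almost everywhere on $\mathbb{S}$.
   Context: $\mathbb{B}$ is the open unit ball of $\mathbb{R}^3$, $\mathbb{S}$ the unit sphere, $\sigma$ surface measure. Lamé constants $\mu>0$, $2\mu+\lambda>0$; $\Delta^*\bm{u}=\mu\Delta\bm{u}+(\lambda+\mu)\nabla\,\mathrm{div}\,\bm{u}$. $\bm{h}^p_e(\mathbb{B})$ ($1\le p<\infty$): solutions of $\Delta^*\bm{u}=0$ with $\sup_{0\le r<1}\|\bm{u}(r\cdot)\|_{\bm{L}^p(\mathbb{S})}<\infty$; $\bm{h}^\infty_e$: bounded solutions. Every $\bm{u}\in\bm{h}^p_e$, $1<p\le\infty$, is of the form $\bm{P}_e\bm{f}$ with $\bm{f}\in\bm{L}^p(\mathbb{S})$. With $\beta=\frac{\lambda+\mu}{2\lambda+6\mu}$, $\alpha=\frac{\lambda+2\mu}{\lambda+3\mu}$, $P(x,\eta)=\frac{1}{4\pi}\frac{1-|x|^2}{|x-\eta|^3}$,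 $\Phi(x,\eta)=\frac{1}{4\pi}\int_0^1\big(\frac{1-t^2|x|^2}{(1-2tx\cdot\eta+t^2|x|^2)^{3/2}}-1-3tx\cdot\eta\big)\frac{dt}{t^{1+\alpha}}$, the elastic Poisson kernel is $\mathcal{P}_e(x,\eta)=P(x,\eta)\mathcal{I}+\mathcal{L}(x,\eta)$ with $\mathcal{L}_{ij}=\beta(1-|x|^2)\partial_{x_i}\partial_{x_j}\Phi$, and $\bm{P}_e\bm{f}(x)=\int_{\mathbb{S}}\mathcal{P}_e(x,\eta)\bm{f}(\eta)d\sigma(\eta)$. $\Gamma_\xi=\mathbb{B}\cap\mathrm{conv}(\{\xi\}\cup\{|x|\le1/2\})$ for $\xi\in\mathbb{S}$. *)

(* Defs.v *)
From mathcomp Require Import all_boot all_order all_algebra.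
From mathcomp Require Import all_classical all_reals all_analysis.
Import Order.TTheory GRing.Theory Num.Theory.
Import numFieldNormedType.Exports.

Set Implicit Arguments.
Unset Strict Implicit.
Unset Printing Implicit Defensive.

Local Open Scope ring_scope.
Local Open Scope classical_set_scope.

Section Elastic.
Variable R : realType.

Notation V3 := 'rV[R]_3.

Definition dot3 (x y : V3) : R := \sum_(i < 3) x 0 i * y 0 i.
Definition enorm3 (x : V3) : R := Num.sqrt (dot3 x x).

Definition ball3 : set V3 := [set x | enorm3 x < 1].
Definition sphere3 : set V3 := [set x | enorm3 x = 1].

(* d sigma = sin theta d theta d phi on the parameter rectangle.               *)
Definition sph (p : R * R) : V3 :=
  \row_(i < 3) (if i == 0 :> nat then sin p.1 * cos p.2
                else if i == 1 :> nat then sin p.1 * sin p.2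
                else cos p.1).

Definition param_rect : set (R * R) :=
  [set p | 0 < p.1 < pi /\ 0 < p.2 < 2 * pi].

Definition sigma_jac (p : R * R) : R := sin p.1.

Definition leb2 := (@lebesgue_measure R \x @lebesgue_measure R)%E.

Definition sigma_ae (P : V3 -> Prop) : Prop :=
  leb2.-negligible [set p | param_rect p /\ ~ P (sph p)].

Definition sint (g : V3 -> R) : R :=
  Rintegral leb2 param_rect (fun p => g (sph p) * sigma_jac p).

Definition sint_e (g : V3 -> R) : \bar R :=
  (\int[leb2]_(p in param_rect) (g (sph p) * sigma_jac p)%:E)%E.

Definition sintegrable (g : V3 -> R) : Prop :=
  leb2.-integrable param_rect (fun p => (g (sph p) * sigma_jac p)%:E).

Definition smeasurable (g : V3 -> R) : Prop :=
  measurable_fun param_rect (fun p => g (sph p)).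

Definition L1S (f : V3 -> V3) : Prop :=
  forall i : 'I_3, sintegrable (fun x => f x 0 i).

Definition LpS (p : \bar R) (f : V3 -> V3) : Prop :=
  (forall i : 'I_3, smeasurable (fun x => f x 0 i)) /\
  match p with
  | (q%:E)%E => (sint_e (fun x => (enorm3 (f x) `^ q)%R) < +oo)%E
  | (+oo)%E => exists M : R, sigma_ae (fun x => enorm3 (f x) <= M)
  | (-oo)%E => False
  end.

Definition e3 (i : 'I_3) : V3 := delta_mx 0 i.

Definition partial (i : 'I_3) (g : V3 -> R) : V3 -> R :=
  fun x => 'D_(e3 i) g x.

Variables lam mu : R.

Definition beta_c : R := (lam + mu) / (2 * lam + 6 * mu).
Definition alpha_c : R := (lam + 2 * mu) / (lam + 3 * mu).

Definition Pker (x eta : V3) : R :=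
  (4 * pi)^-1 * (1 - enorm3 x ^+ 2) / enorm3 (x - eta) ^+ 3.

Definition Phi (x eta : V3) : R :=
  (4 * pi)^-1 *
  Rintegral (@lebesgue_measure R) `[0, 1]%classic
    (fun t => ((1 - t ^+ 2 * enorm3 x ^+ 2) /
                 (1 - 2 * t * dot3 x eta + t ^+ 2 * enorm3 x ^+ 2) `^ (3 / 2)
               - 1 - 3 * t * dot3 x eta) / t `^ (1 + alpha_c)).

Definition Lker (x eta : V3) (i j : 'I_3) : R :=
  beta_c * (1 - enorm3 x ^+ 2) *
  partial i (partial j (fun y => Phi y eta)) x.

Definition Pe (x eta : V3) : 'M[R]_3 :=
  \matrix_(i < 3, j < 3) ((i == j)%:R * Pker x eta + Lker x eta i j).

Definition Pe_int (f : V3 -> V3) (x : V3) : V3 :=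
  \row_(i < 3) \sum_(j < 3) sint (fun eta => Pe x eta i j * f eta 0 j).

Definition comp (u : V3 -> V3) (i : 'I_3) : V3 -> R := fun x => u x 0 i.

Definition C2_ball (u : V3 -> V3) : Prop :=
  forall (i : 'I_3) (x : V3), ball3 x ->
    differentiable (comp u i) x /\
    (forall j : 'I_3, differentiable (partial j (comp u i)) x) /\
    (forall j k : 'I_3, {for x, continuous (partial k (partial j (comp u i)))}).

Definition lame_op (u : V3 -> V3) (x : V3) : V3 :=
  \row_(i < 3)
    (mu * \sum_(j < 3) partial j (partial j (comp u i)) x
     + (lam + mu) * \sum_(j < 3) partial i (partial j (comp u j)) x).

Definition lame_solution (u : V3 -> V3) : Prop :=
  C2_ball u /\ forall x, ball3 x -> lame_op u x = 0.

Definition hpe (p : \bar R) (u : V3 -> V3) : Prop :=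
  lame_solution u /\
  match p with
  | (q%:E)%E => exists M : R, forall r : R, 0 <= r < 1 ->
        (sint_e (fun eta => (enorm3 (u (r *: eta)) `^ q)%R) <= M%:E)%E
  | (+oo)%E => exists M : R, forall x, ball3 x -> enorm3 (u x) <= M
  | (-oo)%E => False
  end.

(* Gamma_xi = B /\ conv({xi} \/ {|x| <= 1/2}); since the closed ball of   *)
(* radius 1/2 is convex, its convex hull with xi is the union of segments. *)
Definition Gamma (xi : V3) : set V3 :=
  [set x | ball3 x /\ exists (t : R) (y : V3),
       0 <= t <= 1 /\ enorm3 y <= 1 / 2 /\ x = t *: xi + (1 - t) *: y].

Definition nt_limit (u : V3 -> V3) (xi : V3) (l : V3) : Prop :=
  (u @ within (Gamma xi) (nbhs xi)) --> l.

End Elastic.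

(* Main.v *)
Require Import Defs.
From HB Require Import structures.
From mathcomp Require Import all_boot all_order all_algebra.
From mathcomp Require Import all_classical all_reals all_analysis.
From mathcomp Require Import measurable_realfun ring lra.
From mathcomp Require Import zify.
Import Order.TTheory GRing.Theory Num.Theory.
Import numFieldNormedType.Exports.
Set Implicit Arguments.
Unset Strict Implicit.
Unset Printing Implicit Defensive.
Local Open Scope ring_scope.
Local Open Scope classical_set_scope.

(** Near the boundary the kernel is dominated, inside the cone at a point p of the parameter
rectangle, by the Poisson-type kernel d / max(d, |q - p|)^3 with d = 1 - |x|, and it has integral the
identity; so P_e f converges non-tangentially at every Lebesgue point of f. For u in h^1_e, a potential
theoretic argument on slightly smaller balls gives u(r x) = P_e[u(r .)](x): if w is smooth up to the
sphere with divergence theta, then w minus (1 - |x|^2) times a gradient built from averages of theta is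
harmonic, hence a classical Poisson integral, and the correction term is exactly the L-part of the
kernel. Along an ultrafilter r -> 1 the positive and negative parts of u(r .) define additive functions
on dyadic cells. Stopping such a function at its first large cell leaves an absolutely continuous part
with density G; the stopped cells have small total area, and at density points of the complement of
their triples they do not contribute to the limit. There u tends to G. *)

(** * Dyadic cells, maximal function and Lebesgue points of the plane *)

(** The entries of the kernel change sign, so the boundary limits rest only on its size, its total
    integral and its continuity in the boundary point. The weak limit of [u(r .)] is never built as
    a measure on the sphere. Only its values on dyadic cells are used, and these are merely finitely
    additive. After stopping they are bounded by a multiple of the area, and this domination
    restores countable additivity. Comparing the kernel integral with the cell values is then a
    matter of Riemann sums, since on fine cells the kernel is almost constant. Integrals over the
    sphere are pulled back to the rectangle, with the factor sin theta. Constants may depend on the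
    boundary point, so the poles and the seam of the chart need no uniform treatment. The correction
    term involves three derivatives of the divergence, whereas a solution is only assumed C^2.
    Averages over small segments commute with the constant coefficient system and supply the missing
    derivatives. *)

Section Quadtree.
Context {R : realType}.
Variables (a b : R).
Hypotheses (a0 : 0 < a) (b0 : 0 < b).
Notation mu2 := ((@lebesgue_measure R \x @lebesgue_measure R)%E
  : {measure set (measurableTypeR R * measurableTypeR R)%type -> \bar R}).

Definition cell n (i j : nat) : set (R * R) :=
  `[i%:R * a / 2 ^+ n, i.+1%:R * a / 2 ^+ n[ `*`
  `[j%:R * b / 2 ^+ n, j.+1%:R * b / 2 ^+ n[.

(** The cell with its eight neighbours: a point outside it is separated from the cell by a full cell
    width in one of the two directions. At the border of the root it sticks out. *)
Definition tcell n (i j : nat) : set (R * R) :=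
  `[(i%:R - 1) * a / 2 ^+ n, (i%:R + 2) * a / 2 ^+ n[ `*`
  `[(j%:R - 1) * b / 2 ^+ n, (j%:R + 2) * b / 2 ^+ n[.

Definition area n : R := a * b / 4 ^+ n.

Lemma area_gt0 n : 0 < area n.
Proof. by rewrite /area divr_gt0 ?mulr_gt0 ?exprn_gt0. Qed.

Lemma area_succ n : area n.+1 = area n / 4.
Proof. by rewrite /area exprSr invfM mulrA. Qed.

Lemma measurable_cell n i j : measurable (cell n i j).
Proof. by apply: measurableX; exact: measurable_itv. Qed.

Lemma measurable_tcell n i j : measurable (tcell n i j).
Proof. by apply: measurableX; exact: measurable_itv. Qed.

Lemma leb2_box (x1 x2 y1 y2 : R) : x1 <= x2 -> y1 <= y2 ->
  mu2 (`[x1, x2[ `*` `[y1, y2[) = ((x2 - x1) * (y2 - y1))%:E.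
Proof.
have E (x1' x2' : R) : x1' <= x2' -> lebesgue_measure `[x1', x2'[ = (x2' - x1')%:E.
  rewrite lebesgue_measure_itv /= lte_fin; case: ltP => // h h'.
  by rewrite (_ : x2' = x1') ?subrr//; apply/eqP; rewrite eq_le h h'.
move=> x12 y12; rewrite EFinM -E// -E//.
by apply: product_measure1E; exact: measurable_itv.
Qed.

Lemma exp4 n : (4 : R) ^+ n = 2 ^+ n * 2 ^+ n.
Proof. by rewrite -exprMn; congr (_ ^+ _); ring. Qed.

Lemma leb2_cell n i j : mu2 (cell n i j) = (area n)%:E.
Proof.
have p2 : (0:R) < 2 ^+ n by rewrite exprn_gt0.
rewrite leb2_box.
- congr EFin; rewrite /area exp4 -!natr1; field.
  by rewrite gt_eqF.
- by rewrite ler_pM2r ?invr_gt0// ler_pM2r// ler_nat.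
- by rewrite ler_pM2r ?invr_gt0// ler_pM2r// ler_nat.
Qed.

Lemma leb2_tcell n i j : mu2 (tcell n i j) = (9 * area n)%:E.
Proof.
have p2 : (0:R) < 2 ^+ n by rewrite exprn_gt0.
rewrite leb2_box.
- congr EFin; rewrite /area exp4; field.
  by rewrite gt_eqF.
- by rewrite ler_pM2r ?invr_gt0// ler_pM2r//; lra.
- by rewrite ler_pM2r ?invr_gt0// ler_pM2r//; lra.
Qed.

Lemma half_itv (c : R) n (i i' : nat) : 0 < c -> i'./2 = i ->
  i%:R * c / 2 ^+ n <= i'%:R * c / 2 ^+ n.+1 /\
  i'.+1%:R * c / 2 ^+ n.+1 <= i.+1%:R * c / 2 ^+ n.
Proof.
move=> c0 h.
have p2 : (0:R) < 2 ^+ n by rewrite exprn_gt0.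
have e x : x * c / 2 ^+ n = (2 * x) * (c / 2 ^+ n.+1).
  by rewrite exprS; field; rewrite gt_eqF.
have pp : 0 < c / 2 ^+ n.+1 by rewrite divr_gt0 ?exprn_gt0.
rewrite (e i%:R) (e i.+1%:R) -(mulrA i'%:R) -(mulrA i'.+1%:R) !(ler_pM2r pp).
have := odd_double_half i'; rewrite h => <-.
rewrite -!natr1 natrD -muln2 natrM.
by case: odd => /=; split; lra.
Qed.

Lemma sub_cell n i j i' j' : i'./2 = i -> j'./2 = j ->
  cell n.+1 i' j' `<=` cell n i j.
Proof.
move=> hi hj p [] /=; rewrite !in_itv /=.
have [h1 h2] := half_itv n a0 hi; have [h3 h4] := half_itv n b0 hj.
move=> /andP[u1 u2] /andP[u3 u4]; rewrite /cell /= !in_itv /=.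
by split; apply/andP; split; lra.
Qed.

Lemma sub_tcell n i j i' j' : i'./2 = i -> j'./2 = j ->
  tcell n.+1 i' j' `<=` tcell n i j.
Proof.
move=> hi hj p [] /=; rewrite !in_itv /=.
have [h1 h2] := half_itv n a0 hi; have [h3 h4] := half_itv n b0 hj.
have pa : 0 < a / 2 ^+ n.+1 by rewrite divr_gt0 ?exprn_gt0.
have pb : 0 < b / 2 ^+ n.+1 by rewrite divr_gt0 ?exprn_gt0.
have e (c : R) : c / 2 ^+ n = 2 * (c / 2 ^+ n.+1).
  by rewrite exprS; field; rewrite expf_neq0.
move: h1 h2 h3 h4 pa pb.
rewrite -(natr1 i) -(natr1 j) -(natr1 i') -(natr1 j') !mulrDl -!mulrA !e !mul1r.
set A := a / _; set B := b / _.
move=> h1 h2 h3 h4 pa pb /andP[u1 u2] /andP[u3 u4]; rewrite /tcell /= !in_itv /=.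
rewrite !mulrDl -?mulrA !mulNr !mul1r !e -?/A -?/B.
by split; apply/andP; split; lra.
Qed.

Lemma tcell_anc d n i j : tcell (d + n) i j `<=` tcell n (i %/ 2 ^ d)%N (j %/ 2 ^ d)%N.
Proof.
elim: d i j => [|d IH] i j; first by rewrite !divn1.
rewrite addSn expnS !divnMA !divn2.
by apply: subset_trans (IH _ _); exact: sub_tcell.
Qed.

Lemma cell_split n i j : cell n i j =
  (cell n.+1 i.*2 j.*2 `|` cell n.+1 i.*2.+1 j.*2) `|`
  (cell n.+1 i.*2 j.*2.+1 `|` cell n.+1 i.*2.+1 j.*2.+1).
Proof.
apply/seteqP; split; last first.
  by move=> p [[]|[]]; apply: sub_cell; rewrite ?half_double ?doubleK /= ?uphalf_double.
move=> p [] /=; rewrite !in_itv /= => /andP[u1 u2] /andP[u3 u4].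
have e (c : R) (k : nat) : k%:R * c / 2 ^+ n = k.*2%:R * c / 2 ^+ n.+1.
  by rewrite -muln2 natrM exprS; field; rewrite expf_neq0.
rewrite /cell /= !in_itv /=.
rewrite !e ?doubleS in u1 u2 u3 u4.
have [k1|k1] := ltP p.1 (i.*2.+1%:R * a / 2 ^+ n.+1);
have [k2|k2] := ltP p.2 (j.*2.+1%:R * b / 2 ^+ n.+1).
- by left; left; rewrite u1 u3.
- by right; left; rewrite u1 u4.
- by left; right; rewrite u2 u3.
- by right; right; rewrite u2 u4.
Qed.

Lemma cell_disj n i j i' j' : (i != i') || (j != j') ->
  [disjoint cell n i j & cell n i' j'].
Proof.
move=> h; apply/disj_set2P; rewrite -subset0 => p [] [] /= + + [] /=.
rewrite !in_itv /= => /andP[u1 u2] /andP[u3 u4] /andP[v1 v2] /andP[v3 v4].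
have key (c x : R) (k l : nat) : 0 < c -> k%:R * c / 2 ^+ n <= x ->
    x < l.+1%:R * c / 2 ^+ n -> (k <= l)%N.
  move=> c0 h1 h2; have := le_lt_trans h1 h2.
  by rewrite ltr_pM2r ?invr_gt0 ?exprn_gt0// ltr_pM2r// ltr_nat ltnS.
have e1 : i = i' by apply/eqP; rewrite eqn_leq (key _ _ _ _ a0 u1 v2) (key _ _ _ _ a0 v1 u2).
have e2 : j = j' by apply/eqP; rewrite eqn_leq (key _ _ _ _ b0 u3 v4) (key _ _ _ _ b0 v3 u4).
by move: h; rewrite e1 e2 !eqxx.
Qed.

(** Finite additivity only, recorded on the tree: it holds both for integrals and for their limits
    along an ultrafilter, where countable additivity may fail. *)
Definition additive4 (m : nat -> nat -> nat -> R) := forall n i j,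
  m n i j = m n.+1 i.*2 j.*2 + m n.+1 i.*2.+1 j.*2
          + (m n.+1 i.*2 j.*2.+1 + m n.+1 i.*2.+1 j.*2.+1).

Section Stopping.
Variables (m : nat -> nat -> nat -> R) (s : R).
Hypotheses (m0 : forall n i j, 0 <= m n i j) (madd : additive4 m) (s0 : 0 < s).

(** Calderon-Zygmund stopping, cut off after [k] further levels to make it a structural recursion:
    the search halts at the first cell whose mean exceeds [s] and keeps the triple of that cell. *)
Fixpoint tripled k n i j : set (R * R) :=
  if s * area n < m n i j then tcell n i j else
  if k is k'.+1 then
    (tripled k' n.+1 i.*2 j.*2 `|` tripled k' n.+1 i.*2.+1 j.*2) `|`
    (tripled k' n.+1 i.*2 j.*2.+1 `|` tripled k' n.+1 i.*2.+1 j.*2.+1)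
  else set0.

Lemma measurable_tripled k n i j : measurable (tripled k n i j).
Proof.
elim: k n i j => [|k IH] n i j /=; case: ifP => _ //; try exact: measurable_tcell.
by do !apply: measurableU.
Qed.

(** The cells where the search halts are disjoint and each has area below [m / s]; a triple has nine
    times the area. As nothing below a halting cell is searched, additivity counts its mass once. *)
Lemma leb2_tripled k n i j : (mu2 (tripled k n i j) <= (9 / s * m n i j)%:E)%E.
Proof.
have badle n' i' j' : s * area n' < m n' i' j' ->
    (mu2 (tcell n' i' j') <= (9 / s * m n' i' j')%:E)%E.
  move=> h; rewrite leb2_tcell lee_fin -mulrA ler_pM2l//.
  by rewrite ler_pdivlMl// ltW.
elim: k n i j => [|k IH] n i j /=; case: ifPn => h.
- exact: badle.
- by rewrite measure0 lee_fin mulr_ge0// divr_ge0// ltW.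
- exact: badle.
- rewrite madd !mulrDr !EFinD.
  have H (A B : set (R * R)) (x y : \bar R) : measurable A -> measurable B ->
      (mu2 A <= x -> mu2 B <= y -> mu2 (A `|` B) <= x + y)%E.
    move=> mA mB Ax By; have K := @measureU2 _ _ _ mu2 A B mA mB. apply: (le_trans K); exact: leeD.
  have mT := measurable_tripled.
  by apply: (H); [exact: measurableU|exact: measurableU|exact: (H)|exact: (H)].
Qed.

Lemma tripled_nd k n i j : tripled k n i j `<=` tripled k.+1 n i j.
Proof.
elim: k n i j => [|k IH] n i j; rewrite [X in _ `<=` X]/= [X in X `<=` _]/=.
  by case: ifP => _ x.
case: ifP => [_ x //|_]; apply: setUSS; apply: setUSS; exact: IH.
Qed.

(** The search either reaches the bad cell or has halted at an ancestor, whose triple contains that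
    of the cell by [tcell_anc]. *)
Lemma tcell_tripled k n i j i' j' : i = (i' %/ 2 ^ k)%N -> j = (j' %/ 2 ^ k)%N ->
  s * area (k + n) < m (k + n) i' j' -> tcell (k + n) i' j' `<=` tripled k n i j.
Proof.
elim: k n i j => [|k IH] n i j.
  by rewrite !divn1 => -> -> /= ->.
move=> hi hj bad.
have hi' : ((i' %/ 2 ^ k)./2 = i)%N by rewrite hi expnSr divnMA -divn2.
have hj' : ((j' %/ 2 ^ k)./2 = j)%N by rewrite hj expnSr divnMA -divn2.
have IH1 := IH n.+1 _ _ erefl erefl; rewrite addnS -addSn in IH1.
rewrite [tripled _ _ _ _]/=; case: ifPn => h.
  by rewrite hi hj; exact: tcell_anc.
have {}IH1 := IH1 bad.
move=> p /IH1; have := odd_double_half (i' %/ 2 ^ k)%N; have := odd_double_half (j' %/ 2 ^ k)%N.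
rewrite hi' hj' => <- <-.
by case: odd; case: odd => /= Hp; [right;right|left;right|right;left|left;left].
Qed.
End Stopping.
End Quadtree.

Lemma dyadic_scale {R : realType} (c r : R) : 0 < r -> r <= c ->
  exists n, c / 2 ^+ n.+1 < r /\ r <= c / 2 ^+ n.
Proof.
move=> r0 rc.
have ex : exists n, c / 2 ^+ n.+1 < r.
  have [n _ Hn] := near_infty_natSinv_expn_lt (PosNum (divr_gt0 r0 (lt_le_trans r0 rc))).
  exists n; have /= := Hn n (leqnn n).
  rewrite div1r ltr_pdivlMr ?(lt_le_trans r0)// mulrC => h.
  apply: le_lt_trans h; rewrite ler_pM2l ?(lt_le_trans r0)//.
  rewrite lef_pV2 ?posrE ?exprn_gt0// exprS ler_peMl ?exprn_ge0//; lra.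
case: (ex_minnP ex) => n Hn min; exists n; split => //.
case: n Hn min => [|n] Hn min; first by rewrite divr1.
rewrite leNgt; apply/negP => /min; by rewrite ltnn.
Qed.

Lemma nat_within1 (x y : nat) : (y <= x.+1)%N -> (x <= y.+1)%N ->
  (y.+1 - x < 3)%N /\ y = (x + (y.+1 - x) - 1)%N.
Proof. by lia. Qed.

Section Maximal.
Context {R : realType}.
Variables (a b : R).
Hypotheses (a0 : 0 < a) (b0 : 0 < b).
Notation mu2 := ((@lebesgue_measure R \x @lebesgue_measure R)%E
  : {measure set (measurableTypeR R * measurableTypeR R)%type -> \bar R}).

(** Weak type (1,1) bound for the dyadic maximal function of [m]: [T] is the increasing union, over
    the search depth, of the tripled halting cells. Because of the triples, a point outside [T] also
    controls the cells merely adjacent to its own. *)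
Lemma maximal_set (m : nat -> nat -> nat -> R) (s : R) :
  (forall n i j, 0 <= m n i j) -> additive4 m -> 0 < s ->
  exists T : set (R * R), [/\ measurable T, (mu2 T <= (9 / s * m 0 0 0)%:E)%E &
    forall n i j p, (i < 2 ^ n)%N -> (j < 2 ^ n)%N -> tcell a b n i j p ->
      ~ T p -> m n i j <= s * area a b n].
Proof.
move=> m0 madd s0; exists (\bigcup_k tripled a b m s k 0 0 0).
have mT k : measurable (tripled a b m s k 0 0 0) by exact: measurable_tripled.
split.
- exact: bigcup_measurable.
- have K := @nondecreasing_cvg_mu _ _ _ mu2 (fun k => tripled a b m s k 0 0 0) mT.
  have {}K := K (bigcup_measurable (fun k _ => mT k)).
  have nd : {homo (fun k => tripled a b m s k 0 0 0) : n m / (n <= m)%N >-> (n <= m)%O}.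
    apply: homo_leq => [x|y x z xy yz|k].
    - exact: lexx.
    - exact: le_trans xy yz.
    - by apply/subsetPset; exact: tripled_nd.
  move: (K nd) => /cvg_lim <- //; apply: lime_le.
    by apply/cvg_ex; eexists; exact: K.
  by apply: nearW => k /=; exact: leb2_tripled.
- move=> n i j p hi hj tp nT; rewrite leNgt; apply/negP => bad; apply: nT.
  exists n => //; move: (@tcell_tripled _ a b a0 b0 m s n 0 0 0 i j).
  rewrite addn0; apply => //; by rewrite divn_small.
Qed.

Definition bx (p : R * R) (r : R) : set (R * R) :=
  `]p.1 - r, p.1 + r[ `*` `]p.2 - r, p.2 + r[.

Lemma measurable_bx p r : measurable (bx p r).
Proof. by apply: measurableX; exact: measurable_itv. Qed.

Notation Q0 := (cell a b 0 0 0).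

Lemma cell0P (p : R * R) : Q0 p <-> (0 <= p.1 < a /\ 0 <= p.2 < b).
Proof. by rewrite /cell /= !in_itv /= !mul0r !expr0 !divr1 !mul1r. Qed.

Definition idx (c x : R) n := Num.trunc (x * 2 ^+ n / c).

Lemma idxP (c x : R) n : 0 < c -> 0 <= x < c ->
  [/\ (idx c x n < 2 ^ n)%N, (idx c x n)%:R * c / 2 ^+ n <= x &
      x < (idx c x n).+1%:R * c / 2 ^+ n].
Proof.
move=> c0 /andP[x0 xc].
have p2 : (0:R) < 2 ^+ n by rewrite exprn_gt0.
have y0 : 0 <= x * 2 ^+ n / c by rewrite divr_ge0 ?(ltW c0)// mulr_ge0// ltW.
have /andP[h1 h2] := truncn_itv y0; rewrite -/(idx c x n) in h1 h2.
have e : x = (x * 2 ^+ n / c) * c / 2 ^+ n by field; rewrite ?gt_eqF.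
split.
- have : (idx c x n)%:R < (2 ^ n)%:R :> R.
    apply: le_lt_trans h1 _; rewrite ltr_pdivrMr// natrX mulrC ltr_pM2l//.
  by rewrite ltr_nat.
- by rewrite [leRHS]e ler_pM2r ?invr_gt0// ler_pM2r.
- by rewrite [ltLHS]e ltr_pM2r ?invr_gt0// ltr_pM2r.
Qed.

Lemma idx_close (c x y : R) n : 0 < c -> 0 <= x < c -> 0 <= y < c ->
  `|x - y| <= c / 2 ^+ n ->
  ((idx c y n) <= (idx c x n).+1)%N.
Proof.
move=> c0 hx hy d.
have [_ _ u2] := idxP n c0 hx; have [_ v1 _] := idxP n c0 hy.
rewrite -ltnS -(ltr_nat R).
have p2 : (0:R) < 2 ^+ n by rewrite exprn_gt0.
have pp : 0 < c / 2 ^+ n by rewrite divr_gt0.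
rewrite -(ltr_pM2r pp) mulrA; apply: le_lt_trans v1 _.
rewrite -natr1 mulrDl mul1r; move: d; rewrite ler_norml => /andP[d1 d2].
by rewrite mulrA; lra.
Qed.

Lemma tcell_of_idx n p q : Q0 p -> Q0 q ->
  `|p.1 - q.1| <= a / 2 ^+ n -> `|p.2 - q.2| <= b / 2 ^+ n ->
  tcell a b n (idx a q.1 n) (idx b q.2 n) p.
Proof.
move=> /cell0P[p1 p2] /cell0P[q1 q2] d1 d2.
have [_ u1 u2] := idxP n a0 q1; have [_ v1 v2] := idxP n b0 q2.
move: d1 d2; rewrite !ler_norml => /andP[d1 d2] /andP[d3 d4].
rewrite /tcell /= !in_itv /=.
move: u1 u2 v1 v2; rewrite -(natr1 (idx a _ _)) -(natr1 (idx b _ _)) -!mulrA !mulrDl !mul1r !mulNr !mul1r.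
by move=> *; split; apply/andP; split; lra.
Qed.

Lemma le_integral_setU (h : R * R -> \bar R) (A B : set (R * R)) :
  measurable A -> measurable B -> measurable_fun setT h -> (forall x, 0 <= h x)%E ->
  (\int[mu2]_(q in A `|` B) h q <= \int[mu2]_(q in A) h q + \int[mu2]_(q in B) h q)%E.
Proof.
move=> mA mB mh h0.
have -> : A `|` B = A `|` (B `\` A) by rewrite setUDr setDv setD0.
rewrite ge0_integral_setU//.
- apply: leeD => //; apply: ge0_subset_integral => //; first exact: measurableD.
  exact: measurable_funTS.
- exact: measurableD.
- exact: measurable_funTS.
- by apply/disj_set2P; rewrite setDE setICA setICr setI0.
Qed.

Lemma le_integral_bigsetU (h : R * R -> \bar R) (I : eqType) (s : seq I)
  (A : I -> set (R * R)) (M : \bar R) :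
  (forall i, measurable (A i)) -> measurable_fun setT h -> (forall x, 0 <= h x)%E ->
  (0 <= M)%E ->
  (forall i, i \in s -> \int[mu2]_(q in A i) h q <= M)%E ->
  (\int[mu2]_(q in \big[setU/set0]_(i <- s) A i) h q <= (size s)%:R%:E * M)%E.
Proof.
move=> mA mh h0 M0; elim: s => [|i s IH] H.
  by rewrite big_nil integral_set0 mul0e.
rewrite big_cons; apply: le_trans (le_integral_setU (mA i) _ mh h0) _.
  by apply: bigsetU_measurable.
have -> : ((size (i :: s))%:R%:E * M = M + (size s)%:R%:E * M)%E.
  by rewrite /= -natr1 EFinD ge0_muleDl ?lee_fin// mul1e addeC.
by apply: leeD; [apply: H; rewrite mem_head|apply: IH => k ks; apply: H; rewrite inE ks orbT].
Qed.

(** Nine cells of area [a b / 4^n], where [2^-n <= 2 r / min a b]: this gives 9 * 4 = 36 in front of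
    [r^2]. *)
Definition bx_const : R := 36 * (a * b) / (Num.min a b) ^+ 2.

Lemma minab_gt0 : 0 < Num.min a b.
Proof. by rewrite lt_min a0 b0. Qed.

Lemma bx_const_gt0 : 0 < bx_const.
Proof. by rewrite divr_gt0 ?mulr_gt0 ?exprn_gt0 ?minab_gt0. Qed.

(* A square of side comparable to 2^-n meets at most nine cells of level n. *)
Lemma bx_integral_le (h : R * R -> \bar R) (s r : R) (p : R * R) :
  measurable_fun setT h -> (forall x, 0 <= h x)%E -> 0 <= s ->
  Q0 p -> 0 < r -> r <= Num.min a b ->
  (forall n i j, (i < 2 ^ n)%N -> (j < 2 ^ n)%N -> tcell a b n i j p ->
     \int[mu2]_(q in cell a b n i j) h q <= (s * area a b n)%:E)%E ->
  (\int[mu2]_(q in bx p r `&` Q0) h q <= (bx_const * s * r ^+ 2)%:E)%E.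
Proof.
move=> mh h0 s0 Qp r0 rc H.
have [n [n1 n2]] := dyadic_scale r0 rc.
have p2 : (0:R) < 2 ^+ n by rewrite exprn_gt0.
have ra : r <= a / 2 ^+ n.
  by apply: le_trans n2 _; rewrite ler_pM2r ?invr_gt0// ge_min lexx.
have rb : r <= b / 2 ^+ n.
  by apply: le_trans n2 _; rewrite ler_pM2r ?invr_gt0// ge_min lexx orbT.
pose ia := idx a p.1 n; pose ib := idx b p.2 n.
pose G (ij : nat * nat) := [set q | bx p r q /\ Q0 q] `&` cell a b n ij.1 ij.2.
(* The offsets -1, 0, 1 are written [k - 1] with [k < 3]. Truncated subtraction repeats the index 0
   at the left edge, which does no harm in a union bound. *)
pose L := [seq (ia + k - 1, ib + l - 1)%N | k <- iota 0 3, l <- iota 0 3].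
have mG ij : measurable (G ij).
  apply: measurableI; last exact: measurable_cell.
  by apply: measurableI; [exact: measurable_bx|exact: measurable_cell].
have sub : bx p r `&` Q0 `<=` \big[setU/set0]_(ij <- L) G ij.
  move=> q [bq Qq]; have := Qq; rewrite cell0P => -[q1 q2].
  have := Qp; rewrite cell0P => -[p1 p2'].
  have := bq; rewrite /bx /= !in_itv /= => -[/andP[b1 b2] /andP[b3 b4]].
  have [_ u1 u2] := idxP n a0 q1; have [_ v1 v2] := idxP n b0 q2.
  have d1 : `|p.1 - q.1| <= a / 2 ^+ n by clear - b1 b2 ra; rewrite ler_norml; apply/andP; split; lra.
  have d2 : `|p.2 - q.2| <= b / 2 ^+ n by clear - b3 b4 rb; rewrite ler_norml; apply/andP; split; lra.
  have d1' : `|q.1 - p.1| <= a / 2 ^+ n by rewrite distrC.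
  have d2' : `|q.2 - p.2| <= b / 2 ^+ n by rewrite distrC.
  have k1 := idx_close a0 p1 q1 d1; have k2 := idx_close a0 q1 p1 d1'.
  have k3 := idx_close b0 p2' q2 d2; have k4 := idx_close b0 q2 p2' d2'.
  rewrite -bigcup_seq; exists (idx a q.1 n, idx b q.2 n); last first.
    split; first by split.
    by rewrite /cell /= !in_itv /= u1 u2 v1 v2.
  apply/allpairsP; exists ((idx a q.1 n).+1 - ia, (idx b q.2 n).+1 - ib)%N => /=.
  rewrite -/ia -/ib in k1 k2 k3 k4.
  have [w1 w2] := nat_within1 k1 k2; have [w3 w4] := nat_within1 k3 k4.
  split; [by rewrite -[[:: _; _; _]]/(iota 0 3) mem_iota|by rewrite -[[:: _; _; _]]/(iota 0 3) mem_iota|].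
  by apply/eqP; rewrite xpair_eqE; apply/andP; split; apply/eqP.
apply: (@le_trans _ _ (\int[mu2]_(q in \big[setU/set0]_(ij <- L) G ij) h q)%E).
  apply: ge0_subset_integral => //.
  - by apply: measurableI; [exact: measurable_bx|exact: measurable_cell].
  - by apply: bigsetU_measurable => ij _; exact: mG.
  - exact: measurable_funTS.
apply: le_trans (@le_integral_bigsetU h _ L G (s * area a b n)%:E mG mh h0 _ _) _.
- by rewrite lee_fin mulr_ge0// ltW// area_gt0.
- move=> [i j] _.
  (* Either the piece is empty, or the cell contains a point of the square and then [p] lies in its
     triple. *)
  have [->|/set0P[q [[bq Qq] cq]]] := eqVneq (G (i, j)) set0.
    by rewrite integral_set0 lee_fin mulr_ge0// ltW// area_gt0.
  apply: (@le_trans _ _ (\int[mu2]_(q in cell a b n i j) h q)%E).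
    apply: ge0_subset_integral => //; [exact: mG|exact: measurable_cell|exact: measurable_funTS|].
    by move=> x [].
  have := Qq; rewrite cell0P => -[q1 q2].
  have [i1 u1 u2] := idxP n a0 q1; have [j1 v1 v2] := idxP n b0 q2.
  have [ei ej] : i = idx a q.1 n /\ j = idx b q.2 n.
    have cq' : cell a b n (idx a q.1 n) (idx b q.2 n) q by rewrite /cell /= !in_itv /= u1 u2 v1 v2.
    have [/eqP|] := boolP ((i, j) == (idx a q.1 n, idx b q.2 n)); first by case.
    rewrite xpair_eqE negb_and => /(@cell_disj _ a b a0 b0 n _ _ _ _)/disj_set2P.
    by rewrite -subset0 => /(_ q); case.
  rewrite ei ej; apply: H => //.
  have := bq; rewrite /bx /= !in_itv /= => -[/andP[b1 b2] /andP[b3 b4]].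
  by apply: tcell_of_idx => //; clear - b1 b2 b3 b4 ra rb;
    rewrite ler_norml; apply/andP; split; lra.
rewrite -EFinM lee_fin [X in (X%:R)](_ : _ = 9)%N//.
rewrite /bx_const /area exp4.
have c0 := minab_gt0; set c := Num.min a b in n1 c0 *.
have hz : (2 ^+ n)^-1 <= 2 * r / c.
  rewrite ler_pdivlMr//; move: n1; rewrite exprS invfM; clear.
  by set z := (2 ^+ n)^-1 => n1; nra.
have z0 : 0 <= (2 ^+ n)^-1 :> R by rewrite invr_ge0 exprn_ge0.
have hz2 := ler_pM z0 z0 hz hz.
have -> : 36 * (a * b) / c ^+ 2 * s * r ^+ 2 =
  9 * s * (a * b) * ((2 * r / c) * (2 * r / c)) by clear - c0; field; rewrite gt_eqF.
rewrite invfM; set z := (2 ^+ n)^-1 in hz2 *.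
have -> : 9 * (s * (a * b * (z * z))) = 9 * s * (a * b) * (z * z) by ring.
by rewrite ler_wpM2l// !mulr_ge0// ltW.
Qed.

(** The cell integrals of [h] are additive on the tree, so [maximal_set] applies; [bx_integral_le]
    turns its bound on cells into one on squares centred at [p]. *)
Lemma maximal_fun (h : R * R -> R) (s : R) :
  measurable_fun setT h -> (forall x, 0 <= h x) ->
  mu2.-integrable Q0 (EFin \o h) -> 0 < s ->
  exists T : set (R * R), [/\ measurable T,
    (mu2 T <= (9 / s)%:E * \int[mu2]_(q in Q0) (h q)%:E)%E &
    forall p r, Q0 p -> ~ T p -> 0 < r -> r <= Num.min a b ->
      (\int[mu2]_(q in bx p r `&` Q0) (h q)%:E <= (bx_const * s * r ^+ 2)%:E)%E].
Proof.
move=> mh h0 ih s0.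
have mc n i j : measurable (cell a b n i j) by exact: measurable_cell.
have mQ : measurable Q0 by exact: mc.
pose I A := (\int[mu2]_(q in A `&` Q0) (h q)%:E)%E.
have mhE : measurable_fun setT (EFin \o h) by exact/measurable_EFinP.
have I0 A : (0 <= I A)%E by apply: integral_ge0 => x _; rewrite lee_fin.
have Ifin A : measurable A -> (I A \is a fin_num).
  move=> mA; rewrite ge0_fin_numE//.
  apply: le_lt_trans (_ : \int[mu2]_(q in Q0) (h q)%:E < +oo)%E.
    apply: ge0_subset_integral => //; [exact: measurableI|exact: measurable_funTS|].
    by move=> x _; rewrite lee_fin.
  have := integrableP _ _ _ ih => -[_]; congr (_ < _)%E; apply: eq_integral => x _.
  by rewrite /= ger0_norm.
have IU A B : measurable A -> measurable B -> [disjoint A & B] -> I (A `|` B) = (I A + I B)%E.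
  move=> mA mB dAB; rewrite /I setIUl ge0_integral_setU//.
  - exact: measurableI.
  - exact: measurableI.
  - exact: measurable_funTS.
  - by move=> x _; rewrite lee_fin.
  - apply/disj_set2P; rewrite setIACA; move/disj_set2P: dAB => ->; exact: set0I.
pose m n i j := fine (I (cell a b n i j)).
have mE n i j : I (cell a b n i j) = (m n i j)%:E by rewrite fineK// Ifin.
have madd : additive4 m.
  move=> n i j; apply: EFin_inj; rewrite !EFinD -!mE cell_split//.
  have dj i1 j1 i2 j2 : (i1 != i2) || (j1 != j2) ->
    [disjoint cell a b n.+1 i1 j1 & cell a b n.+1 i2 j2] by exact: cell_disj.
  have nS k : k != k.+1 by rewrite neq_ltn ltnSn.
  have nS' k : k.+1 != k by rewrite neq_ltn ltnSn orbT.
  rewrite !IU//; try exact: measurableU; try (by apply: dj; rewrite ?nS ?nS' ?orbT).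
  apply/disj_set2P; rewrite setIUl !setIUr.
  have dj0 i1 j1 i2 j2 : (i1 != i2) || (j1 != j2) ->
    cell a b n.+1 i1 j1 `&` cell a b n.+1 i2 j2 = set0 by move=> /dj /disj_set2P.
  by rewrite !dj0 ?setU0// ?nS ?orbT.
have m0 n i j : 0 <= m n i j by rewrite fine_ge0.
have [T [mT T1 T2]] := maximal_set m0 madd s0.
exists T; split => //.
- apply: le_trans T1 _; rewrite EFinM -mE /I setIid; exact: lexx.
- move=> p r Qp nT r0 rc; apply: bx_integral_le => //; first exact: ltW.
  move=> n i j hi hj tp; have := T2 n i j p hi hj tp nT.
  rewrite -lee_fin -mE; apply: le_trans.
  rewrite /I; have -> // : cell a b n i j `&` Q0 = cell a b n i j.
  apply/setIidPl; elim: n i j hi hj {tp} => [|n IH] i j.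
    by rewrite expn0 !ltnS !leqn0 => /eqP -> /eqP -> x.
  move=> hi hj; apply: (subset_trans (sub_cell a0 b0 erefl erefl)).
  by apply: IH; rewrite ltn_half_double -mul2n -expnS.
Qed.
End Maximal.

Lemma ae_imply {d} {T : sigmaRingType d} {R : realType} (mu : set T -> \bar R)
  (P Q : T -> Prop) : (forall p, P p -> Q p) ->
  {ae mu, forall p, P p} -> {ae mu, forall p, Q p}.
Proof.
move=> PQ [A [mA A0 sA]]; exists A; split=> // p nQ; apply: sA => /PQ.
exact: nQ.
Qed.

Section LebesguePoints.
Context {R : realType}.
Variables (a b : R).
Hypotheses (a0 : 0 < a) (b0 : 0 < b).
Notation mu2 := ((@lebesgue_measure R \x @lebesgue_measure R)%E
  : {measure set (measurableTypeR R * measurableTypeR R)%type -> \bar R}).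
Notation Q0 := (cell a b 0 0 0).

(** Normalised by [r^2] instead of the area of the square, and cut to the root, the only place where
    integrability will be assumed. *)
Definition lpoint (h : R * R -> R) (p : R * R) := forall e : R, 0 < e ->
  exists2 d : R, 0 < d & forall r, 0 < r -> r < d ->
    (\int[mu2]_(q in bx p r `&` Q0) `|h q - h p|%:E <= (e * r ^+ 2)%:E)%E.

Definition ae_lpoint (h : R * R -> R) := {ae mu2, forall p, Q0 p -> lpoint h p}.

Lemma mQ0 : measurable Q0. Proof. exact: measurable_cell. Qed.

Lemma mbQ (p : R * R) r : measurable (bx p r `&` Q0).
Proof. by apply: measurableI; [exact: measurable_bx|exact: mQ0]. Qed.

Lemma measurable_dist (h : R * R -> R) (c : R) : measurable_fun setT h ->
  measurable_fun setT (fun q => `|h q - c|%:E).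
Proof.
move=> mh; apply/measurable_EFinP; apply: measurableT_comp => //.
exact: measurable_funB.
Qed.

Lemma leb2_bx (p : R * R) r : 0 < r -> mu2 (bx p r) = (4 * r ^+ 2)%:E.
Proof.
move=> r0.
have E (x : R) : lebesgue_measure `]x - r, x + r[ = (2 * r)%:E.
  by rewrite -ball_itv lebesgue_measure_ball ?ltW// mulr2n; congr EFin; ring.
have -> : 4 * r ^+ 2 = (2 * r) * (2 * r) by ring.
rewrite EFinM -{1}(E p.1) -(E p.2).
by apply: product_measure1E; exact: measurable_itv.
Qed.

Lemma integral_bx_cst (p : R * R) (r c : R) : 0 < r -> 0 <= c ->
  (\int[mu2]_(q in bx p r `&` Q0) c%:E <= (4 * c * r ^+ 2)%:E)%E.
Proof.
move=> r0 c0; have -> : 4 * c * r ^+ 2 = c * (4 * r ^+ 2) by ring.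
rewrite EFinM -(leb2_bx p r0) -integral_cst//; last exact: measurable_bx.
by apply: ge0_subset_integral => //; [exact: mbQ|exact: measurable_bx].
Qed.

Lemma le_integral_bx2 (p : R * R) r (f g h : R * R -> R) :
  measurable_fun setT f -> measurable_fun setT g -> measurable_fun setT h ->
  (forall q, 0 <= f q) -> (forall q, 0 <= g q) -> (forall q, 0 <= h q) ->
  (forall q, Q0 q -> h q <= f q + g q) ->
  (\int[mu2]_(q in bx p r `&` Q0) (h q)%:E <=
   \int[mu2]_(q in bx p r `&` Q0) (f q)%:E + \int[mu2]_(q in bx p r `&` Q0) (g q)%:E)%E.
Proof.
move=> mf mg mh f0 g0 h0 H.
have mE (k : R * R -> R) : measurable_fun setT k ->
  measurable_fun (bx p r `&` Q0) (fun x => (k x)%:E).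
  by move=> mk; apply: measurable_funTS; exact/measurable_EFinP.
rewrite -ge0_integralD//; try exact: mbQ; try exact: mE;
  try (by move=> x _; rewrite lee_fin).
apply: ge0_le_integral => //; try exact: mbQ; try exact: mE.
- by move=> x _; rewrite lee_fin.
- apply: (mE (fun x => f x + g x)); exact: measurable_funD.
- by move=> x [_ Qx]; rewrite lee_fin; exact: H.
Qed.

(** One domination hypothesis covers sums, differences and multiples at once. *)
Lemma lpoint_comb (f g h : R * R -> R) p (c : R) :
  measurable_fun setT f -> measurable_fun setT g -> measurable_fun setT h ->
  0 <= c -> (forall q, `|h q - h p| <= `|f q - f p| + c * `|g q - g p|) ->
  lpoint f p -> lpoint g p -> lpoint h p.
Proof.
move=> mf mg mh c0 H lf lg e e0.
have e20 : 0 < e / 2 by rewrite divr_gt0.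
(* [c + 1] keeps the quotient positive when [c] is 0. *)
have e30 : 0 < e / 2 / (c + 1) by rewrite divr_gt0// ltr_wpDl.
have [d1 d10 H1] := lf _ e20; have [d2 d20 H2] := lg _ e30.
exists (Num.min d1 d2); first by rewrite lt_min d10 d20.
move=> r r0; rewrite lt_min => /andP[rd1 rd2].
have md (k : R * R -> R) : measurable_fun setT k -> measurable_fun setT (fun q => `|k q - k p|).
  by move=> mk; apply/measurable_EFinP; exact: measurable_dist.
apply: le_trans (@le_integral_bx2 p r (fun q => `|f q - f p|) (fun q => c * `|g q - g p|)
  (fun q => `|h q - h p|) (md _ mf) _ (md _ mh) _ _ _ _) _ => //.
- by apply: measurable_funM => //; exact: md.
- by move=> q; rewrite mulr_ge0.
have -> : e * r ^+ 2 = e / 2 * r ^+ 2 + e / 2 * r ^+ 2 by field.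
rewrite EFinD; apply: leeD; first exact: H1.
under eq_integral do rewrite EFinM.
rewrite ge0_integralZl//; last 2 first.
- exact: mbQ.
- by apply: measurable_funTS; exact: measurable_dist.
apply: (@le_trans _ _ (c%:E * (e / 2 / (c + 1) * r ^+ 2)%:E)%E).
  by apply: lee_wpmul2l; [rewrite lee_fin|exact: H2].
rewrite -EFinM lee_fin mulrA ler_wpM2r// ?sqr_ge0//.
by rewrite mulrA ler_pdivrMr ?ltr_wpDl// mulrDr mulr1 [c * _]mulrC lerDl ltW.
Qed.

Lemma ae_and (P Q : R * R -> Prop) : {ae mu2, forall p, P p} ->
  {ae mu2, forall p, Q p} -> {ae mu2, forall p, P p /\ Q p}.
Proof.
move=> [A [mA A0 sA]] [B [mB B0 sB]]; exists (A `|` B); split.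
- exact: measurableU.
- apply/eqP; rewrite eq_le measure_ge0 andbT.
  have K := @measureU2 _ _ _ mu2 A B mA mB; apply: (le_trans K).
  have {K}[A0' B0'] : (mu2 A <= 0)%E /\ (mu2 B <= 0)%E by split; [rewrite -A0|rewrite -B0].
  by rewrite -[leRHS]adde0; exact: leeD.
- move=> p /= /not_andP[nP|nQ]; [left; exact: sA|right; exact: sB].
Qed.

Lemma negligible_lim (N : set (R * R)) (C : R) :
  (forall n : nat, exists A : set (R * R), [/\ measurable A, N `<=` A &
     (mu2 A <= (C / 2 ^+ n)%:E)%E]) -> mu2.-negligible N.
Proof.
move=> /choice[A HA]; exists (\bigcap_n A n); split.
- by apply: bigcapT_measurable => n; have [] := HA n.
- apply/eqP; rewrite eq_le measure_ge0 andbT.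
  apply/lee_addgt0Pr => e e0; rewrite add0e.
  have [n Hn] : exists n, C / 2 ^+ n <= e.
    have [C0|C0] := leP C 0; first by exists 0%N; rewrite expr0 divr1; lra.
    have [e1|/ltW e1] := leP e C.
      have [n [n1 _]] := dyadic_scale e0 e1; exists n.+1; exact: ltW.
    by exists 0%N; rewrite expr0 divr1.
  have [mA _ An] := HA n.
  apply: (@le_trans _ _ (mu2 (A n))).
    apply: le_measure; rewrite ?inE//; last by move=> x; apply.
    by apply: bigcapT_measurable => k; have [] := HA k.
  by apply: le_trans An _; rewrite lee_fin.
- by move=> x Nx n _; have [_ + _] := HA n; apply.
Qed.

(* The maximal function of h - g controls the error. *)
Lemma ae_lpoint_limit (h : R * R -> R) :
  measurable_fun setT h ->
  (forall e, 0 < e -> exists g : R * R -> R, [/\ measurable_fun setT g,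
     mu2.-integrable Q0 (EFin \o (fun q => `|h q - g q|)), ae_lpoint g &
     (\int[mu2]_(q in Q0) `|h q - g q|%:E <= e%:E)%E]) ->
  ae_lpoint h.
Proof.
move=> mh H.
(* [bx_const] comes from the maximal function of [h - g], 1 from the Lebesgue point of [g], and 4
   from the constant [h p - g p] on a square of area [4 r^2]. *)
pose C : R := bx_const a b + 5.
have C0 : 0 < C by rewrite /C ltr_pwDr// ltW// bx_const_gt0.
pose P (s : R) p := Q0 p -> exists2 d, 0 < d & forall r, 0 < r -> r < d ->
  (\int[mu2]_(q in bx p r `&` Q0) `|h q - h p|%:E <= (C * s * r ^+ 2)%:E)%E.
have key s : 0 < s -> {ae mu2, forall p, P s p}.
  (* 10 is 9 from the weak type bound plus 1 from Chebyshev's inequality, for an approximation of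
     [h] within [s / 2^n] in L^1. *)
  move=> s0; apply: (@negligible_lim _ 10) => n.
  have e0 : 0 < s / 2 ^+ n by rewrite divr_gt0// exprn_gt0.
  have [g [mg ig [N [mN N0 HN]] hg]] := H _ e0.
  have mhg : measurable_fun setT (fun q => `|h q - g q|).
    by apply: measurableT_comp => //; exact: measurable_funB.
  have [T [mT T1 T2]] := maximal_fun a0 b0 mhg (fun q => normr_ge0 _) ig s0.
  (* Chebyshev's set, where [h] and [g] are at least [s] apart; the second absolute value matches
     the form of the inequality. *)
  pose S := Q0 `&` [set q | (s%:E <= `| `|h q - g q|%:E |)%E].
  have mS : measurable S.
    apply: emeasurable_fun_c_infty; first exact: mQ0.
    by apply: measurable_funTS; apply: measurableT_comp => //; exact/measurable_EFinP.
  exists (N `|` (T `|` S)); split.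
  - by do !apply: measurableU.
  - move=> p; apply: contra_notP => nA Qp.
    have [nN nT nS] : [/\ ~ N p, ~ T p & ~ S p] by split=> ?; apply: nA; [left|right;left|right;right].
    have lg : lpoint g p by apply: contrapT => nl; apply: nN; apply: HN => /(_ Qp).
    have hgp : `|h p - g p| <= s.
      rewrite leNgt; apply/negP => sp; apply: nS; split => //=.
      by rewrite normr_id lee_fin ltW.
    have [d d0 Hd] := lg s s0.
    exists (Num.min d (Num.min a b)); first by rewrite !lt_min d0 a0 b0.
    move=> r r0; rewrite lt_min => /andP[rd rab].
    have md : measurable_fun setT (fun q => `|g q - g p|).
      by apply/measurable_EFinP; exact: measurable_dist.
    have K1 := @le_integral_bx2 p r (fun q => `|h q - g q|) (fun q => `|g q - g p| + s)
      (fun q => `|h q - h p|) mhg.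
    apply: (le_trans (K1 _ _ _ _ _ _)) => //.
    + exact: measurable_funD.
    + by apply/measurable_EFinP; exact: measurable_dist.
    + by move=> q; rewrite addr_ge0// ltW.
    + move=> q _; have -> : h q - h p = (h q - g q) + (g q - g p) - (h p - g p) by ring.
      apply: le_trans (ler_normB _ _) _; rewrite [leRHS]addrA lerD//.
      exact: ler_normD.
    have K2 := @le_integral_bx2 p r (fun q => `|g q - g p|) (fun q => s)
      (fun q => `|g q - g p| + s) md.
    have -> : C * s * r ^+ 2 = bx_const a b * s * r ^+ 2 + (s * r ^+ 2 + 4 * s * r ^+ 2).
      by rewrite /C; ring.
    rewrite !EFinD; apply: leeD; first by apply: T2 => //; exact: ltW.
    apply: (le_trans (K2 _ _ _ _ _ _)) => //.
    + exact: measurable_funD.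
    + by move=> q; exact: ltW.
    + by move=> q; rewrite addr_ge0// ltW.
    + by apply: leeD; [exact: Hd|apply: integral_bx_cst => //; exact: ltW].
  - have -> : 10 / 2 ^+ n = (9 / s * (s / 2 ^+ n)) + 1 / 2 ^+ n :> R.
      by field; rewrite expf_neq0//= gt_eqF.
    have U (A B : set (R * R)) (x y : \bar R) : measurable A -> measurable B ->
        (mu2 A <= x -> mu2 B <= y -> mu2 (A `|` B) <= x + y)%E.
      move=> mA mB Ax By; have K := @measureU2 _ _ _ mu2 A B mA mB.
      by apply: (le_trans K); exact: leeD.
    rewrite -[leRHS]add0e; apply: (U) => //; first exact: measurableU.
      by rewrite -[X in (_ <= X)%E]N0.
    rewrite EFinD; apply: (U) => //.
      apply: le_trans T1 _; rewrite [leRHS]EFinM; apply: lee_wpmul2l => //.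
      by rewrite lee_fin divr_ge0// ltW.
    have mk := @le_integral_abse _ _ _ mu2 Q0 mQ0 (fun q => `|h q - g q|%:E) s.
    have {}mk : (s%:E * mu2 S <= \int[mu2]_(x in Q0) `| `|h x - g x|%:E |)%E.
      by apply: mk => //; apply: measurable_funTS; exact/measurable_EFinP.
    have {}mk : (s%:E * mu2 S <= (s / 2 ^+ n)%:E)%E.
      apply: le_trans mk (le_trans _ hg); rewrite le_eqVlt; apply/orP; left; apply/eqP.
      by apply: eq_integral => x _; rewrite /= normr_id.
    have -> : (1 / 2 ^+ n)%:E = (s^-1%:E * (s / 2 ^+ n)%:E)%E.
      by rewrite -EFinM mulrA mulVf// gt_eqF.
    by rewrite lee_pdivlMl.
(* Only countably many null sets can be discarded, so the thresholds [1 / (k + 1)] stand for all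
   [s]. *)
have ae_k : {ae mu2, forall p, forall k : nat, P (k.+1%:R^-1) p}.
  by apply/ae_foralln => k; exact: key.
apply: ae_imply ae_k => p Hp Qp e e0.
have [k Hk] : exists k : nat, k.+1%:R^-1 <= e / C.
  exists (Num.trunc (C / e)); rewrite -[leRHS]invrK lef_pV2 ?posrE ?invr_gt0 ?divr_gt0//.
  rewrite invf_div; have /andP[_ /ltW //] := truncn_itv (ltW (divr_gt0 C0 e0)).
have [d d0 Hd] := Hp k Qp; exists d => // r r0 rd.
apply: le_trans (Hd r r0 rd) _; rewrite lee_fin ler_wpM2r ?sqr_ge0//.
by rewrite -ler_pdivlMl// mulrC.
Qed.
End LebesguePoints.

Lemma cvge0_lt {R : realType} {T : Type} {F : set_system T} (f : T -> \bar R) (e : R) :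
  f @ F --> 0%E -> 0 < e -> \forall x \near F, (f x < e%:E)%E.
Proof.
move=> fF e0; have /fF // : nbhs (0%E : \bar R) [set y | (y < e%:E)%E].
apply: open_nbhs_nbhs; split; first exact: open_ereal_lt_ereal.
by rewrite /= lte_fin.
Qed.

Lemma integrable_bnd {d} {T : measurableType d} {R : realType}
  (mu : {measure set T -> \bar R}) (D : set T) (f : T -> R) (C : R) :
  measurable D -> (mu D < +oo)%E -> measurable_fun D f ->
  (forall x, D x -> `|f x| <= C) -> mu.-integrable D (EFin \o f).
Proof.
move=> mD muD mf H; apply: measurable_bounded_integrable => //.
exists C; split; first exact: num_real.
by move=> x Cx y Dy; apply: le_trans (H y Dy) (ltW Cx).
Qed.

(** [A] or its complement, whichever does not contain [x]: the measure of its part near [x] is the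
    Lebesgue point defect of the indicator of [A]. *)
Definition jump_set {R : realType} (A : set R) (x : R) : set R :=
  [set y | \1_A y != \1_A x :> R].

Lemma measurable_jump_set {R : realType} (A : set R) (x : R) :
  measurable A -> measurable (jump_set A x).
Proof.
move=> mA; have -> : jump_set A x = if x \in A then ~` A else A.
  apply/seteqP; split=> y; rewrite /jump_set /= !indicE; case: ifPn => xA;
    case: (boolP (y \in A)) => yA /=; rewrite ?eqxx ?oner_eq0//.
  - by rewrite notin_setE in yA.
  - by rewrite inE in yA.
  - by rewrite inE in yA.
  - by rewrite eq_sym oner_eq0.
  - by rewrite notin_setE in yA.
by case: ifP => _ //; exact: measurableC.
Qed.

(** Differentiation is invoked on the line only; the plane is reached from here through
    rectangles. *)
Lemma ae_density1 {R : realType} (A : set R) : measurable A ->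
  {ae @lebesgue_measure R, forall x : R, forall e : R, 0 < e -> exists2 d : R, 0 < d &
    forall r, 0 < r -> r < d ->
    (lebesgue_measure (ball x r `&` jump_set A x) <= (e * r)%:E)%E}.
Proof.
move=> mA; have := lebesgue_differentiation (locally_integrable_indic openT mA).
apply: ae_imply => x lx e e0.
(* The mean is taken over an interval of length [2 r], hence the half. *)
have e20 : 0 < e / 2 by rewrite divr_gt0.
have : \forall r \near (0:R)^'+, (davg \1_A x r < (e / 2)%:E)%E.
  exact: cvge0_lt lx e20.
move=> [d /= d0 Hd]; exists d => // r r0 rd.
have {}Hd : (davg \1_A x r < (e / 2)%:E)%E.
  by apply: Hd => //=; rewrite sub0r normrN gtr0_norm.
move: Hd; rewrite /davg /iavg (lebesgue_measure_ball _ (ltW r0)).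
set B := jump_set A x; have mB : measurable B by exact: measurable_jump_set.
have -> : (\int[lebesgue_measure]_(y in ball x r) `|((center (\1_A x) \o \1_A) y)%:E| =
  \int[lebesgue_measure]_(y in ball x r) (\1_B y)%:E)%E.
  apply: eq_integral => y _; congr EFin; rewrite /= /B /jump_set !indicE.
  have -> : (y \in [set y0 | \1_A y0 != \1_A x :> R]) = ((y \in A) != (x \in A)).
    apply/idP/idP; rewrite inE /= !indicE; by case: (y \in A); case: (x \in A); rewrite /= ?eqxx ?oner_eq0// eq_sym oner_eq0.
  by case: (y \in A); case: (x \in A); rewrite /= ?subrr ?normr0 ?subr0 ?sub0r ?normrN ?normr1.
rewrite integral_indic//; last exact: measurable_ball.
rewrite inver; case: ifPn => [|_].
  by rewrite mulrn_eq0 /= (gt_eqF r0).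
move=> H; have {H} := ltW H; rewrite setIC -/B => H.
rewrite lee_pdivrMl in H; last by rewrite mulr2n; lra.
apply: le_trans H _; rewrite -EFinM lee_fin mulr2n; lra.
Qed.

Section Lebesgue2.
Context {R : realType}.
Variables (a b : R).
Hypotheses (a0 : 0 < a) (b0 : 0 < b).
Notation mu2 := ((@lebesgue_measure R \x @lebesgue_measure R)%E
  : {measure set (measurableTypeR R * measurableTypeR R)%type -> \bar R}).
Notation Q0 := (cell a b 0 0 0).

Lemma ae_fst (P : R -> Prop) : {ae @lebesgue_measure R, forall x, P x} ->
  {ae mu2, forall p, P p.1}.
Proof.
move=> [N [mN N0 sN]]; exists (N `*` setT); split.
- exact: measurableX.
- apply: etrans (product_measure1E _ _ _ _) _ => //.
  by rewrite [X in (X * _)%E](_ : _ = 0%E)// mul0e.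
- by move=> p np; split => //; apply: sN.
Qed.

Lemma ae_snd (P : R -> Prop) : {ae @lebesgue_measure R, forall x, P x} ->
  {ae mu2, forall p, P p.2}.
Proof.
move=> [N [mN N0 sN]]; exists (setT `*` N); split.
- exact: measurableX.
- apply: etrans (product_measure1E _ _ _ _) _ => //.
  by rewrite [X in (_ * X)%E](_ : _ = 0%E)// mule0.
- by move=> p np; split => //; apply: sN.
Qed.

Lemma leb2_X (A B : set R) : measurable A -> measurable B ->
  mu2 (A `*` B) = (lebesgue_measure A * lebesgue_measure B)%E.
Proof. by move=> mA mB; apply: product_measure1E. Qed.

(** If the indicator of the product changes between [p] and [q], one of its two factors does. The
    defect therefore lives on two strips, each the product of a set of small one-dimensional measure
    with a full side of the square. *)
Lemma ae_lpoint_rect (A B : set R) : measurable A -> measurable B ->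
  ae_lpoint a b (\1_(A `*` B) : R * R -> R).
Proof.
move=> mA mB; have H := ae_and (ae_fst (ae_density1 mA)) (ae_snd (ae_density1 mB)).
apply: ae_imply H => p [HA HB] Qp e e0.
(* Two strips, each of area at most [(e / 4) r] times [2 r]. *)
have e4 : 0 < e / 4 by rewrite divr_gt0.
have [d1 d10 H1] := HA _ e4; have [d2 d20 H2] := HB _ e4.
exists (Num.min d1 d2); first by rewrite lt_min d10 d20.
move=> r r0; rewrite lt_min => /andP[rd1 rd2].
set NA := jump_set A p.1 in H1.
set NB := jump_set B p.2 in H2.
pose I := `]p.1 - r, p.1 + r[%classic; pose J := `]p.2 - r, p.2 + r[%classic.
have mI : measurable I by exact: measurable_itv.
have mJ : measurable J by exact: measurable_itv.
have mNA : measurable NA by exact: measurable_jump_set.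
have mNB : measurable NB by exact: measurable_jump_set.
pose E := ((I `&` NA) `*` J) `|` (I `*` (J `&` NB)).
have mE : measurable E by apply: measurableU; apply: measurableX => //; exact: measurableI.
have -> : (\int[mu2]_(q in bx p r `&` Q0) `|\1_(A `*` B) q - \1_(A `*` B) p|%:E =
  \int[mu2]_(q in bx p r `&` Q0) `|\1_(A `*` B) q - \1_(A `*` B) p : R|%:E)%E by [].
apply: (@le_trans _ _ (\int[mu2]_(q in setT) (\1_E q)%:E)%E).
  apply: (@le_trans _ _ (\int[mu2]_(q in bx p r `&` Q0) (\1_E q)%:E)%E); last first.
    by apply: ge0_subset_integral => //; [exact: mbQ|exact/measurable_EFinP].
  apply: ge0_le_integral => //; first exact: mbQ.
  - apply: measurable_funTS; apply: measurable_dist; apply: measurable_indic; exact: measurableX.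
  - by apply: measurable_funTS; exact/measurable_EFinP.
  - move=> q [[q1 q2] _]; rewrite lee_fin.
    have [qE|qE] := boolP (q \in E).
      rewrite [leRHS]indicE qE /= !indicE.
      by case: (_ \in _); case: (_ \in _); rewrite /= ?subrr ?normr0 ?subr0 ?sub0r ?normrN ?normr1.
    have [n1 n2] : \1_A q.1 = \1_A p.1 :> R /\ \1_B q.2 = \1_B p.2 :> R.
      rewrite notin_setE in qE; split; apply: contrapT => /eqP h; apply: qE.
        by left; split => //; split.
      by right; split => //; split.
    have ind (x : R * R) : \1_(A `*` B) x = \1_A x.1 * \1_B x.2 :> R.
      rewrite !indicE -natrM mulnb; congr (_%:R); congr nat_of_bool.
      by apply/idP/andP; rewrite !inE; move=> [].
    by rewrite !ind n1 n2 subrr normr0.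
rewrite integral_indic// setIT.
have K := @measureU2 _ _ _ mu2 _ _ (measurableX (measurableI _ _ mI mNA) mJ) (measurableX mI (measurableI _ _ mJ mNB)).
apply: (le_trans K).
have -> : e * r ^+ 2 = (e / 4 * r) * (2 * r) + (2 * r) * (e / 4 * r) by field.
have Eb (x : R) : lebesgue_measure `]x - r, x + r[ = (2 * r)%:E.
  by rewrite -ball_itv lebesgue_measure_ball ?ltW// mulr2n; congr EFin; ring.
have {}H1 := H1 r r0 rd1; have {}H2 := H2 r r0 rd2.
rewrite ball_itv in H1; rewrite ball_itv in H2.
rewrite EFinD !EFinM; apply: leeD.
- have P1 : (mu2 ((I `&` NA) `*` J) <= (e / 4 * r * (2 * r))%:E)%E.
    rewrite leb2_X//; last exact: measurableI.
    rewrite (Eb p.2) [leRHS]EFinM; apply: lee_wpmul2r => //.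
    by rewrite lee_fin mulr_ge0// ltW.
  by rewrite -!EFinM; exact: P1.
- have P2 : (mu2 (I `*` (J `&` NB)) <= (2 * r * (e / 4 * r))%:E)%E.
    rewrite leb2_X//; last exact: measurableI.
    rewrite (Eb p.1) [leRHS]EFinM; apply: lee_wpmul2l => //.
    by rewrite lee_fin mulr_ge0// ltW.
  by rewrite -!EFinM; exact: P2.
Qed.

(** Monotone class argument starting from rectangles. Proper differences are settled by
    [lpoint_comb], increasing unions by [ae_lpoint_limit]: the indicators converge in L^1 of the
    root, whose area is finite. *)
Lemma ae_lpoint_indic (E : set (R * R)) : measurable E -> ae_lpoint a b (\1_E : R * R -> R).
Proof.
pose H := [set E : set (R * R) | measurable E /\ ae_lpoint a b (\1_E : R * R -> R)].
suff : @measurable _ (measurableTypeR R * measurableTypeR R)%type `<=` H by move=> + /[dup] ? => /[apply] -[].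
rewrite measurable_prod_measurableType.
apply: (@lambda_system_subset _ _ _ setT) => //.
- move=> _ _ [A1 mA1 [B1 mB1 <-]] [A2 mA2 [B2 mB2 <-]].
  exists (A1 `&` A2); first exact: measurableI.
  by exists (B1 `&` B2); [exact: measurableI|rewrite setXI].
- split=> //.
  + by split => //; rewrite -setXTT; apply: ae_lpoint_rect.
  + move=> A B BA [mA lA] [mB lB]; split; first exact: measurableD.
    apply: ae_imply (ae_and lA lB) => p [H1 H2] Qp.
    apply: (@lpoint_comb _ a b (\1_A) (\1_B) _ p 1 _ _ _ _ _ (H1 Qp) (H2 Qp)) => //.
    * by apply: measurable_indic; exact: measurableD.
    * move=> q; rewrite mul1r.
      have e x : \1_(A `\` B) x = \1_A x - \1_B x :> R.
        rewrite !indicE; have [xB|xB] := boolP (x \in B).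
          have -> : x \in A by move: xB; rewrite !inE; exact: BA.
          by rewrite subrr memNset//= => -[_]; rewrite inE in xB.
        rewrite subr0; congr (_%:R); congr nat_of_bool; rewrite notin_setE in xB.
        by apply/idP/idP => /set_mem h; apply/mem_set; [case: h|split].
      rewrite !e; have -> : \1_A q - \1_B q - (\1_A p - \1_B p) = (\1_A q - \1_A p) - (\1_B q - \1_B p) :> R by ring.
      exact: ler_normB.
  + move=> F ndF HF; have mF n : measurable (F n) by have [] := HF n.
    have mU : measurable (\bigcup_i F i) by exact: bigcup_measurable.
    split => //; apply: ae_lpoint_limit => // e e0.
    pose G n := ((\bigcup_i F i) `\` F n) `&` Q0.
    have mQ : measurable Q0 by exact: mQ0.
    have mG n : measurable (G n) by apply: measurableI => //; exact: measurableD.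
    have capG : \bigcap_n G n = set0.
      rewrite -subset0 => x Gx; have [[n _ Fn] _] := (Gx 0%N I).1; have [[_ +] _] := Gx n I.
      by apply.
    have finG : (mu2 (G 0%N) < +oo)%E.
      apply: (@le_lt_trans _ _ (mu2 Q0)); last by rewrite leb2_cell ?ltry.
      by apply: le_measure; rewrite ?inE//; move=> x [].
    have niG : {homo G : n m / (n <= m)%N >-> (m <= n)%O}.
      move=> n m nm; apply/subsetPset => x [[Ux nx] Qx]; split => //; split => //.
      by apply: contra_not nx; move/subsetPset: (ndF _ _ nm); apply.
    have K := @nonincreasing_cvg_mu _ _ _ mu2 G finG mG (bigcapT_measurable mG) niG.
    rewrite capG measure0 in K.
    have : \forall n \near \oo, (mu2 (G n) < e%:E)%E.
      exact: cvge0_lt K e0.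
    move=> [n _ /(_ n (leqnn n)) Hn].
    have ed x : `|\1_(\bigcup_i F i) x - \1_(F n) x| = \1_((\bigcup_i F i) `\` F n) x :> R.
      rewrite !indicE; have [xB|xB] := boolP (x \in F n).
        have -> : x \in \bigcup_i F i by move: xB; rewrite !inE => ?; exists n.
        by rewrite subrr normr0 memNset//= => -[_]; rewrite inE in xB.
      rewrite subr0 normr_nat; congr (_%:R); congr nat_of_bool; rewrite notin_setE in xB.
      by apply/idP/idP => /set_mem h; apply/mem_set; [split|case: h].
    exists (\1_(F n)); split => //; first by apply: measurable_indic; exact: mF.
    * have -> : (fun q => `|\1_(\bigcup_i F i) q - \1_(F n) q| : R) = \1_((\bigcup_i F i) `\` F n).
        by apply/funext => x; exact: ed.
      apply: (@integrable_bnd _ _ _ _ _ _ 1) => //.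
      - by rewrite leb2_cell ?ltry.
      - by apply: measurable_funTS; apply: measurable_indic; exact: measurableD.
      - by move=> x _; rewrite indicE normr_nat; case: (_ \in _).
    * by have [] := HF n.
    * under eq_integral do rewrite ed.
      rewrite integral_indic//; last exact: measurableD.
      exact: ltW Hn.
- by move=> _ [A mA [B mB <-]]; split; [exact: measurableX|exact: ae_lpoint_rect].
Qed.
End Lebesgue2.

Import HBSimple HBNNSimple.

(** Continuity off 0; the point 0, with its default value, is treated as a measurable singleton. *)
Lemma measurable_inv {R : realType} : measurable_fun [set: R] (fun y : R => y^-1).
Proof.
have o0 : open [set~ (0:R)].
  by apply: closed_openC; apply: accessible_closed_set1; apply: hausdorff_accessible; exact: Rhausdorff.
rewrite -(setvU [set (0:R)]); apply/measurable_funU => //.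
- exact: open_measurable.
- split; last exact: measurable_fun_set1.
  apply: open_continuous_measurable_fun => // y; rewrite inE /= => /eqP y0.
  exact: inv_continuous.
Qed.

Section Lebesgue3.
Context {R : realType}.
Variables (a b : R).
Hypotheses (a0 : 0 < a) (b0 : 0 < b).
Notation mu2 := ((@lebesgue_measure R \x @lebesgue_measure R)%E
  : {measure set (measurableTypeR R * measurableTypeR R)%type -> \bar R}).
Notation Q0 := (cell a b 0 0 0).

Lemma ae_lpoint_sum (I : Type) (s : seq I) (c : I -> R) (E : I -> set (R * R)) :
  (forall i, measurable (E i)) ->
  ae_lpoint a b (fun x => \sum_(i <- s) c i * \1_(E i) x).
Proof.
move=> mE; elim: s => [|i s IH].
  exists set0; split => //; move=> p np; apply: np => Qp e e0; exists 1 => // r r0 r1.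
  under eq_integral do rewrite !big_nil subrr normr0.
  by rewrite integral0 lee_fin mulr_ge0 ?sqr_ge0// ltW.
have H1 := ae_lpoint_indic a0 b0 (mE i).
apply: ae_imply (ae_and IH H1) => p [K1 K2] Qp.
have mS (t : seq I) : measurable_fun [set: R * R] (fun x : R * R => \sum_(i <- t) c i * \1_(E i) x).
  apply: measurable_sum => k; apply: measurable_funM => //; exact: measurable_indic.
apply: (@lpoint_comb _ a b _ (\1_(E i)) _ p `|c i| _ _ _ _ _ (K1 Qp) (K2 Qp)) => //.
move=> q; rewrite !big_cons -normrM.
apply: le_trans (ler_normD _ _); rewrite le_eqVlt; apply/orP; left; apply/eqP.
by congr (`| _ |); ring.
Qed.

Lemma ae_lpoint_nnsfun (f : {nnsfun (measurableTypeR R * measurableTypeR R)%type >-> R}) :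
  ae_lpoint a b f.
Proof.
have -> : (f : R * R -> R) = fun x => \sum_(y <- finmap.enum_fset (fset_set (range f))) y * \1_(f @^-1` [set y]) x.
  by apply/funext => x; rewrite fimfunE fsbig_finite.
apply: (@ae_lpoint_sum R (finmap.enum_fset (fset_set (range f))) (fun y => y) (fun y => f @^-1` [set y])).
by move=> y; exact: (measurable_sfunP f (measurable_set1 y)).
Qed.

(** Increasing simple functions converge to [h] in L^1 by dominated convergence, with [h] itself as
    majorant. *)
Lemma ae_lpoint_ge0 (h : R * R -> R) : measurable_fun setT h -> (forall q, 0 <= h q) ->
  mu2.-integrable Q0 (EFin \o h) -> ae_lpoint a b h.
Proof.
move=> mh h0 ih; have mQ : measurable Q0 by exact: mQ0.
apply: ae_lpoint_limit => // e e0.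
have mhE : measurable_fun setT (EFin \o h) by exact/measurable_EFinP.
pose g := nnsfun_approx (@measurableT _ (measurableTypeR R * measurableTypeR R)%type) mhE.
have g0 n q : 0 <= g n q by [].
have gcv q : (EFin \o (fun n => g n q)) n @[n --> \oo] --> (h q)%:E.
  by apply: cvg_nnsfun_approx => // x _; rewrite lee_fin.
have gle n q : g n q <= h q.
  rewrite -lee_fin -(cvg_lim _ (gcv q))//.
  apply: lime_ge; first by apply/cvg_ex; eexists; exact: gcv.
  by exists n => // k /= nk; rewrite lee_fin; apply/lefP/nd_nnsfun_approx.
have mg n : measurable_fun setT (g n) by [].
have mg' n : measurable_fun Q0 (fun q => (g n q)%:E).
  by apply: measurable_funTS; apply/measurable_EFinP; exact: mg.
have gb : {ae mu2, forall q, forall n : nat, Q0 q -> (`|(g n q)%:E| <= (EFin \o h) q)%E}.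
  by apply: aeW => q n _; rewrite /= ger0_norm// lee_fin.
have gc : {ae mu2, forall q, Q0 q -> (g n q)%:E @[n --> \oo] --> (EFin \o h) q}.
  by apply: aeW => q _; exact: gcv.
have mhQ : measurable_fun Q0 (EFin \o h) by exact: measurable_funTS.
have [_ K _] := @dominated_convergence _ _ _ mu2 Q0 mQ (fun n q => (g n q)%:E) (EFin \o h)
  (EFin \o h) mg' mhQ gc ih gb.
have [n _ Hn] := cvge0_lt K e0.
have {}Hn := Hn n (leqnn n).
exists (g n); split => //; first exact: mg.
- apply: (@le_integrable _ _ _ mu2 Q0 mQ _ (EFin \o h)) => //.
    apply/measurable_EFinP; apply: measurable_funTS; apply: measurableT_comp => //.
    exact: measurable_funB.
  move=> q _; rewrite /= lee_fin normr_id ger0_norm ?subr_ge0// ger0_norm//.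
  by rewrite gerBl.
- exact: ae_lpoint_nnsfun.
- apply: le_trans (ltW Hn); rewrite le_eqVlt; apply/orP; left; apply/eqP.
  by apply: eq_integral => x _; rewrite /= distrC.
Qed.

Lemma ae_lpoint_L1 (h : R * R -> R) : measurable_fun setT h ->
  mu2.-integrable Q0 (EFin \o h) -> ae_lpoint a b h.
Proof.
move=> mh ih; have mQ : measurable Q0 by exact: mQ0.
have H (k : R * R -> R) : measurable_fun setT k -> (forall q, 0 <= k q) ->
    (forall q, k q <= `|h q|) -> ae_lpoint a b k.
  move=> mk k0 kh; apply: ae_lpoint_ge0 => //.
  apply: (@le_integrable _ _ _ mu2 Q0 mQ _ (EFin \o h)) => //.
    by apply/measurable_EFinP; exact: measurable_funTS.
  by move=> q _; rewrite /= lee_fin ger0_norm.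
have mp : measurable_fun setT (fun q => Num.max (h q) 0) by apply: measurable_maxr.
have mn : measurable_fun setT (fun q => Num.max (- h q) 0).
  by apply: measurable_maxr => //; exact: measurableT_comp.
have Hp := H _ mp (fun q => _) (fun q => _).
have Hn := H _ mn (fun q => _) (fun q => _).
apply: ae_imply (ae_and (Hp _ _) (Hn _ _)) => [p [K1 K2] Qp|q|q|q|q].
- apply: (@lpoint_comb _ a b _ _ h p 1 _ _ _ _ _ (K1 Qp) (K2 Qp)) => // q.
  have e x : h x = Num.max (h x) 0 - Num.max (- h x) 0.
    by case: (leP (h x) 0) => hx; [rewrite (@max_l _ _ (- h x)) ?oppr_ge0//; ring
      |rewrite (@max_r _ _ (- h x)) ?oppr_le0 ?ltW//; ring].
  rewrite mul1r {1}(e q) {1}(e p).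
  have -> (x y z t : R) : x - y - (z - t) = (x - z) - (y - t) by ring.
  exact: ler_normB.
- by rewrite le_max lexx orbT.
- by rewrite ge_max normr_ge0 ler_norm.
- by rewrite le_max lexx orbT.
- by rewrite ge_max normr_ge0 -normrN ler_norm.
Qed.

(** * The model kernel on the parameter plane *)

Definition supdist (p q : R * R) : R := Num.max `|q.1 - p.1| `|q.2 - p.2|.

(** The size of the Poisson kernel seen from depth [d] in the cone at [p]: there the distance to a
    boundary point is comparable to the larger of the depth and the distance along the sphere. *)
Definition pkernel (d : R) (p q : R * R) : R := d / (Num.max d (supdist p q)) ^+ 3.

Lemma measurable_supdist p : measurable_fun setT (supdist p).
Proof.
apply: measurable_maxr; apply: measurableT_comp => //; exact: measurable_funB.
Qed.

Lemma pkernel_ge0 d p q : 0 <= d -> 0 <= pkernel d p q.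
Proof. by move=> d0; rewrite divr_ge0// exprn_ge0// le_max d0. Qed.

Lemma pkernel_le d p q r : 0 < d -> 0 < r -> r <= Num.max d (supdist p q) ->
  pkernel d p q <= d / r ^+ 3.
Proof.
move=> d0 r0 h; have m0 : 0 < Num.max d (supdist p q) by rewrite lt_max d0.
rewrite ler_pM2l// lef_pV2 ?posrE ?exprn_gt0//.
by rewrite lerXn2r// nnegrE ltW.
Qed.

Lemma measurable_pkernel d p : 0 < d -> measurable_fun setT (pkernel d p).
Proof.
move=> d0; apply: measurable_funM => //.
apply: measurableT_comp; first exact: measurable_inv.
by apply: measurable_funX; apply: measurable_maxr => //; exact: measurable_supdist.
Qed.

Lemma bx_supdist p q r : bx p r q <-> supdist p q < r.
Proof.
rewrite /bx /supdist /= !in_itv /= gt_max !ltr_norml.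
split=> [[/andP[h1 h2] /andP[h3 h4]]|/andP[/andP[h1 h2] /andP[h3 h4]]].
  by apply/andP; split; apply/andP; split; lra.
by split; apply/andP; split; lra.
Qed.

Lemma ge0_sub_int (f : R * R -> R) A B : measurable A -> measurable B ->
  measurable_fun setT f -> (forall x, 0 <= f x) -> A `<=` B ->
  (\int[mu2]_(q in A) (f q)%:E <= \int[mu2]_(q in B) (f q)%:E)%E.
Proof.
move=> mA mB mf f0 AB; apply: ge0_subset_integral => //.
- by apply: measurable_funTS; exact/measurable_EFinP.
- by move=> x _; rewrite lee_fin.
Qed.

Lemma integral_pkernel_le (H : R * R -> R) d p A (c : R) : measurable A ->
  measurable_fun setT H -> (forall q, 0 <= H q) -> 0 < d -> 0 <= c ->
  (forall q, A q -> pkernel d p q <= c) ->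
  (\int[mu2]_(q in A) (pkernel d p q * H q)%:E <= c%:E * \int[mu2]_(q in A) (H q)%:E)%E.
Proof.
move=> mA mH H0 d0 c0 Hc.
have mHE : measurable_fun A (EFin \o H) by apply: measurable_funTS; exact/measurable_EFinP.
rewrite -ge0_integralZl//; last by move=> x _; rewrite lee_fin.
apply: ge0_le_integral => //.
- by move=> x _; rewrite lee_fin mulr_ge0// pkernel_ge0// ltW.
- apply/measurable_EFinP; apply: measurable_funTS; apply: measurable_funM => //.
  exact: measurable_pkernel.
- apply: (@measurable_funTS _ _ _ _ A (fun x => (c%:E * (H x)%:E)%E)).
  by apply/measurable_EFinP; apply: measurable_funM.
- by move=> x Ax; rewrite -EFinM lee_fin ler_wpM2r// Hc.
Qed.

(* Summing the kernel over the dyadic annuli around a Lebesgue point. *)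
Lemma pkernel_lpoint (H : R * R -> R) (p : R * R) :
  measurable_fun setT H -> (forall q, 0 <= H q) ->
  (\int[mu2]_(q in Q0) (H q)%:E < +oo)%E ->
  (forall e : R, 0 < e -> exists2 d : R, 0 < d & forall r, 0 < r -> r < d ->
    (\int[mu2]_(q in bx p r `&` Q0) (H q)%:E <= (e * r ^+ 2)%:E)%E) ->
  forall e : R, 0 < e -> exists2 d0 : R, 0 < d0 & forall d, 0 < d -> d < d0 ->
    (\int[mu2]_(q in Q0) (pkernel d p q * H q)%:E <= e%:E)%E.
Proof.
move=> mH H0 iH HL e e0.
have mQ : measurable Q0 by exact: mQ0.
have mbq r : measurable (bx p r `&` Q0) by exact: mbQ.
pose M := fine (\int[mu2]_(q in Q0) (H q)%:E)%E.
have ME : (\int[mu2]_(q in Q0) (H q)%:E)%E = M%:E.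
  by rewrite fineK// ge0_fin_numE//; apply: integral_ge0 => q _; rewrite lee_fin.
have M0 : 0 <= M by rewrite fine_ge0//; apply: integral_ge0 => q _; rewrite lee_fin.
(* The square of radius [d] and all the annuli together contribute at most [9 e1], half of [e]. *)
pose e1 := e / 18; have e10 : 0 < e1 by rewrite divr_gt0.
have [l l0 Hl] := HL _ e10.
(* Outside radius [l / 4] the kernel is at most [64 d / l^3]; the factor 128 makes this tail at most
   half of [e]. *)
pose d0 := Num.min (l / 2) (e / (128 * (M + 1) / l ^+ 3)).
have c0 : 0 < 128 * (M + 1) / l ^+ 3 by rewrite divr_gt0 ?exprn_gt0// mulr_gt0// ltr_wpDl.
exists d0; first by rewrite lt_min divr_gt0//= divr_gt0.
move=> d dp; rewrite lt_min => /andP[dl de].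
have mK : measurable_fun setT (fun q => (pkernel d p q * H q)%:E).
  by apply/measurable_EFinP; apply: measurable_funM => //; exact: measurable_pkernel.
have K0 q : (0 <= (pkernel d p q * H q)%:E)%E.
  by rewrite lee_fin mulr_ge0// pkernel_ge0// ltW.
have p2 j : 0 < 2 ^+ j :> R by rewrite exprn_gt0.
(* [9 - 8 / 2^j] is 1, from the square of radius [d], plus the geometric sum of the contributions
   [4 / 2^i] of the annuli with [i < j]. *)
have key j : 2 ^+ j * d < l ->
  (\int[mu2]_(q in bx p (2 ^+ j * d) `&` Q0) (pkernel d p q * H q)%:E <=
    (e1 * (9 - 8 / 2 ^+ j))%:E)%E.
  elim: j => [|j IH].
    rewrite expr0 mul1r divr1 => ddl.
    have cd : 0 <= d / d ^+ 3 by rewrite divr_ge0 ?exprn_ge0 ?ltW.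
    apply: (le_trans (@integral_pkernel_le H d p _ (d / d ^+ 3) (mbq _) mH H0 dp cd _)).
      by move=> q _; apply: pkernel_le => //; rewrite le_max lexx.
    apply: (@le_trans _ _ ((d / d ^+ 3)%:E * (e1 * d ^+ 2)%:E)%E).
      by apply: lee_wpmul2l; [rewrite lee_fin|exact: Hl].
    rewrite -EFinM lee_fin le_eqVlt; apply/orP; left; apply/eqP.
    by field; rewrite gt_eqF.
  move=> hj; have rj0 : 0 < 2 ^+ j * d by rewrite mulr_gt0.
  have hj' : 2 ^+ j * d < l.
    by apply: le_lt_trans hj; rewrite exprS -mulrA ler_peMl ?(ltW rj0)// ler1n.
  pose B := (bx p (2 ^+ j.+1 * d) `&` Q0) `\` bx p (2 ^+ j * d).
  have mB : measurable B by apply: measurableD => //; exact: measurable_bx.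
  apply: (@le_trans _ _ (\int[mu2]_(q in (bx p (2 ^+ j * d) `&` Q0) `|` B)
      (pkernel d p q * H q)%:E)%E).
    apply: ge0_subset_integral => //; [exact: mbq|by apply: measurableU => //; exact: mbq|exact: measurable_funTS|].
    move=> q [q1 q2]; have [h|h] := pselect (bx p (2 ^+ j * d) q); first by left.
    by right; split.
  apply: (le_trans (le_integral_setU (mbq _) mB mK K0)).
  have -> : e1 * (9 - 8 / 2 ^+ j.+1) = e1 * (9 - 8 / 2 ^+ j) + e1 * (4 / 2 ^+ j).
    by rewrite exprS; field; rewrite gt_eqF.
  rewrite EFinD; apply: leeD; first exact: IH.
  have cd : 0 <= d / (2 ^+ j * d) ^+ 3 by rewrite divr_ge0 ?exprn_ge0 ?ltW.
  apply: (le_trans (@integral_pkernel_le H d p B (d / (2 ^+ j * d) ^+ 3) mB mH H0 dp cd _)).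
    move=> q [_ nq]; apply: pkernel_le => //; rewrite le_max; apply/orP; right.
    by rewrite leNgt; apply/negP => /bx_supdist.
  apply: (@le_trans _ _ ((d / (2 ^+ j * d) ^+ 3)%:E * (e1 * (2 ^+ j.+1 * d) ^+ 2)%:E)%E).
    apply: lee_wpmul2l; first by rewrite lee_fin.
    apply: le_trans (Hl _ _ hj); last by rewrite mulr_gt0.
    by apply: ge0_sub_int => //; [exact: mbq|move=> x []].
  rewrite -EFinM lee_fin [2 ^+ j.+1]exprS le_eqVlt; apply/orP; left; apply/eqP.
  by field; rewrite !gt_eqF.
have [n [n1 n2]] := dyadic_scale dp (ltW dl).
have nl : 2 ^+ n * d < l.
  by move: n2; rewrite ler_pdivlMr// mulrC => n2; clear - n2 l0; lra.
have nl' : l / 4 <= 2 ^+ n * d.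
  by move: n1; rewrite ltr_pdivrMr// exprS; clear; lra.
pose B := Q0 `\` bx p (2 ^+ n * d).
have mB : measurable B by apply: measurableD => //; exact: measurable_bx.
apply: (@le_trans _ _ (\int[mu2]_(q in (bx p (2 ^+ n * d) `&` Q0) `|` B)
    (pkernel d p q * H q)%:E)%E).
  apply: ge0_subset_integral => //; [by apply: measurableU => //; exact: mbq|exact: measurable_funTS|].
  move=> q q2; have [h|h] := pselect (bx p (2 ^+ n * d) q); first by left.
  by right; split.
apply: (le_trans (le_integral_setU (mbq _) mB mK K0)).
have -> : e = e / 2 + e / 2 by field.
rewrite EFinD; apply: leeD.
  apply: le_trans (key n nl) _; rewrite lee_fin.
  rewrite /e1 mulrBr lerBlDr; have : 0 <= e / 18 * (8 / 2 ^+ n) by rewrite mulr_ge0// divr_ge0 ?ltW.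
  clear - e0; lra.
have l4 : 0 < l / 4 by rewrite divr_gt0.
have cd : 0 <= d / (l / 4) ^+ 3 by rewrite divr_ge0 ?exprn_ge0 ?ltW.
apply: (le_trans (@integral_pkernel_le H d p B (d / (l / 4) ^+ 3) mB mH H0 dp cd _)).
  move=> q [_ nq]; apply: pkernel_le => //; rewrite le_max; apply/orP; right.
  by apply: le_trans nl' _; rewrite leNgt; apply/negP => /bx_supdist.
apply: (@le_trans _ _ ((d / (l / 4) ^+ 3)%:E * M%:E)%E).
  apply: lee_wpmul2l; first by rewrite lee_fin.
  by rewrite -ME; apply: ge0_sub_int => // x [].
rewrite -EFinM lee_fin.
have : d * (128 * (M + 1) / l ^+ 3) <= e by rewrite -ler_pdivlMr// ltW.
have l3 : 0 < (l ^+ 3)^-1 by rewrite invr_gt0 exprn_gt0.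
have -> : d / (l / 4) ^+ 3 * M = 64 * (d * M * (l ^+ 3)^-1) by field; rewrite gt_eqF.
have -> : d * (128 * (M + 1) / l ^+ 3) = 128 * (d * M * (l ^+ 3)^-1) + 128 * (d * (l ^+ 3)^-1) by ring.
have : 0 < d * (l ^+ 3)^-1 by rewrite mulr_gt0.
clear; lra.
Qed.
End Lebesgue3.

(** * Integrals depending on a parameter *)

Section ParametricIntegral.
Context {R : realType} {d : measure_display} {Y : measurableType d}.
Variable mu : {measure set Y -> \bar R}.
Variables (D : set Y).
Hypotheses (mD : measurable D) (muD : (mu D < +oo)%E).

Lemma le_Rintegral_bnd (f : Y -> R) (C : R) : measurable_fun D f ->
  (forall y, D y -> `|f y| <= C) -> `|\int[mu]_(y in D) f y| <= C * fine (mu D).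
Proof.
move=> mf H; have i1 := integrable_bnd mD muD mf H.
apply: le_trans (le_normr_Rintegral mD i1) _.
rewrite -(Rintegral_cst mu mD); apply: le_Rintegral => //.
- apply: (@integrable_bnd _ _ _ _ _ _ C) => //; first exact: measurableT_comp.
  by move=> y Dy; rewrite normr_id H.
- by apply: (@integrable_bnd _ _ _ _ _ _ `|C|) => //; move=> y _; rewrite normr_id.
Qed.

Lemma bounded_cvg_Rintegral (F : nat -> Y -> R) (f : Y -> R) (C : R) :
  (forall n, measurable_fun D (F n)) -> measurable_fun D f ->
  (forall n y, D y -> `|F n y| <= C) ->
  (forall y, D y -> F n y @[n --> \oo] --> f y) ->
  \int[mu]_(y in D) F n y @[n --> \oo] --> \int[mu]_(y in D) f y.
Proof.
move=> mF mf FC Ff.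
have iC : mu.-integrable D (EFin \o cst C).
  by apply: (@integrable_bnd _ _ _ _ _ _ `|C|) => // y _; rewrite normr_id.
have ifl : mu.-integrable D (EFin \o f).
  apply: (@integrable_bnd _ _ _ _ _ _ C) => // y Dy.
  have cv : `|F n y| @[n --> \oo] --> `|f y| by apply: cvg_norm; exact: Ff.
  rewrite -(cvg_lim _ cv)//.
  by apply: limr_le; [apply/cvg_ex; eexists; exact: cv|apply: nearW => n; exact: FC].
apply: fine_cvg; rewrite fineK; last exact: integrable_fin_num.
have [] // := @dominated_convergence _ _ _ mu D mD (fun n y => (F n y)%:E) (EFin \o f) (EFin \o cst C).
- by move=> n; exact/measurable_EFinP.
- exact/measurable_EFinP.
- by apply: aeW => y Dy; apply: cvg_EFin; [exact: nearW|exact: Ff].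
- by apply: aeW => y n Dy; rewrite /= lee_fin FC.
Qed.

(** Dominated convergence is about sequences: if continuity failed, bad points chosen within
    [1 / (n + 1)] of [z0] would form a sequence contradicting it. *)
Lemma continuous_Rintegral (Z : pseudoMetricType R) (F : Z -> Y -> R) (z0 : Z) (C : R) :
  (\forall z \near z0, measurable_fun D (F z) /\ forall y, D y -> `|F z y| <= C) ->
  (forall y, D y -> F z y @[z --> z0] --> F z0 y) ->
  \int[mu]_(y in D) F z y @[z --> z0] --> \int[mu]_(y in D) F z0 y.
Proof.
move=> /nbhs_ballP[r /= r0 Hr] Hc; apply/cvgrPdist_lt => e e0.
apply: contrapT => nH.
have ex (n : nat) : exists z, ball z0 (Num.min r n.+1%:R^-1) z /\
    ~ (`|\int[mu]_(y in D) F z0 y - \int[mu]_(y in D) F z y| < e).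
  apply: contrapT => nz; apply: nH; apply/nbhs_ballP.
  exists (Num.min r n.+1%:R^-1) => /=; first by rewrite lt_min r0 invr_gt0 ltr0n.
  by move=> z bz; apply: contrapT => ne; apply: nz; exists z.
have [z Hz] := choice ex.
have zr n : ball z0 r (z n) by apply: le_ball (Hz n).1; rewrite ge_min lexx.
have zz0 : z n @[n --> \oo] --> z0.
  move=> A /nbhs_ballP[s /= s0 sA]; exists (Num.trunc s^-1) => // n /= hn.
  apply: sA; apply: le_ball (Hz n).1; rewrite ge_min; apply/orP; right.
  rewrite -[leRHS]invrK lef_pV2 ?posrE ?invr_gt0//.
  have s1 : 0 <= s^-1 by rewrite invr_ge0 ltW.
  have /andP[_ h] := truncn_itv s1.
  by apply: le_trans (ltW h) _; rewrite ler_nat.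
have K : \int[mu]_(y in D) F (z n) y @[n --> \oo] --> \int[mu]_(y in D) F z0 y.
  apply: (@bounded_cvg_Rintegral _ _ C).
  - by move=> n; have [] := Hr _ (zr n).
  - by have [] := Hr _ (ballxx z0 r0).
  - by move=> n y Dy; have [_ +] := Hr _ (zr n); apply.
  - by move=> y Dy; exact: (@cvg_comp _ _ _ z (fun z => F z y) _ _ _ zz0 (Hc y Dy)).
move/cvgrPdist_lt : K => /(_ e e0)[n _ /(_ n (leqnn n))] Kn.
by have [_] := Hz n; apply.
Qed.
End ParametricIntegral.

Section Lines.
Context {R : realType} {V : normedModType R}.

(** A derivative along [v] is an ordinary derivative on a line in direction [v]; this is how
    theorems of one real variable are brought to bear on functions of a vector. *)
Lemma derive_line (F : V -> R) (x v : V) (t d : R) :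
  is_derive (t *: v + x) v F d <-> is_derive t 1 (fun s => F (s *: v + x)) d.
Proof.
have E : (fun h : R => h^-1 *: ((F \o shift (t *: v + x)) (h *: v) - F (t *: v + x))) =
  (fun h : R => h^-1 *: (((fun s => F (s *: v + x)) \o shift t) (h *: (1:R)) - F (t *: v + x))).
  by apply/funext => h /=; rewrite addrA -scalerDl [h *: 1]mulr1.
split=> -[H1 H2]; apply: DeriveDef; rewrite /derivable /derive.
- by rewrite -E; exact: H1.
- by rewrite -E; exact: H2.
- by rewrite E; exact: H1.
- by rewrite E; exact: H2.
Qed.

Lemma derive_line0 (F : V -> R) (x v : V) (d : R) :
  is_derive x v F d <-> is_derive (0:R) 1 (fun s => F (s *: v + x)) d.
Proof. by have := derive_line F x v 0 d; rewrite scale0r add0r. Qed.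

(** Everything is asked only on a segment through [x] in the direction [v], where the theorem for
    one real parameter applies. *)
Lemma is_derive_Rintegral {dd : measure_display} {Y : measurableType dd}
  (mu : {measure set Y -> \bar R}) (D : set Y) (F dF : V -> Y -> R) (x v : V) (e C : R) :
  measurable D -> (mu D < +oo)%E -> 0 < e ->
  (forall t, `|t| < e -> measurable_fun D (F (t *: v + x))) ->
  (forall t y, `|t| < e -> D y -> `|F (t *: v + x) y| <= C) ->
  (forall t y, `|t| < e -> D y -> is_derive (t *: v + x) v (F ^~ y) (dF (t *: v + x) y)) ->
  (forall t y, `|t| < e -> D y -> `|dF (t *: v + x) y| <= C) ->
  is_derive x v (fun z => \int[mu]_(y in D) F z y) (\int[mu]_(y in D) dF x y).
Proof.
move=> mD muD e0 mF FC dFd dFC; apply/derive_line0.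
have I0 : `]- e, e[%classic (0 : R) by rewrite /= in_itv /= oppr_lt0 e0.
have It (t : R) : `]- e, e[%classic t -> `|t| < e by rewrite /= in_itv /= ltr_norml.
have intf (t : R) : `]- e, e[%classic t -> mu.-integrable D (EFin \o (fun y => F (t *: v + x) y)).
  by move=> /It te; apply: (@integrable_bnd _ _ _ _ _ _ C) => //;
    [exact: mF|move=> y Dy; exact: FC].
have dline (t : R) y : `]- e, e[%classic t -> D y ->
    is_derive t 1 (fun s => F (s *: v + x) y) (dF (t *: v + x) y).
  by move=> /It te Dy; apply/(derive_line (F ^~ y)); exact: dFd.
have der (t : R) y : `]- e, e[%classic t -> D y -> derivable (fun s : R => F (s *: v + x) y) t 1.
  by move=> Ie Dy; have [] := dline t y Ie Dy.
have intC : mu.-integrable D (EFin \o cst `|C|).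
  by apply: (@integrable_bnd _ _ _ _ _ _ `|C|) => // y _; rewrite normr_id.
have ub (t : R) y : `]- e, e[%classic t -> D y ->
    `|partial1of2 (fun s y => F (s *: v + x) y) t y| <= cst `|C| y.
  move=> It' Dy; rewrite partial1of2E; have [_ ->] := dline t y It' Dy.
  apply: le_trans (dFC _ _ (It _ It') Dy) (ler_norm _).
have K1 := @derivable_under_integral _ _ _ mu (fun s y => F (s *: v + x) y) D mD
  0 (- e) e I0 intf der (cst `|C|) (fun y => normr_ge0 _) intC ub.
have K2 := @differentiation_under_integral _ _ _ mu (fun s y => F (s *: v + x) y) D mD
  0 (- e) e I0 intf der (cst `|C|) (fun y => normr_ge0 _) intC ub.
apply: DeriveDef => //; rewrite -derive1E K2; apply: eq_Rintegral => y /set_mem Dy.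
by rewrite partial1of2E; have [_ ->] := dline 0 y I0 Dy; rewrite scale0r add0r.
Qed.
End Lines.

(** * The Poisson kernel and its derivatives *)

Section Euclid3.
Context {R : realType}.
Notation V3 := 'rV[R]_3.
Implicit Types (x y z : V3).

Lemma dot3E x y : dot3 x y = x 0 ord0 * y 0 ord0 + x 0 (lift ord0 ord0) * y 0 (lift ord0 ord0)
  + x 0 (lift ord0 (lift ord0 ord0)) * y 0 (lift ord0 (lift ord0 ord0)).
Proof. by rewrite /dot3 !big_ord_recl big_ord0 addr0 addrA. Qed.

Lemma dot3C x y : dot3 x y = dot3 y x.
Proof. by apply: eq_bigr => i _; rewrite mulrC. Qed.

Lemma dot3Dl x y z : dot3 (x + y) z = dot3 x z + dot3 y z.
Proof. by rewrite /dot3 -big_split; apply: eq_bigr => i _; rewrite mxE mulrDl. Qed.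

Lemma dot3Zl (c : R) x y : dot3 (c *: x) y = c * dot3 x y.
Proof. by rewrite /dot3 big_distrr /=; apply: eq_bigr => i _; rewrite mxE mulrA. Qed.

Lemma dot3Dr x y z : dot3 x (y + z) = dot3 x y + dot3 x z.
Proof. by rewrite dot3C dot3Dl !(dot3C _ x). Qed.

Lemma dot3Zr (c : R) x y : dot3 x (c *: y) = c * dot3 x y.
Proof. by rewrite dot3C dot3Zl dot3C. Qed.

Lemma dot3_ge0 x : 0 <= dot3 x x.
Proof. by apply: sumr_ge0 => i _; rewrite -expr2 sqr_ge0. Qed.

Lemma enorm3_ge0 x : 0 <= enorm3 x.
Proof. exact: sqrtr_ge0. Qed.

Lemma enorm3_sq x : enorm3 x ^+ 2 = dot3 x x.
Proof. by rewrite sqr_sqrtr// dot3_ge0. Qed.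

(** Lagrange's identity: the difference of the squares is the sum of the squared 2 by 2 minors. *)
Lemma cauchy_schwarz3 x y : `|dot3 x y| <= enorm3 x * enorm3 y.
Proof.
rewrite -(@ler_pXn2r _ 2)// ?nnegrE ?mulr_ge0 ?enorm3_ge0//.
rewrite real_normK ?num_real// exprMn !enorm3_sq !dot3E.
set a := x 0 _; set b := x 0 _; set c := x 0 _; set a' := y 0 _; set b' := y 0 _; set c' := y 0 _.
rewrite -subr_ge0.
have -> : (a * a + b * b + c * c) * (a' * a' + b' * b' + c' * c') - (a * a' + b * b' + c * c') ^+ 2
  = (a * b' - b * a') ^+ 2 + (a * c' - c * a') ^+ 2 + (b * c' - c * b') ^+ 2 by ring.
by rewrite !addr_ge0 ?sqr_ge0.
Qed.

Lemma enorm3D x y : enorm3 (x + y) <= enorm3 x + enorm3 y.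
Proof.
rewrite -(@ler_pXn2r _ 2)// ?nnegrE ?addr_ge0 ?enorm3_ge0//.
rewrite enorm3_sq sqrrD !enorm3_sq dot3Dl !dot3Dr (dot3C y x).
have := cauchy_schwarz3 x y; have := ler_norm (dot3 x y); lra.
Qed.

Lemma enorm3Z (c : R) x : enorm3 (c *: x) = `|c| * enorm3 x.
Proof.
by rewrite /enorm3 dot3Zl dot3Zr mulrA -expr2 sqrtrM ?sqr_ge0// sqrtr_sqr.
Qed.

Lemma enorm3N x : enorm3 (- x) = enorm3 x.
Proof. by rewrite -scaleN1r enorm3Z normrN1 mul1r. Qed.

Lemma enorm3B x y : enorm3 (x - y) <= enorm3 x + enorm3 y.
Proof. by apply: le_trans (enorm3D _ _) _; rewrite enorm3N. Qed.

Lemma enorm3_distC x y : enorm3 (x - y) = enorm3 (y - x).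
Proof. by rewrite -enorm3N opprB. Qed.

Lemma enorm3_sub_ge x y : enorm3 x - enorm3 y <= enorm3 (x - y).
Proof. by rewrite lerBlDr -{1}(subrK y x) enorm3D. Qed.

Lemma coord_le_enorm3 x i : `|x 0 i| <= enorm3 x.
Proof.
rewrite -(@ler_pXn2r _ 2)// ?nnegrE ?enorm3_ge0// real_normK ?num_real// enorm3_sq.
rewrite /dot3 (bigD1 i)//= expr2 lerDl; apply: sumr_ge0 => k _; by rewrite -expr2 sqr_ge0.
Qed.

Lemma coord_le_norm x i : `|x 0 i| <= `|x|.
Proof.
rewrite [leRHS]/Num.Def.normr /= mx_normrE; apply/bigmax_geP; right.
by exists (0, i).
Qed.

Lemma norm_le_coord x (c : R) : 0 <= c -> (forall i, `|x 0 i| <= c) -> `|x| <= c.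
Proof.
move=> c0 H; rewrite [leLHS]/Num.Def.normr /= mx_normrE; apply/bigmax_leP; split => // -[i j] _ /=.
by rewrite (ord1 i).
Qed.

Lemma norm_le_enorm3 x : `|x| <= enorm3 x.
Proof. by apply: norm_le_coord => [|i]; [exact: enorm3_ge0|exact: coord_le_enorm3]. Qed.

(** The norm on the right is the maximum of the coordinates; 2 is a convenient bound for the square
    root of 3. *)
Lemma enorm3_le_norm x : enorm3 x <= 2 * `|x|.
Proof.
rewrite -(@ler_pXn2r _ 2)// ?nnegrE ?enorm3_ge0 ?mulr_ge0// enorm3_sq.
apply: (@le_trans _ _ (\sum_(i < 3) `|x| ^+ 2)).
  apply: ler_sum => i _; rewrite -expr2 -[leLHS]real_normK ?num_real//.
  by rewrite lerXn2r ?nnegrE// coord_le_norm.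
rewrite !big_ord_recl big_ord0 exprMn; have := sqr_ge0 `|x|; lra.
Qed.

Lemma enorm3_0 : enorm3 (0 : V3) = 0.
Proof. by rewrite -(scale0r (0 : V3)) enorm3Z normr0 mul0r. Qed.

Lemma enorm3_eq0 x : enorm3 x = 0 -> x = 0.
Proof.
move=> h; apply/rowP => i; rewrite mxE; apply/eqP; rewrite -normr_le0.
by rewrite -h coord_le_enorm3.
Qed.

Lemma cvg_coord {T : Type} {F : set_system T} {FF : Filter F} (Y : T -> V3) y i :
  Y @ F --> y -> (fun t => Y t 0 i) @ F --> y 0 i.
Proof. by move=> hY; exact: (cvg_comp _ _ hY (@coord_continuous _ _ _ 0 i y)). Qed.

Lemma cvg_dot3 {T : Type} {F : set_system T} {FF : Filter F} (Y : T -> V3) y :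
  Y @ F --> y -> (fun t => dot3 (Y t) (Y t)) @ F --> dot3 y y.
Proof.
move=> hY; rewrite dot3E (_ : (fun t => dot3 (Y t) (Y t)) = (fun t =>
    Y t 0 ord0 * Y t 0 ord0 + Y t 0 (lift ord0 ord0) * Y t 0 (lift ord0 ord0) +
    Y t 0 (lift ord0 (lift ord0 ord0)) * Y t 0 (lift ord0 (lift ord0 ord0)))); last first.
  by apply/funext => t; exact: dot3E.
by apply: cvgD; [apply: cvgD|]; apply: cvgM; exact: cvg_coord.
Qed.

Lemma cvg_enorm3 {T : Type} {F : set_system T} {FF : Filter F} (Y : T -> V3) y :
  Y @ F --> y -> (fun t => enorm3 (Y t)) @ F --> enorm3 y.
Proof. by move=> /cvg_dot3 h; exact: (cvg_comp _ _ h (@sqrt_continuous _ _)). Qed.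

Lemma continuous_enorm3 : continuous (@enorm3 R).
Proof. by move=> x; exact: (@cvg_enorm3 V3 (nbhs x) _ id x (@cvg_id _ _)). Qed.

Lemma e3E i j : e3 R i 0 j = (i == j)%:R.
Proof. by rewrite /e3 mxE eqxx /= eq_sym. Qed.

Lemma enorm3_e3 i : enorm3 (e3 R i) = 1.
Proof.
rewrite /enorm3 /dot3 (bigD1 i)//= e3E eqxx mulr1 big1 ?addr0 ?sqrtr1// => j ji.
by rewrite e3E eq_sym (negbTE ji) mulr0.
Qed.

Lemma is_derive_coord x v i : is_derive x v (fun y : V3 => y 0 i) (v 0 i).
Proof.
apply/derive_line0; rewrite (_ : (fun s : R => (s *: v + x) 0 i) = (fun s => s * v 0 i + x 0 i)).
  by apply: is_derive_eq; rewrite /GRing.scale /=; ring.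
by apply/funext => s; rewrite !mxE.
Qed.

End Euclid3.

(** The quadratic is the squared distance to a fixed point along a coordinate line, with [c] its
    value at [s = 0]. *)
Lemma is_derive_invsqrt {R : realType} (b c : R) : 0 < c ->
  is_derive (0 : R) 1 (fun s : R => (Num.sqrt (s ^+ 2 + s * b + c))^-1)
    (- (b / 2) * (Num.sqrt c)^-1 ^+ 3).
Proof.
move=> c0; have s0 : 0 < Num.sqrt c by rewrite sqrtr_gt0.
have dq : is_derive (0 : R) 1 (fun s : R => s ^+ 2 + s * b + c) b.
  by apply: is_derive_eq; rewrite /GRing.scale /=; ring.
have q0 : (0 : R) ^+ 2 + 0 * b + c = c by rewrite expr0n /= mul0r !add0r.
have ds : is_derive ((0 : R) ^+ 2 + 0 * b + c) 1 Num.sqrt (2 * Num.sqrt c)^-1.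
  by rewrite q0; exact: is_derive1_sqrt.
have dsq := @is_derive1_comp _ _ (fun s : R => s ^+ 2 + s * b + c) 0 _ _ ds dq.
have sn0 : (Num.sqrt \o (fun s : R => s ^+ 2 + s * b + c)) 0 != 0 by rewrite /= q0 gt_eqF.
have [ex v] := dsq; apply: DeriveDef; first exact: (derivableV sn0 ex).
rewrite (deriveV sn0 ex) v /= q0 /GRing.scale /=; field.
by rewrite gt_eqF.
Qed.

Section PoissonKernel.
Context {R : realType}.
Notation V3 := 'rV[R]_3.
Implicit Types (x y z eta : V3).

(** [P0] below is [4 pi] times the Poisson kernel, and [P1], [P2] are its first and second
    derivatives in [y]. All are polynomials in the coordinates and in [rho], so that formulas for
    derivatives become ring identities. *)
Definition rho eta y : R := (enorm3 (y - eta))^-1.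

Definition P0 eta y : R := (1 - dot3 y y) * rho eta y ^+ 3.

Definition P1 eta (i : 'I_3) y : R :=
  - 2 * y 0 i * rho eta y ^+ 3
  - 3 * (1 - dot3 y y) * (y 0 i - eta 0 i) * rho eta y ^+ 5.

Definition P2 eta (i j : 'I_3) y : R :=
  - 2 * (i == j)%:R * rho eta y ^+ 3
  + 6 * (y 0 j * (y 0 i - eta 0 i) + y 0 i * (y 0 j - eta 0 j)) * rho eta y ^+ 5
  - 3 * (1 - dot3 y y) * (i == j)%:R * rho eta y ^+ 5
  + 15 * (1 - dot3 y y) * (y 0 i - eta 0 i) * (y 0 j - eta 0 j) * rho eta y ^+ 7.

Lemma is_derive_dot3 y j : is_derive y (e3 R j) (fun y : V3 => dot3 y y) (2 * y 0 j).
Proof.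
apply/derive_line0.
rewrite (_ : (fun s : R => _) = (fun s : R => s ^+ 2 + s * (2 * y 0 j) + dot3 y y)).
  apply: is_derive_eq; rewrite /GRing.scale /=; ring.
have d1 : dot3 (e3 R j) (e3 R j) = 1 by rewrite -enorm3_sq enorm3_e3 expr1n.
have d2 : dot3 (e3 R j) y = y 0 j.
  by rewrite /dot3 (bigD1 j)//= e3E eqxx mul1r big1 ?addr0// => i ij; rewrite e3E eq_sym (negbTE ij) mul0r.
by apply/funext => s; rewrite dot3Dl !dot3Dr !dot3Zl !dot3Zr (dot3C y) d1 d2; ring.
Qed.

Lemma is_derive_rho eta y j : y != eta ->
  is_derive y (e3 R j) (rho eta) (- (y 0 j - eta 0 j) * rho eta y ^+ 3).
Proof.
move=> ye; have N0 : 0 < enorm3 (y - eta).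
  rewrite lt_neqAle enorm3_ge0 andbT eq_sym; apply: contra ye => /eqP/enorm3_eq0.
  by move/eqP; rewrite subr_eq0.
have q0 : 0 < dot3 (y - eta) (y - eta) by rewrite -enorm3_sq exprn_gt0.
apply/derive_line0.
have d1 : dot3 (e3 R j) (e3 R j) = 1 by rewrite -enorm3_sq enorm3_e3 expr1n.
have d2 : dot3 (e3 R j) (y - eta) = y 0 j - eta 0 j.
  rewrite /dot3 (bigD1 j)//= e3E eqxx mul1r big1 ?addr0 ?mxE// => i ij.
  by rewrite e3E eq_sym (negbTE ij) mul0r.
have := is_derive_invsqrt (2 * (y 0 j - eta 0 j)) q0.
rewrite (_ : (fun s : R => rho eta (s *: e3 R j + y)) = (fun s : R => (Num.sqrt
  (s ^+ 2 + s * (2 * (y 0 j - eta 0 j)) + dot3 (y - eta) (y - eta)))^-1)); last first.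
  apply/funext => s; rewrite /rho /enorm3 -addrA; move: d2.
  move: (y - eta) => z d2.
  rewrite dot3Dl !dot3Dr !dot3Zl !dot3Zr (dot3C z) d1 d2.
  by congr (Num.sqrt _)^-1; ring.
by rewrite (mulrC 2) mulfK.
Qed.

Lemma is_derive_P0 eta y j : y != eta -> is_derive y (e3 R j) (P0 eta) (P1 eta j y).
Proof.
move=> ye; have h1 := is_derive_dot3 y j; have h2 := is_derive_rho j ye.
rewrite /P0; apply: is_derive_eq; rewrite /P1 /GRing.scale /=; ring.
Qed.

Lemma is_derive_P1 eta y i j : y != eta -> is_derive y (e3 R i) (P1 eta j) (P2 eta i j y).
Proof.
move=> ye; have h1 := is_derive_dot3 y i; have h2 := is_derive_rho i ye.
have h3 := is_derive_coord y (e3 R i) j.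
rewrite /P1; apply: is_derive_eq; rewrite /P2 /GRing.scale /= e3E; ring.
Qed.

Lemma rho_gt0 eta y : y != eta -> 0 < rho eta y.
Proof.
move=> ye; rewrite invr_gt0 lt_neqAle enorm3_ge0 andbT eq_sym; apply: contra ye => /eqP/enorm3_eq0.
by move/eqP; rewrite subr_eq0.
Qed.

Lemma ball3_neq eta y : enorm3 eta = 1 -> enorm3 y < 1 -> y != eta.
Proof. by move=> e1 y1; apply/eqP => ye; move: y1; rewrite ye e1 ltxx. Qed.

Lemma rho_le eta y (c : R) : enorm3 eta = 1 -> enorm3 y <= c -> c < 1 -> rho eta y <= (1 - c)^-1.
Proof.
move=> e1 yc c1; have y1 : enorm3 y < 1 by exact: le_lt_trans yc c1.
have := rho_gt0 (ball3_neq e1 y1); rewrite invr_gt0 => N0.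
rewrite /rho lef_pV2 ?posrE ?subr_gt0//.
by have := enorm3_sub_ge eta y; rewrite enorm3_distC e1; lra.
Qed.

(** Inserting the factor [|y - eta|^2 rho^2 = 1] brings every term to [rho^5]. What is left is
    [6 (1 - |eta|^2)], which is 0 for a unit vector. *)
Lemma P0_harmonic eta y : enorm3 eta = 1 -> y != eta -> \sum_(i < 3) P2 eta i i y = 0.
Proof.
move=> e1 ye; have r0 := rho_gt0 ye.
have N0 : enorm3 (y - eta) != 0 by move: r0; rewrite invr_gt0 => /gt_eqF ->.
have h : dot3 (y - eta) (y - eta) * rho eta y ^+ 2 = 1.
  by rewrite -enorm3_sq /rho exprVn mulfV// expf_neq0.
have e2 : dot3 eta eta = 1 by rewrite -enorm3_sq e1 expr1n.
move: h e2; rewrite !big_ord_recl big_ord0 /P2 !eqxx !dot3E !mxE.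
set a := y 0 _; set b := y 0 _; set c := y 0 _; set a' := eta 0 _; set b' := eta 0 _; set c' := eta 0 _.
set r := rho eta y => h e2.
pose Z := (a - a') * (a - a') + (b - b') * (b - b') + (c - c') * (c - c').
have hZ : Z * r ^+ 2 = 1 by exact: h.
have -> : r ^+ 3 = Z * r ^+ 5 by rewrite -[LHS]mul1r -hZ; ring.
rewrite (_ : (true%:R : R) = 1)//.
have e3' : c' * c' = 1 - a' * a' - b' * b' by move: e2; lra.
have hz7 : r ^+ 5 = Z * r ^+ 7 by rewrite -[LHS]mul1r -hZ; ring.
transitivity (r ^+ 5 * (-6 * Z + 12 * (a * (a - a') + b * (b - b') + c * (c - c'))
   - 9 * (1 - (a * a + b * b + c * c))) + 15 * (1 - (a * a + b * b + c * c)) * (Z * r ^+ 7)).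
  by rewrite /Z; ring.
rewrite -hz7.
transitivity (r ^+ 5 * (6 - 6 * (a' * a' + b' * b' + c' * c'))); first by rewrite /Z; ring.
by rewrite e2; ring.
Qed.

(** With [N = |y - eta|] one has [1 - |y|^2 <= 2 N] and [N <= 2], so each of the four terms is of
    order [N^-4]; 52 is 4 + 12 + 6 + 30. *)
Lemma P2_le eta y i j : enorm3 eta = 1 -> enorm3 y < 1 -> `|P2 eta i j y| <= 52 * rho eta y ^+ 4.
Proof.
move=> e1 y1; have ye := ball3_neq e1 y1; have r0 := rho_gt0 ye.
set r := rho eta y in r0 *; pose N := enorm3 (y - eta).
have Nr : N * r = 1 by rewrite mulfV// -invr_eq0 gt_eqF.
have N0 : 0 <= N by exact: enorm3_ge0.
have N2 : N <= 2 by have := enorm3B y eta; rewrite -/N e1; lra.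
have yN : 1 - enorm3 y <= N by have := enorm3_sub_ge eta y; rewrite enorm3_distC e1.
have d0 : 0 <= 1 - dot3 y y by rewrite -enorm3_sq subr_ge0 expr_le1// ?enorm3_ge0// ltW.
have dN : 1 - dot3 y y <= 2 * N.
  by rewrite -enorm3_sq; have := enorm3_ge0 y; set n := enorm3 y in yN y1 * => n0; nra.
have yi k : `|y 0 k| <= 1 by apply: le_trans (coord_le_enorm3 _ _) (ltW y1).
have zi k : `|y 0 k - eta 0 k| <= N by have := coord_le_enorm3 (y - eta) k; rewrite !mxE.
have del : `|(i == j)%:R : R| <= 1 by case: (i == j); rewrite ?normr1 ?normr0.
have r3 : r ^+ 3 <= 2 * r ^+ 4.
  have -> : r ^+ 3 = N * r ^+ 4 by rewrite -[LHS]mul1r -Nr; ring.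
  by rewrite ler_wpM2r ?exprn_ge0// ltW.
have r5 : r ^+ 4 = N * r ^+ 5 by rewrite -[LHS]mul1r -Nr; ring.
have r7 : r ^+ 4 = N * N * N * r ^+ 7.
  transitivity ((N * r) * (N * r) * (N * r) * r ^+ 4); first by rewrite Nr !mul1r.
  by ring.
have p k : 0 <= r ^+ k by rewrite exprn_ge0// ltW.
have T1 : `|- 2 * (i == j)%:R * r ^+ 3| <= 4 * r ^+ 4.
  rewrite 2!normrM normrN (ger0_norm (p 3)) [`|2|]ger0_norm//.
  have : `|(i == j)%:R : R| * r ^+ 3 <= 1 * (2 * r ^+ 4) by apply: ler_pM.
  by rewrite -mulrA; lra.
have T2 : `|6 * (y 0 j * (y 0 i - eta 0 i) + y 0 i * (y 0 j - eta 0 j)) * r ^+ 5| <= 12 * r ^+ 4.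
  rewrite 2!normrM (ger0_norm (p 5)) [`|6|]ger0_norm// r5.
  have : `|y 0 j * (y 0 i - eta 0 i) + y 0 i * (y 0 j - eta 0 j)| <= N + N.
    apply: le_trans (ler_normD _ _) _; rewrite !normrM; apply: lerD;
      by rewrite -[leRHS]mul1r; apply: ler_pM.
  by have := p 5; set A := `| _ |; move=> p5 hA; nra.
have T3 : `|3 * (1 - dot3 y y) * (i == j)%:R * r ^+ 5| <= 6 * r ^+ 4.
  rewrite 3!normrM (ger0_norm (p 5)) (ger0_norm d0) [`|3|]ger0_norm// r5.
  have : (1 - dot3 y y) * `|(i == j)%:R : R| <= 2 * N * 1 by apply: ler_pM.
  by have := p 5; set A := _ * `| _ |; rewrite -[3 * _ * _]mulrA -/A; move=> p5 hA; nra.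
have T4 : `|15 * (1 - dot3 y y) * (y 0 i - eta 0 i) * (y 0 j - eta 0 j) * r ^+ 7| <= 30 * r ^+ 4.
  rewrite 4!normrM (ger0_norm (p 7)) (ger0_norm d0) [`|15|]ger0_norm// r7.
  have : (1 - dot3 y y) * `|y 0 i - eta 0 i| * `|y 0 j - eta 0 j| <= 2 * N * N * N.
    by apply: ler_pM => //; [exact: mulr_ge0|apply: ler_pM].
  set A := _ * `| _ | * `| _ | => hA; rewrite -2!(mulrA 15) -/A.
  by have := p 7; move=> p7; nra.
rewrite /P2 -/r; apply: le_trans (ler_normD _ _) _.
have := le_trans (ler_normB (- 2 * (i == j)%:R * r ^+ 3 + 6 * (y 0 j * (y 0 i - eta 0 i) + y 0 i * (y 0 j - eta 0 j)) * r ^+ 5) (3 * (1 - dot3 y y) * (i == j)%:R * r ^+ 5)) (lerD (le_trans (ler_normD _ _) (lerD T1 T2)) T3).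
by move: T4; clear; lra.
Qed.

(** Crude bounds, uniform on a smaller ball, to serve as majorants under the integral. The two terms
    of [P1] give 2 + 6, rounded up. *)
Lemma P01_le eta y i (c : R) : enorm3 eta = 1 -> enorm3 y <= c -> c < 1 ->
  `|P0 eta y| <= 10 * (1 - c)^-1 ^+ 5 /\ `|P1 eta i y| <= 10 * (1 - c)^-1 ^+ 5.
Proof.
move=> e1 yc c1; have y1 : enorm3 y < 1 by exact: le_lt_trans yc c1.
have ye := ball3_neq e1 y1; have r0 := rho_gt0 ye; have rc := rho_le e1 yc c1.
have c0 : 0 <= c by exact: le_trans (enorm3_ge0 _) yc.
set r := rho eta y in r0 rc *; set k := (1 - c)^-1 in rc *.
have k1 : 1 <= k by rewrite -[leLHS]invr1 lef_pV2 ?posrE//; lra.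
have d0 : 0 <= 1 - dot3 y y by rewrite -enorm3_sq subr_ge0 expr_le1// ?enorm3_ge0// ltW.
have d1 : 1 - dot3 y y <= 1 by rewrite gerBl dot3_ge0.
have p n : 0 <= r ^+ n by rewrite exprn_ge0// ltW.
have rk n : r ^+ n <= k ^+ n by rewrite lerXn2r// nnegrE ?ltW// (lt_le_trans r0).
have k35 : k ^+ 3 <= k ^+ 5 by rewrite ler_weXn2l.
have k5 : 0 <= k ^+ 5 by rewrite exprn_ge0// (le_trans _ k1).
have yi : `|y 0 i| <= 1 by apply: le_trans (coord_le_enorm3 _ _) (ltW y1).
have zi : `|y 0 i - eta 0 i| <= 2.
  have := coord_le_enorm3 (y - eta) i; rewrite !mxE => h; apply: le_trans h _.
  by have := enorm3B y eta; rewrite e1; lra.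
split.
  rewrite /P0 -/r normrM (ger0_norm d0) (ger0_norm (p 3)).
  apply: (@le_trans _ _ (1 * k ^+ 5)); last by rewrite ler_wpM2r// ler1n.
  by apply: ler_pM => //; exact: le_trans (rk 3) k35.
rewrite /P1 -/r; apply: le_trans (ler_normB _ _) _.
have T1 : `|- 2 * y 0 i * r ^+ 3| <= 2 * k ^+ 5.
  rewrite 2!normrM normrN (ger0_norm (p 3)) [`|2|]ger0_norm//.
  apply: ler_pM; [by rewrite mulr_ge0|exact: p| |exact: le_trans (rk 3) k35].
  by rewrite -[leRHS]mulr1 ler_wpM2l.
have T2 : `|3 * (1 - dot3 y y) * (y 0 i - eta 0 i) * r ^+ 5| <= 6 * k ^+ 5.
  rewrite 3!normrM (ger0_norm (p 5)) (ger0_norm d0) [`|3|]ger0_norm//.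
  apply: ler_pM; [by rewrite !mulr_ge0|exact: p| |exact: rk].
  rewrite (_ : 6 = 3 * 1 * 2) ?mulr1; last by ring.
  by apply: ler_pM => //; [rewrite mulr_ge0|rewrite -[leRHS]mulr1 ler_wpM2l].
apply: le_trans (lerD T1 T2) _; lra.
Qed.

Lemma cvg_exprn {T : Type} {F : set_system T} {FF : Filter F} (f : T -> R) (l : R) n :
  f @ F --> l -> (fun t => f t ^+ n) @ F --> l ^+ n.
Proof. by move=> h; exact: (cvg_comp _ _ h (@exprn_continuous _ n l)). Qed.

Lemma cvg_rho {T : Type} {F : set_system T} {FF : Filter F} (E Y : T -> V3) eta y :
  E @ F --> eta -> Y @ F --> y -> y != eta -> (fun t => rho (E t) (Y t)) @ F --> rho eta y.
Proof.
move=> hE hY ye; apply: cvgV; first by rewrite -invr_eq0 gt_eqF// rho_gt0.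
by apply: cvg_enorm3; exact: cvgB.
Qed.

Lemma cvg_P0 {T : Type} {F : set_system T} {FF : Filter F} (E Y : T -> V3) eta y :
  E @ F --> eta -> Y @ F --> y -> y != eta -> (fun t => P0 (E t) (Y t)) @ F --> P0 eta y.
Proof.
move=> hE hY ye; have hr := @cvg_rho _ F FF E Y eta y hE hY ye; have hd := @cvg_dot3 _ _ F FF Y y hY.
have cc (c : R) : (fun=> c) @ F --> c by exact: cvg_cst.
have D : (fun t => 1 - dot3 (Y t) (Y t)) @ F --> 1 - dot3 y y by exact: cvgB.
have p3 : (fun t => rho (E t) (Y t) ^+ 3) @ F --> rho eta y ^+ 3 by exact: cvg_exprn.
exact: (cvgM D p3).
Qed.

Lemma cvg_P2 {T : Type} {F : set_system T} {FF : Filter F} (E Y : T -> V3) eta y i j :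
  E @ F --> eta -> Y @ F --> y -> y != eta -> (fun t => P2 (E t) i j (Y t)) @ F --> P2 eta i j y.
Proof.
move=> hE hY ye; have hr := @cvg_rho _ F FF E Y eta y hE hY ye; have hd := @cvg_dot3 _ _ F FF Y y hY.
have hi := @cvg_coord _ _ F FF Y y i hY; have ei := @cvg_coord _ _ F FF E eta i hE.
have hj := @cvg_coord _ _ F FF Y y j hY; have ej := @cvg_coord _ _ F FF E eta j hE.
have cc (c : R) : (fun=> c) @ F --> c by exact: cvg_cst.
have D : (fun t => 1 - dot3 (Y t) (Y t)) @ F --> 1 - dot3 y y by exact: cvgB.
 have Zi : (fun t => Y t 0 i - E t 0 i) @ F --> y 0 i - eta 0 i by exact: cvgB.
 have Zj : (fun t => Y t 0 j - E t 0 j) @ F --> y 0 j - eta 0 j by exact: cvgB.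
have p n : (fun t => rho (E t) (Y t) ^+ n) @ F --> rho eta y ^+ n by exact: cvg_exprn.
have dl := cc ((i == j)%:R).
exact: (cvgD (cvgB (cvgD (cvgM (cvgM (cc (- 2)) dl) (p 3))
  (cvgM (cvgM (cc 6) (cvgD (cvgM hj Zi) (cvgM hi Zj))) (p 5)))
  (cvgM (cvgM (cvgM (cc 3) D) dl) (p 5))) (cvgM (cvgM (cvgM (cvgM (cc 15) D) Zi) Zj) (p 7))).
Qed.
End PoissonKernel.

(** * Measurability and Fubini's theorem in the plane *)

Section PlaneMeasurability.
Context {R : realType}.

(** The squares with rational centre and radius contained in [U] cover it. A code that decodes to
    nothing, or to a square leaving [U], contributes the empty set. *)
Lemma open_measurable2 (U : set (R * R)) : open U -> measurable U.
Proof.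
move=> oU.
pose bq (t : rat * rat * rat) : set (R * R) := bx (ratr t.1.1, ratr t.1.2) (ratr t.2).
pose B (n : nat) : set (R * R) :=
  if @unpickle (rat * rat * rat)%type n is Some t then
    (if pselect (bq t `<=` U) then bq t else set0) else set0.
have -> : U = \bigcup_n B n.
  apply/seteqP; split=> p; last first.
    move=> [n _]; rewrite /B; case: unpickle => // t.
    by case: pselect => // h /h.
  move=> Up; have /nbhs_ballP[e /= e0 pe] : nbhs p U by apply: open_nbhs_nbhs.
  have e3 : 0 < e / 3 by rewrite divr_gt0.
  have [q1 /[!in_itv]/= /andP[h1 h1']] : exists q : rat, ratr q \in `]p.1 - e / 3, p.1 + e / 3[%R.
    by have /rat_in_itvoo[q hq] : p.1 - e / 3 < p.1 + e / 3; [lra|exists q].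
  have [q2 /[!in_itv]/= /andP[h2 h2']] : exists q : rat, ratr q \in `]p.2 - e / 3, p.2 + e / 3[%R.
    by have /rat_in_itvoo[q hq] : p.2 - e / 3 < p.2 + e / 3; [lra|exists q].
  have [r /[!in_itv]/= /andP[h3 h3']] : exists q : rat, ratr q \in `]e / 3, e / 2[%R.
    by have /rat_in_itvoo[q hq] : e / 3 < e / 2; [lra|exists q].
  exists (pickle (q1, q2, r)); first exact: I.
  rewrite /B pickleK.
  have bp : bq (q1, q2, r) p.
    by rewrite /bq /bx /= !in_itv /=; split; apply/andP; split; lra.
  case: pselect => // h; exfalso; apply: h => z.
  rewrite /bq /bx /= !in_itv /= => -[/andP[u1 u2] /andP[u3 u4]].
  apply: pe; split; rewrite /ball /= ltr_norml; apply/andP; split; lra.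
apply: bigcup_measurable => n _; rewrite /B; case: unpickle => // t.
by case: pselect => h /=; [exact: measurable_bx|exact: measurable0].
Qed.

Lemma continuous_measurable2 (g : R * R -> R) : continuous g -> measurable_fun setT g.
Proof.
move=> cg; apply: (measurability _ (RGenOInfty.measurableE R)).
move=> /= _ [_ [a ->]] <-; rewrite setTI; apply: open_measurable2.
by apply: open_comp => [p _|]; [exact: cg|exact: interval_open].
Qed.
End PlaneMeasurability.

(** Boundedness on sets of finite measure makes every section integrable, so that the real-valued
    inner integrals never take a default value. *)
Lemma Rintegral_prod {R : realType} d1 d2 (T1 : measurableType d1) (T2 : measurableType d2)
  (m1 : {sigma_finite_measure set T1 -> \bar R}) (m2 : {sigma_finite_measure set T2 -> \bar R})
  (A : set T1) (B : set T2) (f : T1 * T2 -> R) (C : R) :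
  measurable A -> measurable B -> (m1 A < +oo)%E -> (m2 B < +oo)%E ->
  measurable_fun setT f -> (forall x y, A x -> B y -> `|f (x, y)| <= C) ->
  Rintegral (m1 \x m2)%E (A `*` B) f = \int[m1]_(x in A) \int[m2]_(y in B) f (x, y) /\
  Rintegral (m1 \x m2)%E (A `*` B) f = \int[m2]_(y in B) \int[m1]_(x in A) f (x, y).
Proof.
move=> mA mB fA fB mf fC.
have mAB : measurable (A `*` B) by exact: measurableX.
have fAB : ((m1 \x m2) (A `*` B) < +oo)%E.
  by rewrite [ltLHS]product_measure1E// lte_mul_pinfty// ge0_fin_numE.
pose h : T1 * T2 -> \bar R := (EFin \o f) \_ (A `*` B).
have ih : (m1 \x m2)%E.-integrable setT h.
  apply/(integrable_mkcond (EFin \o f) mAB).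
  apply: (@integrable_bnd _ _ _ _ _ _ C) => //; first exact: measurable_funTS.
  by move=> -[x y] [/= Ax By]; exact: fC.
have E0 : (\int[m1 \x m2]_(z in A `*` B) (f z)%:E = \int[m1 \x m2]_z h z)%E.
  by rewrite integral_mkcond.
have hE x y : h (x, y) = if (x \in A) && (y \in B) then (f (x, y))%:E else 0%E.
  rewrite /h patchE; congr (if _ then _ else _).
  by apply/idP/andP => [/set_mem[/= Ax By]|[/set_mem Ax /set_mem By]]; [split; exact/mem_set|apply/mem_set].
have f1 x : A x -> m2.-integrable B (EFin \o (fun y => f (x, y))).
  move=> Ax; apply: (@integrable_bnd _ _ _ _ _ _ C) => //.
    by apply: measurable_funTS; exact: (measurableT_comp mf (measurable_pair1 x)).
  by move=> y By; exact: fC.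
have f2 y : B y -> m1.-integrable A (EFin \o (fun x => f (x, y))).
  move=> By; apply: (@integrable_bnd _ _ _ _ _ _ C) => //.
    by apply: measurable_funTS; exact: (measurableT_comp mf (measurable_pair2 y)).
  by move=> x Ax; exact: fC.
split; rewrite /Rintegral E0; congr fine.
- rewrite -integral12_prod_meas1// [RHS]integral_mkcond; apply: eq_integral => x _.
  rewrite patchE /fubini_F; case: ifPn => xA.
    rewrite fineK; last by apply: integrable_fin_num => //; apply: f1; exact: set_mem.
    rewrite [RHS]integral_mkcond; apply: eq_integral => y _.
    by rewrite hE xA patchE.
  by rewrite integral0_eq// => y _; rewrite hE (negbTE xA).
- rewrite -integral21_prod_meas1// [RHS]integral_mkcond; apply: eq_integral => y _.
  rewrite patchE /fubini_G; case: ifPn => yB.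
    rewrite fineK; last by apply: integrable_fin_num => //; apply: f2; exact: set_mem.
    rewrite [RHS]integral_mkcond; apply: eq_integral => x _.
    by rewrite hE yB patchE andbT.
  by rewrite integral0_eq// => x _; rewrite hE (negbTE yB) andbF.
Qed.

Section SphereParam.
Context {R : realType}.
Notation V3 := 'rV[R]_3.
Notation mu2 := (@leb2 R).
Notation D := (@param_rect R).

Lemma param_rectE : D = `]0, pi[ `*` `]0, 2 * pi[.
Proof. by apply/seteqP; split=> p; rewrite /param_rect /= !in_itv. Qed.

Lemma measurable_param_rect : measurable D.
Proof. by rewrite param_rectE; apply: measurableX; exact: measurable_itv. Qed.

Lemma leb_itv_fin (x y : R) : (lebesgue_measure `]x, y[%classic < +oo :> \bar R)%E.
Proof. by rewrite lebesgue_measure_itv /=; case: ifP => _; rewrite -?EFinB ltry. Qed.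

Lemma leb_cc_fin (x y : R) : (lebesgue_measure `[x, y]%classic < +oo :> \bar R)%E.
Proof. by rewrite lebesgue_measure_itv /=; case: ifP => _; rewrite -?EFinB ltry. Qed.

Lemma leb2_param_rect : (mu2 D < +oo)%E.
Proof.
rewrite param_rectE /leb2 [ltLHS]product_measure1E; [|exact: measurable_itv..].
by rewrite lte_mul_pinfty//; [rewrite ge0_fin_numE// leb_itv_fin|exact: leb_itv_fin].
Qed.

Lemma sph_coord0 (p : R * R) : sph p 0 ord0 = sin p.1 * cos p.2.
Proof. by rewrite /sph mxE. Qed.

Lemma sph_coord1 (p : R * R) : sph p 0 (lift ord0 ord0) = sin p.1 * sin p.2.
Proof. by rewrite /sph mxE. Qed.

Lemma sph_coord2 (p : R * R) : sph p 0 (lift ord0 (lift ord0 ord0)) = cos p.1.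
Proof. by rewrite /sph mxE. Qed.

Lemma enorm3_sph (p : R * R) : enorm3 (sph p) = 1.
Proof.
have h : dot3 (sph p) (sph p) = 1.
  rewrite dot3E sph_coord0 sph_coord1 sph_coord2.
  have := cos2Dsin2 p.1; have := cos2Dsin2 p.2; rewrite !expr2 => h2 h1.
  rewrite -h1 -[in RHS](mulr1 (sin p.1 * sin p.1)) -h2; ring.
by rewrite /enorm3 h sqrtr1.
Qed.

Lemma measurable_sin_cos : measurable_fun [set: R] (@sin R) /\ measurable_fun [set: R] (@cos R).
Proof.
by split; apply: continuous_measurable_fun; [exact: continuous_sin|exact: continuous_cos].
Qed.

Lemma ord3P (P : 'I_3 -> Prop) : P ord0 -> P (lift ord0 ord0) ->
  P (lift ord0 (lift ord0 ord0)) -> forall i, P i.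
Proof.
move=> h0 h1 h2 [[|[|[|//]]] hi].
- by rewrite (_ : Ordinal hi = ord0)//; exact: val_inj.
- by rewrite (_ : Ordinal hi = lift ord0 ord0)//; exact: val_inj.
- by rewrite (_ : Ordinal hi = lift ord0 (lift ord0 ord0))//; exact: val_inj.
Qed.

Lemma measurable_sph i : measurable_fun setT (fun p : R * R => sph p 0 i).
Proof.
have [ms mc] := measurable_sin_cos.
move: i; apply: ord3P.
- rewrite (_ : (fun p => _) = (fun p : R * R => sin p.1 * cos p.2)).
    by apply: measurable_funM; exact: measurableT_comp.
  by apply/funext => p; exact: sph_coord0.
- rewrite (_ : (fun p => _) = (fun p : R * R => sin p.1 * sin p.2)).
    by apply: measurable_funM; exact: measurableT_comp.
  by apply/funext => p; exact: sph_coord1.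
- rewrite (_ : (fun p => _) = (fun p : R * R => cos p.1)).
    exact: measurableT_comp.
  by apply/funext => p; exact: sph_coord2.
Qed.

Lemma cvg_rV {T : Type} {F : set_system T} {FF : Filter F} (Y : T -> V3) (y : V3) :
  (forall i, (fun t => Y t 0 i) @ F --> y 0 i) -> Y @ F --> y.
Proof.
move=> H; apply/cvgrPdist_le => e e0.
have K : \forall t \near F, forall i, `|y 0 i - Y t 0 i| <= e.
  by apply: filter_forall => i; move/cvgrPdist_le : (H i); apply.
apply: filterS K => t Ht; apply: norm_le_coord; first exact: ltW.
by move=> i; rewrite !mxE.
Qed.

Lemma continuous_sph : continuous (@sph R).
Proof.
move=> p; apply: cvg_rV.
have c1 : q.1 @[q --> p] --> p.1 by exact: cvg_fst.
have c2 : q.2 @[q --> p] --> p.2 by exact: cvg_snd.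
have s1 : sin q.1 @[q --> p] --> sin p.1 by exact: (cvg_comp _ _ c1 (@continuous_sin _ _)).
have s2 : sin q.2 @[q --> p] --> sin p.2 by exact: (cvg_comp _ _ c2 (@continuous_sin _ _)).
have k1 : cos q.1 @[q --> p] --> cos p.1 by exact: (cvg_comp _ _ c1 (@continuous_cos _ _)).
have k2 : cos q.2 @[q --> p] --> cos p.2 by exact: (cvg_comp _ _ c2 (@continuous_cos _ _)).
apply: ord3P.
- rewrite sph_coord0 (_ : (fun t => _) = (fun p : R * R => sin p.1 * cos p.2)); first exact: cvgM.
  by apply/funext => q; exact: sph_coord0.
- rewrite sph_coord1 (_ : (fun t => _) = (fun p : R * R => sin p.1 * sin p.2)); first exact: cvgM.
  by apply/funext => q; exact: sph_coord1.
- rewrite sph_coord2 (_ : (fun t => _) = (fun p : R * R => cos p.1)); first exact: k1.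
  by apply/funext => q; exact: sph_coord2.
Qed.

Lemma measurable_rho {d} {T : measurableType d} (E Y : T -> V3) :
  (forall i, measurable_fun setT (fun t => E t 0 i)) ->
  (forall i, measurable_fun setT (fun t => Y t 0 i)) ->
  measurable_fun setT (fun t => rho (E t) (Y t)).
Proof.
move=> mE mY; apply: measurableT_comp; first exact: measurable_inv.
apply: (@measurableT_comp _ _ _ _ _ _ (@Num.sqrt R)).
  by apply: continuous_measurable_fun; exact: sqrt_continuous.
rewrite (_ : (fun t => _) = (fun t => \sum_(i < 3) (Y t 0 i - E t 0 i) * (Y t 0 i - E t 0 i))).
  by apply: measurable_sum => i; apply: measurable_funM; apply: measurable_funB.
by apply/funext => t; apply: eq_bigr => i _; rewrite !mxE.
Qed.

Lemma measurable_dot3 {d} {T : measurableType d} (Y : T -> V3) :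
  (forall i, measurable_fun setT (fun t => Y t 0 i)) ->
  measurable_fun setT (fun t => dot3 (Y t) (Y t)).
Proof. by move=> mY; apply: measurable_sum => i; apply: measurable_funM. Qed.

Lemma measurable_P {d} {T : measurableType d} (E Y : T -> V3) i j :
  (forall i, measurable_fun setT (fun t => E t 0 i)) ->
  (forall i, measurable_fun setT (fun t => Y t 0 i)) ->
  [/\ measurable_fun setT (fun t => P0 (E t) (Y t)),
      measurable_fun setT (fun t => P1 (E t) i (Y t)) &
      measurable_fun setT (fun t => P2 (E t) i j (Y t))].
Proof.
move=> mE mY; have mr := measurable_rho mE mY; have md := measurable_dot3 mY.
have mr' n : measurable_fun setT (fun t => rho (E t) (Y t) ^+ n) by exact: measurable_funX.
have m1 : measurable_fun setT (fun t => 1 - dot3 (Y t) (Y t)) by exact: measurable_funB.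
have mz k : measurable_fun setT (fun t => Y t 0 k - E t 0 k) by exact: measurable_funB.
split.
- by apply: measurable_funM.
- by apply: measurable_funB; do ?[apply: measurable_funM => //].
- apply: measurable_funD; last by do ?[apply: measurable_funM => //].
  apply: measurable_funB; last by do ?[apply: measurable_funM => //].
  apply: measurable_funD; do ?[apply: measurable_funM => //].
  by apply: measurable_funD; apply: measurable_funM.
Qed.

Lemma sigma_jac_bnd (p : R * R) : `|sigma_jac p| <= 1.
Proof. exact: sin_max. Qed.

Lemma measurable_jac : measurable_fun setT (@sigma_jac R).
Proof. by have [ms _] := measurable_sin_cos; exact: measurableT_comp. Qed.

Lemma sigma_jac_gt0 p : D p -> 0 < sigma_jac p.
Proof. by move=> [/sin_gt0_pi]. Qed.
End SphereParam.

Lemma FTC_oo {R : realType} (f F : R -> R) (a b : R) : a < b ->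
  (forall x : R, is_derive x (1 : R) F (f x)) -> continuous f ->
  \int[@lebesgue_measure R]_(x in `]a, b[) f x = F b - F a.
Proof.
move=> ab dF cf.
have cF : continuous F by move=> x; apply/differentiable_continuous/derivable1_diffP; have [] := dF x.
have cwf : {within `[a, b], continuous f} by apply: continuous_subspaceT.
have H := @continuous_FTC2 R f F a b ab cwf _ _.
have {H} H : (\int[lebesgue_measure]_(x in `[a, b]) (f x)%:E = (F b)%:E - (F a)%:E)%E.
  apply: H; last by move=> x _; rewrite derive1E; have [_ ->] := dF x.
  split; first by move=> x _; have [] := dF x.
  - exact: cvg_at_right_filter (cF a).
  - exact: cvg_at_left_filter (cF b).
have ifcc : lebesgue_measure.-integrable `[a, b] (EFin \o f).
  by apply: continuous_compact_integrable => //; exact: segment_compact.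
rewrite Rintegral_itv_obnd_cbnd; last first.
  by apply: integrableS ifcc => //; exact: subset_itv_oo_cc.
by rewrite Rintegral_itv_bndo_bndc ?/Rintegral ?H//; apply: integrableS ifcc => //; exact: subset_itv_co_cc.
Qed.

(** * The integral of the Poisson kernel over the sphere *)

Section ZonalIntegral.
Context {R : realType}.
Notation mu2 := (@leb2 R).
Notation D := (@param_rect R).
Variable a : R.
Hypotheses (a0 : 0 <= a) (a1 : a < 1).

(** For [|y| = a] and [w = y . eta] with [eta] a unit vector, this is [|y - eta|^-k];
    differentiating in [w] raises [k] by two. *)
Definition zon (k : nat) (w : R) : R := (Num.sqrt (1 + a ^+ 2 - 2 * w))^-1 ^+ k.

Lemma zon_arg w : `|w| <= a -> (1 - a) ^+ 2 <= 1 + a ^+ 2 - 2 * w.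
Proof. by rewrite ler_norml => /andP[_ h]; rewrite sqrrB expr1n; lra. Qed.

Lemma zon_pos w : `|w| <= a -> 0 < 1 + a ^+ 2 - 2 * w.
Proof. by move=> /zon_arg; apply: lt_le_trans; rewrite exprn_gt0// subr_gt0. Qed.

Lemma zon_bnd k w : `|w| <= a -> `|zon k w| <= (1 - a)^-1 ^+ k.
Proof.
move=> wa; rewrite ger0_norm ?exprn_ge0 ?invr_ge0 ?sqrtr_ge0//.
have p1 : 0 < 1 - a by rewrite subr_gt0.
rewrite lerXn2r ?nnegrE ?invr_ge0 ?sqrtr_ge0 ?(ltW p1)//.
rewrite lef_pV2 ?posrE ?sqrtr_gt0 ?zon_pos//.
rewrite -[leLHS]gtr0_norm// -sqrtr_sqr ler_sqrt; first exact: zon_arg.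
exact: ltW (zon_pos wa).
Qed.

Lemma is_derive_zon k (w : R) : `|w| <= a -> is_derive w (1 : R) (zon k) (k%:R * zon k.+2 w).
Proof.
move=> /zon_pos w0.
have s0 : Num.sqrt (1 + a ^+ 2 - 2 * w) != 0 by rewrite gt_eqF// sqrtr_gt0.
have dq : is_derive w (1 : R) (fun v : R => 1 + a ^+ 2 - 2 * v) (- 2).
  by apply: is_derive_eq; rewrite /GRing.scale /=; ring.
have ds : is_derive (1 + a ^+ 2 - 2 * w) (1 : R) Num.sqrt (2 * Num.sqrt (1 + a ^+ 2 - 2 * w))^-1.
  exact: is_derive1_sqrt.
have dsq := @is_derive1_comp _ Num.sqrt (fun v : R => 1 + a ^+ 2 - 2 * v) w _ _ ds dq.
have di := @is_deriveV _ (Num.sqrt \o (fun v : R => 1 + a ^+ 2 - 2 * v)) w _ 1 s0 dsq.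
have dX := @is_deriveX _ _ _ k _ _ _ di.
have -> : zon k = (fun y => ((Num.sqrt \o (fun v : R => 1 + a ^+ 2 - 2 * v)) y)^-1) ^+ k.
  by apply/funext => y; rewrite exprfctE.
apply: is_derive_eq; rewrite /GRing.scale /= /zon.
case: k {dX} => [|k]; first by rewrite !mul0r.
rewrite /= -exprVn invfM; set r := (Num.sqrt _)^-1; rewrite !exprS; field; by [].
Qed.

Lemma measurable_zon k : measurable_fun setT (zon k).
Proof.
apply: measurable_funX; apply: measurableT_comp; first exact: measurable_inv.
apply: (@measurableT_comp _ _ _ _ _ _ (@Num.sqrt R)).
  by apply: continuous_measurable_fun; exact: sqrt_continuous.
by apply: measurable_funB => //; exact: measurable_funM.
Qed.

(** The integral of [|y - eta|^-3] over the sphere when [w] is [y . eta] in the chart. That it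
    depends on [|y|] only is proved by differentiating along two families of rotations: about the
    vertical axis, and tilting that axis. *)
Definition zonint (w : R * R -> R) : R := Rintegral mu2 D (fun p => zon 3 (w p) * sin p.1).

Lemma is_derive_zonint (w wt : R -> R * R -> R) (K : R) (t : R) :
  (forall s, measurable_fun setT (w s)) ->
  (forall s p, `|w s p| <= a) -> (forall s p, `|wt s p| <= K) ->
  (forall (s : R) p, is_derive s (1 : R) (w ^~ p) (wt s p)) ->
  is_derive t (1 : R) (fun s : R => zonint (w s))
    (Rintegral mu2 D (fun p => 3 * zon 5 (w t p) * wt t p * sin p.1)).
Proof.
move=> mw wa wK dw.
have mD := @measurable_param_rect R.
have K0 : 0 <= K by exact: le_trans (normr_ge0 _) (wK 0 (0, 0)).
have p1 : 0 < (1 - a)^-1 by rewrite invr_gt0 subr_gt0.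
have kge n : 0 <= (1 - a)^-1 ^+ n by rewrite exprn_ge0// ltW.
pose C := (1 - a)^-1 ^+ 3 + 3 * (1 - a)^-1 ^+ 5 * K.
have tv (s : R) : s *: (1 : R) + t = s + t by rewrite /GRing.scale /= mulr1.
apply: (@is_derive_Rintegral _ _ _ _ mu2 D (fun s p => zon 3 (w s p) * sin p.1)
  (fun s p => 3 * zon 5 (w s p) * wt s p * sin p.1) t 1 1 C) => //.
- exact: leb2_param_rect.
- move=> s _; apply: measurable_funTS; apply: measurable_funM; last exact: measurable_jac.
  by apply: measurableT_comp; [exact: measurable_zon|exact: mw].
- move=> s p _ _; rewrite normrM.
  apply: (@le_trans _ _ ((1 - a)^-1 ^+ 3 * 1)); last first.
    by rewrite mulr1 lerDl; apply: mulr_ge0 => //; apply: mulr_ge0.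
  by apply: ler_pM => //; [exact: zon_bnd|exact: sin_max].
- move=> s p _ _; set s' := _ *: _ + t.
  have d1 : is_derive s' (1 : R) (fun s : R => zon 3 (w s p)) (3 * zon 5 (w s' p) * wt s' p).
    exact: (@is_derive1_comp _ (zon 3) (w ^~ p) s' _ _ (is_derive_zon 3 (wa _ _)) (dw _ _)).
  apply: is_derive_eq; rewrite /GRing.scale /=; ring.
- move=> s p _ _; rewrite 3!normrM ger0_norm//.
  apply: (@le_trans _ _ (3 * (1 - a)^-1 ^+ 5 * K * 1)); last first.
    by rewrite mulr1 lerDr.
  apply: ler_pM => //; try exact: sin_max; try by (do ?apply: mulr_ge0).
  apply: ler_pM => //; try by (do ?apply: mulr_ge0).
  by rewrite ler_wpM2l// zon_bnd.
Qed.

(** [y . eta] for [y] with horizontal length [b], azimuth [t] and height [c]. *)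
Definition wz (b c t : R) (p : R * R) : R := b * (sin p.1 * cos (p.2 - t)) + c * cos p.1.

Lemma wz_bnd b c t p : b ^+ 2 + c ^+ 2 = a ^+ 2 -> `|wz b c t p| <= a.
Proof.
move=> bc; rewrite -(@ler_pXn2r _ 2)// ?nnegrE// real_normK ?num_real// -bc /wz.
set s := sin p.1; set k := cos p.1; set m := cos _.
have h1 : s ^+ 2 + k ^+ 2 = 1 by rewrite addrC cos2Dsin2.
have h2 : m ^+ 2 <= 1 by rewrite -real_normK ?num_real// expr_le1// cos_max.
have h3 : s ^+ 2 * m ^+ 2 + k ^+ 2 <= 1.
  by rewrite -h1 lerD2r ler_piMr// sqr_ge0.
have h4 : (b * (s * m) + c * k) ^+ 2 + (b * k - c * (s * m)) ^+ 2 =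
   (b ^+ 2 + c ^+ 2) * (s ^+ 2 * m ^+ 2 + k ^+ 2) by ring.
have h5 : (b ^+ 2 + c ^+ 2) * (s ^+ 2 * m ^+ 2 + k ^+ 2) <= b ^+ 2 + c ^+ 2.
  by rewrite ler_piMr// addr_ge0 ?sqr_ge0.
by have := sqr_ge0 (b * k - c * (s * m)); lra.
Qed.

(** [y . eta] for [y] of length [a] in the vertical plane of azimuth 0, at angle [t] from the
    axis. *)
Definition wtilt (t : R) (p : R * R) : R := a * (sin t * (sin p.1 * cos p.2) + cos t * cos p.1).

Lemma wtilt_bnd t p : `|wtilt t p| <= a.
Proof.
have := @wz_bnd (a * sin t) (a * cos t) 0 p; rewrite /wz subr0.
rewrite (_ : a * sin t * (sin p.1 * cos p.2) + a * cos t * cos p.1 = wtilt t p); last by rewrite /wtilt; ring.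
apply; rewrite !exprMn -mulrDr [_ + cos t ^+ 2]addrC cos2Dsin2 mulr1//.
Qed.

Lemma measurable_wz b c t : measurable_fun setT (wz b c t).
Proof.
have [ms mc] := @measurable_sin_cos R.
apply: measurable_funD; last by apply: measurable_funM => //; exact: measurableT_comp.
apply: measurable_funM => //; apply: measurable_funM; first exact: measurableT_comp.
by apply: measurableT_comp => //; exact: measurable_funB.
Qed.

Lemma measurable_wtilt t : measurable_fun setT (wtilt t).
Proof.
have [ms mc] := @measurable_sin_cos R.
apply: measurable_funM => //; apply: measurable_funD; last first.
  by apply: measurable_funM => //; exact: measurableT_comp.
apply: measurable_funM => //; apply: measurable_funM; exact: measurableT_comp.
Qed.

Lemma Rint_param (f : R * R -> R) (C : R) : measurable_fun setT f -> (forall p, `|f p| <= C) ->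
  Rintegral mu2 D f = \int[lebesgue_measure]_(x in `]0, pi[) \int[lebesgue_measure]_(y in `]0, 2 * pi[) f (x, y) /\
  Rintegral mu2 D f = \int[lebesgue_measure]_(y in `]0, 2 * pi[) \int[lebesgue_measure]_(x in `]0, pi[) f (x, y).
Proof.
move=> mf fC; rewrite param_rectE.
apply: (@Rintegral_prod R _ _ _ _ lebesgue_measure lebesgue_measure _ _ f C) => //;
  try exact: measurable_itv; exact: leb_itv_fin.
Qed.

(** The derivative in [t] is minus the derivative in the longitude, whose integral over a full
    period vanishes. *)
Lemma zonint_wz_const b c (t t' : R) : b ^+ 2 + c ^+ 2 = a ^+ 2 ->
  zonint (wz b c t) = zonint (wz b c t').
Proof.
move=> bc.
apply: (@is_derive_0_is_cst R (fun s => zonint (wz b c s)) t t') => {t' }{}t.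
pose wt (s : R) (p : R * R) := b * (sin p.1 * sin (p.2 - s)).
have [ms mc] := @measurable_sin_cos R.
have dw (s : R) p : is_derive s (1 : R) (fun s : R => wz b c s p) (wt s p).
  by rewrite /wz /wt /=; apply: is_derive_eq; rewrite /GRing.scale /=; ring.
have wtK s p : `|wt s p| <= `|b|.
  rewrite /wt normrM ler_piMr// normrM mulr_ile1//; exact: sin_max.
have := @is_derive_zonint (wz b c) wt `|b| t (measurable_wz b c) (fun s p => wz_bnd s p bc) wtK dw.
suff -> : Rintegral mu2 D (fun p => 3 * zon 5 (wz b c t p) * wt t p * sin p.1) = 0 by [].
have mf : measurable_fun setT (fun p : R * R => 3 * zon 5 (wz b c t p) * wt t p * sin p.1).
  apply: measurable_funM; last exact: measurable_jac.
  apply: measurable_funM.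
    by apply: measurable_funM => //; apply: measurableT_comp; [exact: measurable_zon|exact: measurable_wz].
  apply: measurable_funM => //; apply: measurable_funM; first exact: measurableT_comp.
  by apply: measurableT_comp => //; exact: measurable_funB.
have fC p : `|3 * zon 5 (wz b c t p) * wt t p * sin p.1| <= 3 * (1 - a)^-1 ^+ 5 * `|b| * 1.
  rewrite 3!normrM [`|3|]ger0_norm//.
  apply: ler_pM => //; try exact: sin_max; try by (do ?apply: mulr_ge0).
  apply: ler_pM => //; try by (do ?apply: mulr_ge0).
  by rewrite ler_wpM2l// zon_bnd// wz_bnd.
have [-> _] := Rint_param mf fC.
transitivity (\int[@lebesgue_measure R]_(x in `]0, pi[) (cst 0 : R -> R) x); last first.
  by rewrite Rintegral_cst ?mul0r//; exact: measurable_itv.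
apply: eq_Rintegral => x _ /=.
have b0 : 0 < 2 * pi :> R by rewrite mulr_gt0// pi_gt0.
have dF : forall y : R, is_derive y (1 : R) (fun y => - (zon 3 (wz b c t (x, y)) * sin x)) ((fun y => 3 * zon 5 (wz b c t (x, y)) * wt t (x, y) * sin x) y).
  move=> y. have dwy : is_derive (y : R) (1 : R) (fun y : R => wz b c t (x, y)) (- wt t (x, y)).
    by rewrite /wz /wt /=; apply: is_derive_eq; rewrite /GRing.scale /=; ring.
  have d1 := @is_derive1_comp _ (zon 3) (fun y => wz b c t (x, y)) y _ _ (is_derive_zon 3 (wz_bnd _ _ bc)) dwy.
  have d2 : is_derive (y : R) (1 : R) (fun y : R => zon 3 (wz b c t (x, y))) (3 * zon 5 (wz b c t (x, y)) * (- wt t (x, y))) by exact: d1.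
  by apply: is_derive_eq; rewrite /GRing.scale /=; ring.
have cF : continuous (fun y : R => 3 * zon 5 (wz b c t (x, y)) * wt t (x, y) * sin x).
  move=> y.
  have dwy : is_derive (y : R) (1 : R) (fun y : R => wz b c t (x, y)) (- wt t (x, y)).
    by rewrite /wz /wt /=; apply: is_derive_eq; rewrite /GRing.scale /=; ring.
  have d1 := @is_derive1_comp _ (zon 5) (fun y => wz b c t (x, y)) y _ _ (is_derive_zon 5 (wz_bnd _ _ bc)) dwy.
  have d2 : is_derive (y : R) (1 : R) (fun y : R => zon 5 (wz b c t (x, y))) (5 * zon 7 (wz b c t (x, y)) * (- wt t (x, y))) by exact: d1.
  by apply/differentiable_continuous/derivable1_diffP; rewrite /wt /=; exact: ex_derive.
rewrite (FTC_oo b0 dF cF).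
rewrite /wz /= sub0r opprK (_ : 2 * pi - t = - t + pi *+ 2); last by rewrite mulr2n; ring.
by rewrite cosD2pi addNr.
Qed.

(* The rotation generator is minus the theta-derivative of cos phi sin theta g
   plus the phi-derivative of cos theta sin phi g. *)
Lemma zonint_wtilt_const (t t' : R) : zonint (wtilt t) = zonint (wtilt t').
Proof.
apply: (@is_derive_0_is_cst R (fun s => zonint (wtilt s)) t t') => {t' }{}t.
pose wt (s : R) (p : R * R) := a * (cos s * (sin p.1 * cos p.2) - sin s * cos p.1).
have [ms mc] := @measurable_sin_cos R.
have dw (s : R) p : is_derive s (1 : R) (fun s : R => wtilt s p) (wt s p).
  by rewrite /wtilt /wt; apply: is_derive_eq; rewrite /GRing.scale /=; ring.
have wtK s p : `|wt s p| <= a.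
  rewrite (_ : wt s p = wtilt (s + pi / 2) p); first exact: wtilt_bnd.
  by rewrite /wt /wtilt sinDpihalf cosDpihalf; ring.
have := @is_derive_zonint wtilt wt a t measurable_wtilt wtilt_bnd wtK dw.
suff -> : Rintegral mu2 D (fun p => 3 * zon 5 (wtilt t p) * wt t p * sin p.1) = 0 by [].
(* [w1] and [w2] are the derivatives of [wtilt t] in the colatitude and the longitude; [f1] and [f2]
   are the derivatives of the two products named above, with [g = zon 3 (wtilt t)]. *)
pose w1 (p : R * R) := a * (sin t * (cos p.1 * cos p.2) - cos t * sin p.1).
pose w2 (p : R * R) := - (a * (sin t * (sin p.1 * sin p.2))).
pose f1 (p : R * R) := cos p.2 * cos p.1 * zon 3 (wtilt t p) + cos p.2 * sin p.1 * (3 * zon 5 (wtilt t p) * w1 p).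
pose f2 (p : R * R) := cos p.1 * cos p.2 * zon 3 (wtilt t p) + cos p.1 * sin p.2 * (3 * zon 5 (wtilt t p) * w2 p).
have m1 : measurable_fun setT (fun p : R * R => sin p.1) by exact: measurableT_comp.
have m2 : measurable_fun setT (fun p : R * R => sin p.2) by exact: measurableT_comp.
have m3 : measurable_fun setT (fun p : R * R => cos p.1) by exact: measurableT_comp.
have m4 : measurable_fun setT (fun p : R * R => cos p.2) by exact: measurableT_comp.
have mz k : measurable_fun setT (fun p => zon k (wtilt t p)).
  by apply: measurableT_comp; [exact: measurable_zon|exact: measurable_wtilt].
have mf1 : measurable_fun setT f1.
  apply: measurable_funD; do ?[apply: measurable_funM => //].
  by apply: measurable_funB; do ?[apply: measurable_funM => //].
have mf2 : measurable_fun setT f2.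
  apply: measurable_funD; do ?[apply: measurable_funM => //].
  by apply: measurableT_comp => //; do ?[apply: measurable_funM => //].
have w1K p : `|w1 p| <= 2.
  rewrite /w1 normrM -[leRHS]mul1r; apply: ler_pM => //; first by rewrite ger0_norm// ltW.
  apply: le_trans (ler_normB _ _) _; rewrite (_ : 2 = 1 + 1) //; apply: lerD.
    by rewrite normrM mulr_ile1// ?sin_max// normrM mulr_ile1// cos_max.
  by rewrite normrM mulr_ile1// ?sin_max// cos_max.
have w2K p : `|w2 p| <= 2.
  rewrite /w2 normrN normrM -[leRHS]mul1r; apply: ler_pM => //; first by rewrite ger0_norm// ltW.
  by rewrite normrM (@le_trans _ _ 1) ?ler1n// mulr_ile1// ?sin_max// normrM mulr_ile1// sin_max.
pose C := (1 - a)^-1 ^+ 3 + 3 * (1 - a)^-1 ^+ 5 * 2.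
have zb (x y : R) w p : `|x| <= 1 -> `|y| <= 1 -> `|w| <= 2 ->
   `|x * y * zon 3 (wtilt t p)| <= (1 - a)^-1 ^+ 3 /\
   `|x * y * (3 * zon 5 (wtilt t p) * w)| <= 3 * (1 - a)^-1 ^+ 5 * 2.
  move=> x1 y1 w2'; have xy : `|x * y| <= 1 by rewrite normrM mulr_ile1.
  split; rewrite normrM.
    by rewrite -[leRHS]mul1r; apply: ler_pM => //; rewrite zon_bnd// wtilt_bnd.
  rewrite -[leRHS]mul1r; apply: ler_pM => //.
  rewrite normrM; apply: ler_pM => //; rewrite normrM ger0_norm//.
  by rewrite ler_wpM2l// zon_bnd// wtilt_bnd.
have f1C p : `|f1 p| <= C.
  have [h1 _] := @zb (cos p.2) (cos p.1) 0 p (cos_max _) (cos_max _) ltac:(by rewrite normr0).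
  have [_ h2] := @zb (cos p.2) (sin p.1) (w1 p) p (cos_max _) (sin_max _) (w1K p).
  by apply: le_trans (ler_normD _ _) _; exact: lerD.
have f2C p : `|f2 p| <= C.
  have [h1 _] := @zb (cos p.1) (cos p.2) 0 p (cos_max _) (cos_max _) ltac:(by rewrite normr0).
  have [_ h2] := @zb (cos p.1) (sin p.2) (w2 p) p (cos_max _) (sin_max _) (w2K p).
  by apply: le_trans (ler_normD _ _) _; exact: lerD.
have mD := @measurable_param_rect R.
have i1 : mu2.-integrable D (EFin \o f1).
  by apply: (@integrable_bnd _ _ _ _ _ _ C) => //; [exact: leb2_param_rect|exact: measurable_funTS].
have i2 : mu2.-integrable D (EFin \o f2).
  by apply: (@integrable_bnd _ _ _ _ _ _ C) => //; [exact: leb2_param_rect|exact: measurable_funTS].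
have -> : Rintegral mu2 D (fun p => 3 * zon 5 (wtilt t p) * wt t p * sin p.1) =
    Rintegral mu2 D f2 - Rintegral mu2 D f1.
  rewrite -RintegralB//; apply: eq_Rintegral => p _.
  rewrite /f1 /f2 /wt /w1 /w2; set z3 := zon 3 _; set z5 := zon 5 _.
  have h1 : cos p.2 ^+ 2 = 1 - sin p.2 ^+ 2 by rewrite sin2cos2; ring.
  transitivity (3 * z5 * a * (cos t * sin p.1 ^+ 2 * cos p.2 - sin t * cos p.1 * sin p.1 * (cos p.2 ^+ 2 + sin p.2 ^+ 2))).
    by rewrite cos2Dsin2; ring.
  by ring.
have [_ ->] := Rint_param mf1 f1C; have [-> _] := Rint_param mf2 f2C.
have dwt1 (x y : R) : is_derive (x : R) (1 : R) (fun x : R => wtilt t (x, y)) (w1 (x, y)).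
  by rewrite /wtilt /w1 /=; apply: is_derive_eq; rewrite /GRing.scale /=; ring.
have dwt2 (x y : R) : is_derive (y : R) (1 : R) (fun y : R => wtilt t (x, y)) (w2 (x, y)).
  by rewrite /wtilt /w2 /=; apply: is_derive_eq; rewrite /GRing.scale /=; ring.
rewrite (_ : (fun x => \int[lebesgue_measure]_(y in `]0, 2 * pi[) f2 (x, y)) = cst 0); last first.
  apply/funext => x /=.
  have b0 : 0 < 2 * pi :> R by rewrite mulr_gt0// pi_gt0.
  have dF : forall y : R, is_derive y (1 : R) (fun y : R => cos x * sin y * zon 3 (wtilt t (x, y))) ((fun y : R => f2 (x, y)) y).
    move=> y. have d1 := @is_derive1_comp _ (zon 3) _ y _ _ (is_derive_zon 3 (wtilt_bnd t (x, y))) (dwt2 x y).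
    have d2 : is_derive (y : R) (1 : R) (fun y : R => zon 3 (wtilt t (x, y))) (3 * zon 5 (wtilt t (x, y)) * w2 (x, y)) by exact: d1.
    by apply: is_derive_eq; rewrite /f2 /GRing.scale /=; ring.
  have cF : continuous (fun y : R => f2 (x, y)).
    move=> y; have dz k : is_derive (y : R) (1 : R) (fun y : R => zon k (wtilt t (x, y))) (k%:R * zon k.+2 (wtilt t (x, y)) * w2 (x, y)).
      exact: (@is_derive1_comp _ (zon k) _ y _ _ (is_derive_zon k (wtilt_bnd t (x, y))) (dwt2 x y)).
    have d3 := dz 3; have d5 := dz 5.
    by apply/differentiable_continuous/derivable1_diffP; rewrite /f2 /w2 /=; exact: ex_derive.
  rewrite (FTC_oo b0 dF cF).
  by rewrite sin0 (_ : 2 * pi = 0 + pi *+ 2) ?sinD2pi ?sin0 ?mulr0 ?mul0r ?subrr// mulr2n; ring.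

rewrite (_ : (fun y => \int[lebesgue_measure]_(x in `]0, pi[) f1 (x, y)) = cst 0); last first.
  apply/funext => y /=.
  have b0 : 0 < pi :> R by exact: pi_gt0.
  have dF : forall x : R, is_derive x (1 : R) (fun x : R => cos y * sin x * zon 3 (wtilt t (x, y))) ((fun x : R => f1 (x, y)) x).
    move=> x. have d1 := @is_derive1_comp _ (zon 3) _ x _ _ (is_derive_zon 3 (wtilt_bnd t (x, y))) (dwt1 x y).
    have d2 : is_derive (x : R) (1 : R) (fun x : R => zon 3 (wtilt t (x, y))) (3 * zon 5 (wtilt t (x, y)) * w1 (x, y)) by exact: d1.
    by apply: is_derive_eq; rewrite /f1 /GRing.scale /=; ring.
  have cF : continuous (fun x : R => f1 (x, y)).
    move=> x; have dz k : is_derive (x : R) (1 : R) (fun x : R => zon k (wtilt t (x, y))) (k%:R * zon k.+2 (wtilt t (x, y)) * w1 (x, y)).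
      exact: (@is_derive1_comp _ (zon k) _ x _ _ (is_derive_zon k (wtilt_bnd t (x, y))) (dwt1 x y)).
    have d3 := dz 3; have d5 := dz 5.
    by apply/differentiable_continuous/derivable1_diffP; rewrite /f1 /w1 /=; exact: ex_derive.
  rewrite (FTC_oo b0 dF cF).
  by rewrite sin0 sinpi !mulr0 !mul0r subrr.

by rewrite !Rintegral_cst ?mul0r ?subrr//; exact: measurable_itv.
Qed.
End ZonalIntegral.

Section SphereIntegral.
Context {R : realType}.
Notation V3 := 'rV[R]_3.
Notation mu2 := (@leb2 R).
Notation D := (@param_rect R).

Lemma polar_angle (u v : R) : exists t, u = Num.sqrt (u ^+ 2 + v ^+ 2) * cos t /\
  v = Num.sqrt (u ^+ 2 + v ^+ 2) * sin t.
Proof.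
set b := Num.sqrt _.
have b2 : b ^+ 2 = u ^+ 2 + v ^+ 2 by rewrite sqr_sqrtr// addr_ge0 ?sqr_ge0.
have [b0|bn0] := eqVneq b 0.
  exists 0; rewrite b0 !mul0r; move/eqP: b2; rewrite b0 expr0n/= eq_sym paddr_eq0 ?sqr_ge0// !sqrf_eq0.
  by case/andP => /eqP-> /eqP->.
have bp : 0 < b by rewrite lt_neqAle eq_sym bn0 sqrtr_ge0.
have ub : (u / b) ^+ 2 <= 1.
  by rewrite expr_div_n ler_pdivrMr ?exprn_gt0// mul1r b2 lerDl sqr_ge0.
have ub1 : -1 <= u / b <= 1 by rewrite -ler_norml -(@expr_le1 _ 2)// real_normK ?num_real.
have hc : cos (acos (u / b)) = u / b by apply: acosK; rewrite in_itv/= ub1.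
have hs : sin (acos (u / b)) = `|v| / b.
  rewrite sin_acos// -[b in RHS](gtr0_norm bp) -normf_div -sqrtr_sqr.
  congr Num.sqrt; apply: (mulIf (expf_neq0 2 bn0)).
  rewrite mulrBl !expr_div_n !divfK ?expf_neq0// b2; ring.
have [v0|v0] := leP 0 v.
  exists (acos (u / b)); rewrite hc hs ger0_norm//; split; by field.
exists (- acos (u / b)); rewrite cosN sinN hc hs ltr0_norm//; split; by field.
Qed.

(** For [y] on the axis the integrand does not depend on the longitude, and in the colatitude it has
    the antiderivative [zon 1 / a], up to sign and a factor [2 pi]. *)
Lemma zonint_axis (a : R) : 0 <= a -> a < 1 ->
  zonint a (wtilt a 0) = 4 * pi * (1 - a ^+ 2)^-1.
Proof.
move=> a0 a1.
have mf : measurable_fun setT (fun p : R * R => zon a 3 (wtilt a 0 p) * sin p.1).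
  apply: measurable_funM; last exact: measurable_jac.
  by apply: measurableT_comp; [exact: measurable_zon|exact: measurable_wtilt].
have fC (p : R * R) : `|zon a 3 (wtilt a 0 p) * sin p.1| <= (1 - a)^-1 ^+ 3 * 1.
  rewrite normrM; apply: ler_pM => //; last exact: sin_max.
  by rewrite zon_bnd// wtilt_bnd.
rewrite /zonint; have [-> _] := Rint_param mf fC.
have wE (x y : R) : wtilt a 0 (x, y) = a * cos x by rewrite /wtilt sin0 cos0 /= mul0r add0r mul1r.
pose g (x : R) := 2 * pi * (zon a 3 (a * cos x) * sin x).
transitivity (\int[@lebesgue_measure R]_(x in `]0, pi[) g x).
  apply: eq_Rintegral => x _.
  rewrite (_ : (fun y => _) = cst (zon a 3 (a * cos x) * sin x)); last first.
    by apply/funext => y /=; rewrite wE.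
  rewrite Rintegral_cst; last exact: measurable_itv.
  have -> : fine ((@lebesgue_measure R) `]0%R, (2 * pi)%R[%classic) = 2 * pi; last by rewrite /g mulrC.
  by rewrite lebesgue_measure_itv /= lte_fin mulr_gt0 ?pi_gt0// sube0.
have wb (x : R) : `|a * cos x| <= a by rewrite -(wE x 0) wtilt_bnd.
have dw (x : R) : is_derive (x : R) (1 : R) (fun x : R => a * cos x) (- a * sin x).
  by apply: is_derive_eq; rewrite /GRing.scale /=; ring.
have dz k (x : R) : is_derive (x : R) (1 : R) (fun x : R => zon a k (a * cos x))
    (k%:R * zon a k.+2 (a * cos x) * (- a * sin x)).
  exact: (@is_derive1_comp _ (zon a k) (fun x => a * cos x) x _ _ (is_derive_zon a1 k (wb x)) (dw x)).
have cg : continuous g.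
  move=> x; have d3 := dz 3 x; rewrite /g.
  by apply/differentiable_continuous/derivable1_diffP; exact: ex_derive.
have p0 : 0 < pi :> R := pi_gt0 R.
(* The centre is treated apart because of the factor [a^-1] in the antiderivative. *)
have [az|an0] := eqVneq a 0.
  have dF : forall x : R, is_derive x (1 : R) (fun x : R => - (2 * pi * cos x)) (g x).
    move=> x; apply: is_derive_eq; rewrite /g /zon az mul0r mulr0 subr0 expr0n /= addr0 sqrtr1 invr1 expr1n /GRing.scale /=; ring.
  rewrite (FTC_oo p0 dF cg) cospi cos0 az expr0n subr0 invr1; ring.
have dF : forall x : R, is_derive x (1 : R) (fun x : R => - (2 * pi * a^-1 * zon a 1 (a * cos x))) (g x).
  move=> x; have d1 := dz 1%N x; apply: is_derive_eq; rewrite /g /GRing.scale /=; by field.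
rewrite (FTC_oo p0 dF cg) cospi cos0 !mulr1 /zon !expr1.
have -> : 1 + a ^+ 2 - 2 * (a * -1) = (1 + a) ^+ 2 by ring.
have -> : 1 + a ^+ 2 - 2 * a = (1 - a) ^+ 2 by ring.
rewrite !sqrtr_sqr !gtr0_norm ?subr_gt0//; last by rewrite ltr_wpDr.
have h1 : 1 - a != 0 by rewrite subr_eq0 eq_sym lt_eqF.
have h2 : 1 + a != 0 by rewrite gt_eqF// ltr_wpDr.
have h3 : 1 - a ^+ 2 != 0 by rewrite -[1 in X in X != 0](expr1n _ 2) subr_sqr mulf_neq0.
by field; rewrite h1 h2 h3 an0.
Qed.

Lemma dot3_zonal (y : V3) : exists t, forall p : R * R,
  dot3 y (sph p) = wz (Num.sqrt (y 0 ord0 ^+ 2 + y 0 (lift ord0 ord0) ^+ 2)) (y 0 (lift ord0 (lift ord0 ord0))) t p.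
Proof.
have [t [h1 h2]] := polar_angle (y 0 ord0) (y 0 (lift ord0 ord0)).
exists t => p; rewrite dot3E sph_coord0 sph_coord1 sph_coord2 /wz cosB.
set b := Num.sqrt _ in h1 h2 *; rewrite h1 h2; ring.
Qed.

(** Turn [y] about the axis into the plane of azimuth 0, then tilt it onto the axis. *)
Lemma zonint_dot3 (y : V3) : enorm3 y < 1 ->
  zonint (enorm3 y) (fun p => dot3 y (sph p)) = 4 * pi * (1 - enorm3 y ^+ 2)^-1.
Proof.
move=> y1; have y0 := enorm3_ge0 y; set a := enorm3 y in y0 y1 *.
have [t ht] := dot3_zonal y.
have -> := funext ht.
set b := Num.sqrt _; set c := y 0 _.
have bc : b ^+ 2 + c ^+ 2 = a ^+ 2.
  by rewrite sqr_sqrtr ?addr_ge0 ?sqr_ge0// /a enorm3_sq dot3E !expr2.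
rewrite (zonint_wz_const y0 y1 t 0 bc).
have [s [hc hb]] := polar_angle c b.
have sa : Num.sqrt (c ^+ 2 + b ^+ 2) = a by rewrite addrC bc sqrtr_sqr ger0_norm.
rewrite sa in hc hb.
rewrite (_ : wz b c 0 = wtilt a s); last first.
  by apply/funext => p; rewrite /wz /wtilt subr0 hc hb; ring.
by rewrite (zonint_wtilt_const y0 y1 s 0) zonint_axis.
Qed.

Lemma P0_zon (y : V3) (p : R * R) :
  P0 (sph p) y = (1 - enorm3 y ^+ 2) * zon (enorm3 y) 3 (dot3 y (sph p)).
Proof.
rewrite /P0 -enorm3_sq; congr (_ * _); rewrite /zon /rho /enorm3 -/(enorm3 y).
congr ((Num.sqrt _)^-1 ^+ 3).
rewrite -!enorm3_sq.
have := @enorm3_sq _ (sph p); rewrite enorm3_sph expr1n => h.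
transitivity (dot3 (sph p) (sph p) + dot3 y y - 2 * dot3 y (sph p)); last by rewrite -h enorm3_sq.
rewrite enorm3_sq !dot3E !mxE; ring.
Qed.

Lemma sint_P0 (y : V3) : enorm3 y < 1 -> sint (fun eta => P0 eta y) = 4 * pi.
Proof.
move=> y1; have y0 := enorm3_ge0 y.
have mD := @measurable_param_rect R.
have wb p : `|dot3 y (sph p)| <= enorm3 y.
  by apply: le_trans (cauchy_schwarz3 _ _) _; rewrite enorm3_sph mulr1.
have m1 : measurable_fun setT (fun p : R * R => dot3 y (sph p)).
  by apply: measurable_sum => i; apply: measurable_funM => //; exact: measurable_sph.
have mf : measurable_fun setT (fun p : R * R => zon (enorm3 y) 3 (dot3 y (sph p)) * sin p.1).
  apply: measurable_funM; last exact: measurable_jac.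
  by apply: measurableT_comp m1; exact: measurable_zon.
have fC (p : R * R) : `|zon (enorm3 y) 3 (dot3 y (sph p)) * sin p.1| <= (1 - enorm3 y)^-1 ^+ 3 * 1.
  rewrite normrM; apply: ler_pM => //; last exact: sin_max.
  by rewrite zon_bnd.
transitivity ((1 - enorm3 y ^+ 2) * zonint (enorm3 y) (fun p => dot3 y (sph p))).
  rewrite /zonint -RintegralZl//; last first.
    apply: (@integrable_bnd _ _ _ _ _ _ ((1 - enorm3 y)^-1 ^+ 3 * 1)) => //; [exact: leb2_param_rect|exact: measurable_funTS].
  by apply: eq_Rintegral => p _; rewrite P0_zon /sigma_jac mulrA.
rewrite zonint_dot3// mulrCA divff ?mulr1//.
by rewrite subr_eq0 eq_sym lt_eqF// expr_lt1.
Qed.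

(** Bounds on a closed ball of radius [c > |x|] yield bounds on a short segment through [x] in any
    direction. *)
Lemma is_derive_Rint_ball {dd : measure_display} {Y : measurableType dd}
  (m : {measure set Y -> \bar R}) (A : set Y) (f df : V3 -> Y -> R) (x v : V3) (c C : R) :
  measurable A -> (m A < +oo)%E -> enorm3 x < c ->
  (forall y, enorm3 y <= c -> measurable_fun A (f y)) ->
  (forall y p, A p -> enorm3 y <= c -> `|f y p| <= C) ->
  (forall y p, A p -> enorm3 y <= c -> is_derive y v (f ^~ p) (df y p)) ->
  (forall y p, A p -> enorm3 y <= c -> `|df y p| <= C) ->
  is_derive x v (fun y => \int[m]_(p in A) f y p) (\int[m]_(p in A) df x p).
Proof.
move=> mA fA xc mf fC dfd dC.
have n0 := enorm3_ge0 v.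
pose e := (c - enorm3 x) / (enorm3 v + 1).
have e0 : 0 < e by rewrite divr_gt0 ?subr_gt0// ltr_wpDl.
have ec t : `|t| < e -> enorm3 (t *: v + x) <= c.
  move=> te; have h1 := enorm3D (t *: v) x; rewrite enorm3Z in h1.
  have : `|t| * enorm3 v <= e * enorm3 v by rewrite ler_wpM2r// ltW.
  have : e * (enorm3 v + 1) = c - enorm3 x by rewrite /e divfK// gt_eqF// ltr_wpDl.
  by rewrite mulrDr mulr1; lra.
apply: (@is_derive_Rintegral _ _ _ _ m A f df x v e C) => //.
- by move=> t te; exact: mf (ec _ te).
- by move=> t p te Ap; exact: fC (ec _ te).
- by move=> t p te Ap; exact: dfd (ec _ te).
- by move=> t p te Ap; exact: dC (ec _ te).
Qed.

Lemma is_derive_sint (f df : V3 -> V3 -> R) (x v : V3) (c C : R) :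
  enorm3 x < c ->
  (forall y, enorm3 y <= c -> measurable_fun setT (fun p : R * R => f y (sph p))) ->
  (forall y p, enorm3 y <= c -> `|f y (sph p)| <= C) ->
  (forall y p, enorm3 y <= c -> is_derive y v (f ^~ (sph p)) (df y (sph p))) ->
  (forall y p, enorm3 y <= c -> `|df y (sph p)| <= C) ->
  is_derive x v (fun y => sint (f y)) (sint (df x)).
Proof.
move=> xc mf fC dfd dC.
have mD := @measurable_param_rect R.
apply: (@is_derive_Rint_ball _ _ mu2 D (fun y p => f y (sph p) * sigma_jac p)
  (fun y p => df y (sph p) * sigma_jac p) x v c C) => //.
- exact: leb2_param_rect.
- move=> y yc; apply: measurable_funTS; apply: measurable_funM; last exact: measurable_jac.
  exact: mf yc.
- move=> y p _ yc; rewrite normrM -[leRHS]mulr1; apply: ler_pM => //; last exact: sigma_jac_bnd.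
  exact: fC yc.
- move=> y p _ yc; have h := dfd _ p yc.
  by apply: is_derive_eq; rewrite /GRing.scale /=; ring.
- move=> y p _ yc; rewrite normrM -[leRHS]mulr1; apply: ler_pM => //; last exact: sigma_jac_bnd.
  exact: dC yc.
Qed.

Lemma near_ball3 (x : V3) (c : R) : enorm3 x < c -> \forall y \near x, enorm3 y < c.
Proof. by move=> h; exact: (cvgr_lt _ (@continuous_enorm3 R x) _ h). Qed.

Lemma is_derive_sphere_cst (f : V3 -> R) (k d : R) (x v : V3) : ball3 x ->
  (forall y, ball3 y -> f y = k) -> is_derive x v f d -> d = 0.
Proof.
move=> bx fk [_ <-].
rewrite (_ : 'D_v f x = 'D_v (cst k) x); first exact: derive_cst.
apply: near_eq_derive; near=> y; rewrite fk//.
by near: y; exact: near_ball3.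
Unshelve. all: by end_near. Qed.

Lemma sint_P1 (y : V3) j : enorm3 y < 1 -> sint (fun eta => P1 eta j y) = 0.
Proof.
move=> y1; pose c := (enorm3 y + 1) / 2.
have c1 : c < 1 by rewrite /c; lra.
have cy : enorm3 y < c by rewrite /c; lra.
have H : is_derive y (e3 R j) (fun y => sint (fun eta => P0 eta y)) (sint (fun eta => P1 eta j y)).
  apply: (@is_derive_sint (fun y eta => P0 eta y) (fun y eta => P1 eta j y) y _ c (10 * (1 - c)^-1 ^+ 5)) => //.
  - by move=> z _; have [] := @measurable_P _ _ _ (fun p => sph p) (fun=> z) j j measurable_sph (fun i => measurable_cst _).
  - by move=> z p zc; have [] := P01_le j (enorm3_sph p) zc c1.
  - by move=> z p zc; apply: is_derive_P0; apply: ball3_neq; rewrite ?enorm3_sph//; exact: le_lt_trans zc c1.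
  - by move=> z p zc; have [] := P01_le j (enorm3_sph p) zc c1.
exact: (is_derive_sphere_cst y1 (@sint_P0) H).
Qed.

Lemma P2_le_c eta (y : V3) i j (c : R) : enorm3 eta = 1 -> enorm3 y <= c -> c < 1 ->
  `|P2 eta i j y| <= 52 * (1 - c)^-1 ^+ 4.
Proof.
move=> e1 yc c1; have y1 := le_lt_trans yc c1.
apply: (le_trans (P2_le i j e1 y1)); rewrite ler_pM2l// lerXn2r ?nnegrE ?rho_le//.
  by rewrite invr_ge0 enorm3_ge0.
by rewrite invr_ge0 subr_ge0 ltW.
Qed.

(** The constant integral of [P0] is differentiated twice under the integral sign. For this reason
    the L-part of the kernel will not change the total integral. *)
Lemma sint_P2 (y : V3) i j : enorm3 y < 1 -> sint (fun eta => P2 eta i j y) = 0.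
Proof.
move=> y1; pose c := (enorm3 y + 1) / 2.
have c1 : c < 1 by rewrite /c; lra.
have cy : enorm3 y < c by rewrite /c; lra.
have k1 : 1 <= (1 - c)^-1 by rewrite invf_ge1; have := enorm3_ge0 y; rewrite /c; lra.
have k45 : (1 - c)^-1 ^+ 4 <= (1 - c)^-1 ^+ 5 by rewrite ler_weXn2l.
have k5 : 0 <= (1 - c)^-1 ^+ 5 by rewrite exprn_ge0// (le_trans _ k1).
have H : is_derive y (e3 R i) (fun y => sint (fun eta => P1 eta j y)) (sint (fun eta => P2 eta i j y)).
  apply: (@is_derive_sint (fun y eta => P1 eta j y) (fun y eta => P2 eta i j y) y _ c (52 * (1 - c)^-1 ^+ 5)) => //.
  - by move=> z _; have [] := @measurable_P _ _ _ (fun p => sph p) (fun=> z) j j measurable_sph (fun i => measurable_cst _).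
  - move=> z p zc; have [_ h] := P01_le j (enorm3_sph p) zc c1; apply: (le_trans h).
    by rewrite ler_wpM2r// ler_nat.
  - by move=> z p zc; apply: is_derive_P1; apply: ball3_neq; rewrite ?enorm3_sph//; exact: le_lt_trans zc c1.
  - move=> z p zc; apply: (le_trans (P2_le_c i j (enorm3_sph p) zc c1)).
    by rewrite ler_wpM2l.
exact: (is_derive_sphere_cst y1 (fun z => sint_P1 j (y := z)) H).
Qed.
End SphereIntegral.

(** * Mean value estimates *)

Section MeanValue.
Context {R : realType}.
Notation V3 := 'rV[R]_3.

Lemma FTC_cc (f F : R -> R) (a b : R) : a < b ->
  (forall x : R, a <= x <= b -> is_derive x (1 : R) F (f x)) ->
  (forall x : R, a <= x <= b -> {for x, continuous f}) ->
  \int[@lebesgue_measure R]_(x in `[a, b]) f x = F b - F a.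
Proof.
move=> ab dF cf.
have cF x : a <= x <= b -> {for x, continuous F}.
  by move=> xab; apply/differentiable_continuous/derivable1_diffP; have [] := dF x xab.
have cwf : {within `[a, b], continuous f}.
  by apply: continuous_in_subspaceT => x; rewrite inE /= in_itv /=; exact: cf.
have H := @continuous_FTC2 R f F a b ab cwf _ _.
rewrite /Rintegral H //=.
- split; first by move=> x; rewrite in_itv /= => /andP[h1 h2]; have [] := dF x; rewrite ?(ltW h1) ?(ltW h2).
  + by apply: cvg_at_right_filter; apply: cF; rewrite lexx ltW.
  + by apply: cvg_at_left_filter; apply: cF; rewrite lexx ltW.
- move=> x; rewrite in_itv /= => /andP[h1 h2]; rewrite derive1E.
  have xab : a <= x <= b by rewrite (ltW h1) (ltW h2).
  by have [_ ->] := dF x xab.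
Qed.

Lemma mvt01 (f df : R -> R) (K : R) :
  (forall t : R, 0 <= t <= 1 -> is_derive t (1 : R) f (df t)) ->
  (forall t, 0 <= t <= 1 -> `|df t| <= K) -> `|f 1 - f 0| <= K.
Proof.
move=> fd fK.
have cf : {within `[0, 1], continuous f}.
  apply: continuous_in_subspaceT => x; rewrite inE /= in_itv /= => x01.
  by apply/differentiable_continuous/derivable1_diffP; have [] := fd x x01.
have [x|c c01 ->] := @MVT_segment R f df 0 1 ler01 _ cf.
  by rewrite in_itv /= => /andP[h1 h2]; apply: fd; rewrite !ltW.
by rewrite subr0 mulr1 fK//; move: c01; rewrite in_itv.
Qed.

Lemma mvt_line (g dg : V3 -> R) (z v : V3) (s K : R) :
  (forall t : R, 0 <= t <= 1 -> is_derive ((t * s) *: v + z) v g (dg ((t * s) *: v + z))) ->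
  (forall t, 0 <= t <= 1 -> `|dg ((t * s) *: v + z)| <= K) ->
  `|g (s *: v + z) - g z| <= K * `|s|.
Proof.
move=> gd gK.
have := @mvt01 (fun t => g ((t * s) *: v + z)) (fun t => dg ((t * s) *: v + z) * s) (K * `|s|).
rewrite mul1r mul0r scale0r add0r; apply => t t01; last by rewrite normrM ler_wpM2r// gK.
have /derive_line h := gd t t01.
have d : is_derive (t : R) (1 : R) (fun t : R => t * s) s.
  by apply: is_derive_eq; rewrite /GRing.scale /=; ring.
exact: (@is_derive1_comp _ (fun u => g (u *: v + z)) (fun t => t * s) t _ _ h d).
Qed.

Lemma enorm3_mono (y z : V3) : (forall i, `|z 0 i| <= `|y 0 i|) -> enorm3 z <= enorm3 y.
Proof.
move=> h; rewrite ler_sqrt ?dot3_ge0//; apply: ler_sum => i _.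
by rewrite -!expr2 -real_normK ?num_real// -[leRHS]real_normK ?num_real// lerXn2r ?nnegrE.
Qed.

(** The path from 0 to [y] along the three axes uses partial derivatives only, and it stays in the
    ball because its points have coordinates no larger in modulus than those of [y]. *)
Lemma mvt_ball (g : V3 -> R) (dg : 'I_3 -> V3 -> R) (K : R) (y : V3) :
  (forall i z, enorm3 z <= enorm3 y -> is_derive z (e3 R i) g (dg i z)) ->
  (forall i z, enorm3 z <= enorm3 y -> `|dg i z| <= K) ->
  `|g y - g 0| <= 3 * K * enorm3 y.
Proof.
move=> gd gK.
have K0 : 0 <= K by exact: le_trans (normr_ge0 _) (gK ord0 y (lexx _)).
pose z1 : V3 := y 0 ord0 *: e3 R ord0 + 0.
pose z2 : V3 := y 0 (lift ord0 ord0) *: e3 R (lift ord0 ord0) + z1.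
pose z3 : V3 := y 0 (lift ord0 (lift ord0 ord0)) *: e3 R (lift ord0 (lift ord0 ord0)) + z2.
have z3y : z3 = y.
  apply/rowP; apply: ord3P; rewrite /z3 /z2 /z1 !mxE /= ?mulr1 ?mulr0 ?addr0 ?add0r//.
have tb (t : R) (u : R) : 0 <= t <= 1 -> `|t * u| <= `|u|.
  by case/andP=> t0 t1; rewrite normrM ger0_norm// ler_piMl.
have step i z : (forall t, 0 <= t <= 1 -> enorm3 ((t * y 0 i) *: e3 R i + z) <= enorm3 y) ->
    `|g (y 0 i *: e3 R i + z) - g z| <= K * enorm3 y.
  move=> hz; apply: (@le_trans _ _ (K * `|y 0 i|)); last by rewrite ler_wpM2l// coord_le_enorm3.
  by apply: mvt_line => t t01; [exact: gd (hz _ t01)|exact: gK (hz _ t01)].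
have s1 : `|g z1 - g 0| <= K * enorm3 y.
  apply: step => t t01; apply: enorm3_mono; apply: ord3P; rewrite !mxE /= ?mulr1 ?mulr0 ?addr0 ?normr0 ?tb//.
have s2 : `|g z2 - g z1| <= K * enorm3 y.
  apply: step => t t01; apply: enorm3_mono; apply: ord3P; rewrite /z1 !mxE /= ?mulr1 ?mulr0 ?addr0 ?add0r ?normr0 ?tb//.
have s3 : `|g z3 - g z2| <= K * enorm3 y.
  apply: step => t t01; apply: enorm3_mono; apply: ord3P; rewrite /z2 /z1 !mxE /= ?mulr1 ?mulr0 ?addr0 ?add0r ?normr0 ?tb//.
rewrite -{1}z3y (_ : g z3 - g 0 = (g z3 - g z2) + ((g z2 - g z1) + (g z1 - g 0))); last by ring.
apply: (le_trans (ler_normD _ _)); apply: (le_trans (lerD s3 (ler_normD _ _))).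
rewrite -mulrA; move: (lerD s1 s2) => h; move: h; set u := `|g z1 - _|; set w := `|g z2 - _|; set v := K * _; clear => h; lra.
Qed.
Lemma is_derive_dot3l (eta z : V3) (i : 'I_3) :
  is_derive z (e3 R i) (fun z : V3 => dot3 z eta) (eta 0 i).
Proof.
have d0 := is_derive_coord z (e3 R i) ord0.
have d1 := is_derive_coord z (e3 R i) (lift ord0 ord0).
have d2 := is_derive_coord z (e3 R i) (lift ord0 (lift ord0 ord0)).
rewrite (_ : (fun z : V3 => dot3 z eta) = fun z : V3 => z 0 ord0 * eta 0 ord0 + z 0 (lift ord0 ord0) * eta 0 (lift ord0 ord0)
   + z 0 (lift ord0 (lift ord0 ord0)) * eta 0 (lift ord0 (lift ord0 ord0))); last first.
  by apply/funext => w; rewrite dot3E.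
apply: is_derive_eq; rewrite /GRing.scale /= !e3E.
by move: i {d0 d1 d2}; apply: ord3P => /=; ring.
Qed.

Lemma is_derive_scale (g : V3 -> R) (y v : V3) (t d : R) :
  is_derive (t *: y) v g d -> is_derive y v (fun z => g (t *: z)) (t * d).
Proof.
move=> /derive_line0 h; apply/derive_line0.
have dt : is_derive (0 : R) (1 : R) (fun s : R => s * t) t.
  by apply: is_derive_eq; rewrite /GRing.scale /=; ring.
rewrite (_ : (fun s : R => g (t *: (s *: v + y))) = (fun u => g (u *: v + t *: y)) \o (fun s => s * t)); last first.
  by apply/funext => s /=; rewrite scalerDr scalerA [t * s]mulrC.
rewrite mulrC; apply: is_derive1_comp.
by rewrite mul0r.
Qed.

End MeanValue.

(** * The elastic Poisson kernel *)

Section ElasticKernel.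
Context {R : realType}.
Notation V3 := 'rV[R]_3.
Notation mu2 := (@leb2 R).
Notation D := (@param_rect R).
Variables lam mu : R.
Hypotheses (mu0 : 0 < mu) (lm0 : 0 < 2 * mu + lam).
Notation al := (alpha_c lam mu).
Notation leb := (@lebesgue_measure R).

Lemma alpha_bnd : 0 < al < 1.
Proof.
have h : 0 < lam + 3 * mu.
  by rewrite (_ : _ + _ = (2 * mu + lam) + mu); [exact: addr_gt0|ring].
rewrite /alpha_c divr_gt0//=; last by rewrite addrC.
by rewrite ltr_pdivrMr// mul1r ltrD2l ltr_pM2r// ltr_nat.
Qed.

(** At [t = 0] both sides are 0, the left one because its numerator is. *)
Lemma sqr_powR (t : R) : 0 <= t -> t ^+ 2 / t `^ (1 + al) = t `^ (1 - al).
Proof.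
have /andP[a0 a1] := alpha_bnd.
rewrite le_eqVlt => /predU1P[<-|t0].
  by rewrite expr0n mul0r powR0// gt_eqF// subr_gt0.
rewrite -powR_mulrn ?(ltW t0)// -powRB ?(gt_eqF t0) ?implybT//.
by congr (_ `^ _); ring.
Qed.

Lemma powR_le1 (t : R) : 0 <= t <= 1 -> `|t `^ (1 - al)| <= 1.
Proof.
have /andP[a0 a1] := alpha_bnd; case/andP=> t0 t1; rewrite ger0_norm ?powR_ge0//.
have := @ge0_ler_powR R (1 - al) _ t 1; rewrite powR1; apply; rewrite ?nnegrE ?subr_ge0 ?(ltW a1)//.
Qed.

Lemma enorm3_scale (t : R) (y : V3) : 0 <= t <= 1 -> enorm3 (t *: y) <= t * enorm3 y.
Proof. by case/andP=> t0 t1; rewrite enorm3Z ger0_norm. Qed.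

Lemma enorm3_scale_le (t c : R) (y : V3) : 0 <= t <= 1 -> enorm3 y <= c -> enorm3 (t *: y) <= c.
Proof.
move=> t01 yc; apply: (le_trans (enorm3_scale y t01)); apply: le_trans yc.
by case/andP: t01 => t0 t1; rewrite ler_piMl// enorm3_ge0.
Qed.

Lemma rho0 (eta : V3) : enorm3 eta = 1 -> rho eta 0 = 1.
Proof. by move=> e1; rewrite /rho sub0r enorm3N e1 invr1. Qed.

Definition Kc (c : R) : R := 52 * (1 - c)^-1 ^+ 4.

Lemma Kc_ge0 c : c < 1 -> 0 <= Kc c.
Proof. by move=> c1; apply: mulr_ge0 => //; rewrite exprn_ge0// invr_ge0 subr_ge0 ltW. Qed.

Section Bounds.
Variables (eta : V3) (c : R).
Hypotheses (e1 : enorm3 eta = 1) (c1 : c < 1).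
Notation K := (Kc c).

Lemma P1_lin j (y : V3) : enorm3 y <= c -> `|P1 eta j y - 3 * eta 0 j| <= 3 * K * enorm3 y.
Proof.
move=> yc.
have h0 : P1 eta j 0 = 3 * eta 0 j.
  by rewrite /P1 (rho0 e1) !expr1n dot3E !mxE; ring.
rewrite -h0; apply: (@mvt_ball _ (P1 eta j) (fun i => P2 eta i j)) => i z zy.
  by apply: is_derive_P1; apply: ball3_neq => //; exact: le_lt_trans (le_trans zy yc) c1.
exact: (P2_le_c i j e1 (le_trans zy yc) c1).
Qed.

(** [1 + 3 y . eta] is the Taylor polynomial of degree one of [P0] at 0, which is why it is
    subtracted in [Phi]: against a quadratic remainder the weight [t^-(1 + alpha)] leaves the
    integrand bounded. *)
Lemma P0_quad (y : V3) : enorm3 y <= c ->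
  `|P0 eta y - 1 - 3 * dot3 y eta| <= 9 * K * enorm3 y ^+ 2.
Proof.
move=> yc; have K0 := Kc_ge0 c1.
have := @mvt_ball _ (fun z => P0 eta z - 1 - 3 * dot3 z eta) (fun i z => P1 eta i z - 3 * eta 0 i)
  (3 * K * enorm3 y) y.
rewrite /P0 (rho0 e1) !expr1n [dot3 0 _]dot3E [dot3 0 _]dot3E !mxE !mul0r !addr0 mulr0 !subr0 mulr1 subrr subr0 => H.
rewrite (_ : 9 * K * enorm3 y ^+ 2 = 3 * (3 * K * enorm3 y) * enorm3 y); last by ring.
apply: H.
  move=> i z zy.
  have dP := @is_derive_P0 _ eta z i (ball3_neq e1 (le_lt_trans (le_trans zy yc) c1)).
  have dd := is_derive_dot3l eta z i.
  by apply: is_derive_eq; rewrite /GRing.scale /=; ring.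
move=> i z zy; apply: (le_trans (P1_lin i (le_trans zy yc))).
by rewrite ler_wpM2l// mulr_ge0.
Qed.
End Bounds.

(** The integrand of [4 pi Phi], followed by its first and second derivatives. Two derivatives
    remove the subtracted affine part and turn [t^2 / t^(1 + alpha)] into [t^(1 - alpha)]. *)
Definition PhiI (eta y : V3) (t : R) : R := (P0 eta (t *: y) - 1 - 3 * dot3 (t *: y) eta) / t `^ (1 + al).
Definition PhiI1 (eta : V3) (j : 'I_3) (y : V3) (t : R) : R :=
  t * (P1 eta j (t *: y) - 3 * eta 0 j) / t `^ (1 + al).
Definition PhiI2 (eta : V3) (i j : 'I_3) (y : V3) (t : R) : R := t `^ (1 - al) * P2 eta i j (t *: y).

Lemma PhiE (eta y : V3) : enorm3 eta = 1 -> enorm3 y < 1 ->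
  Phi lam mu y eta = (4 * pi)^-1 * \int[leb]_(t in `[0, 1]) PhiI eta y t.
Proof.
move=> e1 y1; rewrite /Phi; congr (_ * _); apply: eq_Rintegral => t.
rewrite inE /= in_itv /= => t01; rewrite /PhiI /P0.
have t0 : 0 <= t by case/andP: t01.
have hs : 1 - 2 * t * dot3 y eta + t ^+ 2 * enorm3 y ^+ 2 = enorm3 (t *: y - eta) ^+ 2.
  transitivity (dot3 eta eta - 2 * t * dot3 y eta + t ^+ 2 * dot3 y y).
    by rewrite -!enorm3_sq e1 expr1n.
  by rewrite enorm3_sq !dot3E !mxE; ring.
have hd : dot3 (t *: y) (t *: y) = t ^+ 2 * enorm3 y ^+ 2 by rewrite enorm3_sq !dot3E !mxE; ring.
have hl : dot3 (t *: y) eta = t * dot3 y eta by rewrite !dot3E !mxE; ring.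
rewrite hs hd hl mulrA; congr ((_ - _ - _) / _).
rewrite (_ : (enorm3 (t *: y - eta) ^+ 2) `^ (3 / 2) = enorm3 (t *: y - eta) ^+ 3); last first.
  rewrite -(powR_mulrn 2) ?enorm3_ge0// -powRrM -(powR_mulrn 3) ?enorm3_ge0//.
  by congr (_ `^ _); field.
by rewrite /rho exprVn.
Qed.

Lemma measurable_PhiI (eta y : V3) i j : [/\ measurable_fun setT (PhiI eta y),
  measurable_fun setT (PhiI1 eta i y) & measurable_fun setT (PhiI2 eta i j y)].
Proof.
have mY k : measurable_fun setT (fun t : R => (t *: y) 0 k).
  by rewrite (_ : (fun t => _) = (fun t : R => t * y 0 k)); [exact: measurable_funM|apply/funext => t; rewrite mxE].
have [m0 m1 m2] := @measurable_P _ _ _ (fun=> eta) (fun t : R => t *: y) i j (fun k => measurable_cst _) mY.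
have mp r : measurable_fun setT (fun t : R => t `^ r) by exact: measurable_powR.
have mi : measurable_fun setT (fun t : R => (t `^ (1 + al))^-1).
  by apply: measurableT_comp => //; exact: measurable_inv.
have [_ m1i _] := @measurable_P _ _ _ (fun=> eta) (fun t : R => t *: y) i j (fun k => measurable_cst _) mY.
split.
- apply: measurable_funM => //; apply: measurable_funB; first exact: measurable_funB.
  apply: measurable_funM => //; apply: measurable_sum => k; exact: measurable_funM.
- apply: measurable_funM => //; apply: measurable_funM => //; exact: measurable_funB.
- exact: measurable_funM.
Qed.

Lemma sqr_div_powR_le1 (t : R) : 0 <= t <= 1 -> `|t ^+ 2 / t `^ (1 + al)| <= 1.
Proof. by move=> /[dup] t01 /andP[t0 _]; rewrite sqr_powR// powR_le1. Qed.

Section Derivatives.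
Variables (eta : V3).
Hypothesis (e1 : enorm3 eta = 1).

Lemma PhiI_bnd (c : R) (y : V3) t : c < 1 -> enorm3 y <= c -> 0 <= t <= 1 ->
  `|PhiI eta y t| <= 9 * Kc c.
Proof.
move=> c1 yc t01; have tyc := enorm3_scale_le t01 yc.
have y1 : enorm3 (t *: y) <= t.
  apply: (le_trans (enorm3_scale y t01)); case/andP: t01 => t0 _.
  by rewrite ler_piMr// (le_trans yc)// ltW.
have K0 := Kc_ge0 c1.
have t0 : 0 <= t by case/andP: t01.
rewrite /PhiI normrM.
apply: (@le_trans _ _ (9 * Kc c * t ^+ 2 * `|(t `^ (1 + al))^-1|)).
  rewrite ler_wpM2r//; apply: (le_trans (P0_quad e1 c1 tyc)).
  apply: ler_wpM2l; first exact: mulr_ge0.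
  by rewrite lerXn2r ?nnegrE ?enorm3_ge0.
rewrite -mulrA -[t ^+ 2]ger0_norm ?exprn_ge0// -normrM -[leRHS]mulr1; apply: ler_wpM2l; first exact: mulr_ge0.
exact: sqr_div_powR_le1.
Qed.

Lemma PhiI1_bnd j (c : R) (y : V3) t : c < 1 -> enorm3 y <= c -> 0 <= t <= 1 ->
  `|PhiI1 eta j y t| <= 9 * Kc c.
Proof.
move=> c1 yc t01; have tyc := enorm3_scale_le t01 yc.
have y1 : enorm3 (t *: y) <= t.
  apply: (le_trans (enorm3_scale y t01)); case/andP: t01 => t0 _.
  by rewrite ler_piMr// (le_trans yc)// ltW.
have K0 := Kc_ge0 c1.
have t0 : 0 <= t by case/andP: t01.
rewrite /PhiI1 normrM.
apply: (@le_trans _ _ (9 * Kc c * t ^+ 2 * `|(t `^ (1 + al))^-1|)).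
  rewrite ler_wpM2r// normrM ger0_norm// expr2 mulrCA ler_wpM2l//.
  apply: (le_trans (P1_lin e1 c1 j tyc)).
  apply: (@le_trans _ _ (3 * Kc c * t)); first by apply: ler_wpM2l => //; exact: mulr_ge0.
  by rewrite ler_wpM2r// ler_wpM2r// ler_nat.
rewrite -mulrA -[t ^+ 2]ger0_norm ?exprn_ge0// -normrM -[leRHS]mulr1; apply: ler_wpM2l; first exact: mulr_ge0.
exact: sqr_div_powR_le1.
Qed.

Lemma PhiI2_bnd i j (c : R) (y : V3) t : c < 1 -> enorm3 y <= c -> 0 <= t <= 1 ->
  `|PhiI2 eta i j y t| <= Kc c.
Proof.
move=> c1 yc t01; rewrite /PhiI2 normrM -[leRHS]mul1r; apply: ler_pM => //; first exact: powR_le1.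
exact: (P2_le_c i j e1 (enorm3_scale_le t01 yc) c1).
Qed.

Lemma is_derive_PhiI j (y : V3) t : enorm3 y < 1 -> 0 <= t <= 1 ->
  is_derive y (e3 R j) (PhiI eta ^~ t) (PhiI1 eta j y t).
Proof.
move=> y1 t01; have ty1 : enorm3 (t *: y) < 1 by exact: le_lt_trans (enorm3_scale_le t01 (lexx _)) y1.
have d1 := is_derive_scale (is_derive_P0 j (ball3_neq e1 ty1)).
have dd := is_derive_scale (is_derive_dot3l eta (t *: y) j).
by rewrite /PhiI; apply: is_derive_eq; rewrite /PhiI1 /GRing.scale /=; ring.
Qed.

Lemma is_derive_PhiI1 i j (y : V3) t : enorm3 y < 1 -> 0 <= t <= 1 ->
  is_derive y (e3 R i) (PhiI1 eta j ^~ t) (PhiI2 eta i j y t).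
Proof.
move=> y1 t01; have ty1 : enorm3 (t *: y) < 1 by exact: le_lt_trans (enorm3_scale_le t01 (lexx _)) y1.
have d1 := is_derive_scale (is_derive_P1 i j (ball3_neq e1 ty1)).
have t0 : 0 <= t by case/andP: t01.
by rewrite /PhiI1; apply: is_derive_eq; rewrite /PhiI2 -sqr_powR// /GRing.scale /=; ring.
Qed.

Lemma partial_Phi i j (x : V3) : enorm3 x < 1 ->
  partial i (partial j (fun y => Phi lam mu y eta)) x =
  (4 * pi)^-1 * \int[leb]_(t in `[0, 1]) PhiI2 eta i j x t.
Proof.
have itv (t : R) : `[0, 1]%classic t -> 0 <= t <= 1 by rewrite /= in_itv.
have mI : measurable (`[0, 1]%classic : set R) by exact: measurable_itv.
have cE (y : V3) : enorm3 y < 1 -> enorm3 y < (enorm3 y + 1) / 2 /\ (enorm3 y + 1) / 2 < 1 by move=> ?; lra.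
have D1 (y : V3) : enorm3 y < 1 -> partial j (fun y => Phi lam mu y eta) y =
    (4 * pi)^-1 * \int[leb]_(t in `[0, 1]) PhiI1 eta j y t.
  move=> y1; have [yc c1] := cE y y1; set c := (_ + 1) / 2 in yc c1.
  have H : is_derive y (e3 R j) (fun y => \int[leb]_(t in `[0, 1]) PhiI eta y t)
      (\int[leb]_(t in `[0, 1]) PhiI1 eta j y t).
    apply: (@is_derive_Rint_ball _ _ _ leb _ (PhiI eta) (PhiI1 eta j) y _ c (9 * Kc c)) => //.
    - exact: leb_cc_fin.
    - by move=> z zc; apply: measurable_funTS; have [] := measurable_PhiI eta z i j.
    - by move=> z t /itv t01 zc; exact: PhiI_bnd.
    - by move=> z t /itv t01 zc; apply: is_derive_PhiI => //; exact: le_lt_trans zc c1.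
    - by move=> z t /itv t01 zc; exact: PhiI1_bnd.
  rewrite /partial (_ : 'D_(e3 R j) _ y =
    'D_(e3 R j) (fun y => (4 * pi)^-1 * \int[leb]_(t in `[0, 1]) PhiI eta y t) y); last first.
    (* [PhiE] holds inside the unit ball only, so the two functions are compared near [y]. *)
    apply: near_eq_derive; near=> z; apply: PhiE => //; near: z; exact: near_ball3.
  have H2 : is_derive y (e3 R j) (fun y => (4 * pi)^-1 * \int[leb]_(t in `[0, 1]) PhiI eta y t)
     ((4 * pi)^-1 * \int[leb]_(t in `[0, 1]) PhiI1 eta j y t).
    by apply: is_derive_eq; rewrite /GRing.scale /=.
  by have [_ ->] := H2.
move=> x1; have [xc c1] := cE x x1; set c := (_ + 1) / 2 in xc c1.
have H : is_derive x (e3 R i) (fun y => \int[leb]_(t in `[0, 1]) PhiI1 eta j y t)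
    (\int[leb]_(t in `[0, 1]) PhiI2 eta i j x t).
  have K0 := Kc_ge0 c1.
  apply: (@is_derive_Rint_ball _ _ _ leb _ (PhiI1 eta j) (PhiI2 eta i j) x _ c (9 * Kc c)) => //.
  - exact: leb_cc_fin.
  - by move=> z zc; apply: measurable_funTS; have [] := measurable_PhiI eta z j j.
  - by move=> z t /itv t01 zc; exact: PhiI1_bnd.
  - by move=> z t /itv t01 zc; apply: is_derive_PhiI1 => //; exact: le_lt_trans zc c1.
  - move=> z t /itv t01 zc; apply: (le_trans (PhiI2_bnd i j c1 zc t01)).
    by rewrite ler_peMl// ler1n.
rewrite {1}/partial (_ : 'D_(e3 R i) _ x =
  'D_(e3 R i) (fun y => (4 * pi)^-1 * \int[leb]_(t in `[0, 1]) PhiI1 eta j y t) x); last first.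
  apply: near_eq_derive; near=> z; apply: D1; near: z; exact: near_ball3.
have H2 : is_derive x (e3 R i) (fun y => (4 * pi)^-1 * \int[leb]_(t in `[0, 1]) PhiI1 eta j y t)
   ((4 * pi)^-1 * \int[leb]_(t in `[0, 1]) PhiI2 eta i j x t).
  by apply: is_derive_eq; rewrite /GRing.scale /=.
by have [_ ->] := H2.
Unshelve. all: by end_near. Qed.

End Derivatives.
End ElasticKernel.

Section SigmaFinitePlane.
Context {R : realType}.
Let m := (@lebesgue_measure R).
(** [leb2] is a constant of its own; the measure structure of the product is transferred to it so
    that Fubini's theorem in a further variable and the Radon-Nikodym theorem apply. *)
Lemma sigma_finite_leb2 : sigma_finite setT (@leb2 R).
Proof.
have /sigma_finiteP[F [TF ndF Foo]] := sigma_finiteT m.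
exists (fun n => F n `*` F n).
  rewrite -setXTT TF predeqE => -[x y]; split.
    move=> [/= [n _ Fnx] [k _ Gky]]; exists (maxn n k) => //; split.
    - by move: x Fnx; exact/subsetPset/ndF/leq_maxl.
    - by move: y Gky; exact/subsetPset/ndF/leq_maxr.
  by move=> [n _ []/= ? ?]; split; exists n.
move=> k; have [? ?] := Foo k.
split; first exact: measurableX.
by rewrite /leb2 product_measure1E// lte_mul_pinfty// ge0_fin_numE.
Qed.
HB.instance Definition _ := Measure.copy (@leb2 R) (m \x m)%E.
HB.instance Definition _ := Measure_isSigmaFinite.Build _ _ _ (@leb2 R) sigma_finite_leb2.
End SigmaFinitePlane.

Lemma integrable_cstM {d} {T : measurableType d} {R : realType} (m : {measure set T -> \bar R})
  (A : set T) (k : R) (f : T -> R) : measurable A -> m.-integrable A (EFin \o f) ->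
  m.-integrable A (EFin \o (fun x => k * f x)).
Proof. by move=> mA /(integrableZl mA k); apply: eq_integrable => // x _ /=; rewrite EFinM. Qed.

Section KernelProperties.
Context {R : realType}.
Notation V3 := 'rV[R]_3.
Notation mu2 := (@leb2 R).
Notation D := (@param_rect R).
Variables lam mu : R.
Hypotheses (mu0 : 0 < mu) (lm0 : 0 < 2 * mu + lam).
Notation al := (alpha_c lam mu).
Notation be := (beta_c lam mu).
Notation leb := (@lebesgue_measure R).

Lemma itv01P (t : R) : `[0, 1]%classic t -> 0 <= t <= 1. Proof. by rewrite /= in_itv. Qed.

(** Combine [1 - t <= |t x - eta|] and [|x - eta| <= |t x - eta| + (1 - t)] with weights 3/4 and
    1/4. *)
Lemma ray_dist_ge (x eta : V3) (t : R) : enorm3 eta = 1 -> enorm3 x < 1 -> 0 <= t <= 1 ->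
  (enorm3 (x - eta) / 2 + 1 - t) / 2 <= enorm3 (t *: x - eta).
Proof.
move=> e1 x1 /andP[t0 t1].
have h1 : 1 - t <= enorm3 (t *: x - eta).
  have := enorm3_sub_ge eta (t *: x); rewrite enorm3_distC e1.
  have : enorm3 (t *: x) <= t by rewrite enorm3Z ger0_norm// ler_piMr// ltW.
  lra.
have h2 : enorm3 (x - eta) <= enorm3 (t *: x - eta) + (1 - t).
  rewrite (_ : x - eta = (t *: x - eta) + (1 - t) *: x); last first.
    by apply/rowP => i; rewrite !mxE; ring.
  apply: (le_trans (enorm3D _ _)); rewrite lerD2l enorm3Z ger0_norm ?subr_ge0//.
  by rewrite ler_piMr ?subr_ge0// ltW.
by move: h1 h2; clear; set u := enorm3 _; set v := enorm3 _; lra.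
Qed.

(** Integrating along the ray gains one power of the distance; the antiderivative gives [8/3 N^-3],
    rounded up. *)
Lemma integral_pow4 (N : R) : 0 < N ->
  \int[leb]_(t in `[0, 1]) ((N / 2 + 1 - t)^-1 ^+ 4) <= 3 * N^-1 ^+ 3.
Proof.
move=> N0.
have pos (t : R) : 0 <= t <= 1 -> N / 2 + 1 - t != 0 by case/andP=> _ t1; rewrite gt_eqF//; lra.
have dV (t : R) : 0 <= t <= 1 -> is_derive t (1 : R) (fun t : R => (N / 2 + 1 - t)^-1) ((N / 2 + 1 - t)^-1 ^+ 2).
  move=> t01.
  have d1 : is_derive t (1 : R) (fun t : R => N / 2 + 1 - t) (- 1).
    by apply: is_derive_eq; rewrite /GRing.scale /=; ring.
  have d2 := @is_deriveV _ (fun t : R => N / 2 + 1 - t) t _ 1 (pos t t01) d1.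
  by apply: is_derive_eq; rewrite /GRing.scale /= -exprVn; ring.
have dF (t : R) : 0 <= t <= 1 ->
    is_derive t (1 : R) (fun t : R => 3^-1 * (N / 2 + 1 - t)^-1 ^+ 3) ((N / 2 + 1 - t)^-1 ^+ 4).
  move=> t01; have := dV t t01 => d; apply: is_derive_eq; rewrite /GRing.scale /=.
  by move: (N / 2 + 1 - t) (pos t t01) => q q0; field.
have cF (t : R) : 0 <= t <= 1 -> {for t, continuous (fun t : R => (N / 2 + 1 - t)^-1 ^+ 4)}.
  move=> t01; have := dV t t01 => d.
  by apply/differentiable_continuous/derivable1_diffP; exact: ex_derive.
rewrite (FTC_cc ltr01 dF cF).
rewrite addrK invfM invrK !exprMn subr0.
have : 0 <= 3^-1 * (N / 2 + 1)^-1 ^+ 3 by rewrite mulr_ge0// exprn_ge0// invr_ge0; lra.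
have : 0 <= N^-1 ^+ 3 by rewrite exprn_ge0// invr_ge0 ltW.
set u := N^-1 ^+ 3; set v := 3^-1 * (N / 2 + 1)^-1 ^+ 3; clear.
by rewrite (_ : 2 ^+ 3 = 8); last ring; lra.
Qed.

Lemma LkerE (x eta : V3) i j : enorm3 eta = 1 -> enorm3 x < 1 ->
  Lker lam mu x eta i j = be * (1 - enorm3 x ^+ 2) *
    ((4 * pi)^-1 * \int[leb]_(t in `[0, 1]) PhiI2 lam mu eta i j x t).
Proof. by move=> e1 x1; rewrite /Lker partial_Phi. Qed.

Lemma PkerE (x eta : V3) : Pker x eta = (4 * pi)^-1 * P0 eta x.
Proof. by rewrite /Pker /P0 /rho exprVn -enorm3_sq mulrA. Qed.

Lemma fourpi_inv : 0 < (4 * pi : R)^-1 <= 1.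
Proof.
have := pi_ge2 R => p2.
by rewrite invr_gt0 invf_le1 ?mulr_gt0 ?pi_gt0//=; lra.
Qed.

(** Second derivatives of [P0] have size [|t x - eta|^-4], and integration in [t] brings them back
    to [|x - eta|^-3], the size of the Poisson kernel. The constant is 52 from [P2_le], 16 = 2^4
    from the halving in [ray_dist_ge], and 3 from [integral_pow4]. *)
Lemma Lker_bound : exists2 C : R, 0 <= C & forall (x eta : V3) i j,
  enorm3 eta = 1 -> enorm3 x < 1 -> `|Lker lam mu x eta i j| <= C * ((1 - enorm3 x ^+ 2) * rho eta x ^+ 3).
Proof.
have /andP[pp p1] := fourpi_inv.
exists (`|be| * (52 * 16 * 3)) => [|x eta i j e1 x1]; first by do !apply: mulr_ge0.
have xe := ball3_neq e1 x1.
have r0 := rho_gt0 xe; set N := enorm3 (x - eta); have N0 : 0 < N by rewrite -invr_gt0.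
have q0 : 0 <= 1 - enorm3 x ^+ 2 by rewrite subr_ge0 expr_le1 ?enorm3_ge0// ltW.
rewrite LkerE// 2!normrM (ger0_norm q0).
have mI : measurable (`[0, 1]%classic : set R) by exact: measurable_itv.
have c1 : (enorm3 x + 1) / 2 < 1 by lra.
have xc : enorm3 x <= (enorm3 x + 1) / 2 by lra.
have [_ _ m2] := measurable_PhiI lam mu eta x i j.
have i2 : leb.-integrable `[0, 1] (EFin \o PhiI2 lam mu eta i j x).
  apply: (@integrable_bnd _ _ _ _ _ _ (Kc ((enorm3 x + 1) / 2))) => //.
  - exact: leb_cc_fin.
  - exact: measurable_funTS.
  - by move=> t /itv01P t01; exact: PhiI2_bnd.
have tpos (t : R) : 0 <= t <= 1 -> 0 < N / 2 + 1 - t by case/andP=> _ t1; lra.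
have mq : measurable_fun setT (fun t : R => (N / 2 + 1 - t)^-1 ^+ 4).
  apply: measurable_funX; apply: measurableT_comp; first exact: measurable_inv.
  exact: measurable_funB.
have i4 : leb.-integrable `[0, 1] (EFin \o (fun t : R => (N / 2 + 1 - t)^-1 ^+ 4)).
  apply: (@integrable_bnd _ _ _ _ _ _ ((N / 2)^-1 ^+ 4)) => //.
  - exact: leb_cc_fin.
  - exact: measurable_funTS.
  - move=> t /itv01P t01; have h := tpos t t01; rewrite ger0_norm ?exprn_ge0 ?invr_ge0 ?(ltW h)//.
    rewrite lerXn2r ?nnegrE ?invr_ge0 ?(ltW h)// ?divr_ge0 ?(ltW N0)// lef_pV2 ?posrE ?divr_gt0//.
    by case/andP: t01 => _ t1; lra.
have B : `|\int[leb]_(t in `[0, 1]) PhiI2 lam mu eta i j x t| <= 52 * 16 * (3 * N^-1 ^+ 3).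
  have LN : `|\int[leb]_(t in `[0, 1]) PhiI2 lam mu eta i j x t| <= \int[leb]_(t in `[0, 1]) `|PhiI2 lam mu eta i j x t|.
    exact: le_normr_Rintegral.
  apply: (le_trans LN).
  apply: (@le_trans _ _ (\int[leb]_(t in `[0, 1]) (52 * 16 * ((N / 2 + 1 - t)^-1 ^+ 4)))); last first.
    by rewrite RintegralZl// ler_wpM2l ?mulr_ge0// integral_pow4.
  apply: le_Rintegral => //.
  - exact: integrable_norm i2.
  - exact: integrable_cstM.
  - move=> t /itv01P t01; rewrite /PhiI2 normrM -[leRHS]mul1r; apply: ler_pM => //.
      exact: powR_le1.
    have tx1 : enorm3 (t *: x) < 1 by exact: le_lt_trans (enorm3_scale_le t01 (lexx _)) x1.
    apply: (le_trans (P2_le i j e1 tx1)); rewrite -mulrA ler_wpM2l//.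
    have h := tpos t t01; have g := ray_dist_ge e1 x1 t01.
    rewrite (_ : 16 = 2 ^+ 4); last by ring.
    rewrite -exprMn lerXn2r ?nnegrE ?mulr_ge0 ?invr_ge0 ?enorm3_ge0 ?(ltW h)//.
    have k2 : 2 * (N / 2 + 1 - t)^-1 = ((N / 2 + 1 - t) / 2)^-1 by rewrite invfM invrK mulrC.
    have u0 : 0 < (N / 2 + 1 - t) / 2 by rewrite divr_gt0.
    rewrite k2 /rho lef_pV2 ?posrE ?(lt_le_trans u0 g)//.
rewrite (normrM (4 * pi)^-1) (gtr0_norm pp).
apply: (@le_trans _ _ (`|be| * (1 - enorm3 x ^+ 2) * (52 * 16 * (3 * N^-1 ^+ 3)))).
  apply: ler_wpM2l; first exact: mulr_ge0.
  apply: le_trans B; rewrite ler_piMl//.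
by rewrite /rho -/N le_eqVlt; apply/orP; left; apply/eqP; ring.
Qed.

Lemma Pe_bound : exists2 C : R, 0 <= C & forall (x eta : V3) i j,
  enorm3 eta = 1 -> enorm3 x < 1 -> `|Pe lam mu x eta i j| <= C * ((1 - enorm3 x ^+ 2) * rho eta x ^+ 3).
Proof.
have /andP[pp p1] := fourpi_inv.
have [C C0 HC] := Lker_bound; exists (1 + C) => [|x eta i j e1 x1]; first by rewrite addr_ge0.
have q0 : 0 <= 1 - enorm3 x ^+ 2 by rewrite subr_ge0 expr_le1 ?enorm3_ge0// ltW.
have r0 := ltW (rho_gt0 (ball3_neq e1 x1)).
have w0 : 0 <= (1 - enorm3 x ^+ 2) * rho eta x ^+ 3 by rewrite mulr_ge0// exprn_ge0.
rewrite /Pe mxE PkerE; apply: (le_trans (ler_normD _ _)); rewrite [leRHS]mulrDl.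
apply: lerD (HC x eta i j e1 x1).
rewrite /P0 -enorm3_sq 2!normrM (ger0_norm w0) (gtr0_norm pp) mul1r.
case: (i == j); rewrite ?normr1 ?normr0 ?mul0r// mul1r ler_piMl//.
Qed.

(** Continuity in the boundary point gives measurability here, and small oscillation on fine cells
    in the h^1 theorem. *)
Lemma cvg_Pe (x : V3) i j : enorm3 x < 1 -> continuous (fun p : R * R => Pe lam mu x (sph p) i j).
Proof.
move=> x1 p.
have -> : (fun p : R * R => Pe lam mu x (sph p) i j) = fun p : R * R =>
    (i == j)%:R * ((4 * pi)^-1 * P0 (sph p) x) + be * (1 - enorm3 x ^+ 2) *
    ((4 * pi)^-1 * \int[leb]_(t in `[0, 1]) PhiI2 lam mu (sph p) i j x t).
  by apply/funext => q; rewrite /Pe mxE PkerE LkerE// enorm3_sph.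
have cs : (fun q : R * R => sph q) @ p --> sph p by exact: continuous_sph.
have ck (k : V3) : (fun=> k) @ nbhs p --> k by exact: cvg_cst.
have ckR (k : R) : (fun=> k) @ nbhs p --> k by exact: cvg_cst.
have c1 : (enorm3 x + 1) / 2 < 1 by lra.
have xc : enorm3 x <= (enorm3 x + 1) / 2 by lra.
apply: cvgD.
  apply: cvgM => //; apply: cvgM => //; apply: cvg_P0 => //.
  by apply: ball3_neq; rewrite ?enorm3_sph.
apply: cvgM => //; apply: cvgM => //.
apply: (@continuous_Rintegral _ _ _ leb `[0, 1]%classic _ _ _
   (fun q : R * R => PhiI2 lam mu (sph q) i j x) p (Kc ((enorm3 x + 1) / 2))).
- exact: measurable_itv.
- exact: leb_cc_fin.
- near=> q; split; first by apply: measurable_funTS; have [] := measurable_PhiI lam mu (sph q) x i j.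
  by move=> t /itv01P t01; apply: PhiI2_bnd => //; exact: enorm3_sph.
- move=> t /itv01P t01; apply: cvgM => //; apply: cvg_P2 => //.
  apply: ball3_neq; rewrite ?enorm3_sph//.
  exact: le_lt_trans (enorm3_scale_le t01 (lexx _)) x1.
Unshelve. all: by end_near. Qed.

Lemma measurable_Pe (x : V3) i j : enorm3 x < 1 ->
  measurable_fun setT (fun p : R * R => Pe lam mu x (sph p) i j).
Proof. by move=> x1; apply: continuous_measurable2; exact: cvg_Pe. Qed.

(** Fubini's theorem; for fixed [x] in the ball all the points [t x] keep their distance from the
    sphere, so the integrand is bounded. *)
Lemma sint_PhiI2 (x : V3) i j (g : V3 -> R) (M : R) : enorm3 x < 1 ->
  measurable_fun setT (fun p : R * R => g (sph p)) -> (forall p : R * R, `|g (sph p)| <= M) ->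
  sint (fun eta => (\int[leb]_(t in `[0, 1]) PhiI2 lam mu eta i j x t) * g eta) =
  \int[leb]_(t in `[0, 1]) (t `^ (1 - al) * sint (fun eta => P2 eta i j (t *: x) * g eta)).
Proof.
move=> x1 mg gM.
have c1 : (enorm3 x + 1) / 2 < 1 by lra.
have xc : enorm3 x <= (enorm3 x + 1) / 2 by lra.
have mI : measurable (`[0, 1]%classic : set R) by exact: measurable_itv.
have mD := @measurable_param_rect R.
set c := (_ + 1) / 2 in c1 xc.
have M0 : 0 <= M by exact: le_trans (normr_ge0 _) (gM (0, 0)).
have mY k : measurable_fun setT (fun q : (R * R) * R => (q.2 *: x) 0 k).
  rewrite (_ : (fun q => _) = (fun q : (R * R) * R => q.2 * x 0 k)); last by apply/funext => q; rewrite mxE.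
  exact: measurable_funM.
have mE k : measurable_fun setT (fun q : (R * R) * R => sph q.1 0 k).
  by apply: (measurableT_comp (@measurable_sph R k)).
have [_ _ mP2] := @measurable_P _ _ _ (fun q : (R * R) * R => sph q.1) (fun q => q.2 *: x) i j mE mY.
have mj : measurable_fun setT (fun q : (R * R) * R => sigma_jac q.1).
  by apply: (measurableT_comp (@measurable_jac R)).
have mg' : measurable_fun setT (fun q : (R * R) * R => g (sph q.1)).
  by apply: (measurableT_comp mg).
have mp : measurable_fun setT (fun q : (R * R) * R => q.2 `^ (1 - al)).
  by apply: (measurableT_comp (@measurable_powR R _)).
pose f (q : (R * R) * R) := q.2 `^ (1 - al) * (P2 (sph q.1) i j (q.2 *: x) * g (sph q.1) * sigma_jac q.1).
have mf : measurable_fun setT f.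
  by apply: measurable_funM => //; apply: measurable_funM => //; exact: measurable_funM.
have P2b p (t : R) : 0 <= t <= 1 -> `|P2 (sph p) i j (t *: x) * g (sph p)| <= Kc c * M.
  move=> t01; rewrite normrM; apply: ler_pM => //.
  exact: (P2_le_c i j (enorm3_sph p) (enorm3_scale_le t01 xc) c1).
have P2b' p (t : R) : 0 <= t <= 1 -> `|P2 (sph p) i j (t *: x) * g (sph p) * sigma_jac p| <= Kc c * M.
  move=> t01; rewrite normrM -[leRHS]mulr1; apply: ler_pM => //; last exact: sigma_jac_bnd.
  exact: P2b.
have fC p t : D p -> `[0, 1]%classic t -> `|f (p, t)| <= 1 * (Kc c * M).
  move=> _ /itv01P t01; rewrite /f normrM; apply: ler_pM => //; last exact: P2b'.
  exact: powR_le1.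
have [E1 E2] := @Rintegral_prod R _ _ _ _ mu2 leb D `[0, 1]%classic f _ mD mI leb2_param_rect (leb_cc_fin 0 1) mf fC.
transitivity (\int[mu2]_(p in D) \int[leb]_(t in `[0, 1]) f (p, t)).
  apply: eq_Rintegral => p _; rewrite /f /= -mulrA mulrC -RintegralZl//; last first.
    have [_ _ m2] := measurable_PhiI lam mu (sph p) x i j.
    apply: (@integrable_bnd _ _ _ _ _ _ (Kc c)) => //; first exact: leb_cc_fin.
      exact: measurable_funTS.
    by move=> t /itv01P t01; apply: PhiI2_bnd => //; exact: enorm3_sph.
  by apply: eq_Rintegral => t _; rewrite /PhiI2; ring.
rewrite -E1 E2; apply: eq_Rintegral => t; rewrite inE => /itv01P t01.
rewrite /f /= RintegralZl//.
apply: (@integrable_bnd _ _ _ _ _ _ (Kc c * M)) => //; first exact: leb2_param_rect.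
  apply: measurable_funTS; apply: measurable_funM; last exact: measurable_jac.
  apply: measurable_funM => //.
  by have [_ _] := @measurable_P _ _ _ (fun q : R * R => sph q) (fun q => t *: x) i j measurable_sph (fun k => measurable_cst _).
by move=> p _; exact: P2b'.
Qed.

Lemma integrable_sint (g : R * R -> R) (C : R) : measurable_fun setT g -> (forall p, `|g p| <= C) ->
  mu2.-integrable D (EFin \o (fun p => g p * sigma_jac p)).
Proof.
move=> mg gC; have mD := @measurable_param_rect R.
apply: (@integrable_bnd _ _ _ _ _ _ (C * 1)) => //; first exact: leb2_param_rect.
  by apply: measurable_funTS; apply: measurable_funM => //; exact: measurable_jac.
by move=> p _; rewrite normrM; apply: ler_pM => //; exact: sigma_jac_bnd.
Qed.

(** With the integral over [t] outside, the L-part is a mean along the ray of second derivatives of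
    Poisson integrals. Both the total integral of the kernel and the representation formula start
    from this form. *)
Lemma sint_Pe_split (x : V3) i j (g : V3 -> R) (M : R) : enorm3 x < 1 ->
  measurable_fun setT (fun p : R * R => g (sph p)) -> (forall p : R * R, `|g (sph p)| <= M) ->
  sint (fun eta => Pe lam mu x eta i j * g eta) =
  (4 * pi)^-1 * ((i == j)%:R * sint (fun eta => P0 eta x * g eta) +
    be * (1 - enorm3 x ^+ 2) * \int[leb]_(t in `[0, 1]) (t `^ (1 - al) * sint (fun eta => P2 eta i j (t *: x) * g eta))).
Proof.
move=> x1 mg gM; have mD := @measurable_param_rect R.
have c1 : (enorm3 x + 1) / 2 < 1 by lra.
have xc : enorm3 x <= (enorm3 x + 1) / 2 by lra.
set c := (_ + 1) / 2 in c1 xc.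
have mI : measurable (`[0, 1]%classic : set R) by exact: measurable_itv.
rewrite -(sint_PhiI2 i j x1 mg gM).
have M0 : 0 <= M by exact: le_trans (normr_ge0 _) (gM (0, 0)).
have mL : measurable_fun setT (fun p : R * R => \int[leb]_(t in `[0, 1]) PhiI2 lam mu (sph p) i j x t).
  apply: continuous_measurable2 => p.
  apply: (@continuous_Rintegral _ _ _ leb `[0, 1]%classic _ _ _
     (fun q : R * R => PhiI2 lam mu (sph q) i j x) p (Kc ((enorm3 x + 1) / 2))) => //.
  - exact: leb_cc_fin.
  - near=> q; split; first by apply: measurable_funTS; have [] := measurable_PhiI lam mu (sph q) x i j.
    by move=> t /itv01P t01; apply: PhiI2_bnd => //; exact: enorm3_sph.
  - move=> t /itv01P t01; apply: cvgM => //; first exact: cvg_cst.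
    apply: cvg_P2 => //; [exact: continuous_sph|exact: cvg_cst|].
    apply: ball3_neq; rewrite ?enorm3_sph//.
    exact: le_lt_trans (enorm3_scale_le t01 (lexx _)) x1.
have bL p : `|\int[leb]_(t in `[0, 1]) PhiI2 lam mu (sph p) i j x t| <= Kc c * fine (leb `[0, 1]%classic).
  apply: le_Rintegral_bnd => //; first exact: leb_cc_fin.
    by apply: measurable_funTS; have [] := measurable_PhiI lam mu (sph p) x i j.
  by move=> t /itv01P t01; apply: PhiI2_bnd => //; exact: enorm3_sph.
have [mP _ _] := @measurable_P _ _ _ (fun q : R * R => sph q) (fun q => x) i j measurable_sph (fun k => measurable_cst _).
have bP p : `|P0 (sph p) x| <= 10 * (1 - c)^-1 ^+ 5 by have [] := P01_le i (enorm3_sph p) xc c1.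
have norm_mul_le (u v A B : R) : `|u| <= A -> `|v| <= B -> `|u * v| <= A * B.
  by move=> h1 h2; rewrite normrM ler_pM.
have iP : mu2.-integrable D (EFin \o (fun p => P0 (sph p) x * g (sph p) * sigma_jac p)).
  apply: (@integrable_sint (fun p : R * R => P0 (sph p) x * g (sph p)) (10 * (1 - c)^-1 ^+ 5 * M)).
    exact: measurable_funM.
  by move=> p; exact: norm_mul_le.
have iL : mu2.-integrable D (EFin \o (fun p =>
    (\int[leb]_(t in `[0, 1]) PhiI2 lam mu (sph p) i j x t) * g (sph p) * sigma_jac p)).
  apply: (@integrable_sint (fun p : R * R => (\int[leb]_(t in `[0, 1]) PhiI2 lam mu (sph p) i j x t) * g (sph p))
     (Kc c * fine (leb `[0, 1]%classic) * M)).
    exact: measurable_funM.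
  by move=> p; exact: norm_mul_le.
set q := be * (1 - enorm3 x ^+ 2); set pf := (4 * pi)^-1.
pose F (p : R * R) := P0 (sph p) x * g (sph p) * sigma_jac p.
pose G (p : R * R) := (\int[leb]_(t in `[0, 1]) PhiI2 lam mu (sph p) i j x t) * g (sph p) * sigma_jac p.
have iF : mu2.-integrable D (EFin \o F) by exact: iP.
have iG : mu2.-integrable D (EFin \o G) by exact: iL.
transitivity (Rintegral mu2 D (fun p => (pf * (i == j)%:R) * F p + (pf * q) * G p)).
  apply: eq_Rintegral => p _; rewrite /Pe mxE PkerE LkerE ?enorm3_sph// -/q -/pf /F /G.
  by rewrite mulrDl mulrDl; congr (_ + _); ring.
rewrite RintegralD//; [|exact: integrable_cstM|exact: integrable_cstM].
rewrite !RintegralZl//; rewrite /sint -/F -/G; ring.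
Unshelve. all: by end_near. Qed.

Lemma sint_Pe (x : V3) i j : enorm3 x < 1 ->
  sint (fun eta => Pe lam mu x eta i j) = (i == j)%:R.
Proof.
move=> x1.
have n1 (p : R * R) : `|(1 : R)| <= 1 by rewrite normr1.
have := @sint_Pe_split x i j (fun=> 1) 1 x1 (measurable_cst _) n1.
rewrite (_ : (fun eta => P0 eta x * 1) = (fun eta => P0 eta x)); last by apply/funext => e; rewrite mulr1.
rewrite (_ : (fun eta => Pe lam mu x eta i j * 1) = (fun eta => Pe lam mu x eta i j)); last by apply/funext => e; rewrite mulr1.
move=> ->; rewrite sint_P0//.
rewrite (_ : \int[leb]_(t in `[0, 1]) _ = 0); last first.
  transitivity (\int[leb]_(t in `[0, 1]) (cst 0 : R -> R) t); last by rewrite Rintegral_cst ?mul0r//; exact: measurable_itv.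
  apply: eq_Rintegral => t; rewrite inE => /itv01P t01.
  rewrite (_ : (fun eta => P2 eta i j (t *: x) * 1) = (fun eta => P2 eta i j (t *: x))); last by apply/funext => e; rewrite mulr1.
  by rewrite sint_P2 ?mulr0//; exact: le_lt_trans (enorm3_scale_le t01 (lexx _)) x1.
have p0 : (4 * pi : R) != 0 by rewrite gt_eqF// mulr_gt0// pi_gt0.
by rewrite mulr0 addr0 mulrCA mulVf ?mulr1.
Qed.
End KernelProperties.

(** * Non-tangential limits of Poisson integrals *)

Section Geometry.
Context {R : realType}.
Notation V3 := 'rV[R]_3.
Notation mu2 := (@leb2 R).
Notation D := (@param_rect R).

(** Up to 1/2 the mean value theorem bounds [sin v / v] below by a value of the cosine; beyond, the
    sine has a positive minimum on a compact part of []0, pi[]. *)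
Lemma sin_lower (m : R) : 0 < m -> m < pi ->
  exists2 k : R, 0 < k & forall v, `|v| <= m -> k * `|v| <= `|sin v|.
Proof.
move=> m0 mpi; have pi2 := pi_ge2 R; have pi0 := pi_gt0 R.
have ccos : {within `[0, 1 / 2], continuous (@cos R)} by apply: continuous_subspaceT; exact: continuous_cos.
have [c1] := @EVT_min R _ 0 (1 / 2) ltac:(lra) ccos; rewrite in_itv /= => /andP[c10 c11] H1.
pose M := Num.max m (1 / 2).
have hM : 1 / 2 <= M by rewrite le_max lexx orbT.
have Mpi : M < pi by rewrite gt_max mpi; lra.
have csin : {within `[1 / 2, M], continuous (@sin R)} by apply: continuous_subspaceT; exact: continuous_sin.
have [c2] := @EVT_min R _ (1 / 2) M hM csin; rewrite in_itv /= => /andP[c20 c21] H2.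
have k1 : 0 < cos c1 by apply: cos_gt0_pihalf; lra.
have k2 : 0 < sin c2 by apply: sin_gt0_pi; lra.
exists (Num.min (cos c1) (sin c2 / pi)); first by rewrite lt_min k1 divr_gt0.
have pos v : 0 <= v -> v <= m -> Num.min (cos c1) (sin c2 / pi) * v <= sin v.
  move=> v0 vm; have [vh|vh] := leP v (1 / 2).
    have cs : {within `[0, v], continuous (@sin R)} by apply: continuous_subspaceT; exact: continuous_sin.
    have [x] := @MVT_segment R sin cos 0 v v0 (fun x _ => is_derive_sin x) cs.
    rewrite in_itv /= sin0 !subr0 => /andP[x0 xv] ->.
    rewrite ler_wpM2r// ge_min H1// in_itv /= x0; lra.
  apply: (@le_trans _ _ (sin c2 / pi * v)); first by rewrite ler_wpM2r// ge_min lexx orbT.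
  apply: (@le_trans _ _ (sin c2)).
    rewrite mulrAC ler_pdivrMr// ler_pM2l//; lra.
  by apply: H2; rewrite in_itv /= (ltW vh) le_max vm.
move=> v vm; have [v0|v0] := leP 0 v.
  rewrite ger0_norm//; apply: (le_trans (pos v v0 _)); last exact: ler_norm.
  by rewrite -(ger0_norm v0).
rewrite ltr0_norm//; have h := pos (- v) _ _; rewrite -normrN -sinN; apply: (le_trans (h _ _)).
- by rewrite oppr_ge0 ltW.
- by rewrite -ltr0_norm.
- exact: ler_norm.
Qed.

(** The half-angle form separates the two coordinates into nonnegative terms, which can be bounded
    below one at a time. *)
Lemma sph_dist_sq (p q : R * R) : enorm3 (sph q - sph p) ^+ 2 =
  4 * sin ((q.1 - p.1) / 2) ^+ 2 + 4 * (sin p.1 * sin q.1) * sin ((q.2 - p.2) / 2) ^+ 2.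
Proof.
have h (u : R) : 2 * sin (u / 2) ^+ 2 = 1 - cos u.
  have -> : cos u = cos (u / 2 + u / 2) by congr cos; field.
  by rewrite cosD -!expr2 cos2sin2; ring.
have -> : forall a b c : R, 4 * a + 4 * b * c = 2 * (2 * a) + 2 * b * (2 * c) by move=> *; ring.
rewrite !h !cosB enorm3_sq.
have -> : dot3 (sph q - sph p) (sph q - sph p) = dot3 (sph q) (sph q) + dot3 (sph p) (sph p) - 2 * dot3 (sph q) (sph p).
  by rewrite !dot3E ![(sph q - sph p) _ _]mxE ![(- sph p) _ _]mxE; ring.
rewrite -!enorm3_sq !enorm3_sph dot3E !sph_coord0 !sph_coord1 !sph_coord2; ring.
Qed.

(** The constant depends on [p]: the chart degenerates at the poles and identifies the sides of
    longitude 0 and [2 pi], but an interior point stays away from both. *)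
Lemma sph_dist_ge (p : R * R) : D p -> exists2 c : R, 0 < c &
  forall q, 0 <= q.1 <= pi -> 0 <= q.2 <= 2 * pi -> c * supdist p q <= enorm3 (sph q - sph p).
Proof.
case=> /andP[p10 p1p] /andP[p20 p2p]; have pi2 := pi_ge2 R; have pi0 := pi_gt0 R.
have s0 : 0 < sin p.1 by apply: sin_gt0_pi; rewrite p10.
(* Within [dl] of [p.1] the colatitude keeps away from the poles; farther off, the difference in
   colatitude alone will suffice. *)
pose dl := Num.min p.1 (pi - p.1) / 2.
have dl0 : 0 < dl by rewrite divr_gt0// lt_min p10 subr_gt0.
have dl1 : dl * 2 <= p.1 by rewrite /dl divfK// ge_min lexx.
have dl2 : dl * 2 <= pi - p.1 by rewrite /dl divfK// ge_min lexx orbT.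
have [k1 k10 H1] := @sin_lower (pi / 2) ltac:(lra) ltac:(lra).
(* Half of the largest possible difference in longitude, below [pi] because [p] is off the seam. *)
pose m2 := Num.max p.2 (2 * pi - p.2) / 2.
have m20 : 0 < m2 by rewrite divr_gt0// lt_max p20.
have m2p : m2 < pi by rewrite ltr_pdivrMr// gt_max; lra.
have m2a : p.2 <= m2 * 2 by rewrite /m2 divfK// le_max lexx.
have m2b : 2 * pi - p.2 <= m2 * 2 by rewrite /m2 divfK// le_max lexx orbT.
have [k2 k20 H2] := @sin_lower m2 m20 m2p.
have csin : {within `[p.1 - dl, p.1 + dl], continuous (@sin R)} by apply: continuous_subspaceT; exact: continuous_sin.
have [c3] := @EVT_min R _ (p.1 - dl) (p.1 + dl) ltac:(lra) csin; rewrite in_itv /= => /andP[c30 c31] H3.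
have s3 : 0 < sin c3 by apply: sin_gt0_pi; lra.
have ss : 0 < sin p.1 * sin c3 by exact: mulr_gt0.
pose e := Num.min k1 (Num.min (Num.sqrt (sin p.1 * sin c3) * k2) (k1 * (dl / (2 * pi)))).
have e0 : 0 < e.
  rewrite 2!lt_min k10 /=; apply/andP; split; first by rewrite mulr_gt0 ?sqrtr_gt0.
  by rewrite mulr_gt0// divr_gt0// mulr_gt0.
exists e => // q /andP[q10 q1p] /andP[q20 q2p].
have sup0 : 0 <= supdist p q by rewrite le_max normr_ge0.
rewrite -(@ler_pXn2r _ 2)// ?nnegrE ?enorm3_ge0 ?mulr_ge0 ?(ltW e0)// sph_dist_sq.
set a := q.1 - p.1; set b := q.2 - p.2.
have na : `|a / 2| <= pi / 2 by rewrite normrM [`|2^-1|]gtr0_norm ?invr_gt0// ler_pM2r ?invr_gt0// ler_norml /a; lra.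
have nb : `|b / 2| <= m2 by rewrite normrM [`|2^-1|]gtr0_norm ?invr_gt0// ler_pdivrMr// ler_norml /b; lra.
have sqs (k v : R) : 0 <= k -> k * `|v| <= `|sin v| -> k ^+ 2 * v ^+ 2 <= sin v ^+ 2.
  move=> k0' h; rewrite -[v ^+ 2]real_normK ?num_real// -[sin v ^+ 2]real_normK ?num_real// -exprMn.
  by rewrite lerXn2r ?nnegrE ?mulr_ge0.
have A1 : k1 ^+ 2 * a ^+ 2 <= 4 * sin (a / 2) ^+ 2.
  have := sqs k1 (a / 2) (ltW k10) (H1 _ na); rewrite expr_div_n; set u := a ^+ 2; set w := sin _ ^+ 2.
  have -> : u / 2 ^+ 2 = u / 4 by congr (_ / _); ring.
  by set k := k1 ^+ 2; clear; lra.
have A2 : k2 ^+ 2 * b ^+ 2 <= 4 * sin (b / 2) ^+ 2.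
  have := sqs k2 (b / 2) (ltW k20) (H2 _ nb); rewrite expr_div_n; set u := b ^+ 2; set w := sin _ ^+ 2.
  have -> : u / 2 ^+ 2 = u / 4 by congr (_ / _); ring.
  by set k := k2 ^+ 2; clear; lra.
have sq0 : 0 <= sin q.1 by apply: sin_ge0_pi; rewrite q10.
have B0 : 0 <= 4 * (sin p.1 * sin q.1) * sin (b / 2) ^+ 2.
  by rewrite mulr_ge0 ?sqr_ge0// mulr_ge0// mulr_ge0// ltW.
have sqa : supdist p q ^+ 2 = Num.max (a ^+ 2) (b ^+ 2).
  rewrite /supdist -/a -/b; case: (leP `|a| `|b|) => h; rewrite real_normK ?num_real//.
    by rewrite max_r// -[a ^+ 2]real_normK ?num_real// -[b ^+ 2]real_normK ?num_real// lerXn2r ?nnegrE.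
  by rewrite max_l// -[a ^+ 2]real_normK ?num_real// -[b ^+ 2]real_normK ?num_real// lerXn2r ?nnegrE// ltW.
have [da|da] := leP `|a| dl.
  rewrite exprMn sqa maxr_pMr ?sqr_ge0// ge_max; apply/andP; split.
    apply: (@le_trans _ _ (k1 ^+ 2 * a ^+ 2)); last by apply: (le_trans A1); rewrite lerDl.
    by rewrite ler_wpM2r ?sqr_ge0// lerXn2r ?nnegrE ?(ltW e0) ?(ltW k10)// ge_min lexx.
  apply: (@le_trans _ _ (sin p.1 * sin c3 * (k2 ^+ 2 * b ^+ 2))).
    rewrite mulrA ler_wpM2r ?sqr_ge0//.
    rewrite -[sin p.1 * sin c3]sqr_sqrtr ?(ltW ss)// -exprMn.
    by rewrite lerXn2r ?nnegrE ?(ltW e0) ?mulr_ge0 ?sqrtr_ge0 ?(ltW k20)// !ge_min lexx orbT.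
  apply: (@le_trans _ _ (4 * (sin p.1 * sin q.1) * sin (b / 2) ^+ 2)); last by rewrite lerDr mulr_ge0 ?sqr_ge0.
  rewrite [4 * _]mulrC -[leRHS]mulrA; apply: ler_pM => //; first exact: ltW.
    by rewrite mulr_ge0 ?sqr_ge0.
  rewrite ler_pM2l//; apply: H3; rewrite in_itv /=.
  by move: da; rewrite ler_norml /a; lra.
(* Here the sine of [q.1] may vanish, but [|a| > dl] while the sup distance is at most [2 pi]; this
   is the third entry of [e]. *)
apply: (@le_trans _ _ (k1 ^+ 2 * a ^+ 2)); last by apply: (le_trans A1); rewrite lerDl.
rewrite -exprMn -[(k1 * a) ^+ 2]real_normK ?num_real// lerXn2r ?nnegrE ?mulr_ge0 ?(ltW e0)//.
rewrite normrM (gtr0_norm k10).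
have sup2 : supdist p q <= 2 * pi.
  by rewrite ge_max !ler_norml -/a -/b /a /b; lra.
apply: (@le_trans _ _ (k1 * (dl / (2 * pi)) * (2 * pi))).
  apply: ler_pM => //; first exact: ltW.
  by rewrite !ge_min lexx !orbT.
rewrite -mulrA divfK ?gt_eqF ?mulr_gt0// ler_pM2l//; exact: ltW.
Qed.

(** At parameter [t] of the segment the distance to [xi] is at most [3/2 (1 - t)] and the depth at
    least [(1 - t) / 2]. *)
Lemma Gamma_dist (xi x : V3) : enorm3 xi = 1 -> Gamma xi x -> enorm3 (x - xi) <= 3 * (1 - enorm3 x).
Proof.
move=> x1 [_ [t [y [/andP[t0 t1] [yh ->]]]]].
have e1 : enorm3 (t *: xi + (1 - t) *: y - xi) <= (1 - t) * (3 / 2).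
  rewrite (_ : _ - xi = (1 - t) *: (y - xi)); last by apply/rowP => i; rewrite !mxE; ring.
  rewrite enorm3Z ger0_norm ?subr_ge0// ler_wpM2l ?subr_ge0//.
  by have := enorm3B y xi; rewrite x1; lra.
have e2 : enorm3 (t *: xi + (1 - t) *: y) <= t + (1 - t) / 2.
  apply: (le_trans (enorm3D _ _)); rewrite !enorm3Z x1 mulr1 !ger0_norm ?subr_ge0// lerD2l.
  by rewrite ler_wpM2l ?subr_ge0//; lra.
by move: e1 e2; set u := enorm3 _; set v := enorm3 _; clear; lra.
Qed.

Variables lam mu : R.
Hypotheses (mu0 : 0 < mu) (lm0 : 0 < 2 * mu + lam).

Lemma Pe_nt_bound (p : R * R) : D p -> exists2 C : R, 0 <= C &
  forall x q i j, Gamma (sph p) x -> 0 <= q.1 <= pi -> 0 <= q.2 <= 2 * pi ->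
    `|Pe lam mu x (sph q) i j| <= C * pkernel (1 - enorm3 x) p q.
Proof.
move=> Dp; have [c c0 Hc] := sph_dist_ge Dp; have [C C0 HC] := @Pe_bound R lam mu mu0 lm0.
pose k := Num.min 1 (c / 4).
have k0 : 0 < k by rewrite lt_min ltr01 divr_gt0.
exists (C * (2 * k^-1 ^+ 3)); first by apply: mulr_ge0 => //; apply: mulr_ge0 => //; rewrite exprn_ge0// invr_ge0 ltW.
move=> x q i j Gx q1 q2.
have x1 : enorm3 x < 1 by case: Gx.
apply: (le_trans (HC x (sph q) i j (enorm3_sph q) x1)).
rewrite -[leRHS]mulrA ler_wpM2l// /pkernel.
set d := 1 - enorm3 x; set s := supdist p q; set N := enorm3 (x - sph q).
have d0 : 0 < d by rewrite subr_gt0.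
have N1 : d <= N by have := enorm3_sub_ge (sph q) x; rewrite enorm3_distC enorm3_sph -/N /d; lra.
have N2 : c * s <= 4 * N.
  have h1 := Gamma_dist (enorm3_sph p) Gx; have h2 := Hc q q1 q2.
  have h3 : enorm3 (sph q - sph p) <= N + enorm3 (x - sph p).
    rewrite (_ : sph q - sph p = (x - sph p) - (x - sph q)); last by rewrite opprB addrCA addrAC subrr add0r.
    by apply: (le_trans (enorm3B _ _)); rewrite addrC.
  rewrite -/d in h1; rewrite -/s in h2; move: h1 h2 h3 N1.
  by set u := enorm3 _; set v := enorm3 _; clear; lra.
have mx0 : 0 < Num.max d s by rewrite lt_max d0.
have NN : k * Num.max d s <= N.
  rewrite maxr_pMr ?(ltW k0)// ge_max; apply/andP; split.
    by apply: le_trans N1; rewrite ler_piMl ?(ltW d0)// ge_min lexx.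
  have s0 : 0 <= s by rewrite le_max normr_ge0.
  apply: (@le_trans _ _ (c / 4 * s)); first by rewrite ler_wpM2r// ge_min lexx orbT.
  by rewrite mulrAC ler_pdivrMr// mulrC [N * _]mulrC mulrC.
have N0 : 0 < N by exact: lt_le_trans d0 N1.
rewrite /rho -/N.
have h4 : 1 - enorm3 x ^+ 2 <= 2 * d.
  rewrite /d; have := enorm3_ge0 x; set u := enorm3 x; clear => u0.
  by have := sqr_ge0 (1 - u); rewrite sqrrB; lra.
rewrite (_ : 2 * k^-1 ^+ 3 * (d / Num.max d s ^+ 3) = 2 * d * (k * Num.max d s)^-1 ^+ 3); last first.
  by move: (Num.max d s) => M; rewrite [(k * M)^-1]invfM -(exprVn M 3); ring.
apply: ler_pM => //.
- by rewrite subr_ge0 expr_le1 ?enorm3_ge0// ltW.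
- by rewrite exprn_ge0// invr_ge0 ltW.
- rewrite lerXn2r ?nnegrE ?invr_ge0 ?(ltW N0) ?mulr_ge0 ?(ltW k0) ?(ltW mx0)//.
  by rewrite lef_pV2 ?posrE// mulr_gt0.
Qed.

Lemma nt_limitP (u : V3 -> V3) (xi l : V3) :
  (forall i (e : R), 0 < e -> exists2 dl : R, 0 < dl & forall x, Gamma xi x -> enorm3 (x - xi) < dl ->
     `|u x 0 i - l 0 i| <= e) -> nt_limit u xi l.
Proof.
move=> H; apply: cvg_rV => i; apply/cvgrPdist_le => e e0.
have [dl dl0 Hd] := H i e e0.
have : nbhs xi (fun x : V3 => enorm3 (x - xi) < dl).
  apply/nbhs_ballP; exists (dl / 2) => /=; first by rewrite divr_gt0.
  move=> x; rewrite -ball_normE /= => xd.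
  apply: (le_lt_trans (enorm3_le_norm _)); rewrite distrC in xd.
  by move: xd; set n := `|_|; clear; lra.
apply: filterS => x xd Gx; rewrite distrC; exact: Hd.
Qed.
End Geometry.

Section NontangentialL1.
Context {R : realType}.
Notation V3 := 'rV[R]_3.
Notation mu2 := (@leb2 R).
Notation D := (@param_rect R).
Variables lam mu : R.
Hypotheses (mu0 : 0 < mu) (lm0 : 0 < 2 * mu + lam).
Notation Q0 := (cell (pi : R) (2 * pi) 0 0 0).

Lemma twopi_gt0 : 0 < 2 * pi :> R. Proof. by rewrite mulr_gt0// pi_gt0. Qed.

Lemma param_rect_Q0 : D `<=` Q0.
Proof.
move=> q [/andP[h1 h2] /andP[h3 h4]]; apply/cell0P.
by rewrite (ltW h1) (ltW h3) h2 h4.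
Qed.

Lemma mQpi : measurable Q0. Proof. exact: measurable_cell. Qed.

Lemma leb2_Q0 : (mu2 Q0 < +oo)%E.
Proof. by have := @leb2_cell R pi (2 * pi) (pi_gt0 R) twopi_gt0 0 0 0 => K; rewrite [ltLHS]K ltry. Qed.

Lemma pkernel_le_inv2 (d : R) (p q : R * R) : 0 < d -> pkernel d p q <= d^-1 ^+ 2.
Proof.
move=> d0; have := @pkernel_le R d p q d d0 d0; rewrite le_max lexx => /(_ isT) h.
by apply: (le_trans h); rewrite le_eqVlt; apply/orP; left; apply/eqP; field; rewrite gt_eqF.
Qed.

Lemma integrable_mul_bnd {d} {T : measurableType d} (m : {measure set T -> \bar R}) (A : set T)
  (k f : T -> R) (K : R) : measurable A -> measurable_fun A k ->
  (forall q, A q -> `|k q| <= K) -> m.-integrable A (EFin \o f) ->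
  m.-integrable A (EFin \o (fun q => k q * f q)).
Proof.
move=> mA mk kK fi.
have mf : measurable_fun A f by have /integrableP[/measurable_EFinP] := fi.
apply: (@le_integrable _ _ _ m A mA _ (EFin \o (fun q => K * f q))).
- by apply/measurable_EFinP; exact: measurable_funM.
- move=> q Aq /=; rewrite lee_fin !normrM ler_wpM2r//.
  by apply: (le_trans (kK q Aq)); exact: ler_norm.
- exact: integrable_cstM.
Qed.

Lemma integrable_patch {d} {T : measurableType d} (m : {measure set T -> \bar R}) (A : set T)
  (f : T -> R) : measurable A -> m.-integrable A (EFin \o f) ->
  m.-integrable setT (EFin \o patch (cst 0) A f).
Proof.
move=> mA /(integrable_mkcond _ mA).
by apply: eq_integrable => // q _; rewrite /patch /=; case: ifP.
Qed.

Lemma integrable_subR {d} {T : measurableType d} (m : {measure set T -> \bar R}) (A : set T)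
  (f g : T -> R) : measurable A -> m.-integrable A (EFin \o f) -> m.-integrable A (EFin \o g) ->
  m.-integrable A (EFin \o (fun x => f x - g x)).
Proof. by move=> mA fi gi; have := integrableB mA fi gi; apply: eq_integrable => // x _ /=; rewrite EFinB. Qed.

Lemma integrable_Pe (p : R * R) (x : V3) i j (f : R * R -> R) : D p -> Gamma (sph p) x ->
  mu2.-integrable D (EFin \o f) ->
  mu2.-integrable D (EFin \o (fun q => Pe lam mu x (sph q) i j * f q)).
Proof.
move=> Dp Gx; have [C C0 HC] := @Pe_nt_bound R lam mu mu0 lm0 p Dp.
have x1 : enorm3 x < 1 by case: Gx.
apply: (@integrable_mul_bnd _ _ _ _ _ _ (C * (1 - enorm3 x)^-1 ^+ 2)).
- exact: measurable_param_rect.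
- by apply: measurable_funTS; exact: measurable_Pe.
- move=> q [/andP[h1 h2] /andP[h3 h4]]; apply: (le_trans (HC x q i j Gx _ _)).
  + by rewrite !ltW.
  + by rewrite !ltW.
  + by rewrite ler_wpM2l// pkernel_le_inv2// subr_gt0.
Qed.

Lemma Gamma_depth (xi x : V3) (dl : R) : enorm3 xi = 1 -> Gamma xi x -> enorm3 (x - xi) < dl ->
  0 < 1 - enorm3 x /\ 1 - enorm3 x < dl.
Proof.
move=> e1 [bx _] h; split; first by rewrite subr_gt0.
apply: le_lt_trans h; have := enorm3_sub_ge xi x.
by rewrite e1 enorm3_distC.
Qed.

(* The kernel has integral delta_ij against sin, so after subtracting h(p)/sin(p.1) * sin only the
   Lebesgue-point defect of h remains, and it is absorbed by [pkernel_lpoint]. *)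
Lemma Pe_lpoint (h : R * R -> R) (p : R * R) : measurable_fun setT h ->
  mu2.-integrable Q0 (EFin \o h) -> D p ->
  lpoint pi (2 * pi) h p -> lpoint pi (2 * pi) (@sigma_jac R) p ->
  forall (e : R), 0 < e -> exists2 dl : R, 0 < dl &
   forall x i j, Gamma (sph p) x -> enorm3 (x - sph p) < dl ->
    `|\int[mu2]_(q in D) (Pe lam mu x (sph q) i j * h q) - (i == j)%:R * (h p / sigma_jac p)| <= e.
Proof.
move=> mh ih Dp lh lj e e0.
have mD := @measurable_param_rect R.
have jp : 0 < sigma_jac p by exact: sigma_jac_gt0.
pose c := h p / sigma_jac p.
pose H q := `|h q - c * sigma_jac q|.
have mk : measurable_fun setT (fun q : R * R => h q - c * sigma_jac q).
  by apply: measurable_funB => //; apply: measurable_funM => //; exact: measurable_jac.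
have mH : measurable_fun setT H by exact: measurableT_comp.
have kp : h p - c * sigma_jac p = 0 by rewrite /c divfK ?subrr// gt_eqF.
have lk : lpoint pi (2 * pi) (fun q => h q - c * sigma_jac q) p.
  apply: (@lpoint_comb R pi (2 * pi) h (@sigma_jac R) _ p `|c|) => //; first exact: measurable_jac.
  move=> q; rewrite -normrM.
  rewrite (_ : h q - c * sigma_jac q - (h p - c * sigma_jac p) = (h q - h p) - c * (sigma_jac q - sigma_jac p)); last by ring.
  exact: ler_normB.
have iDh : mu2.-integrable D (EFin \o h) by apply: integrableS ih => //; [exact: mQpi|exact: param_rect_Q0].
have ijD : mu2.-integrable D (EFin \o (@sigma_jac R)).
  have := @integrable_sint R (fun=> 1) 1 (measurable_cst _) (fun _ => ltac:(by rewrite normr1)).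
  by under [X in EFin \o X]eq_fun do rewrite mul1r.
have ijQ : mu2.-integrable Q0 (EFin \o (@sigma_jac R)).
  apply: (@integrable_bnd _ _ _ _ _ _ 1) => //; first exact: mQpi.
  - exact: leb2_Q0.
  - by apply: measurable_funTS; exact: measurable_jac.
  - by move=> q _; exact: sigma_jac_bnd.
have ikQ : mu2.-integrable Q0 (EFin \o (fun q => h q - c * sigma_jac q)).
  have i2 : mu2.-integrable Q0 (EFin \o (fun q => c * sigma_jac q)).
    by apply: integrable_cstM => //; exact: mQpi.
  by apply: integrable_subR => //; exact: mQpi.
have iH : (\int[mu2]_(q in Q0) (H q)%:E < +oo)%E.
  by have /integrableP[_] := ikQ.
have HL (e' : R) : 0 < e' -> exists2 d : R, 0 < d & forall r, 0 < r -> r < d ->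
    (\int[mu2]_(q in bx p r `&` Q0) (H q)%:E <= (e' * r ^+ 2)%:E)%E.
  move=> e'0; have [d d0 Hd] := lk e' e'0; exists d => // r r0 rd.
  have := Hd r r0 rd; rewrite kp; under eq_integral do rewrite subr0; exact.
have [C C0 HC] := @Pe_nt_bound R lam mu mu0 lm0 p Dp.
have e1 : 0 < e / (C + 1) by rewrite divr_gt0// ltr_wpDl.
have [d0 d00 Hd] := @pkernel_lpoint R pi (2 * pi) H p mH (fun q => normr_ge0 _) iH HL _ e1.
exists d0 => // x i j Gx xd.
have [dx dx0] := Gamma_depth (enorm3_sph p) Gx xd; set d := 1 - enorm3 x in dx dx0.
have x1 : enorm3 x < 1 by case: Gx.
have iPh := integrable_Pe i j Dp Gx iDh.
have iPj := integrable_Pe i j Dp Gx ijD.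
have -> : (i == j)%:R * (h p / sigma_jac p) = \int[mu2]_(q in D) (c * (Pe lam mu x (sph q) i j * sigma_jac q)).
  by rewrite RintegralZl// -(sint_Pe mu0 lm0 i j x1) mulrC.
have iPc : mu2.-integrable D (EFin \o (fun q => c * (Pe lam mu x (sph q) i j * sigma_jac q))).
  exact: integrable_cstM.
rewrite -RintegralB//.
have -> : \int[mu2]_(q in D) (Pe lam mu x (sph q) i j * h q - c * (Pe lam mu x (sph q) i j * sigma_jac q)) =
   \int[mu2]_(q in D) (Pe lam mu x (sph q) i j * (h q - c * sigma_jac q)).
  by apply: eq_Rintegral => q _; ring.
have ikD : mu2.-integrable D (EFin \o (fun q => h q - c * sigma_jac q)).
  by apply: integrableS ikQ => //; [exact: mQpi|exact: param_rect_Q0].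
have iPk := integrable_Pe i j Dp Gx ikD.
have LN : `|\int[mu2]_(q in D) (Pe lam mu x (sph q) i j * (h q - c * sigma_jac q))| <=
    \int[mu2]_(q in D) `|Pe lam mu x (sph q) i j * (h q - c * sigma_jac q)|.
  exact: le_normr_Rintegral.
apply: (le_trans LN).
have kH0 q : 0 <= pkernel d p q * H q.
  by apply: mulr_ge0; [exact: pkernel_ge0 (ltW dx)|exact: normr_ge0].
have key : (\int[mu2]_(q in D) (`|Pe lam mu x (sph q) i j * (h q - c * sigma_jac q)|)%:E <= e%:E)%E.
  apply: (@le_trans _ _ (C%:E * (e / (C + 1))%:E)%E); last first.
    by rewrite -EFinM lee_fin mulrCA ger_pMr// ler_pdivrMr ?mul1r ?lerDl// ltr_wpDl.
  apply: (@le_trans _ _ (\int[mu2]_(q in D) (C%:E * (pkernel d p q * H q)%:E)))%E.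
    apply: ge0_le_integral => //.
    - by apply/measurable_EFinP; apply: measurableT_comp => //; have /integrableP[/measurable_EFinP] := iPk.
    - apply: measurable_funeM; apply/measurable_EFinP; apply: measurable_funTS.
      by apply: measurable_funM => //; exact: measurable_pkernel.
    - move=> q [/andP[h1 h2] /andP[h3 h4]]; rewrite -EFinM lee_fin normrM mulrA ler_wpM2r//.
      by apply: HC; rewrite // !ltW.
  rewrite ge0_integralZl//.
  - rewrite lee_wpmul2l ?lee_fin//; apply: le_trans (Hd d dx dx0).
    apply: ge0_subset_integral => //; [exact: mQpi| | |exact: param_rect_Q0].
    + apply/measurable_EFinP; apply: measurable_funTS.
      by apply: measurable_funM => //; exact: measurable_pkernel.
    + by move=> q _; rewrite lee_fin.
  - apply/measurable_EFinP; apply: measurable_funTS.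
    by apply: measurable_funM => //; exact: measurable_pkernel.
  - by move=> q _; rewrite lee_fin.
rewrite /Rintegral -lee_fin fineK//.
have /integrableP[_ fin] := iPk.
by rewrite ge0_fin_numE// integral_ge0.
Qed.

Lemma ae_sigma (P : V3 -> Prop) : {ae mu2, forall p, D p -> P (sph p)} -> sigma_ae P.
Proof.
move=> [A [mA A0 sA]]; exists A; split => // p [Dp nP]; apply: sA => /= h; apply: nP; exact: h.
Qed.

Lemma sigma_ae_ae (P : V3 -> Prop) : sigma_ae P -> {ae mu2, forall p, D p -> P (sph p)}.
Proof.
move=> [A [mA A0 sA]]; exists A; split => // p /= h; apply: sA => /=.
by have /not_implyP[Dp nP] := h; split.
Qed.

Lemma ae_lpoint_jac : {ae mu2, forall p, Q0 p -> lpoint pi (2 * pi) (@sigma_jac R) p}.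
Proof.
apply: (@ae_lpoint_L1 R pi (2 * pi) (pi_gt0 R) twopi_gt0); first exact: measurable_jac.
apply: (@integrable_bnd _ _ _ _ _ _ 1) => //; first exact: mQpi.
- exact: leb2_Q0.
- by apply: measurable_funTS; exact: measurable_jac.
- by move=> q _; exact: sigma_jac_bnd.
Qed.

Lemma nt_limit_L1 (f : V3 -> V3) : L1S f ->
  sigma_ae (fun xi => nt_limit (Pe_int lam mu f) xi (f xi)).
Proof.
move=> fL1; apply: ae_sigma.
have mD := @measurable_param_rect R.
(* The Jacobian is made part of the density, and the extension by zero gives a function on the whole
   plane; dividing by the Jacobian at [p] recovers the value of [f]. *)
pose h (j : 'I_3) := patch (cst 0) D (fun q : R * R => f (sph q) 0 j * sigma_jac q).
have mh j : measurable_fun setT (h j).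
  have /integrableP[/measurable_EFinP m1 _] := fL1 j.
  by apply/(measurable_restrictT _ mD).
have hE j q : D q -> h j q = f (sph q) 0 j * sigma_jac q by move=> Dq; rewrite /h patchT// inE.
have ih j : mu2.-integrable Q0 (EFin \o h j).
  have K2 : mu2.-integrable setT (EFin \o h j) by apply: integrable_patch => //; exact: fL1.
  by apply: integrableS K2 => //; exact: mQpi.
have ae1 j := @ae_lpoint_L1 R pi (2 * pi) (pi_gt0 R) twopi_gt0 (h j) (mh j) (ih j).
apply: ae_imply (ae_and (ae1 ord0) (ae_and (ae1 (lift ord0 ord0)) (ae_and (ae1 (lift ord0 (lift ord0 ord0))) ae_lpoint_jac))).
move=> p [a0 [a1 [a2 aj]]] Dp; have Qp := param_rect_Q0 Dp.
have lp j : lpoint pi (2 * pi) (h j) p.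
  by move: j; apply: ord3P; [exact: a0|exact: a1|exact: a2].
have lj := aj Qp.
apply: nt_limitP => i e e0.
have e3 : 0 < e / 3 by rewrite divr_gt0.
have H j := Pe_lpoint (mh j) (ih j) Dp (lp j) lj e3.
have [d0 d00 H0] := H ord0; have [d1 d10 H1] := H (lift ord0 ord0); have [d2 d20 H2] := H (lift ord0 (lift ord0 ord0)).
exists (Num.min d0 (Num.min d1 d2)); first by rewrite !lt_min d00 d10.
move=> x Gx; rewrite !lt_min => /andP[x0 /andP[x1 x2]].
rewrite mxE.
have fE : f (sph p) 0 i = \sum_(j < 3) (i == j)%:R * (h j p / sigma_jac p).
  rewrite (bigD1 i)//= eqxx mul1r big1 ?addr0; last by move=> j ji; rewrite eq_sym (negbTE ji) mul0r.
  by rewrite hE// mulfK// gt_eqF// sigma_jac_gt0.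
have sE j : sint (fun eta => Pe lam mu x eta i j * f eta 0 j) = \int[mu2]_(q in D) (Pe lam mu x (sph q) i j * h j q).
  by apply: eq_Rintegral => q; rewrite inE => Dq; rewrite hE// mulrA.
rewrite fE; under eq_bigr do rewrite sE.
rewrite -sumrB; apply: (le_trans (ler_norm_sum _ _ _)).
rewrite !big_ord_recl big_ord0 addr0.
have h0 := H0 x i ord0 Gx x0; have h1 := H1 x i (lift ord0 ord0) Gx x1.
have h2 := H2 x i (lift ord0 (lift ord0 ord0)) Gx x2.
apply: (le_trans (lerD h0 (lerD h1 h2))); lra.
Qed.
End NontangentialL1.
Section NontangentialLp.
Context {R : realType}.
Notation V3 := 'rV[R]_3.
Notation mu2 := (@leb2 R).
Notation D := (@param_rect R).

Lemma eqae_integrable_bnd (g : R * R -> R) (M : R) : measurable_fun D g ->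
  {ae mu2, forall p, D p -> `|g p| <= M} ->
  mu2.-integrable D (EFin \o (fun p => g p * sigma_jac p)).
Proof.
move=> mg gM; have mD := @measurable_param_rect R.
have mgj : measurable_fun D (fun p => g p * sigma_jac p).
  by apply: measurable_funM => //; apply: measurable_funTS; exact: measurable_jac.
apply/integrableP; split; first exact/measurable_EFinP.
apply: (@le_lt_trans _ _ (\int[mu2]_(p in D) (`|M|)%:E)%E).
  apply: ae_ge0_le_integral => //.
  - apply/measurable_EFinP; exact: measurableT_comp.
  - apply: ae_imply gM => p h Dp; rewrite /= lee_fin normrM -[leRHS]mulr1.
    apply: ler_pM => //; last exact: sigma_jac_bnd.
    by apply: (le_trans (h Dp)); exact: ler_norm.
rewrite integral_cst//; by apply: lte_mul_pinfty => //; exact: leb2_param_rect.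
Qed.

(** The sphere has finite measure: [n <= 1 + n^q] for a finite exponent, an essential bound
    otherwise. *)
Lemma LpS_L1S (p : \bar R) (f : V3 -> V3) : (1 < p)%E -> LpS p f -> L1S f.
Proof.
move=> p1 [mf Hp] i; have mD := @measurable_param_rect R; rewrite /sintegrable.
case: p p1 Hp => [q|_|] //= => [q1 Hq|[M HM]].
  apply/integrableP; split.
    apply/measurable_EFinP; apply: measurable_funM; first exact: mf.
    by apply: measurable_funTS; exact: measurable_jac.
  have mn : measurable_fun D (fun p => enorm3 (f (sph p))).
    apply: (measurableT_comp (f := @Num.sqrt R)).
      by apply: continuous_measurable_fun; exact: sqrt_continuous.
    by rewrite /dot3; apply: measurable_sum => k; apply: measurable_funM; exact: mf.
  have mj : measurable_fun D (@sigma_jac R) by apply: measurable_funTS; exact: measurable_jac.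
  have mpw : measurable_fun D (fun p => enorm3 (f (sph p)) `^ q).
    exact: (measurableT_comp (@measurable_powR R q) mn).
  have j0 p : D p -> 0 <= sigma_jac p by move=> Dp; exact: ltW (sigma_jac_gt0 Dp).
  apply: (@le_lt_trans _ _ (\int[mu2]_(p in D) ((1 * sigma_jac p)%:E + (enorm3 (f (sph p)) `^ q * sigma_jac p)%:E))%E).
    apply: ge0_le_integral => //.
    - by apply/measurable_EFinP; apply: measurableT_comp => //; apply: measurable_funM => //; exact: mf.
    - apply: emeasurable_funD; apply/measurable_EFinP; exact: measurable_funM.
    - move=> p Dp /=; rewrite -EFinD lee_fin normrM (ger0_norm (j0 p Dp)) -mulrDl ler_wpM2r ?j0//.
      set n := enorm3 _; have fn : `|f (sph p) 0 i| <= n by exact: coord_le_enorm3.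
      apply: (le_trans fn); have [n1|n1] := leP n 1; first by rewrite ler_wpDr ?powR_ge0.
      by rewrite ler_wpDl//; apply: le1r_powR; exact: ltW.
  rewrite ge0_integralD//.
  - apply: lte_add_pinfty; last exact: Hq.
    have iJ := @integrable_sint R (fun=> 1) 1 (measurable_cst _) (fun _ => ltac:(by rewrite normr1)).
    have /integrableP[_] := iJ.
    apply: le_lt_trans; apply: ge0_le_integral => //.
    + by move=> p Dp; rewrite lee_fin mulr_ge0// j0.
    + by apply/measurable_EFinP; exact: measurable_funM.
    + by apply/measurable_EFinP; apply: measurableT_comp => //; exact: measurable_funM.
    + by move=> p _; rewrite lee_fin; exact: ler_norm.
  - by move=> p Dp; rewrite lee_fin mulr_ge0// j0.
  - by apply/measurable_EFinP; exact: measurable_funM.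
  - by move=> p Dp; rewrite lee_fin mulr_ge0// ?powR_ge0 ?j0.
  - by apply/measurable_EFinP; exact: measurable_funM.
apply: (@eqae_integrable_bnd (fun p => f (sph p) 0 i) M); first exact: mf.
apply: ae_imply (sigma_ae_ae HM) => p h Dp.
exact: le_trans (coord_le_enorm3 _ _) (h Dp).
Qed.

Lemma nt_limit_eq (u v : V3 -> V3) (xi l : V3) : (forall x, ball3 x -> u x = v x) ->
  nt_limit v xi l -> nt_limit u xi l.
Proof.
move=> uv H; apply: cvg_trans H; apply: near_eq_cvg.
by apply: (@filterS _ (nbhs xi) _ setT _ _ filterT) => x _ [bx _]; rewrite uv.
Qed.

Lemma sigma_ae_imply (P Q : V3 -> Prop) : (forall x, P x -> Q x) -> sigma_ae P -> sigma_ae Q.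
Proof.
move=> PQ; apply: negligibleS => p [Dp nQ]; split => // /PQ; exact: nQ.
Qed.
End NontangentialLp.

(** * Smooth functions on balls and Steklov averages *)

Section BallCalculus.
Context {R : realType}.
Notation V3 := 'rV[R]_3.
Notation leb := (@lebesgue_measure R).

(** [n] times continuously differentiable on the open ball of radius [r], through iterated partial
    derivatives, so that statements about derivatives go by recursion on [n]. *)
Fixpoint CkB (n : nat) (r : R) (g : V3 -> R) : Prop :=
  (forall x, enorm3 x < r -> {for x, continuous g}) /\
  match n with
  | 0 => True
  | n'.+1 => forall i, (forall x, enorm3 x < r -> derivable g x (e3 R i)) /\ CkB n' r (partial i g)
  end.

Lemma CkB_cont n r g x : CkB n r g -> enorm3 x < r -> {for x, continuous g}.
Proof. by case: n => [|n] [h _]; exact: h. Qed.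

Lemma CkB_is_derive n r g x i : CkB n.+1 r g -> enorm3 x < r -> is_derive x (e3 R i) g (partial i g x).
Proof. by move=> [_ h] xr; have [h1 _] := h i; apply/derivableP; exact: h1. Qed.

Lemma CkB_partial n r g i : CkB n.+1 r g -> CkB n r (partial i g).
Proof. by move=> [_ h]; have [_ h1] := h i. Qed.

Lemma CkB_S n r g : CkB n.+1 r g -> CkB n r g.
Proof.
elim: n r g => [|n IH] r g [h1 h2]; first by split.
by split=> // i; have [h3 h4] := h2 i; split=> //; exact: IH.
Qed.

Lemma CkB_le m n r g : (m <= n)%N -> CkB n r g -> CkB m r g.
Proof.
move=> /subnK <-; elim: (n - m)%N => [|k IH]//; rewrite addSn => /CkB_S; exact: IH.
Qed.

Lemma CkB_sub n r r' g : r' <= r -> CkB n r g -> CkB n r' g.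
Proof.
move=> rr; elim: n g => [|n IH] g [h1 h2]; split=> //.
- by move=> x xr; apply: h1; exact: lt_le_trans xr rr.
- by move=> x xr; apply: h1; exact: lt_le_trans xr rr.
- move=> i; have [h3 h4] := h2 i; split; last exact: IH.
  by move=> x xr; apply: h3; exact: lt_le_trans xr rr.
Qed.

Lemma eq_ball_is_derive (f g : V3 -> R) (x v : V3) d r : enorm3 x < r ->
  (forall y, enorm3 y < r -> f y = g y) -> is_derive x v f d -> is_derive x v g d.
Proof.
move=> xr fg [df dE].
have fgn : \forall y \near x, f y = g y.
  by near=> y; apply: fg; near: y; exact: near_ball3.
apply: DeriveDef.
  by apply: near_eq_derivable df.
by rewrite -dE; apply/esym; exact: near_eq_derive.
Unshelve. all: by end_near. Qed.

Lemma partial_eq (f g : V3 -> R) i x r : enorm3 x < r ->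
  (forall y, enorm3 y < r -> f y = g y) -> partial i f x = partial i g x.
Proof.
move=> xr fg; rewrite /partial; apply: near_eq_derive; near=> y; apply: fg; near: y; exact: near_ball3.
Unshelve. all: by end_near. Qed.

Lemma cvg_near_eq {T : Type} {F : set_system T} {FF : Filter F} (f g : T -> R) (l : R) :
  (\forall t \near F, f t = g t) -> f @ F --> l -> g @ F --> l.
Proof. by move=> h; apply: cvg_trans; exact: near_eq_cvg. Qed.

Lemma cvg_cmul {T : Type} {F : set_system T} {FF : Filter F} (f : T -> R) (k l : R) :
  f @ F --> l -> (fun t => k * f t) @ F --> k * l.
Proof. by move=> h; apply: cvgM => //; exact: cvg_cst. Qed.

Lemma CkB_eq n r f g : (forall x, enorm3 x < r -> f x = g x) -> CkB n r f -> CkB n r g.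
Proof.
move=> fg.
have cn (f' g' : V3 -> R) x : (forall y, enorm3 y < r -> f' y = g' y) -> enorm3 x < r ->
    {for x, continuous f'} -> {for x, continuous g'}.
  move=> e xr h; have h' : f' @ x --> f' x := h.
  suff: g' @ x --> g' x by [].
  have n1 : \forall y \near x, f' y = g' y by have := near_ball3 xr; apply: filterS => y; exact: e.
  by rewrite -(e _ xr); exact: (@cvg_near_eq _ (nbhs x) _ f' g' _ n1 h').
elim: n f g fg => [|n IH] f g fg [h1 h2].
  by split=> // x xr; apply: (cn f g x fg xr); exact: h1.
split=> [x xr|i]; first by apply: (cn f g x fg xr); exact: h1.
have [h3 h4] := h2 i; split.
  move=> x xr; have [d _] := eq_ball_is_derive xr fg (derivableP (h3 x xr)); exact: d.
by apply: (IH _ _ _ h4) => x xr; exact: (partial_eq i xr fg).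
Qed.

Lemma partial_val (g : V3 -> R) x i d : is_derive x (e3 R i) g d -> partial i g x = d.
Proof. by case. Qed.

Lemma cvg_lin {T : Type} {F : set_system T} {FF : Filter F} (f g : T -> R) (u v a b : R) :
  f @ F --> u -> g @ F --> v -> (fun t => a * f t + b * g t) @ F --> a * u + b * v.
Proof. by move=> h1 h2; apply: cvgD; apply: cvgM => //; exact: cvg_cst. Qed.

Lemma CkB_lin n r f g (a b : R) : CkB n r f -> CkB n r g -> CkB n r (fun x => a * f x + b * g x).
Proof.
have cn (f' g' : V3 -> R) x : {for x, continuous f'} -> {for x, continuous g'} ->
    {for x, continuous (fun x => a * f' x + b * g' x)}.
  by move=> h1 h2; exact: (@cvg_lin _ (nbhs x) _ f' g' _ _ a b h1 h2).
elim: n f g => [|n IH] f g Hf Hg.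
  by split=> // x xr; apply: cn; [exact: CkB_cont Hf xr|exact: CkB_cont Hg xr].
have dl i x : enorm3 x < r ->
    is_derive x (e3 R i) (fun x => a * f x + b * g x) (a * partial i f x + b * partial i g x).
  move=> xr; have d1 := CkB_is_derive i Hf xr; have d2 := CkB_is_derive i Hg xr.
  by apply: is_derive_eq; rewrite /GRing.scale /=; ring.
split=> [x xr|i]; first by apply: cn; [exact: CkB_cont Hf xr|exact: CkB_cont Hg xr].
split=> [x xr|]; first by have [d _] := dl i x xr.
have h := IH _ _ (CkB_partial i Hf) (CkB_partial i Hg).
by apply: (CkB_eq _ h) => x xr; rewrite (partial_val (dl i x xr)).
Qed.

Lemma ball_compact (rho' : R) : compact [set x : V3 | enorm3 x <= rho'].
Proof.
apply: bounded_closed_compact.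
  exists rho'; split; first exact: num_real.
  move=> M rM x /= xr; apply: (le_trans (norm_le_enorm3 x)); apply: (le_trans xr); exact: ltW.
have -> : [set x : V3 | enorm3 x <= rho'] = (@enorm3 R) @^-1` [set y | y <= rho'] by [].
by apply: closed_comp; [move=> x _; exact: continuous_enorm3|exact: closed_le].
Qed.

Lemma CkB_bnd n r g rho' : CkB n r g -> rho' < r -> exists2 M, 0 <= M &
  forall x, enorm3 x <= rho' -> `|g x| <= M.
Proof.
move=> gC rr; have [r0|r0] := leP 0 rho'; last first.
  by exists 0 => // x xr; have := le_lt_trans (le_trans (enorm3_ge0 x) xr) r0; rewrite ltxx.
have cg : {within [set x : V3 | enorm3 x <= rho'], continuous (fun x => `|g x|)}.
  apply: continuous_in_subspaceT => x; rewrite inE /= => xr.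
  have h := CkB_cont gC (le_lt_trans xr rr).
  exact: (@cvg_norm _ _ _ (nbhs x) _ g (g x) h).
have ne : [set x : V3 | enorm3 x <= rho'] !=set0 by exists 0; rewrite /= enorm3_0.
have [c _ H] := EVT_max_rV ne (ball_compact (rho' := rho')) cg.
by exists `|g c| => // x xr; apply: H; rewrite inE.
Qed.

Lemma is_derive_translate (g : V3 -> R) (x b v : V3) d : is_derive (x + b) v g d ->
  is_derive x v (fun w => g (w + b)) d.
Proof.
move=> /derive_line0 h; apply/derive_line0.
by rewrite (_ : (fun s : R => g (s *: v + x + b)) = (fun s : R => g (s *: v + (x + b))))//;
  apply/funext => s; rewrite addrA.
Qed.

(** Continuity of the partial derivatives makes those of [g] minus its linear part small near [x],
    and [mvt_ball] turns this into a first order expansion valid in every direction. *)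
Lemma CkB_is_derive_dir n r g x (v : V3) : CkB n.+1 r g -> enorm3 x < r ->
  is_derive x v g (\sum_k v 0 k * partial k g x).
Proof.
move=> gC xr; set L := \sum_k _.
suff H : (fun h : R => h^-1 *: ((g \o shift x) (h *: v) - g x)) @ 0^' --> L.
  by apply: DeriveDef; [apply/cvg_ex; exists L|exact: cvg_lim H].
apply/cvgrPdist_le => e e0.
pose n1 := enorm3 v + 1; have n10 : 0 < n1 by rewrite ltr_wpDl ?enorm3_ge0.
pose e' := e / (3 * n1); have e'0 : 0 < e' by rewrite divr_gt0 ?mulr_gt0.
have [dl dl0 Hdl] : exists2 dl : R, 0 < dl & forall k z, enorm3 (z - x) <= dl -> enorm3 z < r /\ `|partial k g z - partial k g x| <= e'.
  have : \forall z \near x, enorm3 z < r /\ forall k, `|partial k g z - partial k g x| <= e'.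
    near=> z; split; first by near: z; exact: near_ball3.
    near: z; apply: filter_forall => k.
    have := CkB_cont (CkB_partial k gC) xr => /cvgrPdist_le /(_ e' e'0).
    by apply: filterS => z; rewrite distrC.
  move/nbhs_ballP => [d /= d0 Hd]; exists (d / 2); first by rewrite divr_gt0.
  move=> k z zx; have bz : ball x d z.
    rewrite -ball_normE /=; apply: (le_lt_trans (norm_le_enorm3 _)).
    by rewrite enorm3_distC; apply: (le_lt_trans zx); rewrite ltr_pdivrMr// ltr_pMr// ltr1n.
  by have [h1 h2] := Hd z bz; split.
pose G k := partial k g x; have GE k : partial k g x = G k by [].
clearbody G; have LE : L = \sum_k v 0 k * G k by apply: eq_bigr => k _; rewrite GE.
have key (y : V3) : enorm3 y <= dl -> `|g (y + x) - g x - \sum_k y 0 k * G k| <= 3 * e' * enorm3 y.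
  move=> yd.
  have := @mvt_ball R (fun z => g (z + x) - \sum_k z 0 k * G k)
    (fun k z => partial k g (z + x) - G k) e' y.
  rewrite add0r [X in _ - (g x - X)]big1 ?subr0; last by move=> k _; rewrite mxE mul0r.
  rewrite addrAC; apply.
    move=> i z zy.
    have [zr _] := Hdl i (z + x) ltac:(by rewrite addrK (le_trans zy)).
    have d1 := is_derive_translate (CkB_is_derive i gC zr).
    have d0' := is_derive_coord z (e3 R i) ord0.
    have d1' := is_derive_coord z (e3 R i) (lift ord0 ord0).
    have d2' := is_derive_coord z (e3 R i) (lift ord0 (lift ord0 ord0)).
    have -> : (fun z0 : V3 => g (z0 + x) - \sum_k z0 0 k * G k) = fun w : V3 => g (w + x) - (w 0 ord0 * G ord0 +
       w 0 (lift ord0 ord0) * G (lift ord0 ord0) + w 0 (lift ord0 (lift ord0 ord0)) * G (lift ord0 (lift ord0 ord0))).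
      by apply/funext => w; rewrite 3!big_ord_recl big_ord0 addr0 addrA.
    apply: is_derive_eq; rewrite /GRing.scale /= !e3E.
    move: (partial i g (z + x)) => P {zr d1 d0' d1' d2'}.
    by move: i; apply: ord3P => /=; rewrite ?mulr0 ?mulr1 ?addr0 ?add0r.
  by move=> i z zy; have [_] := Hdl i (z + x) ltac:(by rewrite addrK (le_trans zy)); rewrite GE.
near=> h.
have h0 : h != 0 by near: h; exact: nbhs_dnbhs_neq.
have hd : `|h| < dl / n1.
  near: h; apply: dnbhs0_lt; by rewrite divr_gt0.
have hv : enorm3 (h *: v) <= dl.
  rewrite enorm3Z; apply: (@le_trans _ _ (dl / n1 * n1)); last by rewrite divfK// gt_eqF.
  by apply: ler_pM => //; [exact: enorm3_ge0|exact: ltW|rewrite lerDl].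
have := key _ hv; rewrite (_ : \sum_k (h *: v) 0 k * G k = h * L); last first.
  by rewrite LE mulr_sumr; apply: eq_bigr => k _; rewrite mxE mulrA.
move=> K; rewrite distrC /= /GRing.scale /=.
have -> : h^-1 * (g (h *: v + x) - g x) - L = h^-1 * (g (h *: v + x) - g x - h * L).
  by rewrite [in RHS]mulrBr [h^-1 * (h * L)]mulrA mulVf// mul1r.
rewrite normrM normfV mulrC ler_pdivrMr ?normr_gt0//; apply: (le_trans K).
rewrite enorm3Z mulrA mulrAC ler_wpM2r//.
rewrite (_ : 3 * e' * enorm3 v = e * (enorm3 v / n1)); last by rewrite /e'; field; rewrite gt_eqF.
by rewrite ler_piMr ?(ltW e0)// ler_pdivrMr// mul1r lerDl.
Unshelve. all: by end_near. Qed.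

Lemma cvg_aff {T : Type} {F : set_system T} {FF : Filter F} (f : T -> V3) (u : V3) (k : R) (w : V3) :
  f @ F --> u -> (fun t => k *: f t + w) @ F --> k *: u + w.
Proof.
move=> h; apply: cvgD; last exact: cvg_cst.
by apply: cvgZ => //; exact: cvg_cst.
Qed.

Section Averages.
Variables (a : R -> R) (b : R -> V3) (eps : R).
Hypotheses (ca : continuous a) (cb : continuous b).
Hypotheses (a1 : forall s, 0 <= s <= 1 -> `|a s| <= 1) (bE : forall s, 0 <= s <= 1 -> enorm3 (b s) <= eps).

(** One operator for two uses: [a = 1] with [b] a short segment gives Steklov averages, [a = s^2]
    with [b = 0] gives means along rays. Differentiation multiplies the weight [c] by [a]. *)
Definition avg (c : R -> R) (g : V3 -> R) (x : V3) : R :=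
  \int[leb]_(s in `[0, 1]) (c s * g (a s *: x + b s)).

Lemma avg_pt (x : V3) (rho' s : R) : 0 <= s <= 1 -> enorm3 x <= rho' -> enorm3 (a s *: x + b s) <= rho' + eps.
Proof.
move=> s01 xr; apply: (le_trans (enorm3D _ _)); apply: lerD (bE s01).
by rewrite enorm3Z; apply: le_trans xr; rewrite ler_piMl ?enorm3_ge0// a1.
Qed.

Lemma avg_cvg_pt (x : V3) (s : R) : (fun s : R => a s *: x + b s) @ s --> a s *: x + b s.
Proof. by apply: cvgD; [apply: cvgZr_tmp; exact: ca|exact: cb]. Qed.

Lemma avg_measurable (c : R -> R) r n g (x : V3) : continuous c -> CkB n r g -> enorm3 x < r - eps ->
  measurable_fun (`[0, 1]%classic : set R) (fun s : R => c s * g (a s *: x + b s)).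
Proof.
move=> cc gC xr; apply: subspace_continuous_measurable_fun; first exact: measurable_itv.
apply: continuous_in_subspaceT => s; rewrite inE => /itv01P s01.
apply: cvgM; first exact: cc.
have pr : enorm3 (a s *: x + b s) < r.
  by apply: (le_lt_trans (avg_pt s01 (lexx _))); rewrite -ltrBrDr.
exact: (cvg_comp _ _ (@avg_cvg_pt x s) (CkB_cont gC pr)).
Qed.

Lemma avg_bounded (c : R -> R) (K r : R) n g (rho' : R) : (forall s, 0 <= s <= 1 -> `|c s| <= K) ->
  CkB n r g -> rho' < r - eps -> exists2 M, 0 <= M & forall x s, enorm3 x <= rho' -> 0 <= s <= 1 ->
    `|c s * g (a s *: x + b s)| <= M.
Proof.
move=> cK gC rr; have [M M0 HM] := @CkB_bnd n r g (rho' + eps) gC ltac:(by rewrite -ltrBrDr).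
have K0 : 0 <= K by apply: le_trans (cK 0 _); rewrite ?normr_ge0// lexx ler01.
exists (K * M); first exact: mulr_ge0.
by move=> x s xr s01; rewrite normrM; apply: ler_pM => //; [exact: cK|apply: HM; exact: avg_pt].
Qed.

Lemma is_derive_avg (c : R -> R) (K r : R) n g x i : continuous c -> (forall s, 0 <= s <= 1 -> `|c s| <= K) ->
  CkB n.+1 r g -> enorm3 x < r - eps ->
  is_derive x (e3 R i) (avg c g) (avg (fun s => c s * a s) (partial i g) x).
Proof.
move=> cc cK gC xr.
pose rho' := (enorm3 x + (r - eps)) / 2.
have xrho : enorm3 x < rho' by rewrite /rho'; lra.
have rhor : rho' < r - eps by rewrite /rho'; lra.
have K0 : 0 <= K by apply: le_trans (cK 0 _); rewrite ?normr_ge0// lexx ler01.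
have cak s : 0 <= s <= 1 -> `|c s * a s| <= K.
  by move=> s01; rewrite normrM -[leRHS]mulr1; apply: ler_pM => //; [exact: cK|exact: a1].
have [M1 M10 H1] := avg_bounded cK gC rhor.
have [M2 M20 H2] := avg_bounded cak (CkB_partial i gC) rhor.
apply: (@is_derive_Rint_ball _ _ _ leb `[0, 1]%classic (fun z s => c s * g (a s *: z + b s))
  (fun z s => c s * a s * partial i g (a s *: z + b s)) x _ rho' (M1 + M2)).
- exact: measurable_itv.
- exact: leb_cc_fin.
- exact: xrho.
- move=> y yr; exact: (avg_measurable cc gC (le_lt_trans yr rhor)).
- move=> y s /itv01P s01 yr; apply: (le_trans (H1 y s yr s01)); by rewrite lerDl.
- move=> y s /itv01P s01 yr.
  have pr : enorm3 (a s *: y + b s) < r.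
    by apply: (le_lt_trans (avg_pt s01 yr)); rewrite -ltrBrDr.
  have d := is_derive_scale (is_derive_translate (CkB_is_derive i gC pr)).
  by apply: is_derive_eq; rewrite /GRing.scale /= mulrA.
- move=> y s /itv01P s01 yr; apply: (le_trans (H2 y s yr s01)); by rewrite lerDr.
Qed.

Lemma avg_CkB (c : R -> R) (K r : R) n g : continuous c -> (forall s, 0 <= s <= 1 -> `|c s| <= K) ->
  CkB n r g -> CkB n (r - eps) (avg c g).
Proof.
move=> cc cK gC.
have cont (c' : R -> R) m g' x : continuous c' -> (forall s, 0 <= s <= 1 -> `|c' s| <= K) -> CkB m r g' ->
    enorm3 x < r - eps -> {for x, continuous (avg c' g')}.
  move=> cc' cK' gC' xr; pose rho' := (enorm3 x + (r - eps)) / 2.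
  have xrho : enorm3 x < rho' by rewrite /rho'; lra.
  have rhor : rho' < r - eps by rewrite /rho'; lra.
  have [M1 M10 H1] := avg_bounded cK' gC' rhor.
  apply: (@continuous_Rintegral _ _ _ leb `[0, 1]%classic _ _ _
    (fun (z : V3) s => c' s * g' (a s *: z + b s)) x M1).
  - exact: measurable_itv.
  - exact: leb_cc_fin.
  - have := near_ball3 xrho; apply: filterS => z zr; split.
      exact: (avg_measurable cc' gC' (lt_trans zr rhor)).
    by move=> s /itv01P s01; exact: H1 (ltW zr) s01.
  - move=> s /itv01P s01.
    have pr : enorm3 (a s *: x + b s) < r.
      by apply: (le_lt_trans (avg_pt s01 (lexx _))); rewrite -ltrBrDr.
    have cz : (fun z : V3 => a s *: z + b s) @ x --> a s *: x + b s.
      exact: (@cvg_aff _ (nbhs x) _ id x (a s) (b s) (@cvg_id _ (nbhs x))).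
    have cg : g' (a s *: z + b s) @[z --> x] --> g' (a s *: x + b s) by exact: (cvg_comp _ _ cz (CkB_cont gC' pr)).
    exact: (@cvg_cmul _ (nbhs x) _ _ (c' s) _ cg).
elim: n c g cc cK gC => [|n IH] c g cc cK gC.
  by split=> // x xr; exact: cont gC xr.
split=> [x xr|i]; first exact: cont gC xr.
split=> [x xr|]; first by have [d _] := is_derive_avg i cc cK gC xr.
have ck s : 0 <= s <= 1 -> `|c s * a s| <= K.
  have K0 : 0 <= K by apply: le_trans (cK 0 _); rewrite ?normr_ge0// lexx ler01.
  by move=> s01; rewrite normrM -[leRHS]mulr1; apply: ler_pM => //; [exact: cK|exact: a1].
have cca : continuous (fun s => c s * a s) by move=> s; apply: cvgM; [exact: cc|exact: ca].
apply: CkB_eq (IH _ _ cca ck (CkB_partial i gC)) => x xr.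
by rewrite (partial_val (is_derive_avg i cc cK gC xr)).
Qed.
End Averages.
End BallCalculus.

Section Steklov.
Context {R : realType}.
Notation V3 := 'rV[R]_3.
Notation leb := (@lebesgue_measure R).

(** Average over the segment from [x] to [x + eps e_i]: it commutes with derivatives, at the price
    of [eps] in the radius of the domain. *)
Definition stk (i : 'I_3) (eps : R) : (V3 -> R) -> V3 -> R :=
  avg (cst 1) (fun s => (eps * s) *: e3 R i) (cst 1).

Lemma stk_hyps i (eps : R) : 0 <= eps ->
  [/\ continuous (cst 1 : R -> R), continuous (fun s : R => (eps * s) *: e3 R i : V3),
      (forall s : R, 0 <= s <= 1 -> `|cst (1 : R) s| <= 1) &
      (forall s : R, 0 <= s <= 1 -> enorm3 ((eps * s) *: e3 R i) <= eps)].
Proof.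
move=> e0; split.
- by move=> s; exact: cvg_cst.
- by move=> s; apply: cvgZr_tmp; apply: cvgM; [exact: cvg_cst|exact: cvg_id].
- by move=> s _; rewrite /= normr1.
- by move=> s /andP[s0 s1]; rewrite enorm3Z enorm3_e3 mulr1 ger0_norm ?mulr_ge0// ler_piMr.
Qed.

Lemma stkE i (eps : R) g x : stk i eps g x = \int[leb]_(s in `[0, 1]) g (x + (eps * s) *: e3 R i).
Proof. by apply: eq_Rintegral => s _ /=; rewrite mul1r scale1r. Qed.

Lemma stk_CkB n r i (eps : R) g : 0 <= eps -> CkB n r g -> CkB n (r - eps) (stk i eps g).
Proof.
move=> e0 gC; have [h1 h2 h3 h4] := stk_hyps i e0.
by apply: (@avg_CkB R _ _ eps h1 h2 h3 h4 _ 1) => // s _; rewrite /= normr1.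
Qed.

Lemma stk_partial n r i j (eps : R) g x : 0 <= eps -> CkB n.+1 r g -> enorm3 x < r - eps ->
  partial j (stk i eps g) x = stk i eps (partial j g) x.
Proof.
move=> e0 gC xr; have [h1 h2 h3 h4] := stk_hyps i e0.
have n1 : forall s : R, 0 <= s <= 1 -> `|cst (1 : R) s| <= 1 by move=> s _; rewrite /= normr1.
rewrite (partial_val (@is_derive_avg R _ _ eps h1 h2 h3 h4 _ 1 r n g x j h1 n1 gC xr)).
by rewrite /stk; congr avg; apply/funext => s /=; rewrite mulr1.
Qed.

Local Opaque partial stk.

Lemma stk_partial2 n r i j k (eps : R) g x : 0 <= eps -> CkB n.+2 r g -> enorm3 x < r - eps ->
  partial k (partial j (stk i eps g)) x = stk i eps (partial k (partial j g)) x.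
Proof.
move=> e0 gC xr.
rewrite (@partial_eq _ _ (stk i eps (partial j g)) k x (r - eps)) //.
  exact: (stk_partial i k e0 (CkB_partial j gC) xr).
by move=> y yr; exact: (stk_partial i j e0 gC yr).
Qed.

Lemma stk_diff n r i (eps : R) g x : 0 < eps -> CkB n.+1 r g -> enorm3 x < r - eps ->
  stk i eps (partial i g) x = eps^-1 * g (x + eps *: e3 R i) + (- eps^-1) * g x.
Proof.
move=> e0 gC xr; rewrite stkE.
have en : eps != 0 by rewrite gt_eqF.
have pt (s : R) : 0 <= s <= 1 -> enorm3 (x + (eps * s) *: e3 R i) < r.
  case/andP=> s0 s1; apply: (le_lt_trans (enorm3D _ _)).
  rewrite enorm3Z enorm3_e3 mulr1 ger0_norm ?mulr_ge0 ?(ltW e0)//.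
  have : eps * s <= eps by rewrite ler_piMr// ltW.
  by move: xr; set u := enorm3 x; clear; lra.
have dF (s : R) : 0 <= s <= 1 -> is_derive s (1 : R) (fun s => eps^-1 * g (x + (eps * s) *: e3 R i))
    (partial i g (x + (eps * s) *: e3 R i)).
  move=> s01; have d := CkB_is_derive i gC (pt s s01).
  have E t : x + (eps * t) *: e3 R i = (eps * t) *: e3 R i + x by rewrite addrC.
  rewrite E in d; have d1 := (derive_line g x (e3 R i) (eps * s) _).1 d.
  have dt : is_derive (s : R) (1 : R) (fun s : R => eps * s) eps.
    by apply: is_derive_eq; rewrite /GRing.scale /=; ring.
  have d2 := @is_derive1_comp _ (fun t : R => g (t *: e3 R i + x)) (fun s : R => eps * s) s _ _ d1 dt.
  have d3 : is_derive s (1 : R) (fun s : R => g ((eps * s) *: e3 R i + x)) (partial i g ((eps * s) *: e3 R i + x) * eps) by exact: d2.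
  rewrite (_ : (fun s0 : R => _) = (fun s0 : R => eps^-1 * g ((eps * s0) *: e3 R i + x))); last first.
    by apply/funext => t; rewrite E.
  by rewrite E; apply: is_derive_eq; rewrite /GRing.scale /=; field.
have cF (s : R) : 0 <= s <= 1 -> {for s, continuous (fun s : R => partial i g (x + (eps * s) *: e3 R i))}.
  move=> s01.
  have cz : (fun s : R => x + (eps * s) *: e3 R i) @ s --> x + (eps * s) *: e3 R i.
    apply: cvgD; first exact: cvg_cst.
    by apply: cvgZr_tmp; apply: cvgM; [exact: cvg_cst|exact: cvg_id].
  exact: (cvg_comp _ _ cz (CkB_cont (CkB_partial i gC) (pt s s01))).
by rewrite (FTC_cc ltr01 dF cF) mulr1 mulr0 scale0r addr0 mulNr.
Qed.

Lemma translate_CkB n r (eps : R) (b : V3) g : enorm3 b <= eps -> CkB n r g ->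
  CkB n (r - eps) (fun x => g (x + b)).
Proof.
move=> be; have pt x : enorm3 x < r - eps -> enorm3 (x + b) < r.
  move=> xr; apply: (le_lt_trans (enorm3D _ _)); move: be xr.
  by set u := enorm3 x; set v := enorm3 b; clear; lra.
have cont m (g' : V3 -> R) (x : V3) : CkB m r g' -> enorm3 x < r - eps -> {for x, continuous (fun x : V3 => g' (x + b))}.
  move=> gC xr.
  have cz : (fun z : V3 => z + b) @ x --> x + b.
    have h := @cvg_aff R _ (nbhs x) (nbhs_filter x) id x 1 b (@cvg_id _ (nbhs x)).
    have E : (fun z : V3 => 1 *: z + b) = (fun z : V3 => z + b) by apply/funext => z; rewrite scale1r.
    by rewrite -E -[x in X in _ --> X]scale1r.
  exact: (cvg_comp _ _ cz (CkB_cont gC (pt x xr))).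
elim: n g => [|n IH] g gC; first by split=> // x xr; exact: cont gC xr.
have d i x : enorm3 x < r - eps -> is_derive x (e3 R i) (fun x => g (x + b)) (partial i g (x + b)).
  by move=> xr; have d := CkB_is_derive i gC (pt x xr); exact: (is_derive_translate d).
split=> [x xr|i]; first exact: cont gC xr.
split=> [x xr|]; first by have [] := d i x xr.
by apply: CkB_eq (IH _ (CkB_partial i gC)) => x xr; rewrite (partial_val (d i x xr)).
Qed.

Lemma stk_gain n r i (eps : R) g : 0 < eps -> CkB n.+1 r g ->
  CkB n.+1 (r - eps) (partial i (stk i eps g)).
Proof.
move=> e0 gC; have e0' := ltW e0.
apply: (@CkB_eq _ _ _ (fun x => eps^-1 * g (x + eps *: e3 R i) + (- eps^-1) * g x)).
  by move=> x xr; rewrite (stk_partial i i e0' gC xr) (stk_diff i e0 gC xr).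
apply: CkB_lin; last by apply: CkB_sub gC; rewrite lerBlDr lerDl.
by apply: translate_CkB gC; rewrite enorm3Z enorm3_e3 mulr1 ger0_norm.
Qed.

Definition stk3 (eps : R) (g : V3 -> R) : V3 -> R :=
  stk ord0 eps (stk (lift ord0 ord0) eps (stk (lift ord0 (lift ord0 ord0)) eps g)).

(* The derivative of an average in direction i is a difference quotient, so averaging in all three
   directions gains one derivative. *)
Lemma stk3_gain n r (eps : R) g : 0 < eps -> CkB n.+1 r g -> CkB n.+2 (r - eps - eps - eps) (stk3 eps g).
Proof.
move=> e0 gC; have e0' := ltW e0; rewrite /stk3.
set g2 := stk _ eps g; have C2 : CkB n.+1 (r - eps) g2 by exact: stk_CkB.
set g1 := stk _ eps g2; have C1 : CkB n.+1 (r - eps - eps) g1 by exact: stk_CkB.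
set g0 := stk _ eps g1; have C0 : CkB n.+1 (r - eps - eps - eps) g0 by exact: stk_CkB.
split=> [x xr|i]; first exact: CkB_cont C0 xr.
split=> [x xr|]; first by have [] := CkB_is_derive i C0 xr.
move: i; apply: ord3P.
- exact: stk_gain.
- apply: (@CkB_eq _ _ _ (stk ord0 eps (partial (lift ord0 ord0) g1))).
    by move=> x xr; rewrite (stk_partial _ _ e0' C1 xr).
  by apply: stk_CkB; [exact: e0'|exact: stk_gain].
- apply: (@CkB_eq _ _ _ (stk ord0 eps (stk (lift ord0 ord0) eps (partial (lift ord0 (lift ord0 ord0)) g2)))).
    move=> x xr; rewrite (stk_partial _ _ e0' C1 xr) !stkE.
    apply: eq_Rintegral => s; rewrite inE => /itv01P /andP[s0 s1].
    rewrite (stk_partial _ _ e0' C2)//; apply: (le_lt_trans (enorm3D _ _)).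
    rewrite enorm3Z enorm3_e3 mulr1 ger0_norm ?mulr_ge0//.
    have : eps * s <= eps by rewrite ler_piMr.
    by move: xr; set u := enorm3 x; clear; lra.
  apply: stk_CkB; first exact: e0'.
  by apply: stk_CkB; [exact: e0'|exact: stk_gain].
Qed.

Lemma stk_measurable n r i (eps : R) g x : 0 <= eps -> CkB n r g -> enorm3 x < r - eps ->
  leb.-integrable `[0, 1] (EFin \o (fun s : R => g (x + (eps * s) *: e3 R i))).
Proof.
move=> e0 gC xr; have [h1 h2 h3 h4] := stk_hyps i e0.
have n1 : forall s : R, 0 <= s <= 1 -> `|cst (1 : R) s| <= 1 by move=> s _; rewrite /= normr1.
pose rho' := (enorm3 x + (r - eps)) / 2.
have xrho : enorm3 x <= rho' by rewrite /rho'; lra.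
have rhor : rho' < r - eps by rewrite /rho'; lra.
have [M M0 HM] := @avg_bounded R (cst 1) _ eps h3 h4 (cst 1) 1 r n g rho' n1 gC rhor.
have := @avg_measurable R _ _ eps h1 h2 h3 h4 (cst 1) r n g x h1 gC xr => m.
have E s : cst 1 s * g (cst 1 s *: x + (eps * s) *: e3 R i) = g (x + (eps * s) *: e3 R i) by rewrite /= mul1r scale1r.
apply: (@integrable_bnd _ _ _ _ _ _ M); first exact: measurable_itv.
- exact: leb_cc_fin.
- by apply: eq_measurable_fun m => s _; rewrite E.
- by move=> s /itv01P s01; rewrite -E; exact: HM.
Qed.

Lemma stk_lin n r i (eps : R) f g (a b : R) x : 0 <= eps -> CkB n r f -> CkB n r g -> enorm3 x < r - eps ->
  stk i eps (fun y => a * f y + b * g y) x = a * stk i eps f x + b * stk i eps g x.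
Proof.
move=> e0 fC gC xr; rewrite !stkE.
have i1 := stk_measurable i e0 fC xr; have i2 := stk_measurable i e0 gC xr.
rewrite RintegralD//; [|exact: integrable_cstM|exact: integrable_cstM].
by rewrite !RintegralZl.
Qed.

Lemma stk_dev n r i (eps e c : R) f x : 0 <= eps -> CkB n r f -> enorm3 x < r - eps ->
  (forall s : R, 0 <= s <= eps -> `|f (x + s *: e3 R i) - c| <= e) -> `|stk i eps f x - c| <= e.
Proof.
move=> e0 fC xr fF.
have i1 := stk_measurable i e0 fC xr.
have mI : measurable (`[0, 1]%classic : set R) by exact: measurable_itv.
have f1 : fine (leb `[0, 1]%classic) = 1 by rewrite lebesgue_measure_itv /= lte_fin ltr01 /= oppr0 addr0.
have icst : leb.-integrable `[0, 1] (EFin \o cst c).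
  by apply: (@integrable_bnd _ _ _ _ _ _ `|c|) => //; exact: leb_cc_fin.
have E : c = \int[leb]_(s in `[0, 1]) cst c s by rewrite Rintegral_cst// [X in _ * X]f1 mulr1.
rewrite stkE [in X in _ - X]E -RintegralB//.
rewrite -[leRHS]mulr1 -[X in _ * X]f1; apply: le_Rintegral_bnd => //.
- exact: leb_cc_fin.
- have /integrableP[/measurable_EFinP m _] := i1.
  by apply: measurable_funB.
- move=> s /itv01P /andP[s0 s1]; apply: fF.
  by rewrite mulr_ge0//= ler_piMr.
Qed.

Lemma stk_approx n r i (eps dl K rho' : R) f F : 0 <= eps -> CkB n r f -> rho' < r - eps ->
  (forall y, enorm3 y <= rho' + eps -> `|f y - F y| <= dl) ->
  (forall y (s : R), enorm3 y <= rho' -> 0 <= s <= eps -> `|F (s *: e3 R i + y) - F y| <= K) ->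
  forall x, enorm3 x <= rho' -> `|stk i eps f x - F x| <= dl + K.
Proof.
move=> e0 fC rr fF FK x xr; apply: (stk_dev e0 fC (le_lt_trans xr rr)) => s se.
set z := s *: e3 R i.
have zx : enorm3 (x + z) <= rho' + eps.
  apply: (le_trans (enorm3D _ _)); apply: lerD => //.
  by rewrite enorm3Z enorm3_e3 mulr1 ger0_norm; case/andP: se.
rewrite (_ : f (x + z) - F x = (f (x + z) - F (x + z)) + (F (z + x) - F x)); last by rewrite [z + x]addrC; ring.
by apply: (le_trans (ler_normD _ _)); apply: lerD; [exact: fF|exact: FK].
Qed.

Lemma continuous_ball (G : V3 -> R) x r e : {for x, continuous G} -> enorm3 x < r -> 0 < e ->
  exists2 d : R, 0 < d & forall y, enorm3 (y - x) <= d -> enorm3 y < r /\ `|G y - G x| <= e.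
Proof.
move=> cG xr e0.
have n1 : \forall z \near x, `|G x - G z| <= e.
  by have h : G @ x --> G x := cG; move/cvgrPdist_le : h => /(_ e e0).
have : \forall z \near x, enorm3 z < r /\ `|G x - G z| <= e.
  by near=> z; split; near: z; [exact: near_ball3|exact: n1].
move/nbhs_ballP => [d /= d0 Hd]; exists (d / 2); first by rewrite divr_gt0.
move=> z zx; rewrite distrC; apply: Hd.
rewrite -ball_normE /=; apply: (le_lt_trans (norm_le_enorm3 _)).
by rewrite enorm3_distC; apply: (le_lt_trans zx); rewrite ltr_pdivrMr// ltr_pMr// ltr1n.
Unshelve. all: by end_near. Qed.

(** Averaged over a short segment in direction [i], both mixed derivatives become the [j]-derivative
    of the same difference quotient. By continuity the averages approach the values at [x] as the
    segment shrinks. *)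
Lemma CkB_schwarz n r (g : V3 -> R) i j x : CkB n.+2 r g -> enorm3 x < r ->
  partial i (partial j g) x = partial j (partial i g) x.
Proof.
move=> gC xr; apply/eqP; rewrite -subr_eq0 -normr_le0; apply/ler_addgt0Pr => e e0; rewrite add0r.
pose G y := 1 * partial i (partial j g) y + (-1) * partial j (partial i g) y.
have GC : CkB 0 r G.
  by apply: CkB_lin; apply: CkB_le (leq0n n) _; apply: CkB_partial; exact: CkB_partial.
have Gx : partial i (partial j g) x - partial j (partial i g) x = G x by rewrite /G mul1r mulN1r.
rewrite Gx.
have [d d0 Hd] := continuous_ball (CkB_cont GC xr) xr e0.
pose eps := Num.min d ((r - enorm3 x) / 2).
have eps0 : 0 < eps by rewrite lt_min d0 divr_gt0// subr_gt0.
have epsr : enorm3 x < r - eps.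
  have : eps <= (r - enorm3 x) / 2 by rewrite ge_min lexx orbT.
  by move: xr; set u := enorm3 x; clear; lra.
have e0' := ltW eps0.
have S0 : stk i eps G x = 0.
  have C1 : CkB 0 r (partial i (partial j g)) by apply: CkB_le (leq0n n) _; apply: CkB_partial; exact: CkB_partial.
  have C2 : CkB 0 r (partial j (partial i g)) by apply: CkB_le (leq0n n) _; apply: CkB_partial; exact: CkB_partial.
  apply: (etrans (stk_lin i 1 (-1) e0' C1 C2 epsr)); rewrite mul1r mulN1r.
  apply/eqP; rewrite subr_eq0; apply/eqP.
  apply: (etrans (stk_diff i eps0 (CkB_partial j gC) epsr)); apply/esym.
  apply: (etrans (esym (stk_partial i j e0' (CkB_partial i gC) epsr))).
  have xs : enorm3 (x + eps *: e3 R i) < r.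
    apply: (le_lt_trans (enorm3D _ _)); rewrite enorm3Z enorm3_e3 mulr1 ger0_norm//.
    by rewrite -ltrBrDr.
  have d1 := is_derive_translate (CkB_is_derive j gC xs).
  have d2 := CkB_is_derive j gC xr.
  have dd : is_derive x (e3 R j) (fun y => eps^-1 * g (y + eps *: e3 R i) + (- eps^-1) * g y)
     (eps^-1 * partial j g (x + eps *: e3 R i) + (- eps^-1) * partial j g x).
    by apply: is_derive_eq; rewrite /GRing.scale /=; ring.
  apply: etrans (partial_val dd).
  by apply: (@partial_eq _ _ _ j x (r - eps)) => // y yr; exact: (stk_diff i eps0 gC yr).
clearbody G; rewrite -[G x]subr0 -{1}S0 -normrN opprB.
apply: (stk_dev e0' GC epsr) => s /andP[s0 s1].
have xd : enorm3 (x + s *: e3 R i - x) <= d.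
  rewrite addrAC subrr add0r enorm3Z enorm3_e3 mulr1 ger0_norm//.
  by apply: (le_trans s1); rewrite ge_min lexx.
by have [] := Hd _ xd.
Qed.

Section Lame.
Variables lam mu : R.

Definition lame_at (u : 'I_3 -> V3 -> R) (i : 'I_3) (x : V3) : R :=
  mu * \sum_(j < 3) partial j (partial j (u i)) x + (lam + mu) * \sum_(j < 3) partial i (partial j (u j)) x.

(** The system has constant coefficients, so its operator commutes with averages. *)
Lemma stk_lame r k (eps : R) (u : 'I_3 -> V3 -> R) : 0 <= eps ->
  (forall i, CkB 2 r (u i)) -> (forall i x, enorm3 x < r -> lame_at u i x = 0) ->
  forall i x, enorm3 x < r - eps -> lame_at (fun i => stk k eps (u i)) i x = 0.
Proof.
move=> e0 uC ul i x xr.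
have C0 l m (p : 'I_3) : CkB 0 r (partial l (partial m (u p))).
  by apply: CkB_partial; apply: CkB_partial; exact: uC.
rewrite /lame_at.
have E1 j : partial j (partial j (stk k eps (u i))) x = stk k eps (partial j (partial j (u i))) x.
  exact: stk_partial2 e0 (uC i) xr.
have E2 j : partial i (partial j (stk k eps (u j))) x = stk k eps (partial i (partial j (u j))) x.
  exact: stk_partial2 e0 (uC j) xr.
have S3 (F : 'I_3 -> V3 -> R) : (forall j, CkB 0 r (F j)) ->
    CkB 0 r (fun y => \sum_j F j y) /\ \sum_j stk k eps (F j) x = stk k eps (fun y => \sum_j F j y) x.
  move=> FC.
  have E : (fun y => \sum_j F j y) = fun y => 1 * F ord0 y + 1 * (1 * F (lift ord0 ord0) y + 1 * F (lift ord0 (lift ord0 ord0)) y).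
    by apply/funext => y; rewrite 3!big_ord_recl big_ord0 addr0 !mul1r.
  have C12 := CkB_lin 1 1 (FC (lift ord0 ord0)) (FC (lift ord0 (lift ord0 ord0))).
  rewrite E; split; first exact: CkB_lin.
  rewrite (stk_lin k 1 1 e0 (FC _) C12 xr) (stk_lin k 1 1 e0 (FC _) (FC _) xr).
  by rewrite 3!big_ord_recl big_ord0 addr0 !mul1r.
have [A1 B1] := S3 (fun j => partial j (partial j (u i))) (fun j => C0 j j i).
have [A2 B2] := S3 (fun j => partial i (partial j (u j))) (fun j => C0 i j j).
have F1 : \sum_(j < 3) partial j (partial j (stk k eps (u i))) x = stk k eps (fun y => \sum_(j < 3) partial j (partial j (u i)) y) x.
  by transitivity (\sum_(j < 3) stk k eps (partial j (partial j (u i))) x); [apply: eq_bigr => j _; exact: E1|exact: B1].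
have F2 : \sum_(j < 3) partial i (partial j (stk k eps (u j))) x = stk k eps (fun y => \sum_(j < 3) partial i (partial j (u j)) y) x.
  by transitivity (\sum_(j < 3) stk k eps (partial i (partial j (u j))) x); [apply: eq_bigr => j _; exact: E2|exact: B2].
apply: (etrans (f_equal2 (fun a b : R => mu * a + (lam + mu) * b) F1 F2)).
apply: (etrans (esym (stk_lin k mu (lam + mu) e0 A1 A2 xr))); rewrite stkE.
transitivity (\int[leb]_(s in `[0, 1]) (cst 0 : R -> R) s); last by rewrite Rintegral_cst ?mul0r//; exact: measurable_itv.
apply: eq_Rintegral => s; rewrite inE => /itv01P /andP[s0 s1].
apply: ul; apply: (le_lt_trans (enorm3D _ _)).
rewrite enorm3Z enorm3_e3 mulr1 ger0_norm ?mulr_ge0//.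
have : eps * s <= eps by rewrite ler_piMr.
by move: xr; set v := enorm3 x; clear; lra.
Qed.
End Lame.
End Steklov.

(** * The Poisson representation of harmonic functions *)

Section Harmonic.
Context {R : realType}.
Notation V3 := 'rV[R]_3.
Notation mu2 := (@leb2 R).
Notation D := (@param_rect R).

(** Were [d2] positive, [df] would be positive just to the right of 0, and [f] would increase
    there. *)
Lemma second_derivative_max (f df : R -> R) (d2 e : R) : 0 < e ->
  (forall t : R, `|t| < e -> is_derive t (1 : R) f (df t)) -> is_derive (0 : R) (1 : R) df d2 ->
  (forall t, `|t| < e -> f t <= f 0) -> d2 <= 0.
Proof.
move=> e0 fd [dfd dfE] fmax.
have I0 t : t \in `]- e, e[%R -> `|t| < e by rewrite in_itv /= ltr_norml.
have df0 : df 0 = 0.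
  have H : is_derive (0 : R) (1 : R) f 0.
    apply: (@derive1_at_max _ f (- e) e 0); first by rewrite ge0_cp// ltW.
    - by move=> t /I0 te; have [] := fd t te.
    - by rewrite in_itv /= oppr_lt0 e0.
    - by move=> t /I0; exact: fmax.
  have [_ <-] := fd 0 ltac:(by rewrite normr0); by have [_ ->] := H.
rewrite leNgt; apply/negP => d20.
have : \forall h \near (0 : R)^', d2 / 2 < h^-1 * (df h).
  have H : h^-1 *: ((df \o shift 0) (h *: (1 : R)) - df 0) @[h --> (0 : R)^'] --> d2.
    by rewrite -dfE; exact: dfd.
  have d22 : d2 / 2 < d2 by lra.
  have N := cvgr_gt _ H _ d22.
  near=> h; have : d2 / 2 < h^-1 *: ((df \o shift 0) (h *: (1 : R)) - df 0) by near: h; exact: N.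
  by rewrite df0 subr0 /= /GRing.scale /= mulr1 addr0.
move=> /nbhs_ballP[d /= d0 Hd].
pose t := Num.min (d / 2) (e / 2).
have t0 : 0 < t by rewrite lt_min !divr_gt0.
have te : t < e by have : t <= e / 2 by [rewrite ge_min lexx orbT]; lra.
have td : t < d by have : t <= d / 2 by [rewrite ge_min lexx]; lra.
have cf : {within `[0, t], continuous f}.
  apply: continuous_in_subspaceT => x; rewrite inE /= in_itv /= => /andP[x0 xt].
  apply/differentiable_continuous/derivable1_diffP.
  by have [] := fd x ltac:(by rewrite ger0_norm// (le_lt_trans xt)).
have fd' x : x \in `]0, t[%R -> is_derive (x : R) (1 : R) f (df x).
  by rewrite in_itv /= => /andP[x0 xt]; apply: fd; rewrite gtr0_norm// (lt_trans xt).
have [c ] := MVT t0 fd' cf; rewrite in_itv /= subr0 => /andP[c0 ct] E.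
have := Hd c; rewrite -ball_normE /= sub0r normrN gtr0_norm// => /(_ (lt_trans ct td)) /(_ _) h.
have {}h : d2 / 2 < c^-1 * df c by apply: h; rewrite gt_eqF.
have dfc : 0 < df c.
  have : 0 < c^-1 * df c by lra.
  by rewrite pmulr_rgt0// invr_gt0.
have := fmax t ltac:(by rewrite gtr0_norm); rewrite -subr_le0 E leNgt mulr_gt0//.
Unshelve. all: by end_near. Qed.

(** The boundary condition is a uniform upper bound near the sphere, so no values on the sphere
    itself are involved. *)
Lemma max_principle (v : V3 -> R) (v1 v2 : 'I_3 -> V3 -> R) :
  (forall x, enorm3 x < 1 -> {for x, continuous v}) ->
  (forall i x, enorm3 x < 1 -> is_derive x (e3 R i) v (v1 i x) /\ is_derive x (e3 R i) (v1 i) (v2 i x)) ->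
  (forall x, enorm3 x < 1 -> \sum_i v2 i x = 0) ->
  (forall dl, 0 < dl -> exists2 r0, r0 < 1 & forall x, r0 <= enorm3 x -> enorm3 x < 1 -> v x <= dl) ->
  forall x, enorm3 x < 1 -> v x <= 0.
Proof.
move=> cv vd vh vb x0 x01; apply/ler_addgt0Pr => e e0; rewrite add0r.
pose dl := e / 2; have dl0 : 0 < dl by rewrite divr_gt0.
have [r0 r01 Hr] := vb dl dl0.
pose r := Num.max r0 (enorm3 x0).
have r1 : r < 1 by rewrite gt_max r01.
have xr : enorm3 x0 <= r by rewrite le_max lexx orbT.
(* Adding [dl |y|^2] makes the Laplacian strictly positive, which excludes an interior maximum; the
   cost is at most [2 dl = e]. *)
pose W (y : V3) := v y + dl * dot3 y y.
have cW : {within [set x : V3 | enorm3 x <= r], continuous W}.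
  apply: continuous_in_subspaceT => x; rewrite inE /= => xr'.
  have h1 := cv x (le_lt_trans xr' r1).
  have h2 := @cvg_dot3 R _ (nbhs x) (nbhs_filter x) id x (@cvg_id _ (nbhs x)).
  have h3 := @cvg_lin R _ (nbhs x) (nbhs_filter x) v (fun y => dot3 y y) _ _ 1 dl h1 h2.
  rewrite mul1r in h3.
  have E : (fun t => 1 * v t + dl * dot3 t t) = W by apply/funext => t; rewrite mul1r.
  by rewrite E in h3.
have ne : [set x : V3 | enorm3 x <= r] !=set0 by exists x0.
have [c] := EVT_max_rV ne (ball_compact (rho' := r)) cW; rewrite inE /= => cr Hc.
have c1 : enorm3 c < 1 by exact: le_lt_trans cr r1.
have dW i x : enorm3 x < 1 -> is_derive x (e3 R i) W (v1 i x + dl * (2 * x 0 i)).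
  move=> x1; have [d1 _] := vd i x x1; have d2 := is_derive_dot3 x i.
  by apply: is_derive_eq; rewrite /GRing.scale /=; ring.
have dW2 i x : enorm3 x < 1 -> is_derive x (e3 R i) (fun x => v1 i x + dl * (2 * x 0 i)) (v2 i x + 2 * dl).
  move=> x1; have [_ d1] := vd i x x1; have d2 := is_derive_coord x (e3 R i) i.
  have e1 : e3 R i 0 i = 1 by rewrite e3E eqxx.
  by apply: is_derive_eq; rewrite /GRing.scale /= e1; ring.
have [ceq|cne] := eqVneq (enorm3 c) r; last first.
  have clt : enorm3 c < r by rewrite lt_neqAle cne.
  have H i : v2 i c + 2 * dl <= 0.
    have pt (t : R) : `|t| < r - enorm3 c -> enorm3 (t *: e3 R i + c) < r.
      move=> te; apply: (le_lt_trans (enorm3D _ _)).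
      by rewrite enorm3Z enorm3_e3 mulr1 -ltrBrDr.
    apply: (@second_derivative_max (fun t => W (t *: e3 R i + c))
       (fun t => v1 i (t *: e3 R i + c) + dl * (2 * (t *: e3 R i + c) 0 i)) _ (r - enorm3 c)).
    - by rewrite subr_gt0.
    - move=> t te; apply: (derive_line W c (e3 R i) t _).1; apply: dW; exact: lt_trans (pt t te) r1.
    - exact: ((derive_line0 (fun x => v1 i x + dl * (2 * x 0 i)) c (e3 R i) _).1 (dW2 i c c1)).
    - by move=> t te; rewrite scale0r add0r; apply: Hc; rewrite inE /=; exact: ltW (pt t te).
  have := vh c c1; rewrite 3!big_ord_recl big_ord0 addr0.
  have h0 := H ord0; have h1 := H (lift ord0 ord0); have h2 := H (lift ord0 (lift ord0 ord0)).
  move: h0 h1 h2 dl0; set a := v2 _ _; set b := v2 _ _; set d := v2 _ _; clear; lra.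
have vc : v c <= dl by apply: Hr => //; rewrite ceq le_max lexx.
have h : W x0 <= W c by apply: Hc; rewrite inE.
have vW : v x0 <= W x0 by rewrite /W lerDl mulr_ge0 ?dot3_ge0// ltW.
apply: (le_trans vW); apply: (le_trans h); rewrite /W -enorm3_sq ceq.
have rr : r ^+ 2 <= 1 by rewrite expr_le1// ?(ltW r1)// (le_trans (enorm3_ge0 x0)).
have : dl * r ^+ 2 <= dl by rewrite ler_piMr// ltW.
by move: vc; rewrite /dl; set u := v c; set q := _ * r ^+ 2; clear; lra.
Qed.

(** Measurability and boundedness are asked of the pulled back function, the only form in which [g]
    enters an integral over the sphere. *)
Definition bmeas (g : V3 -> R) (M : R) : Prop :=
  measurable_fun setT (fun p : R * R => g (sph p)) /\ forall p : R * R, `|g (sph p)| <= M.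

Lemma bmeas_mul f g M N : bmeas f M -> bmeas g N -> bmeas (fun x => f x * g x) (M * N).
Proof.
move=> [mf fM] [mg gN]; split; first exact: measurable_funM.
by move=> p; rewrite normrM ler_pM.
Qed.

Lemma bmeas_cst (k : R) : bmeas (fun=> k) `|k|. Proof. by split. Qed.

Lemma sint_lin f g M N (a b : R) : bmeas f M -> bmeas g N ->
  sint (fun x => a * f x + b * g x) = a * sint f + b * sint g.
Proof.
move=> [mf fM] [mg gN]; have mD := @measurable_param_rect R.
have i1 := integrable_sint mf fM; have i2 := integrable_sint mg gN.
transitivity (Rintegral mu2 D (fun p => a * (f (sph p) * sigma_jac p) + b * (g (sph p) * sigma_jac p))).
  by apply: eq_Rintegral => p _; ring.
rewrite RintegralD//; [|exact: integrable_cstM|exact: integrable_cstM].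
by rewrite !RintegralZl.
Qed.

Lemma sint_norm_le f g M N : bmeas f M -> bmeas g N -> (forall p : R * R, `|f (sph p)| <= g (sph p)) ->
  `|sint f| <= sint g.
Proof.
move=> [mf fM] [mg gN] fg; have mD := @measurable_param_rect R.
have i1 := integrable_sint mf fM; have i2 := integrable_sint mg gN.
have LN : `|Rintegral mu2 D (fun p => f (sph p) * sigma_jac p)| <= Rintegral mu2 D (fun p => `|f (sph p) * sigma_jac p|).
  exact: le_normr_Rintegral.
apply: (le_trans LN); apply: le_Rintegral => //.
- exact: integrable_norm i1.
- move=> p Dp; rewrite normrM (ger0_norm (ltW (sigma_jac_gt0 Dp))).
  by rewrite ler_wpM2r// ltW// sigma_jac_gt0.
Qed.

Lemma bmeas_P (y : V3) (c : R) i j : enorm3 y <= c -> c < 1 ->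
  [/\ bmeas (fun eta => P0 eta y) (10 * (1 - c)^-1 ^+ 5),
      bmeas (fun eta => P1 eta i y) (10 * (1 - c)^-1 ^+ 5) &
      bmeas (fun eta => P2 eta i j y) (Kc c)].
Proof.
move=> yc c1.
have [m0 m1 m2] := @measurable_P _ _ _ (fun q : R * R => sph q) (fun q => y) i j measurable_sph (fun k => measurable_cst _).
split; split => // p.
- by have [] := P01_le i (enorm3_sph p) yc c1.
- by have [] := P01_le i (enorm3_sph p) yc c1.
- exact: P2_le_c (enorm3_sph p) yc c1.
Qed.

Definition PI (g : V3 -> R) (x : V3) : R := (4 * pi)^-1 * sint (fun eta => P0 eta x * g eta).
Definition PI1 (g : V3 -> R) (j : 'I_3) (x : V3) : R := (4 * pi)^-1 * sint (fun eta => P1 eta j x * g eta).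
Definition PI2 (g : V3 -> R) (i j : 'I_3) (x : V3) : R := (4 * pi)^-1 * sint (fun eta => P2 eta i j x * g eta).

Lemma mid_lt (x : V3) : enorm3 x < 1 -> enorm3 x < (enorm3 x + 1) / 2 /\ (enorm3 x + 1) / 2 < 1.
Proof. by move=> ?; lra. Qed.

Lemma is_derive_PI g M i j (x : V3) : bmeas g M -> enorm3 x < 1 ->
  is_derive x (e3 R j) (PI g) (PI1 g j x) /\ is_derive x (e3 R i) (PI1 g j) (PI2 g i j x).
Proof.
move=> bg x1; have [xc c1] := mid_lt x1; set c := (_ + 1) / 2 in xc c1.
have M0 : 0 <= M by case: bg => _ h; exact: le_trans (normr_ge0 _) (h (0, 0)).
set K := 10 * (1 - c)^-1 ^+ 5.
have K0 : 0 <= K.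
  by have [[_ h] _ _] := bmeas_P j j (ltW xc) c1; exact: le_trans (normr_ge0 _) (h (0, 0)).
have nb (y : V3) (p : R * R) : enorm3 y <= c -> y != sph p.
  by move=> yc; apply: ball3_neq; rewrite ?enorm3_sph//; exact: le_lt_trans yc c1.
split.
  have H : is_derive x (e3 R j) (fun y => sint (fun eta => P0 eta y * g eta)) (sint (fun eta => P1 eta j x * g eta)).
    apply: (@is_derive_sint R (fun y eta => P0 eta y * g eta) (fun y eta => P1 eta j y * g eta) x _ c (K * M)) => //.
    - by move=> y yc; have [b0 _ _] := bmeas_P j j yc c1; have [] := bmeas_mul b0 bg.
    - by move=> y p yc; have [b0 _ _] := bmeas_P j j yc c1; have [_] := bmeas_mul b0 bg; exact.
    - by move=> y p yc; have d := is_derive_P0 j (nb y p yc); apply: is_derive_eq; rewrite /GRing.scale /=; ring.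
    - by move=> y p yc; have [_ b0 _] := bmeas_P j j yc c1; have [_] := bmeas_mul b0 bg; exact.
  by apply: is_derive_eq; rewrite /PI1 /GRing.scale.
have H : is_derive x (e3 R i) (fun y => sint (fun eta => P1 eta j y * g eta)) (sint (fun eta => P2 eta i j x * g eta)).
  apply: (@is_derive_sint R (fun y eta => P1 eta j y * g eta) (fun y eta => P2 eta i j y * g eta) x _ c ((K + Kc c) * M)) => //.
  - by move=> y yc; have [_ b0 _] := bmeas_P j j yc c1; have [] := bmeas_mul b0 bg.
  - move=> y p yc; have [_ b0 _] := bmeas_P j j yc c1; have [_ h] := bmeas_mul b0 bg; apply: (le_trans (h p)).
    by rewrite ler_wpM2r// lerDl Kc_ge0.
  - by move=> y p yc; have d := is_derive_P1 i j (nb y p yc); apply: is_derive_eq; rewrite /GRing.scale /=; ring.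
  - move=> y p yc; have [_ _ b0] := bmeas_P i j yc c1; have [_ h] := bmeas_mul b0 bg; apply: (le_trans (h p)).
    by rewrite ler_wpM2r// lerDr.
by apply: is_derive_eq; rewrite /PI2 /GRing.scale.
Qed.

Lemma continuous_PI g M (x : V3) : bmeas g M -> enorm3 x < 1 -> {for x, continuous (PI g)}.
Proof.
move=> bg x1; have [xc c1] := mid_lt x1; set c := (_ + 1) / 2 in xc c1.
set K := 10 * (1 - c)^-1 ^+ 5.
have H : sint (fun eta => P0 eta z * g eta) @[z --> x] --> sint (fun eta => P0 eta x * g eta).
  apply: (@continuous_Rintegral _ _ _ mu2 D _ _ _
    (fun (z : V3) p => P0 (sph p) z * g (sph p) * sigma_jac p) x (K * M * 1)).
  - exact: measurable_param_rect.
  - exact: leb2_param_rect.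
  - have := near_ball3 xc; apply: filterS => z zc; split.
      apply: measurable_funTS; apply: measurable_funM; last exact: measurable_jac.
      by have [b0 _ _] := bmeas_P ord0 ord0 (ltW zc) c1; have [] := bmeas_mul b0 bg.
    move=> p _; have [b0 _ _] := bmeas_P ord0 ord0 (ltW zc) c1; have [_ h] := bmeas_mul b0 bg.
    by rewrite normrM; apply: ler_pM; [exact: normr_ge0|exact: normr_ge0|exact: h|exact: sigma_jac_bnd].
  - move=> p _.
    have hc : (fun=> sph p) @ nbhs x --> sph p by exact: cvg_cst.
    have h := @cvg_P0 R _ (nbhs x) (nbhs_filter x) (fun=> sph p) id (sph p) x hc
      (@cvg_id _ (nbhs x)) (ball3_neq (enorm3_sph p) x1).
    have h2 := @cvg_cmul R _ (nbhs x) (nbhs_filter x) _ (g (sph p) * sigma_jac p) _ h.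
    have E z : g (sph p) * sigma_jac p * P0 (sph p) z = P0 (sph p) z * g (sph p) * sigma_jac p by ring.
    rewrite E in h2; apply: (@cvg_near_eq R _ (nbhs x) (nbhs_filter x) _ _ _ _ h2).
    by apply: nearW => z; rewrite /= E.
exact: (@cvg_cmul R _ (nbhs x) (nbhs_filter x) _ (4 * pi)^-1 _ H).
Qed.

Lemma PI2_harmonic g M (x : V3) : bmeas g M -> enorm3 x < 1 -> \sum_i PI2 g i i x = 0.
Proof.
move=> bg x1; have [xc c1] := mid_lt x1; set c := (_ + 1) / 2 in xc c1.
have b i : bmeas (fun eta => P2 eta i i x * g eta) (Kc c * M).
  by have [_ _ h] := bmeas_P i i (ltW xc) c1; exact: bmeas_mul.
rewrite 3!big_ord_recl big_ord0 addr0 /PI2 -2!mulrDr.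
have E : sint (fun eta => P2 eta ord0 ord0 x * g eta) + (sint (fun eta => P2 eta (lift ord0 ord0) (lift ord0 ord0) x * g eta) +
   sint (fun eta => P2 eta (lift ord0 (lift ord0 ord0)) (lift ord0 (lift ord0 ord0)) x * g eta)) = 0; last first.
  by rewrite E mulr0.
have bb : bmeas (fun eta => 1 * (P2 eta (lift ord0 ord0) (lift ord0 ord0) x * g eta) +
   1 * (P2 eta (lift ord0 (lift ord0 ord0)) (lift ord0 (lift ord0 ord0)) x * g eta)) (Kc c * M + Kc c * M).
  have [m1 h1] := b (lift ord0 ord0); have [m2 h2] := b (lift ord0 (lift ord0 ord0)).
  split; first by apply: measurable_funD; exact: measurable_funM.
  by move=> p; rewrite 2!mul1r; apply: (le_trans (ler_normD _ _)); exact: lerD.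
have := sint_lin 1 1 (b (lift ord0 ord0)) (b (lift ord0 (lift ord0 ord0))); rewrite 2!mul1r => <-.
have := sint_lin 1 1 (b ord0) bb; rewrite 2!mul1r => <-.
rewrite /sint; transitivity (Rintegral mu2 D (cst 0)); last by rewrite Rintegral_cst ?mul0r//; exact: measurable_param_rect.
apply: eq_Rintegral => p _.
have := @P0_harmonic R (sph p) x (enorm3_sph p) (ball3_neq (enorm3_sph p) x1).
rewrite 3!big_ord_recl big_ord0 addr0; set a := P2 _ _ _ _; set b' := P2 _ _ _ _; set d := P2 _ _ _ _ => h.
rewrite !mul1r -!mulrDl (_ : a + (b' + d) = 0) ?mul0r//.
Qed.

Lemma CkB_lipschitz n r (h : V3 -> R) : 1 < r -> CkB n.+1 r h -> exists2 L, 0 <= L &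
  forall x y, enorm3 x <= 1 -> enorm3 y <= 1 -> `|h y - h x| <= L * enorm3 (y - x).
Proof.
move=> r1 hC.
have H k := @CkB_bnd R n r (partial k h) 1 (CkB_partial k hC) r1.
have [A A0 HA] := H ord0; have [B B0 HB] := H (lift ord0 ord0); have [C C0 HC] := H (lift ord0 (lift ord0 ord0)).
exists (A + B + C) => [|x y x1 y1]; first by rewrite !addr_ge0.
have conv (t : R) : 0 <= t <= 1 -> enorm3 ((t * 1) *: (y - x) + x) <= 1.
  case/andP=> t0 t1; rewrite mulr1 (_ : t *: (y - x) + x = t *: y + (1 - t) *: x); last first.
    by apply/rowP => k; rewrite !mxE; ring.
  apply: (le_trans (enorm3D _ _)); rewrite !enorm3Z !ger0_norm ?subr_ge0//.
  have : t * enorm3 y <= t by rewrite ler_piMr.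
  have : (1 - t) * enorm3 x <= 1 - t by rewrite ler_piMr// subr_ge0.
  by set u := _ * enorm3 y; set w := _ * enorm3 x; clear; lra.
have := @mvt_line R h (fun z => \sum_k (y - x) 0 k * partial k h z) x (y - x) 1 ((A + B + C) * enorm3 (y - x)).
rewrite scale1r subrK normr1 mulr1; apply.
  by move=> t t01; apply: CkB_is_derive_dir hC _; exact: le_lt_trans (conv t t01) r1.
move=> t t01; have cz := conv t t01; set z := _ + x in cz *.
rewrite 3!big_ord_recl big_ord0 addr0.
have n3 k a' : `|partial k h z| <= a' -> `|(y - x) 0 k * partial k h z| <= enorm3 (y - x) * a'.
  by move=> ha; rewrite normrM; apply: ler_pM => //; exact: coord_le_enorm3.
apply: (le_trans (ler_normD _ _)).
apply: (le_trans (lerD (n3 _ _ (HA z cz)) (ler_normD _ _))).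
apply: (le_trans (lerD (lexx _) (lerD (n3 _ _ (HB z cz)) (n3 _ _ (HC z cz))))).
by rewrite le_eqVlt; apply/orP; left; apply/eqP; ring.
Qed.

Lemma CkB_bmeas n r (h : V3 -> R) : 1 < r -> CkB n r h -> exists M, bmeas h M.
Proof.
move=> r1 hC; have [M M0 HM] := @CkB_bnd R n r h 1 hC r1.
exists M; split; last by move=> p; apply: HM; rewrite enorm3_sph.
apply: continuous_measurable2 => p.
have pr : enorm3 (sph p) < r by rewrite enorm3_sph.
exact: (cvg_comp _ _ (@continuous_sph R p) (CkB_cont hC pr)).
Qed.

(* |P(x, eta)| |x - eta| is at most dl P(x, eta) near eta and (1 - |x|^2)/dl^2 away from it. *)
Lemma PI_boundary (h : V3 -> R) M (L : R) : bmeas h M -> 0 <= L ->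
  (forall x y, enorm3 x <= 1 -> enorm3 y <= 1 -> `|h y - h x| <= L * enorm3 (y - x)) ->
  forall x dl, 0 < dl -> enorm3 x < 1 ->
  `|h x - PI h x| <= L * (dl + (1 - enorm3 x ^+ 2) * dl^-1 ^+ 2).
Proof.
move=> bh L0 hL x dl dl0 x1.
have [xc c1] := mid_lt x1; set c := (_ + 1) / 2 in xc c1.
have [b0 _ _] := bmeas_P ord0 ord0 (ltW xc) c1; set K := 10 * _ in b0.
have pp : 0 < (4 * pi : R)^-1 by have /andP[] := @fourpi_inv R.
have pn : (4 * pi : R) != 0 by rewrite -invr_eq0 gt_eqF.
have q0 : 0 <= 1 - enorm3 x ^+ 2 by rewrite subr_ge0 expr_le1 ?enorm3_ge0// ltW.
have one : sint (fun=> 1 : R) = 4 * pi.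
  rewrite -(@sint_P0 R 0) ?enorm3_0//; apply: eq_Rintegral => p _.
  by rewrite /P0 /rho sub0r enorm3N enorm3_sph invr1 expr1n dot3E !mxE !mul0r !addr0 subr0 !mul1r.
have E : h x - PI h x = (4 * pi)^-1 * sint (fun eta => h x * P0 eta x + (-1) * (P0 eta x * h eta)).
  rewrite (sint_lin (h x) (-1) b0 (bmeas_mul b0 bh)) sint_P0// /PI.
  by move: (sint _) => S; move: (4 * pi : R) pn => a an; field.
have bf : bmeas (fun eta => h x * P0 eta x + (-1) * (P0 eta x * h eta)) (`|h x| * K + K * M).
  have [m1 h1] := b0; have [m2 h2] := bmeas_mul b0 bh.
  split; first by apply: measurable_funD; exact: measurable_funM.
  move=> p; apply: (le_trans (ler_normD _ _)); rewrite mulN1r normrN normrM; apply: lerD; last exact: h2.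
  by rewrite ler_wpM2l.
set Q := (1 - enorm3 x ^+ 2) * dl^-1 ^+ 2.
have Q0 : 0 <= Q by rewrite mulr_ge0// exprn_ge0// invr_ge0 ltW.
have bg : bmeas (fun eta => (L * dl) * P0 eta x + (L * Q) * 1) (`|L * dl| * K + `|L * Q| * 1).
  have [m1 h1] := b0.
  split; first by apply: measurable_funD => //; exact: measurable_funM.
  move=> p; apply: (le_trans (ler_normD _ _)); rewrite (normrM (L * dl)) (normrM (L * Q)) normr1; apply: lerD => //.
  by rewrite ler_wpM2l.
rewrite E normrM gtr0_norm//.
have key : `|sint (fun eta => h x * P0 eta x + (-1) * (P0 eta x * h eta))| <=
    sint (fun eta => (L * dl) * P0 eta x + (L * Q) * 1).
  apply: (sint_norm_le bf bg) => p.
  have xe := ball3_neq (enorm3_sph p) x1; have r0 := rho_gt0 xe.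
  set eta := sph p in xe r0 *.
  have P00 : 0 <= P0 eta x by rewrite /P0 -enorm3_sq mulr_ge0// exprn_ge0// ltW.
  have -> : h x * P0 eta x + -1 * (P0 eta x * h eta) = P0 eta x * (h x - h eta) by ring.
  rewrite normrM ger0_norm// mulr1.
  have e1 : enorm3 eta = 1 by exact: enorm3_sph.
  have hl := hL eta x ltac:(by rewrite e1) (ltW x1).
  apply: (@le_trans _ _ (P0 eta x * (L * enorm3 (x - eta)))); first by rewrite ler_wpM2l.
  have -> : P0 eta x * (L * enorm3 (x - eta)) = L * (P0 eta x * enorm3 (x - eta)) by ring.
  have -> : L * dl * P0 eta x + L * Q = L * (dl * P0 eta x + Q) by ring.
  rewrite ler_wpM2l//.
  have [N1|N1] := leP (enorm3 (x - eta)) dl.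
    apply: (@le_trans _ _ (P0 eta x * dl)); first by rewrite ler_wpM2l.
    by rewrite [P0 eta x * dl]mulrC lerDl.
  apply: (@le_trans _ _ Q); last by rewrite lerDr; apply: mulr_ge0 => //; exact: ltW.
  rewrite /P0 -enorm3_sq /Q -mulrA ler_wpM2l//.
  rewrite /rho in r0 *; set N := enorm3 (x - eta) in r0 N1 *.
  have N0 : 0 < N by rewrite -invr_gt0.
  rewrite (_ : N^-1 ^+ 3 * N = N^-1 ^+ 2); last by field; rewrite gt_eqF.
  by rewrite lerXn2r ?nnegrE ?invr_ge0 ?(ltW N0) ?(ltW dl0)// lef_pV2 ?posrE// ltW.
apply: (@le_trans _ _ ((4 * pi)^-1 * sint (fun eta => (L * dl) * P0 eta x + (L * Q) * 1))).
  by rewrite ler_wpM2l// ltW.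
rewrite (sint_lin (L * dl) (L * Q) b0 (bmeas_cst 1)) sint_P0// one.
by rewrite -mulrDl mulrCA mulVf// mulr1 mulrDr.
Qed.

(** The difference [h - PI h] is harmonic and tends to 0 uniformly at the sphere; the maximum
    principle applies to it and to its negative. *)
Lemma poisson_rep r (h : V3 -> R) : 1 < r -> CkB 2 r h ->
  (forall x, enorm3 x < 1 -> \sum_i partial i (partial i h) x = 0) ->
  forall x, enorm3 x < 1 -> h x = PI h x.
Proof.
move=> r1 hC hh.
have [M bh] := CkB_bmeas r1 hC; have [L L0 hL] := CkB_lipschitz r1 hC.
have bnd dl : 0 < dl -> exists2 r0 : R, r0 < 1 & forall x, r0 <= enorm3 x -> enorm3 x < 1 -> `|h x - PI h x| <= dl.
  move=> dl0; pose d := dl / (2 * (L + 1)).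
  have L1 : 0 < L + 1 by rewrite ltr_wpDl.
  have d0 : 0 < d by rewrite divr_gt0 ?mulr_gt0.
  (* Depth at most [d^3 / 2] makes [1 - |x|^2 <= d^3], so that both terms in [PI_boundary] are at
     most [L d]. *)
  pose k := d ^+ 3 / 2; have k0 : 0 < k by rewrite divr_gt0// exprn_gt0.
  exists (1 - Num.min k (1 / 2)) => [|x xr x1].
    by rewrite gtrBl lt_min k0 divr_gt0.
  apply: (le_trans (PI_boundary bh L0 hL d0 x1)).
  have x0 := enorm3_ge0 x.
  have q1 : 1 - enorm3 x ^+ 2 <= d ^+ 3.
    have : Num.min k (1 / 2) <= k by rewrite ge_min lexx.
    have -> : d ^+ 3 = k * 2 by rewrite /k divfK.
    move: xr x1 x0; set u := enorm3 x; set m := Num.min _ _; clear => h1 h2 h3 h4.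
    have : 1 - u ^+ 2 <= 2 * (1 - u) by have := sqr_ge0 (1 - u); rewrite sqrrB; lra.
    by lra.
  apply: (@le_trans _ _ (L * (d + d ^+ 3 * d^-1 ^+ 2))).
    by rewrite ler_wpM2l// lerD2l ler_wpM2r// exprn_ge0// invr_ge0 ltW.
  rewrite (_ : d ^+ 3 * d^-1 ^+ 2 = d); last by field; rewrite gt_eqF.
  have -> : dl = (L + 1) * (d + d) by rewrite /d; field; rewrite gt_eqF.
  by rewrite ler_wpM2r ?addr_ge0 ?(ltW d0)// lerDl.
have main (s : R) : s = 1 \/ s = -1 -> forall x, enorm3 x < 1 -> s * (h x - PI h x) <= 0.
  move=> hs.
  apply: (@max_principle (fun x => s * (h x - PI h x)) (fun i x => s * (partial i h x - PI1 h i x))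
    (fun i x => s * (partial i (partial i h) x - PI2 h i i x))).
  - move=> x x1.
    have c1 := CkB_cont hC (lt_trans x1 r1).
    have c2 := continuous_PI bh x1.
    have := @cvg_lin R _ (nbhs x) (nbhs_filter x) h (PI h) _ _ s (- s) c1 c2.
    have -> : (fun t => s * h t + - s * PI h t) = (fun x => s * (h x - PI h x)) by apply/funext => t; ring.
    by have -> : s * h x + - s * PI h x = s * (h x - PI h x) by ring.
  - move=> i x x1; have xr := lt_trans x1 r1.
    have [d1 d2] := is_derive_PI i i bh x1.
    have d3 := CkB_is_derive i hC xr; have d4 := CkB_is_derive i (CkB_partial i hC) xr.
    by split; apply: is_derive_eq; rewrite /GRing.scale /=; ring.
  - move=> x x1; rewrite -mulr_sumr sumrB; apply/eqP; rewrite mulf_eq0 subr_eq0; apply/orP; right; apply/eqP.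
    by apply: (etrans (hh x x1)); apply/esym; exact: (PI2_harmonic bh x1).
  - move=> dl dl0; have [r0 r01 H] := bnd dl dl0; exists r0 => // x xr x1.
    apply: le_trans (H x xr x1); apply: (le_trans (ler_norm _)); rewrite normrM.
    by case: hs => ->; rewrite ?normrN normr1 mul1r.
move=> x x1; apply/eqP; rewrite -subr_eq0 eq_le.
have := main 1 (or_introl erefl) x x1; rewrite mul1r => -> /=.
by have := main (-1) (or_intror erefl) x x1; rewrite mulN1r oppr_le0.
Qed.
End Harmonic.

(** Derivatives are asked for [t > 0] only, with right limits at 0: the integrals to come contain
    powers of [t] with non-integer exponent. *)
Lemma FTC_LR {R : realType} (f F : R -> R) :
  (forall t : R, 0 < t <= 1 -> is_derive t (1 : R) F (f t)) ->
  (forall t : R, 0 < t <= 1 -> {for t, continuous f}) ->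
  F @ 0^'+ --> F 0 -> f @ 0^'+ --> f 0 ->
  \int[@lebesgue_measure R]_(t in `[0, 1]) f t = F 1 - F 0.
Proof.
move=> dF cf F0 f0.
have cF (t : R) : 0 < t <= 1 -> {for t, continuous F}.
  by move=> t01; apply/differentiable_continuous/derivable1_diffP; have [] := dF t t01.
have t1 : 0 < (1 : R) <= 1 by rewrite ltr01 lexx.
have cwf : {within `[0, 1], continuous f}.
  apply/continuous_within_itvP => //; split => //.
    by move=> t; rewrite in_itv /= => /andP[t0 t1']; apply: cf; rewrite t0 ltW.
  exact: cvg_at_left_filter (cf 1 t1).
have H := @continuous_FTC2 R f F 0 1 ltr01 cwf _ _.
rewrite /Rintegral H //=.
- split => //; first by move=> t; rewrite in_itv /= => /andP[h1 h2]; have [] := dF t; rewrite ?h1 ?(ltW h2).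
  exact: cvg_at_left_filter (cF 1 t1).
- by move=> t; rewrite in_itv /= => /andP[h1 h2]; rewrite derive1E; have [] := dF t; rewrite ?h1 ?(ltW h2).
Qed.

Lemma integrable_addR {d} {T : measurableType d} {R : realType} (m : {measure set T -> \bar R})
  (A : set T) (f g : T -> R) : measurable A -> m.-integrable A (EFin \o f) -> m.-integrable A (EFin \o g) ->
  m.-integrable A (EFin \o (fun x => f x + g x)).
Proof.
move=> mA i1 i2; have := integrableD mA i1 i2; apply: eq_integrable => // x _.
Qed.

Section BallCalculus2.
Context {R : realType}.
Notation V3 := 'rV[R]_3.
Notation leb := (@lebesgue_measure R).

Lemma sum3E (F : 'I_3 -> R) :
  \sum_(k < 3) F k = F ord0 + F (lift ord0 ord0) + F (lift ord0 (lift ord0 ord0)).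
Proof. by rewrite 3!big_ord_recl big_ord0 addr0 addrA. Qed.

Lemma CkB_mul n r (f g : V3 -> R) : CkB n r f -> CkB n r g -> CkB n r (fun x => f x * g x).
Proof.
have cn (f' g' : V3 -> R) x : {for x, continuous f'} -> {for x, continuous g'} ->
    {for x, continuous (fun x => f' x * g' x)}.
  by move=> h1 h2; exact: (@cvgM _ _ (nbhs x) _ f' g' _ _ h1 h2).
elim: n f g => [|n IH] f g Hf Hg.
  by split=> // x xr; apply: cn; [exact: CkB_cont Hf xr|exact: CkB_cont Hg xr].
have dl i x : enorm3 x < r ->
    is_derive x (e3 R i) (fun x => f x * g x) (1 * (partial i f x * g x) + 1 * (f x * partial i g x)).
  move=> xr; have d1 := CkB_is_derive i Hf xr; have d2 := CkB_is_derive i Hg xr.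
  apply: is_derive_eq; rewrite /GRing.scale /=; ring.
split; first by move=> x xr; apply: cn; [exact: CkB_cont Hf xr|exact: CkB_cont Hg xr].
move=> i; split; first by move=> x xr; have [] := dl i x xr.
apply: (@CkB_eq _ n r (fun x => 1 * (partial i f x * g x) + 1 * (f x * partial i g x))).
  by move=> x xr; apply/esym/partial_val; exact: dl.
apply: CkB_lin.
  exact: IH (CkB_partial i Hf) (CkB_S Hg).
exact: IH (CkB_S Hf) (CkB_partial i Hg).
Qed.

Lemma CkB_cst n r (k : R) : CkB n r (fun=> k).
Proof.
elim: n k => [|n IH] k; split => //; try by move=> x _; exact: cst_continuous.
move=> i; split; first by move=> x _; exact: derivable_cst.
by rewrite (_ : partial i _ = fun=> 0)//; apply/funext => x; rewrite /partial derive_cst.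
Qed.

Lemma CkB_coord n r i : CkB n r (fun x : V3 => x 0 i).
Proof.
have c1 x : {for x, continuous (fun x : V3 => x 0 i)} by exact: coord_continuous.
case: n => [|n]; split => //; move=> j; split; first by move=> x _; have [] := is_derive_coord x (e3 R j) i.
rewrite (_ : partial j _ = fun=> (e3 R j) 0 i); first exact: CkB_cst.
by apply/funext => x; apply: partial_val; exact: is_derive_coord.
Qed.

Lemma CkB_depth n r : CkB n r (fun x : V3 => 1 - enorm3 x ^+ 2).
Proof.
rewrite (_ : (fun x => _) = fun x : V3 => 1 * (1 * (fun=> 1) x + (-1) * (x 0 ord0 * x 0 ord0)) +
    (-1) * (1 * (x 0 (lift ord0 ord0) * x 0 (lift ord0 ord0)) +
     1 * (x 0 (lift ord0 (lift ord0 ord0)) * x 0 (lift ord0 (lift ord0 ord0))))).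
  have C j := CkB_mul (CkB_coord n r j) (CkB_coord n r j).
  apply: (CkB_lin 1 (-1)); apply: CkB_lin => //; exact: CkB_cst.
by apply/funext => x; rewrite enorm3_sq /dot3 sum3E; ring.
Qed.

Lemma is_derive_depth (x : V3) j : is_derive x (e3 R j) (fun x : V3 => 1 - enorm3 x ^+ 2) (- (2 * x 0 j)).
Proof.
have -> : (fun x : V3 => 1 - enorm3 x ^+ 2) = fun x => 1 - dot3 x x by apply/funext => y; rewrite enorm3_sq.
by have d := is_derive_dot3 x j; apply: is_derive_eq; rewrite add0r.
Qed.

Lemma partial2_val r (h h1 : V3 -> R) i j x d : enorm3 x < r ->
  (forall y, enorm3 y < r -> is_derive y (e3 R j) h (h1 y)) -> is_derive x (e3 R i) h1 d ->
  partial i (partial j h) x = d.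
Proof.
move=> xr hd dd; apply: etrans (partial_val dd); apply: (partial_eq i xr) => y yr.
exact: partial_val (hd y yr).
Qed.

Lemma is_derive_ray (g : V3 -> R) (x : V3) (t d : R) : is_derive (t *: x) x g d ->
  is_derive t (1 : R) (fun t : R => g (t *: x)) d.
Proof.
have -> : t *: x = t *: x + 0 by rewrite addr0.
move=> /derive_line h.
by rewrite (_ : (fun t : R => g (t *: x)) = fun t : R => g (t *: x + 0))//; apply/funext => s; rewrite addr0.
Qed.

(** The integral over [s] of [k s^m g(s^2 x)]. With [s^2] as ray parameter all weights stay integer
    powers, and a derivative raises [m] by two. *)
Definition mavg (k : R) (m : nat) : (V3 -> R) -> V3 -> R :=
  avg (fun s => s ^+ 2) (fun=> 0) (fun s => k * s ^+ m).

Lemma mavg_hyps k m : [/\ continuous (fun s : R => s ^+ 2), continuous ((fun=> 0) : R -> V3),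
  (forall s : R, 0 <= s <= 1 -> `|s ^+ 2| <= 1),
  (forall s : R, 0 <= s <= 1 -> enorm3 (0 : V3) <= 0) &
  continuous (fun s : R => k * s ^+ m) /\ forall s : R, 0 <= s <= 1 -> `|k * s ^+ m| <= `|k|].
Proof.
have e1 (s : R) n : 0 <= s <= 1 -> `|s ^+ n| <= 1.
  by move=> /andP[s0 s1]; rewrite ger0_norm ?exprn_ge0// exprn_ile1.
split => //.
- exact: exprn_continuous.
- by move=> x; exact: cvg_cst.
- by move=> s s01; exact: e1.
- by move=> s _; rewrite enorm3_0.
- split; first by move=> x; apply: cvg_cmul; exact: exprn_continuous.
  by move=> s s01; rewrite normrM ler_piMr// e1.
Qed.

Lemma mavg_CkB k m n r g : CkB n r g -> CkB n r (mavg k m g).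
Proof.
move=> gC; have [h1 h2 h3 h4 [h5 h6]] := mavg_hyps k m.
by rewrite -[r]subr0; exact: (@avg_CkB R _ _ 0 h1 h2 h3 h4 _ _ _ _ _ h5 h6 gC).
Qed.

Lemma eq_mavg k m r f g x : enorm3 x < r -> (forall y, enorm3 y < r -> f y = g y) -> mavg k m f x = mavg k m g x.
Proof.
move=> xr fg; apply: eq_Rintegral => s; rewrite inE => /itv01P s01; rewrite fg// addr0.
apply: le_lt_trans xr; rewrite enorm3Z ler_piMl ?enorm3_ge0//.
by have [_ _ h3 _ _] := mavg_hyps k m; exact: h3.
Qed.

Lemma is_derive_mavg k m n r g g1 x i : CkB n.+1 r g ->
  (forall y, enorm3 y < r -> is_derive y (e3 R i) g (g1 y)) -> enorm3 x < r ->
  is_derive x (e3 R i) (mavg k m g) (mavg k m.+2 g1 x).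
Proof.
move=> gC g1E xr; have [h1 h2 h3 h4 [h5 h6]] := mavg_hyps k m.
have xr0 : enorm3 x < r - 0 by rewrite subr0.
have := @is_derive_avg R _ _ 0 h1 h2 h3 h4 _ _ _ _ _ _ i h5 h6 gC xr0.
move=> d; apply: (is_derive_eq d).
rewrite (_ : (fun s : R => k * s ^+ m * s ^+ 2) = fun s => k * s ^+ m.+2); last first.
  by apply/funext => s; rewrite -mulrA -exprD addn2.
by apply: (eq_mavg _ _ xr) => y yr; apply: partial_val; exact: g1E.
Qed.

Lemma integrable_mavg k m r g x : CkB 0 r g -> enorm3 x < r ->
  leb.-integrable `[0, 1] (EFin \o (fun s : R => k * s ^+ m * g (s ^+ 2 *: x + 0))).
Proof.
move=> gC xr; have [h1 h2 h3 h4 [h5 h6]] := mavg_hyps k m.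
have xr0 : enorm3 x < r - 0 by rewrite subr0.
have [M M0 HM] := @avg_bounded R _ _ 0 h3 h4 _ _ _ _ _ _ h6 gC xr0.
apply: (@integrable_bnd _ _ _ _ _ _ M) => //; first exact: leb_cc_fin.
  exact: (@avg_measurable R _ _ 0 h1 h2 h3 h4 _ _ _ _ _ h5 gC xr0).
by move=> s /itv01P s01; exact: HM.
Qed.

Lemma mavg_sum k m r (F : 'I_3 -> V3 -> R) (a : 'I_3 -> R) x : (forall j, CkB 0 r (F j)) -> enorm3 x < r ->
  \sum_j a j * mavg k m (F j) x = mavg k m (fun y => \sum_j a j * F j y) x.
Proof.
move=> FC xr; have I j := integrable_mavg k m (FC j) xr.
have mI : measurable (`[0, 1]%classic : set R) by exact: measurable_itv.
have J j : leb.-integrable `[0, 1] (EFin \o (fun s : R => a j * (k * s ^+ m * F j (s ^+ 2 *: x + 0)))).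
  by apply: integrable_cstM => //; exact: I.
rewrite sum3E /mavg /avg -!RintegralZl//.
have J12 : leb.-integrable `[0, 1] (EFin \o (fun s : R => a ord0 * (k * s ^+ m * F ord0 (s ^+ 2 *: x + 0)) +
    a (lift ord0 ord0) * (k * s ^+ m * F (lift ord0 ord0) (s ^+ 2 *: x + 0)))).
  exact: integrable_addR.
rewrite -RintegralD// -RintegralD//.
by apply: eq_Rintegral => s _; rewrite sum3E; ring.
Qed.

Lemma mavg0 k m r g x : enorm3 x < r -> (forall y, enorm3 y < r -> g y = 0) -> mavg k m g x = 0.
Proof.
move=> xr g0; rewrite (eq_mavg k m xr g0) /mavg /avg.
have -> : (fun s : R => k * s ^+ m * 0) = cst 0 by apply/funext => s; rewrite mulr0.
by rewrite Rintegral_cst ?mul0r//; exact: measurable_itv.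
Qed.

(** Integrate the derivative of [s^3 g(s^2 x)] over [[0, 1]]. For [Ps = mavg (1/2) 2 g] this says
    [6 Ps + 4 (x . grad) Ps = g]; when [Ps] is harmonic, the left side is minus the Laplacian of
    [(1 - |x|^2) Ps]. *)
Lemma mavg_ode r g g1 x : CkB 1 r g ->
  (forall j y, enorm3 y < r -> is_derive y (e3 R j) g (g1 j y)) -> (forall j, CkB 0 r (g1 j)) ->
  enorm3 x < r ->
  6 * mavg (1 / 2) 2 g x + 4 * \sum_j x 0 j * mavg (1 / 2) 4 (g1 j) x = g x.
Proof.
move=> gC g1E g1C xr.
have sr (s : R) : 0 <= s <= 1 -> enorm3 (s ^+ 2 *: x) < r.
  move=> s01; apply: le_lt_trans xr; rewrite enorm3Z ler_piMl ?enorm3_ge0//.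
  by have [_ _ h3 _ _] := mavg_hyps 1 1; exact: h3.
have gx1C : CkB 0 r (fun y => \sum_j x 0 j * g1 j y).
  rewrite (_ : (fun y => _) = fun y => 1 * (x 0 ord0 * g1 ord0 y + x 0 (lift ord0 ord0) * g1 (lift ord0 ord0) y)
      + x 0 (lift ord0 (lift ord0 ord0)) * g1 (lift ord0 (lift ord0 ord0)) y).
    by apply: CkB_lin => //; exact: CkB_lin.
  by apply/funext => y; rewrite sum3E mul1r.
rewrite (mavg_sum _ _ _ g1C xr).
have mI : measurable (`[0, 1]%classic : set R) by exact: measurable_itv.
have I1 : leb.-integrable `[0, 1] (EFin \o (fun s : R => 6 * (1 / 2 * s ^+ 2 * g (s ^+ 2 *: x + 0)))).
  by apply: integrable_cstM => //; exact: integrable_mavg (CkB_S gC) xr.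
have I2 : leb.-integrable `[0, 1] (EFin \o (fun s : R => 4 * (1 / 2 * s ^+ 4 * \sum_j x 0 j * g1 j (s ^+ 2 *: x + 0)))).
  by apply: integrable_cstM => //; exact: integrable_mavg gx1C xr.
have cp (s : R) : {for s, continuous (fun s : R => s ^+ 2 *: x)}.
  by apply: cvgZ; [exact: exprn_continuous|exact: cvg_cst].
have ct (f : V3 -> R) (s : R) : CkB 0 r f -> 0 <= s <= 1 -> {for s, continuous (fun s : R => f (s ^+ 2 *: x))}.
  by move=> fC s01; exact: (cvg_comp _ _ (cp s) (CkB_cont fC (sr s s01))).
have dF (s : R) : 0 <= s <= 1 -> is_derive s (1 : R) (fun s : R => s ^+ 3 * g (s ^+ 2 *: x))
   (3 * s ^+ 2 * g (s ^+ 2 *: x) + 2 * s ^+ 4 * \sum_j x 0 j * g1 j (s ^+ 2 *: x)).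
  move=> s01.
  have dg : is_derive (s ^+ 2 *: x) x g (\sum_j x 0 j * g1 j (s ^+ 2 *: x)).
    apply: (is_derive_eq (CkB_is_derive_dir x gC (sr s s01))).
    by apply: eq_bigr => j _; rewrite (partial_val (g1E j _ (sr s s01))).
  move/is_derive_ray : dg => dg.
  have d2 : is_derive s (1 : R) (fun s : R => s ^+ 2) (2 * s).
    by apply: is_derive_eq; rewrite /GRing.scale /=; ring.
  have d3 := @is_derive1_comp _ (fun u => g (u *: x)) (fun t => t ^+ 2) s _ _ dg d2.
  have d3' : is_derive s (1 : R) (fun s : R => g (s ^+ 2 *: x)) ((\sum_j x 0 j * g1 j (s ^+ 2 *: x)) * (2 * s)) := d3.
  by apply: is_derive_eq; rewrite /GRing.scale /=; ring.
have cF (s : R) : 0 <= s <= 1 -> {for s, continuous (fun s : R => 3 * s ^+ 2 * g (s ^+ 2 *: x) + 2 * s ^+ 4 * \sum_j x 0 j * g1 j (s ^+ 2 *: x))}.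
  move=> s01; apply: cvgD; apply: cvgM.
  - by apply: cvg_cmul; exact: exprn_continuous.
  - exact: (ct g s (CkB_S gC) s01).
  - by apply: cvg_cmul; exact: exprn_continuous.
  - exact: (ct _ s gx1C s01).
have := FTC_cc ltr01 dF cF; rewrite !expr1n scale1r mul1r expr0n mul0r subr0 => <-.
rewrite /mavg /avg -!RintegralZl ?mI//;
  [|exact: (integrable_mavg _ _ gx1C xr)|exact: (integrable_mavg _ _ (CkB_S gC) xr)].
rewrite -RintegralD//.
by apply: eq_Rintegral => s _; rewrite addr0; field.
Qed.
End BallCalculus2.

(** * The elastic Poisson representation *)

Section Representation.
Context {R : realType}.
Notation V3 := 'rV[R]_3.
Notation leb := (@lebesgue_measure R).
Variables lam mu : R.
Hypotheses (mu0 : 0 < mu) (lm0 : 0 < 2 * mu + lam).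
Notation al := (alpha_c lam mu).
Notation be := (beta_c lam mu).

Let l3 : 0 < lam + 3 * mu. Proof. by move: mu0 lm0; lra. Qed.
Let l6 : 0 < 2 * lam + 6 * mu. Proof. by move: mu0 lm0; lra. Qed.

Section Potential.
Variables (r : R) (w g : 'I_3 -> V3 -> R) (W1 G1 : 'I_3 -> 'I_3 -> V3 -> R)
  (W2 G2 : 'I_3 -> 'I_3 -> 'I_3 -> V3 -> R).
Hypotheses (r1 : 1 < r) (wC : forall i, CkB 2 r (w i)) (gC : forall i, CkB 2 r (g i)).
Hypotheses (W2C : forall k j i, CkB 0 r (W2 k j i))
  (G1C : forall j i, CkB 1 r (G1 j i)) (G2C : forall k j i, CkB 0 r (G2 k j i)).
Hypothesis dw : forall i j x, enorm3 x < r -> is_derive x (e3 R j) (w i) (W1 j i x).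
Hypothesis dW : forall i j k x, enorm3 x < r -> is_derive x (e3 R k) (W1 j i) (W2 k j i x).
Hypothesis dg : forall i j x, enorm3 x < r -> is_derive x (e3 R j) (g i) (G1 j i x).
Hypothesis dG : forall i j k x, enorm3 x < r -> is_derive x (e3 R k) (G1 j i) (G2 k j i x).
Notation kap := ((lam + mu) / mu).
Hypothesis lapw : forall i x, enorm3 x < r -> \sum_j W2 j j i x = - kap * g i x.
Hypothesis divw : forall i x, enorm3 x < r -> \sum_j W2 i j j x = g i x.
Hypothesis lapg : forall i x, enorm3 x < r -> \sum_j G2 j j i x = 0.
Hypothesis curlg : forall i j x, enorm3 x < r -> G1 j i x = G1 i j x.
Hypothesis divg : forall x, enorm3 x < r -> \sum_j G1 j j x = 0.
Hypothesis ddivg : forall i x, enorm3 x < r -> \sum_j G2 i j j x = 0.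

(* Ps is the gradient of (1/2) int_0^1 theta(s^2 x) ds, where g is the gradient of theta; the factor is
   chosen so that the Laplacian of (1 - |x|^2) Ps is - g. *)
Let Ps i := mavg (1 / 2) 2 (g i).
Let Ps1 j i := mavg (1 / 2) 4 (G1 j i).
Let Ps2 k j i := mavg (1 / 2) 6 (G2 k j i).
Let q (x : V3) : R := 1 - enorm3 x ^+ 2.

Lemma dPs i j x : enorm3 x < r -> is_derive x (e3 R j) (Ps i) (Ps1 j i x).
Proof. by move=> xr; exact: (is_derive_mavg _ _ (gC i) (dg i j) xr). Qed.

Lemma dPs1 i j k x : enorm3 x < r -> is_derive x (e3 R k) (Ps1 j i) (Ps2 k j i x).
Proof. by move=> xr; exact: (is_derive_mavg _ _ (G1C j i) (dG i j k) xr). Qed.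

Let sum1 (F : 'I_3 -> R) : \sum_j F j = \sum_j 1 * F j.
Proof. by apply: eq_bigr => j _; rewrite mul1r. Qed.

Lemma Ps_lap i x : enorm3 x < r -> \sum_j Ps2 j j i x = 0.
Proof.
move=> xr; rewrite sum1 /Ps2 (mavg_sum _ _ _ (fun j => G2C j j i) xr).
by apply: (mavg0 _ _ xr) => y yr; rewrite -sum1 lapg.
Qed.

Lemma Ps_div x : enorm3 x < r -> \sum_j Ps1 j j x = 0.
Proof.
move=> xr; rewrite sum1 /Ps1 (mavg_sum _ _ _ (fun j => CkB_S (G1C j j)) xr).
by apply: (mavg0 _ _ xr) => y yr; rewrite -sum1 divg.
Qed.

Lemma Ps_ddiv i x : enorm3 x < r -> \sum_j Ps2 i j j x = 0.
Proof.
move=> xr; rewrite sum1 /Ps2 (mavg_sum _ _ _ (fun j => G2C i j j) xr).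
by apply: (mavg0 _ _ xr) => y yr; rewrite -sum1 ddivg.
Qed.

Lemma Ps_sym i j x : enorm3 x < r -> Ps1 j i x = Ps1 i j x.
Proof. by move=> xr; apply: (eq_mavg _ _ xr) => y yr; exact: curlg. Qed.

Lemma Ps_ode i x : enorm3 x < r -> 6 * Ps i x + 4 * \sum_j x 0 j * Ps1 j i x = g i x.
Proof. by move=> xr; exact: (mavg_ode (CkB_S (gC i)) (dg i) (fun j => CkB_S (G1C j i)) xr). Qed.

(** The correction carries the factor [q], which vanishes on the sphere, so [h] and [w] have the
    same boundary values; [h1] and [h2] are the derivatives given by Leibniz' rule. *)
Let h i x := w i x - kap * (q x * Ps i x).
Let h1 j i x := W1 j i x - kap * (- (2 * x 0 j) * Ps i x + q x * Ps1 j i x).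
Let h2 k j i x := W2 k j i x - kap * (- (2 * (k == j)%:R) * Ps i x - 2 * x 0 j * Ps1 k i x
   - 2 * x 0 k * Ps1 j i x + q x * Ps2 k j i x).

Lemma CkB_corr n (f : V3 -> R) (W : V3 -> R) : CkB n r f -> CkB n r W -> CkB n r (fun x => W x - kap * (q x * f x)).
Proof.
move=> fC WC; rewrite (_ : (fun x => _) = fun x => 1 * W x + (- kap) * (q x * f x)).
  by apply: CkB_lin => //; apply: CkB_mul => //; exact: CkB_depth.
by apply/funext => x; rewrite mul1r mulNr.
Qed.

Lemma hC i : CkB 2 r (h i).
Proof. by apply: CkB_corr => //; exact: mavg_CkB. Qed.

Lemma dh i j x : enorm3 x < r -> is_derive x (e3 R j) (h i) (h1 j i x).
Proof.
move=> xr; have d1 := dw i j xr; have d2 := dPs i j xr; have d3 : is_derive x (e3 R j) q _ := is_derive_depth x j.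
apply: is_derive_eq; rewrite /h1 /GRing.scale /=; ring.
Qed.

Lemma dh1 i j k x : enorm3 x < r -> is_derive x (e3 R k) (h1 j i) (h2 k j i x).
Proof.
move=> xr; have d1 := dW i j k xr; have d2 := dPs i k xr; have d3 : is_derive x (e3 R k) q _ := is_derive_depth x k.
have d4 := dPs1 i j k xr; have d5 := is_derive_coord x (e3 R k) j.
have e : (e3 R k) 0 j = (k == j)%:R by rewrite /e3 mxE eqxx eq_sym.
rewrite e in d5.
apply: is_derive_eq; rewrite /h2 /GRing.scale /=; ring.
Qed.

Lemma h_harmonic i x : enorm3 x < 1 -> \sum_j partial j (partial j (h i)) x = 0.
Proof.
move=> x1; have xr := lt_trans x1 r1.
transitivity (\sum_j h2 j j i x).
  by apply: eq_bigr => j _; exact: (partial2_val xr (fun y yr => dh i j yr) (dh1 i j j xr)).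
have e1 := lapw i xr; have e2 := Ps_lap i xr; have e3 := Ps_ode i xr.
move: e1 e2 e3; rewrite !sum3E /h2 !eqxx => e1 e2 e3.
set A := W2 ord0 ord0 i x in e1 *; set B := W2 _ _ i x in e1 *; set C := W2 _ _ i x in e1 *.
have -> : C = - kap * g i x - A - B by rewrite -e1; ring.
set A' := Ps2 ord0 ord0 i x in e2 *; set B' := Ps2 _ _ i x in e2 *; set C' := Ps2 _ _ i x in e2 *.
have -> : C' = - A' - B' by rewrite -[LHS](subr0) -e2; ring.
rewrite (_ : (true%:R : R) = 1)// -e3; ring.
Qed.

(** [Ps] is divergence free, and being curl free it lets [x_j d_i Ps_j] be replaced by
    [x_j d_j Ps_i]. So [grad div h] becomes a first order operator along rays applied to [Ps], which
    can be integrated. *)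
Lemma h_graddiv i x : enorm3 x < r ->
  \sum_j h2 i j j x = (6 + 2 * kap) * Ps i x + (4 + 2 * kap) * \sum_j x 0 j * Ps1 j i x.
Proof.
move=> xr; have e1 := divw i xr; have e2 := Ps_ddiv i xr; have e3 := Ps_ode i xr; have e4 := Ps_div xr.
have dk : \sum_j (i == j)%:R * Ps j x = Ps i x.
  by rewrite (bigD1 i)//= eqxx mul1r big1 ?addr0// => j ji; rewrite eq_sym (negPf ji) mul0r.
transitivity (\sum_j W2 i j j x - kap * (-2 * (\sum_j (i == j)%:R * Ps j x) - 2 * (\sum_j x 0 j * Ps1 i j x)
   - 2 * x 0 i * (\sum_j Ps1 j j x) + q x * \sum_j Ps2 i j j x)).
  by rewrite !sum3E /h2; ring.
rewrite dk e1 e2 e4 -e3.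
have -> : \sum_j x 0 j * Ps1 i j x = \sum_j x 0 j * Ps1 j i x.
  by apply: eq_bigr => j _; rewrite Ps_sym.
by set D := \sum_j _; ring.
Qed.
Lemma PI_sphere (f1 f2 : V3 -> R) x : (forall y, enorm3 y = 1 -> f1 y = f2 y) -> PI f1 x = PI f2 x.
Proof.
move=> e; rewrite /PI; congr (_ * _); apply: eq_Rintegral => p _; rewrite e//; exact: enorm3_sph.
Qed.
Lemma h_PI i x : enorm3 x < 1 -> h i x = PI (w i) x.
Proof.
move=> x1; rewrite (poisson_rep r1 (hC i) (fun y y1 => h_harmonic i y1) x1).
by apply: PI_sphere => y y1; rewrite /h /q y1 expr1n subrr mul0r mulr0 subr0.
Qed.

Lemma bw i : exists M, bmeas (w i) M.
Proof. exact: CkB_bmeas r1 (wC i). Qed.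

(** Since [h] is the Poisson integral of [w], its second derivatives are integrals of [P2] against
    the boundary values of [w]; through them the L-part of the kernel enters. *)
Lemma h2_PI2 i j k x : enorm3 x < 1 -> h2 k j i x = PI2 (w i) k j x.
Proof.
move=> x1; have [M b] := bw i; have xr := lt_trans x1 r1.
have e1 := partial2_val xr (fun y yr => dh i j yr) (dh1 i j k xr).
have [_ d2] := is_derive_PI k j b x1.
have e2 := partial2_val x1 (fun y yr => (is_derive_PI k j b yr).1) d2.
rewrite -e1 -e2; apply: (partial_eq k x1) => y y1; apply: (partial_eq j y1) => z z1.
exact: h_PI.
Qed.

(** Continuity is read off from the explicit form of [h2], without another passage to the limit
    under the integral. *)
Lemma PI2C i j k : CkB 0 1 (PI2 (w i) k j).
Proof.
apply: (@CkB_eq _ 0 1 (h2 k j i)); first by move=> x x1; exact: h2_PI2.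
apply: (@CkB_sub _ 0 r) => //; first exact: ltW.
split => // x xr.
have c1 := CkB_cont (W2C k j i) xr.
have c2 := CkB_cont (mavg_CkB (1 / 2) 2 (gC i)) xr.
have c3 a := CkB_cont (mavg_CkB (1 / 2) 4 (G1C a i)) xr.
have c4 := CkB_cont (mavg_CkB (1 / 2) 6 (G2C k j i)) xr.
have c5 a := CkB_cont (CkB_coord 0 r a) xr.
have c6 := CkB_cont (CkB_depth 0 r) xr.
have cM (a b : V3 -> R) : {for x, continuous a} -> {for x, continuous b} -> {for x, continuous (fun x => a x * b x)}.
  by move=> ca cb; exact: (@cvgM _ _ (nbhs x) _ a b _ _ ca cb).
have cL (a b : V3 -> R) (s t : R) : {for x, continuous a} -> {for x, continuous b} -> {for x, continuous (fun x => s * a x + t * b x)}.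
  by move=> ca cb; exact: (@cvg_lin _ _ (nbhs x) _ a b _ _ s t ca cb).
rewrite (_ : h2 k j i = fun x => 1 * W2 k j i x + (- kap) *
   (1 * (- (2 * (k == j)%:R) * Ps i x + (-2) * (x 0 j * Ps1 k i x)) + 1 * ((-2) * (x 0 k * Ps1 j i x) + 1 * (q x * Ps2 k j i x)))).
  apply: (cL _ _ _ _ c1); apply: (cL (fun x => - (2 * (k == j)%:R) * Ps i x + (-2) * (x 0 j * Ps1 k i x))
    (fun x => (-2) * (x 0 k * Ps1 j i x) + 1 * (q x * Ps2 k j i x))).
    by apply: (cL _ _ _ _ c2); exact: (cM _ _ (c5 j) (c3 k)).
  by apply: cL; [exact: (cM _ _ (c5 k) (c3 j))|exact: (cM _ _ c6 c4)].
by apply/funext => y; rewrite /h2; ring.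
Qed.

Lemma PI2_ray_cont i j k x (t : R) : enorm3 x < 1 -> 0 <= t <= 1 -> {for t, continuous (fun t : R => PI2 (w i) k j (t *: x))}.
Proof.
move=> x1 t01; have cp : {for t, continuous (fun t : R => t *: x)} by apply: cvgZ; [exact: cvg_id|exact: cvg_cst].
by apply: (cvg_comp _ _ cp (CkB_cont (PI2C i j k) _)); apply: le_lt_trans x1; apply: enorm3_scale_le.
Qed.
Let ka : 0 < 4 + 2 * kap.
Proof.
have -> : 4 + 2 * kap = (2 * (2 * mu + lam) + 2 * mu) / mu by field; rewrite gt_eqF.
by rewrite divr_gt0// addr_gt0// mulr_gt0.
Qed.

(* The integrand is the derivative of t^(2 - alpha) Ps(t x), by [h_graddiv] and [h2_PI2]. *)
Lemma Ps_integral i x : enorm3 x < 1 ->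
  (4 + 2 * kap) * Ps i x = \int[leb]_(t in `[0, 1]) (t `^ (1 - al) * \sum_j PI2 (w j) i j (t *: x)).
Proof.
move=> x1; have xr := lt_trans x1 r1.
have /andP[al0 al1] : 0 < al < 1 by exact: alpha_bnd.
have a0 : 0 < 1 - al by rewrite subr_gt0.
have a20 : 0 < 2 - al by rewrite subr_gt0 (lt_trans al1)// ltr1n.
(* The origin of [alpha]: with this identity the right side of [h_graddiv] at [t x] is
   [t^(alpha - 1)] times the derivative in [t] of [(4 + 2 kap) t^(2 - alpha) Ps(t x)]. *)
have bE : (2 - al) * (4 + 2 * kap) = 6 + 2 * kap.
  rewrite /alpha_c; field; rewrite (gt_eqF mu0) /= gt_eqF//.
pose S t := \sum_j PI2 (w j) i j (t *: x).
have cS (t : R) : 0 <= t <= 1 -> {for t, continuous S}.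
  move=> t01; rewrite /S (_ : (fun t => _) = fun t => PI2 (w ord0) i ord0 (t *: x) + PI2 (w (lift ord0 ord0)) i (lift ord0 ord0) (t *: x)
    + PI2 (w (lift ord0 (lift ord0 ord0))) i (lift ord0 (lift ord0 ord0)) (t *: x)).
    by apply: cvgD; [apply: cvgD|]; exact: PI2_ray_cont.
  by apply/funext => s; rewrite sum3E.
have SE (t : R) : 0 <= t <= 1 -> S t = (6 + 2 * kap) * Ps i (t *: x) + (4 + 2 * kap) * (t * \sum_j x 0 j * Ps1 j i (t *: x)).
  move=> t01; have tx : enorm3 (t *: x) < 1 by apply: le_lt_trans x1; apply: enorm3_scale_le.
  rewrite /S -(eq_bigr _ (fun j _ => h2_PI2 j j i tx)) (h_graddiv i (lt_trans tx r1)).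
  by congr (_ + _ * _); rewrite mulr_sumr; apply: eq_bigr => j _; rewrite mxE mulrA.
have cPs (t : R) : 0 <= t <= 1 -> {for t, continuous (fun t : R => Ps i (t *: x))}.
  move=> t01; have cp : {for t, continuous (fun t : R => t *: x)} by apply: cvgZ; [exact: cvg_id|exact: cvg_cst].
  apply: (cvg_comp _ _ cp (CkB_cont (mavg_CkB (1 / 2) 2 (gC i)) _)); apply: le_lt_trans xr.
  by apply: enorm3_scale_le.
have pc (t e : R) : 0 < t -> {for t, continuous (fun t : R => t `^ e)}.
  by move=> t0; apply/differentiable_continuous/derivable1_diffP; have [] := is_derive1_powR e t0.
have := @FTC_LR R (fun t => t `^ (1 - al) * S t) (fun t => (4 + 2 * kap) * (t `^ (2 - al) * Ps i (t *: x))).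
rewrite powR1 scale1r mul1r powR0 ?mul0r ?mulr0 ?subr0; last by rewrite gt_eqF.
rewrite powR0 ?mul0r ?gt_eqF//.
move=> HH; apply/esym/HH => [t /andP[t0 t1]|t /andP[t0 t1]||].
- have t01 : 0 <= t <= 1 by rewrite (ltW t0).
  have tr : enorm3 (t *: x) < r by apply: le_lt_trans xr; apply: enorm3_scale_le.
  have d1 : is_derive t (1 : R) (fun t : R => Ps i (t *: x)) (\sum_j x 0 j * Ps1 j i (t *: x)).
    apply: is_derive_ray; apply: (is_derive_eq (CkB_is_derive_dir x (CkB_S (mavg_CkB (1 / 2) 2 (gC i))) tr)).
    by apply: eq_bigr => j _; congr (_ * _); exact: (partial_val (dPs i j tr)).
  have d2 := is_derive1_powR (2 - al) t0.
  rewrite (_ : 2 - al - 1 = 1 - al) in d2; last by ring.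
  have -> : t `^ (1 - al) * S t = (4 + 2 * kap) * ((2 - al) * t `^ (1 - al) * Ps i (t *: x) + t `^ (2 - al) * \sum_j x 0 j * Ps1 j i (t *: x)).
    have -> : t `^ (2 - al) = t `^ (1 - al) * t.
      by rewrite (_ : 2 - al = (1 - al) + 1); [rewrite powRD ?powRr1 ?(ltW t0)// (gt_eqF t0) implybT|ring].
    by rewrite (SE t t01) -bE; ring.
  by apply: is_derive_eq; rewrite /GRing.scale /=; ring.
- have t01 : 0 <= t <= 1 by rewrite (ltW t0).
  by apply: cvgM; [exact: pc|exact: cS].
- have z01 : 0 <= (0 : R) <= 1 by rewrite lexx ler01.
  have c0 := cvg_at_right_filter (cPs 0 z01).
  have p0 : t `^ (2 - al) @[t --> (0:R)^'+] --> (0 : R) by exact: powR_cvg0.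
  have pM := @cvgM _ _ ((0 : R)^'+) _ (fun t : R => t `^ (2 - al)) (fun t : R => Ps i (t *: x)) _ _ p0 c0.
  have H := @cvg_cmul _ _ ((0 : R)^'+) _ (fun t : R => t `^ (2 - al) * Ps i (t *: x)) (4 + 2 * kap) _ (pM _).
  by move: H; rewrite mul0r mulr0; exact.
- have z01 : 0 <= (0 : R) <= 1 by rewrite lexx ler01.
  have c0 := cvg_at_right_filter (cS 0 z01).
  have p0 : t `^ (1 - al) @[t --> (0:R)^'+] --> (0 : R) by exact: powR_cvg0.
  have H := @cvgM _ _ ((0 : R)^'+) _ (fun t : R => t `^ (1 - al)) S _ _ p0 c0 _.
  by move: H; rewrite mul0r; exact.
Qed.

Lemma potential_rep i x : enorm3 x < 1 ->
  w i x = \sum_j sint (fun eta => Pe lam mu x eta i j * w j eta).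
Proof.
move=> x1.
have mI : measurable (`[0, 1]%classic : set R) by exact: measurable_itv.
have I j : leb.-integrable `[0, 1] (EFin \o (fun t : R => t `^ (1 - al) * PI2 (w j) i j (t *: x))).
  pose c := enorm3 x.
  have [M M0 HM] := CkB_bnd (PI2C j j i) x1.
  apply: (@integrable_bnd _ _ _ _ _ _ M) => //; first exact: leb_cc_fin.
    apply: measurable_funM; first by apply: measurable_funTS; exact: measurable_powR.
    apply: subspace_continuous_measurable_fun; first exact: measurable_itv.
    by apply: continuous_in_subspaceT => s; rewrite inE => /itv01P s01; exact: PI2_ray_cont.
  move=> t /itv01P t01; rewrite normrM -[M]mul1r; apply: ler_pM => //; first exact: powR_le1.
  by apply: HM; exact: enorm3_scale_le.
have sp j : sint (fun eta => Pe lam mu x eta i j * w j eta) =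
    (i == j)%:R * PI (w j) x + be * (1 - enorm3 x ^+ 2) * \int[leb]_(t in `[0, 1]) (t `^ (1 - al) * PI2 (w j) i j (t *: x)).
  have [M [b1 b2]] := bw j; rewrite (sint_Pe_split mu0 lm0 i j x1 b1 b2) /PI.
  have -> : \int[leb]_(t in `[0, 1]) (t `^ (1 - al) * PI2 (w j) i j (t *: x)) =
     (4 * pi)^-1 * \int[leb]_(t in `[0, 1]) (t `^ (1 - al) * sint (fun eta => P2 eta i j (t *: x) * w j eta)).
    have fp : (4 * pi : R) != 0 by rewrite mulf_neq0// gt_eqF// pi_gt0.
    rewrite -RintegralZl//.
      by apply: eq_Rintegral => t _; rewrite /PI2; ring.
    have J : leb.-integrable `[0, 1] (EFin \o (fun t : R => (4 * pi) * (t `^ (1 - al) * PI2 (w j) i j (t *: x)))).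
      by apply: integrable_cstM => //; exact: I.
    apply: eq_integrable J => // t _ /=.
    by rewrite /PI2 mulrCA (mulrA (4 * pi)) mulfV// mul1r.
  by ring.
rewrite (eq_bigr _ (fun j _ => sp j)) big_split /= -mulr_sumr.
have -> : \sum_j (i == j)%:R * PI (w j) x = PI (w i) x.
  by rewrite (bigD1 i)//= eqxx mul1r big1 ?addr0// => j ji; rewrite eq_sym (negPf ji) mul0r.
have -> : \sum_j \int[leb]_(t in `[0, 1]) (t `^ (1 - al) * PI2 (w j) i j (t *: x)) = (4 + 2 * kap) * Ps i x.
  rewrite Ps_integral// sum3E -RintegralD// -RintegralD//; last exact: integrable_addR.
  by apply: eq_Rintegral => t _; rewrite sum3E; ring.
rewrite -h_PI// /h /q.
(* The origin of [beta]: it satisfies [beta (4 + 2 kap) = kap], where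
   [4 + 2 kap = 2 (lam + 3 mu) / mu]. *)
have -> : be * (1 - enorm3 x ^+ 2) * ((4 + 2 * kap) * Ps i x) = kap * ((1 - enorm3 x ^+ 2) * Ps i x).
  rewrite /beta_c; field; rewrite (gt_eqF mu0) /= gt_eqF//.
by rewrite subrK.
Qed.
End Potential.
End Representation.

(** * From smooth solutions to dilated C^2 solutions *)

Section ConcreteRepresentation.
Context {R : realType}.
Notation V3 := 'rV[R]_3.
Notation leb := (@lebesgue_measure R).

Lemma sum3_fun (F : 'I_3 -> V3 -> R) : (fun y => \sum_j F j y) =
  fun y => 1 * F ord0 y + 1 * (1 * F (lift ord0 ord0) y + 1 * F (lift ord0 (lift ord0 ord0)) y).
Proof. by apply/funext => y; rewrite sum3E !mul1r addrA. Qed.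

Lemma CkB_sum n r (F : 'I_3 -> V3 -> R) : (forall j, CkB n r (F j)) -> CkB n r (fun y => \sum_j F j y).
Proof. by move=> FC; rewrite sum3_fun; do 2 apply: CkB_lin => //. Qed.

Lemma is_derive_sum3 (F : 'I_3 -> V3 -> R) (d : 'I_3 -> R) (x v : V3) :
  (forall j, is_derive x v (F j) (d j)) -> is_derive x v (fun y => \sum_j F j y) (\sum_j d j).
Proof.
move=> dF; rewrite sum3_fun sum3E.
have d0 := dF ord0; have d1 := dF (lift ord0 ord0); have d2 := dF (lift ord0 (lift ord0 ord0)).
by apply: is_derive_eq; rewrite /GRing.scale /=; ring.
Qed.

Lemma partial_sum3 n r (F : 'I_3 -> V3 -> R) i x : (forall j, CkB n.+1 r (F j)) -> enorm3 x < r ->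
  partial i (fun y => \sum_j F j y) x = \sum_j partial i (F j) x.
Proof.
by move=> FC xr; apply: partial_val; apply: is_derive_sum3 => j; exact: (CkB_is_derive i (FC j) xr).
Qed.

Lemma CkB_partial2 n r (g : V3 -> R) i j : CkB n.+2 r g -> CkB n r (partial i (partial j g)).
Proof. by move=> gC; exact: CkB_partial (CkB_partial j gC). Qed.

Lemma partial_ball_cst r (f : V3 -> R) (k : R) j x : enorm3 x < r ->
  (forall y, enorm3 y < r -> f y = k) -> partial j f x = 0.
Proof. by move=> xr fk; rewrite (partial_eq j xr fk) /partial derive_cst. Qed.

Section Lame.
Variables lam mu : R.
Hypotheses (mu0 : 0 < mu) (lm0 : 0 < 2 * mu + lam).

Section Smooth.
Variables (r : R) (w : 'I_3 -> V3 -> R).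
Hypotheses (wC : forall i, CkB 4 r (w i))
  (wL : forall i x, enorm3 x < r -> lame_at lam mu w i x = 0).

Definition divergence (w : 'I_3 -> V3 -> R) (y : V3) : R := \sum_j partial j (w j) y.
Local Notation th := (divergence w).

Lemma div_CkB : CkB 3 r th.
Proof. by apply: CkB_sum => j; apply: CkB_partial; exact: wC. Qed.

Lemma graddiv i x : enorm3 x < r -> \sum_j partial i (partial j (w j)) x = partial i th x.
Proof.
move=> xr; apply: esym; apply: (@partial_sum3 2 r (fun j => partial j (w j)) i x) => // j.
by apply: CkB_partial; exact: wC.
Qed.

Lemma lap_eq i x : enorm3 x < r -> \sum_j partial j (partial j (w i)) x = - ((lam + mu) / mu) * partial i th x.
Proof.
move=> xr; have := wL i xr; rewrite /lame_at.
have e := graddiv i xr.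
move=> H; have {}H := etrans (esym (f_equal2 (fun a b => mu * a + (lam + mu) * b) erefl e)) H.
move: H; set A := \sum_j _; set B := partial _ _ _ => /= H.
have -> : A = (mu * A + (lam + mu) * B) / mu - (lam + mu) / mu * B by field; rewrite gt_eqF.
by rewrite H; ring.
Qed.

(** After interchanging derivatives, the divergence of the system says that the Laplacian of [th]
    equals [- (lam + mu) / mu] times itself; as [2 mu + lam > 0] it vanishes. *)
Lemma lap_div x : enorm3 x < r -> \sum_j partial j (partial j th) x = 0.
Proof.
move=> xr.
have wC3 i : CkB 3 r (w i) by exact: CkB_S (wC i).
have C1 (i j : 'I_3) : CkB 1 r (partial j (partial j (w i))) by apply: CkB_partial2; exact: wC3.
have E1 : \sum_i partial i (fun y => \sum_j partial j (partial j (w i)) y) x =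
   \sum_i (- ((lam + mu) / mu) * partial i (partial i th) x).
  apply: eq_bigr => i _.
  have d := CkB_is_derive i (CkB_partial i div_CkB) xr.
  apply: etrans (partial_eq i xr (fun y yr => lap_eq i yr)) _.
  by apply: partial_val; apply: is_derive_eq; rewrite /GRing.scale /=; ring.
have E2 : \sum_i partial i (fun y => \sum_j partial j (partial j (w i)) y) x =
   \sum_i \sum_j partial j (partial j (partial i (w i))) x.
  apply: eq_bigr => i _; apply: (etrans (@partial_sum3 0 r (fun j => partial j (partial j (w i))) i x (C1 i) xr)).
  apply: eq_bigr => j _.
  apply: (etrans (@CkB_schwarz R 0 r (partial j (w i)) i j x (CkB_S (CkB_partial j (wC i))) xr)).
  by apply: (partial_eq j xr) => y yr; exact: (CkB_schwarz i j (wC i) yr).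
have E3 j : \sum_i partial j (partial j (partial i (w i))) x = partial j (partial j th) x.
  apply: (etrans (esym (@partial_sum3 1 r (fun i => partial j (partial i (w i))) j x (fun i => CkB_partial2 j i (wC i)) xr))).
  by apply: (partial_eq j xr) => y yr; exact: graddiv.
have E : \sum_j partial j (partial j th) x = - ((lam + mu) / mu) * \sum_j partial j (partial j th) x.
  rewrite mulr_sumr -E1 E2 exchange_big /=; apply: eq_bigr => j _; exact/esym/E3.
move: E; set A := \sum_j _ => E.
have : A = (A - (- ((lam + mu) / mu) * A)) * (mu / (2 * mu + lam)) by field; rewrite !gt_eqF.
by rewrite -E subrr mul0r.
Qed.

(** The data [g] of the correction is the gradient of [th], and two continuous derivatives of it are
    required; hence four derivatives of [w]. *)
Lemma smooth_rep : 1 < r -> forall i x, enorm3 x < 1 ->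
  w i x = \sum_j sint (fun eta => Pe lam mu x eta i j * w j eta).
Proof.
move=> r1.
have thC := div_CkB; have thC2 := CkB_S thC.
apply: (@potential_rep R lam mu mu0 lm0 r w (fun i => partial i th) (fun j i => partial j (w i))
  (fun j i => partial j (partial i th)) (fun k j i => partial k (partial j (w i)))
  (fun k j i => partial k (partial j (partial i th)))).
- exact: r1.
- by move=> i; apply: CkB_le (wC i).
- by move=> i; exact: CkB_partial.
- by move=> k j i; apply: CkB_partial2; apply: CkB_le (wC i).
- by move=> j i; apply: CkB_partial2; exact: thC.
- by move=> k j i; apply: CkB_partial; apply: CkB_partial2; exact: thC.
- by move=> i j x xr; apply: (CkB_is_derive j (wC i) xr).
- by move=> i j k x xr; apply: (CkB_is_derive k (CkB_partial j (wC i)) xr).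
- by move=> i j x xr; apply: (CkB_is_derive j (CkB_partial i thC) xr).
- by move=> i j k x xr; apply: (CkB_is_derive k (CkB_partial j (CkB_partial i thC)) xr).
- exact: lap_eq.
- exact: graddiv.
- move=> i x xr.
  transitivity (\sum_j partial i (partial j (partial j th)) x).
    apply: eq_bigr => j _.
    apply: (etrans (partial_eq j xr (fun y yr => CkB_schwarz j i thC2 yr))).
    exact: (CkB_schwarz j i (CkB_partial j thC) xr).
  apply: (etrans (esym (@partial_sum3 0 r (fun j => partial j (partial j th)) i x (fun j => CkB_partial2 j j thC) xr))).
  by apply: (partial_ball_cst i xr) => y yr; exact: lap_div.
- by move=> i j x xr; exact: (CkB_schwarz j i thC2 xr).
- exact: lap_div.
- move=> i x xr.
  apply: (etrans (esym (@partial_sum3 0 r (fun j => partial j (partial j th)) i x (fun j => CkB_partial2 j j thC) xr))).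
  by apply: (partial_ball_cst i xr) => y yr; exact: lap_div.
Qed.
End Smooth.

Lemma stk3_lame r (eps : R) (u : 'I_3 -> V3 -> R) : 0 <= eps ->
  (forall i, CkB 2 r (u i)) -> (forall i x, enorm3 x < r -> lame_at lam mu u i x = 0) ->
  forall i x, enorm3 x < r - eps - eps - eps -> lame_at lam mu (fun i => stk3 eps (u i)) i x = 0.
Proof.
move=> e0 uC uL.
have C1 k i := stk_CkB k e0 (uC i).
have L1 k := stk_lame k e0 uC uL.
have C2 k l i := stk_CkB k e0 (C1 l i).
have L2 k l := stk_lame k e0 (C1 l) (L1 l).
exact: (stk_lame _ e0 (C2 _ _) (L2 _ _)).
Qed.

Lemma stk3_CkB n r (eps : R) g : 0 <= eps -> CkB n r g -> CkB n (r - eps - eps - eps) (stk3 eps g).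
Proof. by move=> e0 gC; do 3 apply: stk_CkB => //. Qed.

Lemma stk3_approx n r (eps dl K rho' : R) f F : 0 <= eps -> 0 <= K -> CkB n r f -> rho' < r - eps - eps - eps ->
  (forall y, enorm3 y <= rho' + eps + eps + eps -> `|f y - F y| <= dl) ->
  (forall i y (s : R), enorm3 y <= rho' + eps + eps -> 0 <= s <= eps -> `|F (s *: e3 R i + y) - F y| <= K) ->
  forall x, enorm3 x <= rho' -> `|stk3 eps f x - F x| <= dl + K + K + K.
Proof.
move=> e0 K0 fC rr fF FK.
have C1 := stk_CkB (lift ord0 (lift ord0 ord0)) e0 fC.
have C2 := stk_CkB (lift ord0 ord0) e0 C1.
have r1 : rho' + eps < r - eps - eps by move: rr; lra.
have r2 : rho' + eps + eps < r - eps by move: rr; lra.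
have A1 := stk_approx e0 fC r2 fF (FK _).
have A2 := stk_approx e0 C1 r1 (A1 _) (fun y s yr => FK _ y s (le_trans yr (ler_wpDr e0 (lexx _)))).
apply: (stk_approx e0 C2 rr (A2 _)) => y s yr; apply: FK; apply: (le_trans yr).
by rewrite -addrA lerDl addr_ge0.
Qed.

Lemma bmeas_Pe (x : V3) i j : enorm3 x < 1 -> exists2 B, 0 <= B & bmeas (fun eta => Pe lam mu x eta i j) B.
Proof.
move=> x1; have [C C0 H] := Pe_bound mu0 lm0.
have i0 : 0 <= (1 - enorm3 x)^-1 by rewrite invr_ge0 subr_ge0 ltW.
have d0 : 0 <= 1 - enorm3 x ^+ 2 by rewrite subr_ge0 expr_le1// ?enorm3_ge0// ltW.
exists (C * (1 * (1 - enorm3 x)^-1 ^+ 3)); first by rewrite !mulr_ge0// exprn_ge0.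
split; first exact: measurable_Pe.
move=> p; apply: (le_trans (H x (sph p) i j (enorm3_sph p) x1)).
apply: ler_wpM2l => //; apply: ler_pM => //.
- rewrite exprn_ge0// ltW// rho_gt0//; exact: ball3_neq (enorm3_sph p) x1.
- by rewrite gerBl exprn_ge0// enorm3_ge0.
- rewrite lerXn2r ?nnegrE//; last exact: rho_le (enorm3_sph p) (lexx _) x1.
  rewrite ltW// rho_gt0//; exact: ball3_neq (enorm3_sph p) x1.
Qed.

Lemma sint_diff_le (x : V3) i j B (f g : V3 -> R) M N (d : R) : bmeas (fun eta => Pe lam mu x eta i j) B ->
  bmeas f M -> bmeas g N -> (forall p : R * R, `|f (sph p) - g (sph p)| <= d) -> 0 <= B ->
  `|sint (fun eta => Pe lam mu x eta i j * f eta) - sint (fun eta => Pe lam mu x eta i j * g eta)| <= sint (fun=> B * d).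
Proof.
move=> bP bf bg fg B0.
have b1 := bmeas_mul bP bf; have b2 := bmeas_mul bP bg.
have e : sint (fun eta => Pe lam mu x eta i j * f eta) - sint (fun eta => Pe lam mu x eta i j * g eta) =
   sint (fun eta => 1 * (Pe lam mu x eta i j * f eta) + (-1) * (Pe lam mu x eta i j * g eta)).
  by rewrite (sint_lin 1 (-1) b1 b2); ring.
rewrite e.
have b3 : bmeas (fun eta => 1 * (Pe lam mu x eta i j * f eta) + (-1) * (Pe lam mu x eta i j * g eta)) (B * M + B * N).
  split; first by apply: measurable_funD; apply: measurable_funM => //; [case: b1|case: b2].
  move=> p; apply: (le_trans (ler_normD _ _)); rewrite mul1r mulN1r normrN.
  by apply: lerD; [case: b1|case: b2].
apply: (sint_norm_le b3 (bmeas_cst (B * d))) => p.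
rewrite mul1r mulN1r -mulrBr normrM; apply: ler_pM => //; by case: bP.
Qed.

(** Two rounds of [stk3] raise C^2 to C^4. The representation holds for the averaged functions, and
    both sides converge as [e] tends to 0, because the kernel is bounded for fixed [x]. *)
Lemma lame_rep r (u : 'I_3 -> V3 -> R) : 1 < r -> (forall i, CkB 2 r (u i)) ->
  (forall i x, enorm3 x < r -> lame_at lam mu u i x = 0) -> forall i x, enorm3 x < 1 ->
  u i x = \sum_j sint (fun eta => Pe lam mu x eta i j * u j eta).
Proof.
move=> r1 uC uL i x x1.
(* A radius strictly between: the first derivatives of [u] are bounded on this closed ball, and the
   averages find room beyond the unit ball. *)
pose r' := (1 + r) / 2.
have rr : 1 < r' /\ r' < r by move: r1; rewrite /r'; lra.
have [r'1 r'r] := rr.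
have [K K0 HK] : exists2 K, 0 <= K & forall j k y, enorm3 y <= r' -> `|partial k (u j) y| <= K.
  have h j k := CkB_bnd (CkB_partial k (uC j)) r'r.
  pose Kf j k := sval (cid2 (h j k)).
  exists (\sum_j \sum_k Kf j k).
    by do 2 apply: sumr_ge0 => ? _; rewrite /Kf; case: cid2.
  move=> j k y yr; rewrite (bigD1 j)//= (bigD1 k)//= -addrA; apply: ler_wpDr.
    by apply: addr_ge0; [|apply: sumr_ge0 => ? _]; apply: sumr_ge0 => ? _; rewrite /Kf; case: cid2.
  by rewrite /Kf; case: cid2 => M M0 /= -> //.
have [B B0 HB] : exists2 B, 0 <= B & forall j, bmeas (fun eta => Pe lam mu x eta i j) B.
  have h j := bmeas_Pe i j x1.
  pose Bf j := sval (cid2 (h j)).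
  have Bf0 j : 0 <= Bf j by rewrite /Bf; case: cid2.
  exists (\sum_j Bf j); first by apply: sumr_ge0.
  move=> j; have : bmeas (fun eta => Pe lam mu x eta i j) (Bf j) by rewrite /Bf; case: cid2.
  move=> [m b]; split => // p; apply: (le_trans (b p)).
  by rewrite (bigD1 j)//= lerDl sumr_ge0.
(* Six averages change [u] by at most [6 K e], once at [x] and once in each of the three kernel
   integrals. *)
pose C := 6 * K + 3 * (sint (fun=> B) * (6 * K)).
have key (e : R) : 0 < e -> e <= (r' - 1) / 6 ->
    `|u i x - \sum_j sint (fun eta => Pe lam mu x eta i j * u j eta)| <= C * e.
  move=> e0 e6; have e0' := ltW e0.
  pose w j := stk3 e (stk3 e (u j)).
  have q1 : 1 < r - e - e - e - e - e - e by move: e6 r'1 r'r; lra.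
  have wC j : CkB 4 (r - e - e - e - e - e - e) (w j).
    by apply: stk3_gain => //; apply: stk3_gain => //; exact: uC.
  have wL := stk3_lame e0' (fun j => stk3_CkB e0' (uC j)) (stk3_lame e0' uC uL).
  have step j k y (s : R) : enorm3 y <= r' - e -> 0 <= s <= e -> `|u j (s *: e3 R k + y) - u j y| <= K * e.
    move=> yr /andP[s0 se].
    have ins t : 0 <= t <= 1 -> enorm3 ((t * s) *: e3 R k + y) <= r'.
      move=> /andP[t0 t1]; apply: (le_trans (enorm3D _ _)); rewrite enorm3Z enorm3_e3 mulr1 ger0_norm ?mulr_ge0//.
      have : t * s <= s by rewrite ler_piMl.
      by move: yr se; set n := enorm3 y; lra.
    have := @mvt_line R (u j) (partial k (u j)) y (e3 R k) s K.
    move=> /(_ _ _)/le_trans; apply.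
    + move=> t t01; apply: (CkB_is_derive k (uC j)); exact: le_lt_trans (ins t t01) r'r.
    + by move=> t t01; apply: HK; exact: ins.
    + by rewrite ler_wpM2l// ger0_norm.
  have Ke0 : 0 <= K * e by exact: mulr_ge0.
  have ap1 j y : enorm3 y <= 1 + e + e + e -> `|stk3 e (u j) y - u j y| <= 0 + K * e + K * e + K * e.
    apply: (stk3_approx e0' Ke0 (uC j)).
    + by move: e6 r'1 r'r; lra.
    + by move=> z _; rewrite subrr normr0.
    + move=> k z s zr; apply: step; apply: (le_trans zr); move: e6; lra.
  have ap2 j y : enorm3 y <= 1 -> `|w j y - u j y| <= 0 + K * e + K * e + K * e + K * e + K * e + K * e.
    apply: (stk3_approx e0' Ke0 (stk3_CkB e0' (uC j))).
    + by move: e6 r'1 r'r; lra.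
    + exact: ap1.
    + move=> k z s zr; apply: step; apply: (le_trans zr); move: e6 e0; lra.
  have six : 0 + K * e + K * e + K * e + K * e + K * e + K * e = 6 * K * e by ring.
  rewrite six in ap2.
  have Rp := smooth_rep wC wL q1 i x1.
  have bw j := CkB_bmeas q1 (wC j); have bu j := CkB_bmeas r1 (uC j).
  have -> : u i x - \sum_j sint (fun eta => Pe lam mu x eta i j * u j eta) =
     - (w i x - u i x) + \sum_j (sint (fun eta => Pe lam mu x eta i j * w j eta) - sint (fun eta => Pe lam mu x eta i j * u j eta)).
    by rewrite sumrB -Rp; ring.
  apply: (le_trans (ler_normD _ _)); rewrite normrN.
  have -> : C * e = 6 * K * e + \sum_(j < 3) sint (fun=> B : R) * (6 * K * e).
    by rewrite sumr_const card_ord -mulr_natl /C; ring.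
  apply: lerD; first by apply: ap2; exact: ltW.
  apply: (le_trans (ler_norm_sum _ _ _)); apply: ler_sum => j _.
  have [M bM] := bw j; have [N bN] := bu j.
  have := sint_diff_le (HB j) bM bN (fun p => ap2 j (sph p) ltac:(by rewrite enorm3_sph)) B0.
  move=> /le_trans; apply.
  have b0 := bmeas_cst B.
  have E : sint (fun=> B * (6 * K * e)) = sint (fun=> B) * (6 * K * e).
    rewrite (_ : (fun=> B * (6 * K * e)) = (fun x0 : V3 => 6 * K * e * B + 0 * B)).
      by rewrite (sint_lin (6 * K * e) 0 b0 b0); ring.
    by apply/funext => y; ring.
  by rewrite E.
have C0 : 0 <= C.
  have m0 : 0 < (r' - 1) / 6 by move: r'1; lra.
  have := le_trans (normr_ge0 _) (key _ m0 (lexx _)); by rewrite pmulr_lge0.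
apply/eqP; rewrite -subr_eq0 -normr_le0; apply/ler_addgt0Pl => d d0; rewrite addr0.
pose e := Num.min ((r' - 1) / 6) (d / (C + 1)).
have e0 : 0 < e by rewrite lt_min !divr_gt0 ?subr_gt0// ltr_wpDl.
apply: (le_trans (key e e0 _)); first by rewrite ge_min lexx.
apply: (@le_trans _ _ ((C + 1) * (d / (C + 1)))).
  by apply: ler_pM => //; [exact: ltW|rewrite lerDl|rewrite ge_min lexx orbT].
by rewrite mulrCA divff ?mulr1// gt_eqF// ltr_wpDl.
Qed.

Lemma C2_ball_CkB (u : V3 -> V3) i : C2_ball u -> CkB 2 1 (fun x => u x 0 i).
Proof.
move=> uC; split; first by move=> x x1; have [d _] := uC i x x1; exact: differentiable_continuous.
move=> j; split; first by move=> x x1; have [d _] := uC i x x1; exact: diff_derivable.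
split; first by move=> x x1; have [_ [d _]] := uC i x x1; exact: differentiable_continuous (d j).
move=> k; split; first by move=> x x1; have [_ [d _]] := uC i x x1; exact: diff_derivable (d j).
by split => // x x1; have [_ [_ d]] := uC i x x1; exact: d.
Qed.

Lemma scale_lt (s : R) x : 0 < s -> enorm3 x < s^-1 -> enorm3 (s *: x) < 1.
Proof. by move=> s0 xs; rewrite enorm3Z gtr0_norm// mulrC -ltr_pdivlMr// div1r. Qed.

Lemma continuous_scale3 (s : R) : continuous (fun x : V3 => s *: x).
Proof.
move=> x; have H := @cvg_aff _ _ (nbhs x) _ id x s 0 (@cvg_id _ (nbhs x)).
rewrite (_ : (fun x : V3 => s *: x) = fun x => s *: x + 0); last by apply/funext => y; rewrite addr0.
exact: H.
Qed.

Lemma CkB_scale n (s : R) (g : V3 -> R) : 0 < s -> CkB n 1 g -> CkB n s^-1 (fun x => g (s *: x)).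
Proof.
move=> s0; elim: n g => [|n IH] g gC.
  split => // x xr; have cp : {for x, continuous (fun x : V3 => s *: x)} by exact: continuous_scale3.
  exact: (cvg_comp _ _ cp (CkB_cont gC (scale_lt s0 xr))).
have d x i : enorm3 x < s^-1 -> is_derive x (e3 R i) (fun x => g (s *: x)) (s * partial i g (s *: x)).
  move=> xr; apply: is_derive_scale; exact: (CkB_is_derive i gC (scale_lt s0 xr)).
split; first by move=> x xr; exact: (CkB_cont (IH _ (CkB_S gC)) xr).
move=> i; split; first by move=> x xr; have [] := d x i xr.
have C1 := IH _ (CkB_partial i gC).
apply: (@CkB_eq _ n s^-1 (fun x => s * partial i g (s *: x) + 0 * partial i g (s *: x))).
  by move=> x xr; rewrite mul0r addr0; apply/esym; apply: partial_val; exact: d.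
exact: CkB_lin.
Qed.

Lemma partial2_scale (s : R) (g : V3 -> R) i j x : 0 < s -> CkB 2 1 g -> enorm3 x < s^-1 ->
  partial i (partial j (fun x => g (s *: x))) x = s ^+ 2 * partial i (partial j g) (s *: x).
Proof.
move=> s0 gC xr; apply: (@partial2_val _ s^-1 _ (fun x => s * partial j g (s *: x))) => //.
  move=> y yr; apply: is_derive_scale; exact: (CkB_is_derive j gC (scale_lt s0 yr)).
have d : is_derive x (e3 R i) (fun x => partial j g (s *: x)) (s * partial i (partial j g) (s *: x)).
  by apply: is_derive_scale; exact: (CkB_is_derive i (CkB_partial j gC) (scale_lt s0 xr)).
by apply: is_derive_eq; rewrite /GRing.scale /=; ring.
Qed.

(** The dilated function solves the system on the ball of radius [1 / s > 1], the operator being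
    homogeneous of degree two. *)
Lemma lame_solution_rep (u : V3 -> V3) (s : R) : lame_solution lam mu u -> 0 < s < 1 ->
  forall i x, enorm3 x < 1 ->
  u (s *: x) 0 i = \sum_j sint (fun eta => Pe lam mu x eta i j * u (s *: eta) 0 j).
Proof.
move=> [uC uL] /andP[s0 s1].
have s1' : 1 < s^-1 by rewrite invf_gt1.
have cC i := C2_ball_CkB i uC.
apply: (@lame_rep s^-1 (fun i x => u (s *: x) 0 i) s1') => i.
  exact: (CkB_scale s0 (cC i)).
move=> x xr; have sx := scale_lt s0 xr.
have H : lame_op lam mu u (s *: x) 0 i = 0 by rewrite uL// mxE.
rewrite mxE in H.
have E1 : \sum_(j < 3) partial j (partial j (fun x => u (s *: x) 0 i)) x = s ^+ 2 * \sum_(j < 3) partial j (partial j (fun x => u x 0 i)) (s *: x).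
  by rewrite mulr_sumr; apply: eq_bigr => j _; exact: partial2_scale.
have E2 : \sum_(j < 3) partial i (partial j (fun x => u (s *: x) 0 j)) x = s ^+ 2 * \sum_(j < 3) partial i (partial j (fun x => u x 0 j)) (s *: x).
  by rewrite mulr_sumr; apply: eq_bigr => j _; exact: partial2_scale.
apply: (etrans (f_equal2 (fun a b : R => mu * a + (lam + mu) * b) E1 E2)).
rewrite mulrCA (mulrCA (lam + mu)) -mulrDr.
by apply: (etrans (f_equal (fun a => s ^+ 2 * a) H)); rewrite mulr0.
Qed.
End Lame.
End ConcreteRepresentation.

(** * The Fatou theorem in h^1 *)

Section UltraLimits.
Context {R : realType} {T : Type}.
Variables (U : set_system T) (UU : UltraFilter U).

(** Compactness of [[-M, M]]: a cluster point of an ultrafilter is a limit of it. *)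
Lemma ultra_cvg (f : T -> R) (M : R) : (forall t, `|f t| <= M) -> exists l : R, f @ U --> l.
Proof.
move=> fM; have PF : ProperFilter (f @ U) by exact: fmap_proper_filter.
have FM : (f @ U) `[- M, M]%classic.
  by apply: (@filterS _ U _ setT); [move=> t _ /=; rewrite in_itv /= -ler_norml; exact: fM|exact: filterT].
have [l [_ cl]] := @segment_compact R (- M) M _ PF FM.
exists l => A nA; have [//|nU] := in_ultra_setVsetC (f @^-1` A) UU.
have [y [/= h1 h2]] := cl (~` A) A nU nA; by [].
Qed.

Lemma ultra_lim_le (f g : T -> R) (a b : R) : (forall t, f t <= g t) -> f @ U --> a -> g @ U --> b -> a <= b.
Proof.
move=> fg /cvgrPdist_lt fa /cvgrPdist_lt gb; rewrite leNgt; apply/negP => ba.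
have e0 : 0 < (a - b) / 2 by rewrite divr_gt0// subr_gt0.
have [t [h1 h2]] := filter_ex (filterI (fa _ e0) (gb _ e0)).
by have := fg t; move: h1 h2; rewrite !ltr_norml => /andP[_ h1] /andP[h2 _]; lra.
Qed.

Lemma ultra_lim_unique (f : T -> R) (a b : R) : f @ U --> a -> f @ U --> b -> a = b.
Proof. by move=> fa fb; apply: (cvg_unique _ fa fb). Qed.
End UltraLimits.

Section FiniteMeasure.
Context {R : realType} {d} {T : measurableType d} (nu : {measure set T -> \bar R}) (nuFin : fin_num_fun nu).
(** A copy of [nu] that carries finiteness as a structure, the form in which Radon-Nikodym takes
    it. *)
Definition fin_measure & fin_num_fun nu : set T -> \bar R := nu.
HB.instance Definition _ := Measure.copy (fin_measure nuFin) nu.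
HB.instance Definition _ := @Measure_isFinite.Build _ T _ (fin_measure nuFin) nuFin.

Lemma radon_nikodym_measure (mu : {sigma_finite_measure set T -> \bar R}) :
  nu `<< mu -> exists f : T -> \bar R, [/\ forall x, (f x >= 0)%E, forall x, f x \is a fin_num,
    mu.-integrable [set: T] f & forall A, measurable A -> nu A = (\int[mu]_(x in A) f x)%E].
Proof. exact: (@radon_nikodym_sigma_finite _ _ _ mu (fin_measure nuFin)). Qed.
End FiniteMeasure.

(* An ultralimit of uniformly bounded densities is dominated, hence again a measure with a density. *)
Section DominatedUltralimit.
Context {R : realType} {d} {T : measurableType d} (mu : {sigma_finite_measure set T -> \bar R}).
Variables (U : set_system nat) (UU : UltraFilter U) (Q : set T) (c : R) (g : nat -> T -> R).
Hypotheses (mQ : measurable Q) (Qfin : (mu Q < +oo)%E).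
Hypotheses (mg : forall k, measurable_fun setT (g k)) (g0 : forall k x, 0 <= g k x)
  (gc : forall k x, g k x <= c) (gQ : forall k x, ~ Q x -> g k x = 0).

Let intg A k := \int[mu]_(x in A) g k x.

Let muAQ A : measurable A -> (mu (A `&` Q) < +oo)%E.
Proof.
move=> mA; apply: le_lt_trans Qfin; apply: le_measure; rewrite ?inE//; exact: measurableI.
Qed.

Let gi k A : measurable A -> mu.-integrable A (EFin \o g k).
Proof.
move=> mA.
have J : mu.-integrable (A `&` Q) (EFin \o g k).
  apply: (@integrable_bnd _ _ _ _ _ _ c) => //; [exact: measurableI|exact: muAQ|exact: measurable_funTS|].
  by move=> x _; rewrite ger0_norm.
apply/(integrable_mkcond _ mA); move/(integrable_mkcond _ (measurableI _ _ mA mQ)) : J.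
rewrite (_ : (EFin \o g k) \_ (A `&` Q) = (EFin \o g k) \_ A)//; apply/funext => x.
rewrite !patchE in_setI; case: (x \in A) => //=; case: ifPn => // /negP xQ.
by rewrite gQ// => h; apply: xQ; rewrite inE.
Qed.

Let I_ge0 A k : 0 <= intg A k.
Proof. by apply: fine_ge0; apply: integral_ge0 => x _; rewrite lee_fin. Qed.

Let I_le A k : measurable A -> intg A k <= c * fine (mu (A `&` Q)).
Proof.
move=> mA; have -> : intg A k = \int[mu]_(x in A `&` Q) g k x.
  rewrite /intg /Rintegral integral_mkcondr; congr fine; apply: eq_integral => x _.
  rewrite patchE; case: ifPn => // /negP xQ /=.
  by rewrite gQ// => h; apply: xQ; rewrite inE.
have mAQ : measurable (A `&` Q) by exact: measurableI.
rewrite -Rintegral_cst//; apply: le_Rintegral => //.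
- exact: gi.
- apply: (@integrable_bnd _ _ _ _ _ _ `|c|) => //; exact: muAQ.
Qed.

Let I_cvg A : measurable A -> exists l : R, intg A @ U --> l.
Proof.
move=> mA; apply: (@ultra_cvg R nat U UU _ (c * fine (mu (A `&` Q)))) => k.
by rewrite ger0_norm ?I_ge0// I_le.
Qed.

(** The absolute value makes [N] nonnegative on every set, also where the limit is not known to
    exist; on measurable sets it changes nothing. *)
Let N A : R := `|lim (intg A @ U)|.

Let N_cvg A : measurable A -> intg A @ U --> N A.
Proof.
move=> mA; have [l h] := I_cvg mA.
have e : lim (intg A @ U) = l by exact: cvg_lim.
rewrite /N e ger0_norm//.
have c0' : (fun _ : nat => 0 : R) @ U --> (0 : R) by exact: cvg_cst.
exact: (ultra_lim_le UU _ c0' h).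
Qed.

Let N_le A : measurable A -> N A <= c * fine (mu (A `&` Q)).
Proof.
move=> mA; have c0' : (fun _ : nat => c * fine (mu (A `&` Q))) @ U --> c * fine (mu (A `&` Q)) by exact: cvg_cst.
exact: (ultra_lim_le UU (fun k => I_le k mA) (N_cvg mA) c0').
Qed.

Let N_add A B : measurable A -> measurable B -> [disjoint A & B] -> N (A `|` B) = N A + N B.
Proof.
move=> mA mB AB; have mAB : measurable (A `|` B) by exact: measurableU.
apply: (ultra_lim_unique UU (N_cvg mAB)).
have FU : Filter U by exact: _.
have H := @cvg_lin R nat U FU _ _ _ _ 1 1 (N_cvg mA) (N_cvg mB).
rewrite !mul1r in H.
rewrite (_ : intg (A `|` B) = fun t => 1 * intg A t + 1 * intg B t)//; apply/funext => k.
rewrite !mul1r.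
by rewrite /intg Rintegral_setU//; exact: gi.
Qed.

Let nu A : \bar R := (N A)%:E.

Let nu0 : nu set0 = 0%E.
Proof.
congr EFin; apply: (ultra_lim_unique UU (N_cvg measurable0)).
rewrite (_ : intg set0 = fun=> 0); first exact: cvg_cst.
by apply/funext => k; rewrite /intg Rintegral_set0.
Qed.

Let nu_ge0 A : (0 <= nu A)%E.
Proof. by rewrite lee_fin normr_ge0. Qed.

(** Finite additivity passes to the limit, and the domination by [c mu] sends the tails [B n] to 0:
    this is where countable additivity is recovered. *)
Let nu_sigma : semi_sigma_additive nu.
Proof.
move=> F mF tF mU.
pose B n := \bigcup_(k in [set k | (n <= k)%N]) F k.
have mB n : measurable (B n) by exact: bigcup_measurable.
have BE n : B n = F n `|` B n.+1.
  apply/seteqP; split => x.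
    move=> [k /= nk Fx]; move: nk; rewrite leq_eqVlt => /orP[/eqP nk|nk]; [left|right].
      by rewrite nk.
    by exists k.
  by move=> [Fx|[k /= nk Fx]]; [exists n => /=|exists k => //=; exact: ltnW].
have dB n : [disjoint F n & B n.+1].
  apply/disj_setPS => x [Fx [k /= nk Fkx]].
  by have := tF n k I I (ex_intro _ x (conj Fx Fkx)) => e; rewrite -e ltnn in nk.
have NB n : N (B 0%N) = \sum_(0 <= i < n) N (F i) + N (B n).
  elim: n => [|n IH]; first by rewrite big_nil add0r.
  have e : N (B n) = N (F n) + N (B n.+1) by rewrite {1}BE; exact: N_add.
  by rewrite big_nat_recr//= -addrA -e; exact: IH.
have UB : \bigcup_n F n = B 0%N by apply/seteqP; split=> x [k _ Fx]; exists k.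
have NB0 : N (B n) @[n --> \oo] --> (0 : R).
  have h : mu (B n `&` Q) @[n --> \oo] --> mu (\bigcap_n (B n `&` Q)).
    apply: nonincreasing_cvg_mu => //.
    - exact: muAQ.
    - by move=> n; exact: measurableI.
    - by apply: bigcap_measurable => // k _; exact: measurableI.
    - move=> n m nm; apply/subsetPset; apply: setSI => x [k /= mk Fx]; exists k => //=; exact: leq_trans nm mk.
  have e : \bigcap_n (B n `&` Q) = set0.
    apply/seteqP; split => // x Hx; have [[k _ Fkx] _] := Hx 0%N I.
    have [[m /= km Fmx] _] := Hx k.+1 I.
    by have e := tF k m I I (ex_intro _ x (conj Fkx Fmx)); rewrite -e ltnn in km.
  rewrite e measure0 in h.
  have h' : c * fine (mu (B n `&` Q)) @[n --> \oo] --> c * 0.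
    by apply: cvg_cmul; exact: (fine_cvg h).
  rewrite mulr0 in h'.
  apply: (squeeze_cvgr _ (cvg_cst 0) h').
  by near=> n; rewrite normr_ge0 N_le.
rewrite UB /nu.
have -> : (fun n => \sum_(0 <= i < n) (N (F i))%:E)%E = (fun n => (N (B 0%N) - N (B n))%:E).
  by apply/funext => n; rewrite (NB n) addrK sumEFin.
apply: cvg_EFin; first by near=> n.
have FN : Filter (\oo : set_system nat) by exact: _.
have c1 : (fun _ : nat => N (B 0%N)) @ \oo --> N (B 0%N) by exact: cvg_cst.
have H := @cvg_lin R nat \oo FN _ (fun n => N (B n)) _ _ 1 (-1) c1 NB0.
rewrite mul1r mulr0 addr0 in H; apply: (@cvg_near_eq R nat \oo FN _ _ _ _ H).
by near=> n; rewrite /= mulN1r.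
Unshelve. all: by end_near. Qed.

Lemma dominated_ultralimit : exists G : T -> R, [/\ measurable_fun setT G, (forall x, 0 <= G x),
  mu.-integrable setT (EFin \o G) &
  forall A, measurable A -> intg A @ U --> \int[mu]_(x in A) G x].
Proof.
pose nuM : {measure set T -> \bar R} := HB.pack nu (isMeasure.Build _ _ _ nu nu0 nu_ge0 nu_sigma).
have nuFin : fin_num_fun nuM by move=> A mA.
have dom : nuM `<< mu.
  apply/null_content_dominatesP => A mA muA0 /=; congr EFin; apply/eqP.
  rewrite eq_le normr_ge0 andbT; apply: (le_trans (N_le mA)).
  suff -> : mu (A `&` Q) = 0%E by rewrite mulr0.
  by apply/eqP; rewrite -measure_le0 -muA0; apply: le_measure; rewrite ?inE//; exact: measurableI.
have [f [f0 ffin fi fE]] := radon_nikodym_measure nuFin dom.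
have fk x : (fine (f x))%:E = f x by rewrite fineK.
exists (fine \o f); split.
- by apply: measurableT_comp => //; exact: measurable_int fi.
- by move=> x; apply: fine_ge0.
- by apply: eq_integrable fi => // x _ /=.
- move=> A mA; suff -> : \int[mu]_(x in A) (fine \o f) x = N A by exact: N_cvg.
  rewrite /Rintegral (eq_integral f); last by move=> x _ /=.
  by rewrite -fE.
Qed.
End DominatedUltralimit.

Lemma Rintegral_setU4 {d} {T : measurableType d} {R : realType} (mu : {measure set T -> \bar R})
  (A B C D : set T) (f : T -> R) : measurable A -> measurable B -> measurable C -> measurable D ->
  mu.-integrable setT (EFin \o f) -> [disjoint A & B] -> [disjoint C & D] ->
  [disjoint A `|` B & C `|` D] ->
  \int[mu]_(x in (A `|` B) `|` (C `|` D)) f x =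
  \int[mu]_(x in A) f x + \int[mu]_(x in B) f x + (\int[mu]_(x in C) f x + \int[mu]_(x in D) f x).
Proof.
move=> mA mB mC mD fi AB CD ABCD.
have mAB : measurable (A `|` B) by exact: measurableU.
have mCD : measurable (C `|` D) by exact: measurableU.
have fS E : measurable E -> mu.-integrable E (EFin \o f) by move=> mE; apply: integrableS fi.
have mE : measurable (A `|` B `|` (C `|` D)) by exact: measurableU.
rewrite (Rintegral_setU mAB mCD (fS _ mE) ABCD).
by rewrite (Rintegral_setU mA mB (fS _ mAB) AB) (Rintegral_setU mC mD (fS _ mCD) CD).
Qed.

(** * The stopped cell function and its density *)

Section StoppedMartingale.
Context {R : realType}.
Variables (a b : R).
Hypotheses (a0 : 0 < a) (b0 : 0 < b).
Notation mu2 := (@leb2 R).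
Notation Q0 := (cell a b 0 0 0).
Notation area := (area a b).

Lemma sub_cell0 n i j : (i < 2 ^ n)%N -> (j < 2 ^ n)%N -> cell a b n i j `<=` Q0.
Proof.
elim: n i j => [|n IH] i j; first by rewrite expn0 !ltnS !leqn0 => /eqP-> /eqP->.
move=> hi hj p /(sub_cell a0 b0 (erefl i./2) (erefl j./2)); apply: IH; rewrite ltn_half_double -mul2n -expnS//.
Qed.

Lemma integrable_cellS (A B : set (R * R)) (f : R * R -> R) : measurable A -> measurable B -> A `<=` B ->
  mu2.-integrable B (EFin \o f) -> mu2.-integrable A (EFin \o f).
Proof. by move=> mA mB AB; exact: integrableS. Qed.

Lemma Rint_cell4 (f : R * R -> R) : mu2.-integrable setT (EFin \o f) ->
  additive4 (fun n i j => \int[mu2]_(q in cell a b n i j) f q).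
Proof.
move=> fi n i j; rewrite cell_split//.
have mc n' i' j' : measurable (cell a b n' i' j') by exact: measurable_cell.
have dj i' j' i'' j'' : (i' != i'') || (j' != j'') -> [disjoint cell a b n.+1 i' j' & cell a b n.+1 i'' j'']
  by exact: cell_disj.
have nS k : k != k.+1 by rewrite neq_ltn ltnSn.
have dU (A B C : set (R * R)) : [disjoint A & C] -> [disjoint B & C] -> [disjoint A `|` B & C].
  by move=> /disj_setPS h1 /disj_setPS h2; apply/disj_setPS => x [[Ax|Bx] Cx]; [apply: h1|apply: h2].
apply: Rintegral_setU4; [exact: mc|exact: mc|exact: mc|exact: mc|exact: fi| | |].
- by apply: dj; rewrite nS.
- by apply: dj; rewrite nS.
by apply: (dU _ _ _); rewrite disj_set_sym; apply: (dU _ _ _); apply: (dj _ _ _ _); apply/orP; right; rewrite neq_ltn ltnSn ?orbT.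
Qed.

Section Stop.
Variables (m : nat -> nat -> nat -> R) (s : R).
Hypotheses (m0 : forall n i j, 0 <= m n i j) (madd : additive4 m) (s0 : 0 < s).
Hypothesis root_ok : m 0 0 0 <= s * area 0.

(** The cell and all its ancestors have mean at most [s]; [reached] asks this of the strict
    ancestors only. A cell that is reached but not unstopped is a first bad cell. *)
Fixpoint unstopped n i j : bool :=
  (if n is n'.+1 then unstopped n' i./2 j./2 else true) && (m n i j <= s * area n).

Definition reached n i j : bool := if n is n'.+1 then unstopped n' i./2 j./2 else true.

Lemma unstoppedE n i j : unstopped n i j = reached n i j && (m n i j <= s * area n).
Proof. by case: n. Qed.

(** Equal to [m] down to and including the first bad cell; below it the mass is spread evenly over
    the four children. *)
Fixpoint stopped n i j : R :=
  if n is n'.+1 then if unstopped n' i./2 j./2 then m n i j else stopped n' i./2 j./2 / 4 else m 0 i j.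

Lemma stopped_reached n i j : reached n i j -> stopped n i j = m n i j.
Proof. by case: n => //= n ->. Qed.

Lemma stopped_additive : additive4 stopped.
Proof.
move=> n i j; rewrite [in RHS]/= !uphalf_double !half_double.
have [u|_] := boolP (unstopped n i j); last by field.
by rewrite -madd stopped_reached//; move: u; rewrite unstoppedE => /andP[].
Qed.

Lemma m_child n i j : m n.+1 i j <= m n i./2 j./2.
Proof.
rewrite [leRHS]madd -{1}(odd_double_half i) -{1}(odd_double_half j).
have h := m0 n.+1; case: (odd i); case: (odd j); rewrite ?add0n ?add1n.
- by rewrite addrA lerDr !addr_ge0.
- by rewrite -addrA addrCA lerDl ?addr_ge0.
- by rewrite addrCA lerDl !addr_ge0.
- by rewrite -addrA lerDl ?addr_ge0.
Qed.

(** A first bad cell has no more mass than its parent, which is good and four times as large. The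
    root has no parent, hence [root_ok]. *)
Lemma stopped_bound n i j : (i < 2 ^ n)%N -> (j < 2 ^ n)%N -> 0 <= stopped n i j <= 4 * s * area n.
Proof.
have ar k := area_gt0 a0 b0 k.
elim: n i j => [|n IH] i j.
  rewrite expn0 !ltnS !leqn0 => /eqP-> /eqP-> /=; rewrite m0 (le_trans root_ok)//.
  by rewrite ler_wpM2r ?(ltW (ar _))// ler_peMl ?(ltW s0)// ler1n.
rewrite !expnS !mul2n => hi hj /=.
have /IH/(_ _) IH' : (i./2 < 2 ^ n)%N by rewrite ltn_half_double.
have /IH'/andP[h1 h2] : (j./2 < 2 ^ n)%N by rewrite ltn_half_double.
have -> : 4 * s * area n.+1 = s * area n by rewrite area_succ; field.
have [u|_] := boolP (unstopped n i./2 j./2).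
  rewrite m0 (le_trans (m_child _ _ _))//.
  by move: u; rewrite unstoppedE => /andP[].
by rewrite divr_ge0//= ler_pdivrMr// mulrC mulrA.
Qed.

(** The density of [stopped] at resolution [k]; these densities form a bounded martingale. *)
Definition stepf k (q : R * R) : R :=
  \sum_(i < 2 ^ k) \sum_(j < 2 ^ k) (stopped k i j / area k) * \1_(cell a b k i j) q.

Lemma stepf_cell k i j q : (i < 2 ^ k)%N -> (j < 2 ^ k)%N -> cell a b k i j q ->
  stepf k q = stopped k i j / area k.
Proof.
move=> hi hj qc; rewrite /stepf (bigD1 (Ordinal hi))//= (bigD1 (Ordinal hj))//=.
have z (i' j' : nat) : (i != i') || (j != j') -> \1_(cell a b k i' j') q = 0 :> R.
  move=> h; rewrite indicE memNset// => qc'.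
  by have /disj_setPS/(_ q) := @cell_disj R a b a0 b0 k i j i' j' h; apply.
rewrite indicE mem_set// mulr1 big1 ?addr0 => [|j' jj'].
  rewrite big1 ?addr0// => i' ii'; apply: big1 => j' _; rewrite z ?mulr0//.
  by apply/orP; left; apply: contra ii' => /eqP e; apply/eqP/val_inj; rewrite /= e.
rewrite z ?mulr0//; apply/orP; right; apply: contra jj' => /eqP e; apply/eqP/val_inj.
by rewrite /= e.
Qed.

Lemma stepf_out k q : ~ Q0 q -> stepf k q = 0.
Proof.
move=> nq; apply: big1 => i _; apply: big1 => j _.
rewrite indicE memNset ?mulr0// => /sub_cell0 h; apply: nq; exact: h.
Qed.

Lemma cell_idx k q : Q0 q -> [/\ (idx a q.1 k < 2 ^ k)%N, (idx b q.2 k < 2 ^ k)%N &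
  cell a b k (idx a q.1 k) (idx b q.2 k) q].
Proof.
move=> /(cell0P a b q) [h1 h2]; have [i1 i2 i3] := idxP k a0 h1; have [j1 j2 j3] := idxP k b0 h2.
by split => //; split => /=; rewrite in_itv /= ?i2 ?i3 ?j2 ?j3.
Qed.

Lemma stepf_bound k q : 0 <= stepf k q <= 4 * s.
Proof.
have [qQ|nq] := pselect (Q0 q); last first.
  by rewrite stepf_out// lexx mulr_ge0// ltW.
have [hi hj qc] := cell_idx k qQ.
rewrite (stepf_cell hi hj qc); have /andP[h1 h2] := stopped_bound hi hj.
have ar := area_gt0 a0 b0 k.
by rewrite divr_ge0 ?(ltW ar)//= ler_pdivrMr.
Qed.

Lemma measurable_stepf k : measurable_fun setT (stepf k).
Proof.
apply: measurable_sum => i; apply: measurable_sum => j.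
by apply: measurable_funM => //; apply: measurable_indic; exact: measurable_cell.
Qed.

Lemma integrable_stepf k A : measurable A -> mu2.-integrable A (EFin \o stepf k).
Proof.
move=> mA.
have J : mu2.-integrable Q0 (EFin \o stepf k).
  apply: (@integrable_bnd _ _ _ _ _ _ (4 * s)) => //.
  - exact: measurable_cell.
  - by have := leb2_cell a0 b0 0 0 0; rewrite /leb2 => ->; rewrite ltry.
  - by apply: measurable_funTS; exact: measurable_stepf.
  - by move=> q _; have /andP[h1 h2] := stepf_bound k q; rewrite ger0_norm.
apply: (integrable_cellS mA measurableT) => //.
have : mu2.-integrable setT (EFin \o patch (cst 0) Q0 (stepf k)) by apply: integrable_patch => //; exact: measurable_cell.
rewrite (_ : patch (cst 0) Q0 (stepf k) = stepf k)//; apply/funext => x.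
rewrite patchE; case: ifPn => // /negP xQ /=.
by rewrite stepf_out// => h; apply: xQ; rewrite inE.
Qed.

Lemma stepf_integral d n i j : (i < 2 ^ n)%N -> (j < 2 ^ n)%N ->
  \int[mu2]_(q in cell a b n i j) stepf (d + n) q = stopped n i j.
Proof.
elim: d n i j => [|d IH] n i j hi hj.
  have ar := area_gt0 a0 b0 n.
  transitivity (\int[mu2]_(q in cell a b n i j) (stopped n i j / area n)).
    by apply: eq_Rintegral => q; rewrite inE => qc; exact: stepf_cell.
  rewrite Rintegral_cst; last exact: measurable_cell.
  by have := leb2_cell a0 b0 n i j; rewrite /leb2 => -> /=; rewrite divfK// gt_eqF.
rewrite (Rint_cell4 (integrable_stepf (d.+1 + n) measurableT)) addSnnS !IH.
- by rewrite -stopped_additive.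
all: by rewrite expnS mul2n ?ltn_double// -?doubleS ?ltn_Sdouble.
Qed.

(** The densities [stepf k] are uniformly bounded, so they have an ultralimit with a density [G]. On
    a fixed cell their integrals are constant from its level on, which identifies the integrals of
    [G]. *)
Lemma stopped_density : exists G : R * R -> R, [/\ measurable_fun setT G, (forall q, 0 <= G q),
  mu2.-integrable setT (EFin \o G) &
  forall n i j, (i < 2 ^ n)%N -> (j < 2 ^ n)%N -> \int[mu2]_(q in cell a b n i j) G q = stopped n i j].
Proof.
have [U [UU sU]] := @ultraFilterLemma nat \oo _.
have Qfin : (mu2 Q0 < +oo)%E by have := leb2_cell a0 b0 0 0 0; rewrite /leb2 => ->; rewrite ltry.
have c0 : 0 <= 4 * s by rewrite mulr_ge0// ltW.
have [G [mG G0 Gi GE]] := @dominated_ultralimit R _ _ mu2 U UU Q0 (4 * s) stepf (measurable_cell a b 0 0 0) Qfin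
  measurable_stepf (fun k q => (andP (stepf_bound k q)).1) (fun k q => (andP (stepf_bound k q)).2) stepf_out.
exists G; split => // n i j hi hj.
apply: (ultra_lim_unique UU (GE _ (measurable_cell a b n i j))).
have FU : Filter U by exact: _.
apply: (@cvg_near_eq R nat U FU (fun=> stopped n i j)); last exact: cvg_cst.
apply: sU; exists n => // k /= nk.
by rewrite -(subnK nk) stepf_integral.
Qed.
End Stop.
End StoppedMartingale.

(** Replacing a nearly constant weight by a constant costs at most [e] times the mass; with [c = 0]
    this is the plain bound by the size of the weight. *)
Lemma weighted_dev {d} {T : measurableType d} {R : realType} (mu : {measure set T -> \bar R})
  (A : set T) (K f : T -> R) (B c e : R) : measurable A -> measurable_fun A K ->
  (forall x, A x -> `|K x| <= B) -> mu.-integrable A (EFin \o f) -> (forall x, 0 <= f x) ->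
  (forall x, A x -> `|K x - c| <= e) ->
  `|\int[mu]_(x in A) (K x * f x) - c * \int[mu]_(x in A) f x| <= e * \int[mu]_(x in A) f x.
Proof.
move=> mA mK KB fi f0 Ke.
have i1 : mu.-integrable A (EFin \o (fun x => K x * f x)) by apply: (integrable_mul_bnd (K := B)).
have i2 : mu.-integrable A (EFin \o (fun x => c * f x)) by apply: integrable_cstM.
have i3 : mu.-integrable A (EFin \o (fun x => e * f x)) by apply: integrable_cstM.
have i4 : mu.-integrable A (EFin \o (fun x => K x * f x - c * f x)) by apply: integrable_subR.
have i5 : mu.-integrable A (EFin \o (fun x => `|K x * f x - c * f x|)).
  by have := integrable_norm i4; apply: eq_integrable.
have E1 k : k * \int[mu]_(x in A) f x = \int[mu]_(x in A) (k * f x) by rewrite RintegralZl.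
rewrite !E1 -RintegralB//.
have LN : `|\int[mu]_(x in A) (K x * f x - c * f x)| <= \int[mu]_(x in A) `|K x * f x - c * f x| by exact: le_normr_Rintegral.
apply: (le_trans LN); apply: le_Rintegral => // x Ax.
by rewrite -mulrBl normrM (ger0_norm (f0 x)) ler_wpM2r// Ke.
Qed.

Lemma ultra_dev {R : realType} {T : Type} (U : set_system T) (UU : UltraFilter U) (X Y : T -> R) (x y c e : R) :
  X @ U --> x -> Y @ U --> y -> (forall t, `|X t - c * Y t| <= e * Y t) -> `|x - c * y| <= e * y.
Proof.
move=> Xx Yy H; have FU : Filter U by exact: _.
have C1 := @cvg_lin R T U FU X Y x y 1 (- c) Xx Yy.
have C2 := @cvg_lin R T U FU X Y x y (-1) c Xx Yy.
have C3 := @cvg_cmul R T U FU Y e y Yy.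
have e1 : 1 * x + (- c) * y <= e * y.
  by apply: (ultra_lim_le UU _ C1 C3) => t; have := H t; rewrite ler_norml mul1r mulNr => /andP[].
have e2 : (-1) * x + c * y <= e * y.
  by apply: (ultra_lim_le UU _ C2 C3) => t; have := H t; rewrite ler_norml mulN1r => /andP[h _]; lra.
by rewrite ler_norml; apply/andP; split; lra.
Qed.

(** * Comparison of kernel integrals with the stopped density *)

Section Comparison.
Context {R : realType}.
Variables (a b : R).
Hypotheses (a0 : 0 < a) (b0 : 0 < b) (ab : a <= b) (b2a : b <= 2 * a).
Notation mu2 := (@leb2 R).
Notation Q0 := (cell a b 0 0 0).
Notation area := (area a b).

(** A point outside the triple is at sup distance at least [a / 2^n] from the cell, whose sides are
    at most [b / 2^n <= 2 a / 2^n]. *)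
Lemma supdist_cell n i j p q q' : ~ tcell a b n i j p -> cell a b n i j q -> cell a b n i j q' ->
  supdist p q' <= 3 * supdist p q.
Proof.
move=> np [/= q1 q2] [/= q1' q2'].
pose t := (2 : R) ^- n; have t0 : 0 < t by rewrite invr_gt0 exprn_gt0.
move: q1 q2 q1' q2'; rewrite !in_itv /= -[i.+1%:R]natr1 -[j.+1%:R]natr1 -/t => /andP[u1 u2] /andP[u3 u4] /andP[v1 v2] /andP[v3 v4].
have at0 : 0 < a * t by rewrite mulr_gt0.
have far : a * t <= supdist p q.
  rewrite leNgt; apply/negP; rewrite gt_max => /andP[h1 h2]; apply: np.
  have bt : a * t <= b * t by rewrite ler_wpM2r// ltW.
  move: h1 h2; rewrite !ltr_norml => /andP[h1 h1'] /andP[h2 h2'].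
  by split => /=; rewrite in_itv /= -/t; apply/andP; split; lra.
have b2t : b * t <= 2 * (a * t) by rewrite mulrA ler_wpM2r// ltW.
have close : supdist p q' <= supdist p q + b * t.
  have bt : a * t <= b * t by rewrite ler_wpM2r// ltW.
  have d1 : `|q'.1 - p.1| <= `|q.1 - p.1| + b * t.
    rewrite (_ : q'.1 - p.1 = (q.1 - p.1) + (q'.1 - q.1)); last by ring.
    by apply: (le_trans (ler_normD _ _)); rewrite lerD2l ler_norml; apply/andP; split; lra.
  have d2 : `|q'.2 - p.2| <= `|q.2 - p.2| + b * t.
    rewrite (_ : q'.2 - p.2 = (q.2 - p.2) + (q'.2 - q.2)); last by ring.
    by apply: (le_trans (ler_normD _ _)); rewrite lerD2l ler_norml; apply/andP; split; lra.
  rewrite /supdist ge_max; apply/andP; split.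
    by apply: (le_trans d1); rewrite lerD2r le_max lexx.
  by apply: (le_trans d2); rewrite lerD2r le_max lexx orbT.
by lra.
Qed.

Lemma cell_corner n i j : cell a b n i j (i%:R * a / 2 ^+ n, j%:R * b / 2 ^+ n).
Proof.
by split => /=; rewrite in_itv /= lexx /= ltr_pM2r ?invr_gt0 ?exprn_gt0// ltr_pM2r// ltr_nat.
Qed.

Definition cmp_const : R := 3 ^+ 3.

(* Away from p the kernel varies on a cell by a bounded factor: 3^3, by the cube in pkernel. *)
Lemma pkernel_cell d n i j p q q' : 0 < d -> ~ tcell a b n i j p -> cell a b n i j q -> cell a b n i j q' ->
  pkernel d p q <= cmp_const * pkernel d p q'.
Proof.
move=> d0 np qc qc'; have h := supdist_cell np qc qc'.
have M0 (x : R) : 0 < Num.max d x by rewrite lt_max d0.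
have h3 : Num.max d (supdist p q') <= 3 * Num.max d (supdist p q).
  rewrite ge_max; apply/andP; split.
    apply: (@le_trans _ _ (Num.max d (supdist p q))); first by rewrite le_max lexx.
    by rewrite ler_peMl ?ler1n// ltW.
  by apply: (le_trans h); rewrite ler_pM2l// le_max lexx orbT.
rewrite /pkernel /cmp_const mulrCA ler_pM2l// -lef_pV2 ?posrE ?mulr_gt0 ?invr_gt0 ?exprn_gt0//.
rewrite invrM ?unitfE ?gt_eqF ?invr_gt0 ?exprn_gt0// !invrK mulrC ler_pdivrMl ?exprn_gt0//.
by rewrite -exprMn lerXn2r ?nnegrE ?mulr_ge0// ltW.
Qed.

Variables (U : set_system nat) (UU : UltraFilter U) (h : nat -> R * R -> R).
Hypotheses (h0 : forall k q, 0 <= h k q) (hi : forall k, mu2.-integrable setT (EFin \o h k)).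
Variable m : nat -> nat -> nat -> R.
Hypothesis mlim : forall n i j, (fun k => \int[mu2]_(q in cell a b n i j) h k q) @ U --> m n i j.

Lemma limit_ge0 n i j : 0 <= m n i j.
Proof.
have FU : Filter U by exact: _.
have c0 : (fun _ : nat => 0 : R) @ U --> (0 : R) by exact: cvg_cst.
apply: (@ultra_lim_le R nat U UU (fun=> 0) _ 0 (m n i j) _ c0 (@mlim n i j)) => k.
by apply: fine_ge0; apply: integral_ge0 => q _; rewrite lee_fin.
Qed.

Lemma limit_additive (L : nat -> nat -> nat -> R) (f : nat -> R * R -> R) :
  (forall k, mu2.-integrable setT (EFin \o f k)) ->
  (forall n i j, (fun k => \int[mu2]_(q in cell a b n i j) f k q) @ U --> L n i j) -> additive4 L.
Proof.
move=> fi Llim n i j; have FU : Filter U by exact: _.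
apply: (ultra_lim_unique UU (Llim n i j)).
have C1 := @cvg_lin R nat U FU _ _ _ _ 1 1 (Llim n.+1 i.*2 j.*2) (Llim n.+1 i.*2.+1 j.*2).
have C2 := @cvg_lin R nat U FU _ _ _ _ 1 1 (Llim n.+1 i.*2 j.*2.+1) (Llim n.+1 i.*2.+1 j.*2.+1).
have C3 := @cvg_lin R nat U FU _ _ _ _ 1 1 C1 C2.
rewrite !mul1r in C3; apply: (@cvg_near_eq R nat U FU _ _ _ _ C3).
apply: (@filterS _ U FU setT); last exact: filterT.
by move=> k _; rewrite !mul1r (Rint_cell4 a0 b0 (fi k) n i j).
Qed.

Variables (s : R) (T : set (R * R)) (G : R * R -> R).
Hypotheses (s0 : 0 < s) (root_ok : m 0 0 0 <= s * area 0) (mT : measurable T).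
Hypothesis Tbad : forall n i j p, (i < 2 ^ n)%N -> (j < 2 ^ n)%N -> tcell a b n i j p ->
      ~ T p -> m n i j <= s * area n.
Hypotheses (G0 : forall q, 0 <= G q) (Gi : mu2.-integrable setT (EFin \o G)).
Hypothesis GE : forall n i j, (i < 2 ^ n)%N -> (j < 2 ^ n)%N ->
  \int[mu2]_(q in cell a b n i j) G q = stopped a b m s n i j.

Variables (K : R * R -> R) (B C dl : R) (p : R * R).
Hypotheses (mK : measurable_fun setT K) (KB : forall q, `|K q| <= B) (C0 : 0 <= C) (dl0 : 0 < dl).
Hypotheses (KC : forall q, Q0 q -> `|K q| <= C * pkernel dl p q) (nTp : ~ T p).
Variable L : nat -> nat -> nat -> R.
Hypothesis Llim : forall n i j, (fun k => \int[mu2]_(q in cell a b n i j) (K q * h k q)) @ U --> L n i j.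

(** The kernel restricted to [T], to which the errors on bad cells will be charged; extended by zero
    so that its cell integrals are additive on the tree. *)
Let W := patch (cst 0) Q0 (fun q => pkernel dl p q * \1_T q).

Let mcell n i j : measurable (cell a b n i j). Proof. exact: measurable_cell. Qed.

Let cell_fin n i j : (mu2 (cell a b n i j) < +oo)%E.
Proof. by have := leb2_cell a0 b0 n i j; rewrite /leb2 => ->; rewrite ltry. Qed.

Lemma integrable_pk A : measurable A -> (mu2 A < +oo)%E -> mu2.-integrable A (EFin \o (fun q => pkernel dl p q)).
Proof.
move=> mA fA; apply: (@integrable_bnd _ _ _ _ _ _ (dl^-1 ^+ 2)) => //.
  by apply: measurable_funTS; exact: measurable_pkernel.
by move=> q _; rewrite ger0_norm ?pkernel_ge0 ?(ltW dl0)// pkernel_le_inv2.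
Qed.

Lemma integrable_W : mu2.-integrable setT (EFin \o W).
Proof.
apply: integrable_patch => //; first exact: mcell.
apply: (@integrable_bnd _ _ _ _ _ _ (dl^-1 ^+ 2)) => //; [exact: mcell|exact: cell_fin| |].
  apply: measurable_funTS; apply: measurable_funM; first exact: measurable_pkernel.
  exact: measurable_indic.
move=> q _; rewrite normrM ger0_norm ?pkernel_ge0 ?(ltW dl0)//.
apply: (@le_trans _ _ (pkernel dl p q)); last exact: pkernel_le_inv2.
by rewrite ler_piMr ?pkernel_ge0 ?(ltW dl0)// indicE; case: (q \in T); rewrite ?normr1 ?normr0.
Qed.

(** 8 is 2 for the two integrals to be bounded times 4 from the mass bound [4 s area]; each factor
    [cmp_const] is one comparison of kernel values inside a cell. *)
Definition tree_const : R := 8 * cmp_const * cmp_const * C * s.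

(** No cancellation is used: the limit and the stopped integral are each bounded by kernel size
    times mass. Since the triple of the cell lies in [T] and [p] does not, the kernel is comparable
    on the cell to its mean there, so both are charged to the integral of the kernel over the
    cell. *)
Lemma bad_cell n i j : (i < 2 ^ n)%N -> (j < 2 ^ n)%N -> reached a b m s n i j -> s * area n < m n i j ->
  `|L n i j - \int[mu2]_(q in cell a b n i j) (K q * G q)| <= tree_const * \int[mu2]_(q in cell a b n i j) W q.
Proof.
move=> ci cj rc bad.
have np : ~ tcell a b n i j p by move=> tp; move: bad; rewrite ltNge (Tbad ci cj tp nTp).
have sT : cell a b n i j `<=` T.
  move=> q qc; apply: contrapT => nTq; move: bad; rewrite ltNge (Tbad ci cj _ nTq)//.
  move: qc => [/=]; rewrite !in_itv /= => /andP[u1 u2] /andP[u3 u4].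
  have t0 : 0 < (2 : R) ^- n by rewrite invr_gt0 exprn_gt0.
  have at0 : 0 < a * 2 ^- n by rewrite mulr_gt0.
  have bt0 : 0 < b * 2 ^- n by rewrite mulr_gt0.
  by split => /=; rewrite in_itv /=; move: u1 u2 u3 u4; rewrite -[i.+1%:R]natr1 -[j.+1%:R]natr1; set t := 2 ^- n in at0 bt0 *; move=> *; apply/andP; split; lra.
have ar := area_gt0 a0 b0 n.
have t0 : 0 < (2 : R) ^- n by rewrite invr_gt0 exprn_gt0.
pose c : R * R := (i%:R * a / 2 ^+ n, j%:R * b / 2 ^+ n).
have cc : cell a b n i j c.
  exact: cell_corner.
pose kap := pkernel dl p c.
have kap0 : 0 <= kap by rewrite pkernel_ge0// ltW.
have Kk q : cell a b n i j q -> `|K q - 0| <= C * (cmp_const * kap).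
  move=> qc; rewrite subr0; apply: (le_trans (KC (sub_cell0 a0 b0 ci cj qc))).
  by rewrite ler_wpM2l//; exact: pkernel_cell np qc cc.
have hiC k : mu2.-integrable (cell a b n i j) (EFin \o h k) by apply: (integrable_cellS (mcell _ _ _) measurableT).
have GiC : mu2.-integrable (cell a b n i j) (EFin \o G) by apply: (integrable_cellS (mcell _ _ _) measurableT).
have mKc : measurable_fun (cell a b n i j) K by apply: measurable_funTS.
have e1 : `|L n i j - 0 * m n i j| <= C * (cmp_const * kap) * m n i j.
  apply: (ultra_dev UU (@Llim n i j) (@mlim n i j)) => k.
  by apply: (@weighted_dev _ _ _ mu2 _ K (h k) B) => //; exact: mcell.
have e2 : `|\int[mu2]_(q in cell a b n i j) (K q * G q) - 0 * \int[mu2]_(q in cell a b n i j) G q| <=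
    C * (cmp_const * kap) * \int[mu2]_(q in cell a b n i j) G q.
  by apply: (@weighted_dev _ _ _ mu2 _ K G B) => //; exact: mcell.
rewrite !mul0r !subr0 in e1 e2.
have sm := stopped_reached rc.
have /andP[_ mb] := stopped_bound a0 b0 limit_ge0 (limit_additive hi mlim) s0 root_ok ci cj.
rewrite GE// sm in e2; rewrite sm in mb.
have cp : 0 <= cmp_const :> R by rewrite /cmp_const exprn_ge0.
have k1 : kap * area n <= cmp_const * \int[mu2]_(q in cell a b n i j) W q.
  have -> : \int[mu2]_(q in cell a b n i j) W q = \int[mu2]_(q in cell a b n i j) pkernel dl p q.
    apply: eq_Rintegral => q; rewrite inE => qc; rewrite /W patchE mem_set; last exact: (sub_cell0 a0 b0 ci cj qc).
    by rewrite indicE mem_set ?mulr1//; exact: sT.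
  have ip : mu2.-integrable (cell a b n i j) (EFin \o (fun q => pkernel dl p q)) by apply: integrable_pk => //; exact: mcell.
  have ip' : mu2.-integrable (cell a b n i j) (EFin \o (fun q => cmp_const * pkernel dl p q)).
    by apply: integrable_cstM => //; exact: mcell.
  have -> : kap * area n = \int[mu2]_(q in cell a b n i j) kap.
    by rewrite Rintegral_cst; [have := leb2_cell a0 b0 n i j; rewrite /leb2 => ->|exact: mcell].
  have -> : cmp_const * \int[mu2]_(q in cell a b n i j) pkernel dl p q = \int[mu2]_(q in cell a b n i j) (cmp_const * pkernel dl p q).
    by rewrite RintegralZl//; exact: mcell.
  apply: le_Rintegral => //; first exact: mcell.
    by apply: (@integrable_bnd _ _ _ _ _ _ `|kap|) => //; [exact: mcell|exact: cell_fin].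
  by move=> q qc; exact: pkernel_cell np cc qc.
apply: (le_trans (ler_normB _ _)); apply: (le_trans (lerD e1 e2)).
apply: (@le_trans _ _ (2 * (C * (cmp_const * kap)) * (4 * s * area n))).
  have -> : C * (cmp_const * kap) * m n i j + C * (cmp_const * kap) * m n i j = 2 * (C * (cmp_const * kap)) * m n i j by ring.
  apply: ler_wpM2l; last exact: mb.
  by apply: mulr_ge0 => //; apply: mulr_ge0 => //; exact: mulr_ge0.
have -> : 2 * (C * (cmp_const * kap)) * (4 * s * area n) = 8 * cmp_const * C * s * (kap * area n) by ring.
have -> : tree_const * \int[mu2]_(q in cell a b n i j) W q = 8 * cmp_const * C * s * (cmp_const * \int[mu2]_(q in cell a b n i j) W q).
  by rewrite /tree_const; set w := \int[_]_(_ in _) _; ring.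
apply: ler_wpM2l; last exact: k1.
apply: mulr_ge0; last exact: ltW.
by apply: mulr_ge0 => //; apply: mulr_ge0.
Qed.

(** Induction on the remaining depth. A first bad cell is charged to [W], a good cell is split, and
    at the finest level [K] is replaced by its value at the corner of the cell, where [stopped]
    still equals [m]. The factor 2 counts the two replacements. *)
Lemma tree_err d0 e : 0 <= e ->
  (forall n i j q q', (d0 <= n)%N -> (i < 2 ^ n)%N -> (j < 2 ^ n)%N -> cell a b n i j q -> cell a b n i j q' ->
     `|K q - K q'| <= e) ->
  forall d n i j, (i < 2 ^ n)%N -> (j < 2 ^ n)%N -> (d0 <= d + n)%N -> reached a b m s n i j ->
  `|L n i j - \int[mu2]_(q in cell a b n i j) (K q * G q)| <=
     2 * e * m n i j + tree_const * \int[mu2]_(q in cell a b n i j) W q.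
Proof.
move=> e0 osc.
have m0 := limit_ge0; have madd := limit_additive hi mlim.
have cp : 0 <= cmp_const :> R by rewrite /cmp_const exprn_ge0.
have tc0 : 0 <= tree_const.
  by apply: mulr_ge0; [apply: mulr_ge0 => //; apply: mulr_ge0 => //; apply: mulr_ge0|exact: ltW].
have W0 q : 0 <= W q.
  rewrite /W patchE; case: ifPn => // _; rewrite mulr_ge0 ?pkernel_ge0 ?(ltW dl0)//.
have Wi0 A : 0 <= \int[mu2]_(q in A) W q by apply: fine_ge0; apply: integral_ge0 => q _; rewrite lee_fin.
elim=> [|d IH] n i j ci cj dn rc.
  apply: ler_wpDr; first exact: mulr_ge0.
  pose c : R * R := (i%:R * a / 2 ^+ n, j%:R * b / 2 ^+ n).
  have cc : cell a b n i j c.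
    exact: cell_corner.
  have hiC k : mu2.-integrable (cell a b n i j) (EFin \o h k) by apply: (integrable_cellS (mcell _ _ _) measurableT).
  have GiC : mu2.-integrable (cell a b n i j) (EFin \o G) by apply: (integrable_cellS (mcell _ _ _) measurableT).
  have mKc : measurable_fun (cell a b n i j) K by apply: measurable_funTS.
  have Ke q : cell a b n i j q -> `|K q - K c| <= e by move=> qc; exact: (osc n i j).
  have e1 : `|L n i j - K c * m n i j| <= e * m n i j.
    apply: (ultra_dev UU (@Llim n i j) (@mlim n i j)) => k.
    by apply: (@weighted_dev _ _ _ mu2 _ K (h k) B) => //; exact: mcell.
  have e2 : `|\int[mu2]_(q in cell a b n i j) (K q * G q) - K c * \int[mu2]_(q in cell a b n i j) G q| <=
      e * \int[mu2]_(q in cell a b n i j) G q.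
    by apply: (@weighted_dev _ _ _ mu2 _ K G B) => //; exact: mcell.
  rewrite GE// (stopped_reached rc) in e2.
  have -> : L n i j - \int[mu2]_(q in cell a b n i j) (K q * G q) =
     (L n i j - K c * m n i j) - (\int[mu2]_(q in cell a b n i j) (K q * G q) - K c * m n i j) by ring.
  apply: (le_trans (ler_normB _ _)); apply: (le_trans (lerD e1 e2)).
  by rewrite -mulr2n -mulrA mulr_natl.
have [bad|good] := ltP (s * area n) (m n i j).
  apply: ler_wpDl; last exact: bad_cell.
  by apply: mulr_ge0; [exact: mulr_ge0|exact: m0].
have us : unstopped a b m s n i j by rewrite unstoppedE rc good.
have KiG : mu2.-integrable setT (EFin \o (fun q => K q * G q)) by apply: (integrable_mul_bnd (K := B)).
have Kih k : mu2.-integrable setT (EFin \o (fun q => K q * h k q)) by apply: (integrable_mul_bnd (K := B)).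
have LA := limit_additive Kih Llim n i j.
have GA := Rint_cell4 a0 b0 KiG n i j.
have WA := Rint_cell4 a0 b0 integrable_W n i j.
rewrite LA GA WA (madd n i j).
have dn' : (d0 <= d + n.+1)%N by rewrite addnS -addSn.
have child i' j' : i'./2 = i -> j'./2 = j -> (i' < 2 ^ n.+1)%N -> (j' < 2 ^ n.+1)%N -> 
   `|L n.+1 i' j' - \int[mu2]_(q in cell a b n.+1 i' j') (K q * G q)| <=
     2 * e * m n.+1 i' j' + tree_const * \int[mu2]_(q in cell a b n.+1 i' j') W q.
  by move=> ei ej hi' hj'; apply: IH => //=; rewrite ei ej.
have lt1 k : (k < 2 ^ n)%N -> (k.*2 < 2 ^ n.+1)%N by rewrite expnS mul2n ltn_double.
have lt2 k : (k < 2 ^ n)%N -> (k.*2.+1 < 2 ^ n.+1)%N by rewrite expnS mul2n ltn_Sdouble.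
have E1 := child i.*2 j.*2 (doubleK i) (doubleK j) (lt1 _ ci) (lt1 _ cj).
have E2 := child i.*2.+1 j.*2 (uphalf_double i) (doubleK j) (lt2 _ ci) (lt1 _ cj).
have E3 := child i.*2 j.*2.+1 (doubleK i) (uphalf_double j) (lt1 _ ci) (lt2 _ cj).
have E4 := child i.*2.+1 j.*2.+1 (uphalf_double i) (uphalf_double j) (lt2 _ ci) (lt2 _ cj).
have sum4 (x1 x2 x3 x4 y1 y2 y3 y4 z1 z2 z3 z4 : R) : `|x1 - y1| <= z1 -> `|x2 - y2| <= z2 -> `|x3 - y3| <= z3 -> `|x4 - y4| <= z4 ->
    `|x1 + x2 + (x3 + x4) - (y1 + y2 + (y3 + y4))| <= z1 + z2 + (z3 + z4).
  move=> g1 g2 g3 g4; have -> : x1 + x2 + (x3 + x4) - (y1 + y2 + (y3 + y4)) = (x1 - y1) + (x2 - y2) + ((x3 - y3) + (x4 - y4)) by ring.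
  apply: (le_trans (ler_normD _ _)); apply: lerD; apply: (le_trans (ler_normD _ _)); exact: lerD.
apply: (le_trans (sum4 _ _ _ _ _ _ _ _ _ _ _ _ E1 E2 E3 E4)).
set w1 := \int[_]_(_ in _) _; set w2 := \int[_]_(_ in _) _; set w3 := \int[_]_(_ in _) _; set w4 := \int[_]_(_ in _) _.
by rewrite le_eqVlt; apply/orP; left; apply/eqP; ring.
Qed.

(** [tree_err] at the root: its bound does not involve [d0], and the total mass [m 0 0 0] is fixed,
    so the oscillation term can be made arbitrarily small. *)
Lemma kernel_compare :
  (forall e, 0 < e -> exists d0, forall n i j q q', (d0 <= n)%N -> (i < 2 ^ n)%N -> (j < 2 ^ n)%N ->
     cell a b n i j q -> cell a b n i j q' -> `|K q - K q'| <= e) ->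
  `|L 0 0 0 - \int[mu2]_(q in Q0) (K q * G q)| <= tree_const * \int[mu2]_(q in Q0) (pkernel dl p q * \1_T q).
Proof.
move=> osc.
have -> : \int[mu2]_(q in Q0) (pkernel dl p q * \1_T q) = \int[mu2]_(q in Q0) W q.
  by apply: eq_Rintegral => q; rewrite inE => qc; rewrite /W patchE mem_set.
apply/ler_addgt0Pl => e e0.
pose e' := e / (2 * (m 0 0 0 + 1)).
have m1 : 0 < m 0 0 0 + 1 by rewrite ltr_wpDl// limit_ge0.
have e'0 : 0 < e' by rewrite divr_gt0// mulr_gt0.
have [d0 H] := osc e' e'0.
have := @tree_err d0 e' (ltW e'0) H d0 0 0 0 isT isT; rewrite addn0 leqnn => /(_ isT isT)/le_trans; apply.
rewrite lerD2r.
have -> : e = 2 * e' * (m 0 0 0 + 1) by rewrite /e'; field; rewrite gt_eqF.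
by rewrite ler_wpM2l ?lerDl// mulr_ge0// ltW.
Qed.
End Comparison.

Lemma tree_const_ge0 {R : realType} (C s : R) : 0 <= C -> 0 <= s -> 0 <= tree_const s C.
Proof.
move=> C0 s0; have cp : 0 <= cmp_const :> R by rewrite /cmp_const exprn_ge0.
have c8 : 0 <= 8 * cmp_const * cmp_const :> R by rewrite mulr_ge0// mulr_ge0.
by rewrite /tree_const (mulr_ge0 (mulr_ge0 c8 C0) s0).
Qed.

(** * Limits of nonnegative families bounded in L^1 *)

Section FatouFamily.
Context {R : realType}.
Notation V3 := 'rV[R]_3.
Notation mu2 := (@leb2 R).
Notation D := (@param_rect R).
Notation aa := (pi : R).
Notation bb := (2 * pi : R).
Notation Q0 := (cell aa bb 0 0 0).

Let a0 : 0 < aa. Proof. exact: pi_gt0. Qed.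
Let b0 : 0 < bb. Proof. exact: twopi_gt0. Qed.

(** Cells are half-open while the chart lives on the open rectangle; the two sides in between are
    null. *)
Lemma Q0_minus_rect : mu2 (Q0 `\` D) = 0%E.
Proof.
have mD := @measurable_param_rect R; have mQ := @mQpi R.
have DE : D = `]0, aa[%classic `*` `]0, bb[%classic.
  by apply/seteqP; split=> p /=; rewrite !in_itv.
have D1 : mu2 D = (aa * bb)%:E.
  rewrite DE /leb2 product_measure1E; [|exact: measurable_itv|exact: measurable_itv].
  have Lc (c : R) : 0 < c -> lebesgue_measure `]0, c[%classic = c%:E.
    by move=> c0; rewrite lebesgue_measure_itv /= lte_fin c0 -EFinB subr0.
  by rewrite EFinM; congr (_ * _)%E; exact: Lc.
have Q1 : mu2 Q0 = (aa * bb)%:E.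
  by have := leb2_cell a0 b0 0 0 0; rewrite /leb2 => ->; rewrite /area expr0 divr1.
have DQ : Q0 `&` D = D by apply/setIidPr; exact: param_rect_Q0.
have Qf : (mu2 Q0 < +oo)%E by exact: leb2_Q0.
have E : mu2 (Q0 `\` D) = (mu2 Q0 - mu2 (Q0 `&` D))%E by apply: measureD.
by rewrite E DQ Q1 D1 -EFinB subrr.
Qed.

Lemma Rint_Q0_rect (f : R * R -> R) : mu2.-integrable setT (EFin \o f) ->
  \int[mu2]_(q in Q0) f q = \int[mu2]_(q in D) f q.
Proof.
move=> fi; have mD := @measurable_param_rect R; have mQ := @mQpi R.
have mS : measurable (Q0 `\` D) by exact: measurableD.
have fS A : measurable A -> mu2.-integrable A (EFin \o f) by move=> mA; apply: (integrable_cellS mA measurableT).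
have QE : Q0 = D `|` (Q0 `\` D) 
  by apply/seteqP; split=> [x Qx|x [Dx|[]]//]; [have [Dx|nDx] := pselect (D x); [left|right]|exact: param_rect_Q0].
have dj : [disjoint D & Q0 `\` D] by apply/disj_setPS => x [Dx [_ nDx]].
rewrite QE Rintegral_setU//; last by apply: fS; rewrite -QE.
rewrite [X in _ + X](_ : _ = 0) ?addr0// /Rintegral null_set_integral//.
  by have /integrableP[] := fS _ mS.
exact: Q0_minus_rect.
Qed.

Variables (U : set_system nat) (UU : UltraFilter U) (sU : (\oo : set_system nat) `<=` U).

(** Uniform continuity by contradiction: along [U] the two points of the offending pairs converge to
    one and the same point of the plane, where [K] is continuous. This point may lie outside the
    half-open root. *)
Lemma cells_osc (K : R * R -> R) : continuous K -> forall e, 0 < e -> exists d0, forall n i j q q', (d0 <= n)%N ->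
  (i < 2 ^ n)%N -> (j < 2 ^ n)%N -> cell aa bb n i j q -> cell aa bb n i j q' -> `|K q - K q'| <= e.
Proof.
move=> cK e e0; apply: contrapT => H.
have H' d : exists qq : (R * R) * (R * R), [/\ Q0 qq.1, `|qq.1.1 - qq.2.1| <= aa / 2 ^+ d,
    `|qq.1.2 - qq.2.2| <= bb / 2 ^+ d & e < `|K qq.1 - K qq.2|].
  apply: contrapT => Hd; apply: H; exists d => n i j q q' dn hi hj qc qc'.
  rewrite leNgt; apply/negP => he; apply: Hd; exists (q, q') => /=.
  have pw (c : R) : 0 < c -> c / 2 ^+ n <= c / 2 ^+ d.
    by move=> c0; rewrite ler_pM2l// lef_pV2 ?posrE ?exprn_gt0// ler_weXn2l// ler1n.
  have t0 : 0 < (2 : R) ^- n by rewrite invr_gt0 exprn_gt0.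
  split => //; first exact: (sub_cell0 a0 b0 hi hj qc).
    apply: le_trans (pw _ a0); move: qc.1 qc'.1 => /=; rewrite !in_itv /= -[i.+1%:R]natr1 ler_norml.
    by set t := 2 ^- n => /andP[u1 u2] /andP[u3 u4]; apply/andP; split; lra.
  apply: le_trans (pw _ b0); move: qc.2 qc'.2 => /=; rewrite !in_itv /= -[j.+1%:R]natr1 ler_norml.
  by set t := 2 ^- n => /andP[u1 u2] /andP[u3 u4]; apply/andP; split; lra.
have [f fH] := choice H'.
have FU : Filter U by exact: _.
have fQ d : 0 <= (f d).1.1 < aa /\ 0 <= (f d).1.2 < bb by have [h _ _ _] := fH d; exact/(cell0P aa bb).
have [x1 c1] : exists x : R, (fun d => (f d).1.1) @ U --> x.
  by apply: (@ultra_cvg R nat U UU _ aa) => d; have [/andP[h1 h2] _] := fQ d; rewrite ger0_norm// ltW.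
have [x2 c2] : exists x : R, (fun d => (f d).1.2) @ U --> x.
  by apply: (@ultra_cvg R nat U UU _ bb) => d; have [_ /andP[h1 h2]] := fQ d; rewrite ger0_norm// ltW.
have gz (c : R) : (fun d : nat => c / 2 ^+ d) @ U --> (0 : R).
  have h : geometric c (2^-1 : R) @ \oo --> (0 : R) by apply: cvg_geometric; rewrite ger0_norm ?invf_lt1 ?ltr1n.
  rewrite (_ : (fun d : nat => c / 2 ^+ d) = geometric c 2^-1); last by apply/funext => d; rewrite /geometric /= exprVn.
  by move=> A nA; apply: sU; exact: h.
have near_eq (g g' : nat -> R) (c x : R) : g @ U --> x -> (forall d, `|g d - g' d| <= c / 2 ^+ d) -> g' @ U --> x.
  move=> gx gg; apply/cvgrPdist_lt => eps eps0.
  have e2 : 0 < eps / 2 by rewrite divr_gt0.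
  have /cvgrPdist_lt/(_ _ e2) h1 := gx; have /cvgrPdist_lt/(_ _ e2) h2 := gz c.
  apply: filterS2 h1 h2 => d k1 k2; rewrite sub0r normrN in k2.
  have k3 := le_lt_trans (le_trans (gg d) (ler_norm _)) k2.
  have -> : x - g' d = (x - g d) + (g d - g' d) by ring.
  by apply: (le_lt_trans (ler_normD _ _)); lra.
have c1' : (fun d => (f d).2.1) @ U --> x1 by apply: near_eq c1 _ => d; have [_ h _ _] := fH d; exact: h.
have c2' : (fun d => (f d).2.2) @ U --> x2 by apply: near_eq c2 _ => d; have [_ _ h _] := fH d; exact: h.
have p1 : (fun d => K (f d).1) @ U --> K (x1, x2).
  have h : (fun d => ((f d).1.1, (f d).1.2)) @ U --> (x1, x2) by exact: (cvg_pair c1 c2).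
  have := cvg_comp _ _ h (cK (x1, x2)).
  by rewrite (_ : _ \o _ = fun d => K (f d).1)//; apply/funext => d /=; rewrite -surjective_pairing.
have p2 : (fun d => K (f d).2) @ U --> K (x1, x2).
  have h : (fun d => ((f d).2.1, (f d).2.2)) @ U --> (x1, x2) by exact: (cvg_pair c1' c2').
  have := cvg_comp _ _ h (cK (x1, x2)).
  by rewrite (_ : _ \o _ = fun d => K (f d).2)//; apply/funext => d /=; rewrite -surjective_pairing.
have e2 : 0 < e / 2 by rewrite divr_gt0.
have /cvgrPdist_lt/(_ _ e2) h1 := p1; have /cvgrPdist_lt/(_ _ e2) h2 := p2.
have [d [k1 k2]] := filter_ex (filterI h1 h2).
have [_ _ _ k3] := fH d.
have : `|K (f d).1 - K (f d).2| <= `|K (x1, x2) - K (f d).2| + `|K (x1, x2) - K (f d).1|.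
  rewrite (_ : K (f d).1 - K (f d).2 = (K (x1, x2) - K (f d).2) - (K (x1, x2) - K (f d).1)); last by ring.
  exact: ler_normB.
by move: k1 k2 k3 => /=; lra.
Qed.

Variables lam mu : R.
Hypotheses (mu0 : 0 < mu) (lm0 : 0 < 2 * mu + lam).
Variables (h : nat -> R * R -> R) (M : R).
Hypotheses (h0 : forall k q, 0 <= h k q) (hi : forall k, mu2.-integrable setT (EFin \o h k)).
Hypothesis hM : forall k, \int[mu2]_q h k q <= M.

Let M0 : 0 <= M.
Proof. by apply: le_trans (hM 0%N); apply: fine_ge0; apply: integral_ge0 => q _; rewrite lee_fin. Qed.

Let hAM A k : measurable A -> 0 <= \int[mu2]_(q in A) h k q <= M.
Proof.
move=> mA; apply/andP; split; first by apply: fine_ge0; apply: integral_ge0 => q _; rewrite lee_fin.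
apply: le_trans (hM k); have mAc : measurable (~` A) by exact: measurableC.
have dj : [disjoint A & ~` A] by apply/disj_setPS => x [].
have fS B : measurable B -> mu2.-integrable B (EFin \o h k) by move=> mB; apply: (integrable_cellS mB measurableT).
have E : \int[mu2]_(q in A `|` ~` A) h k q = \int[mu2]_(q in A) h k q + \int[mu2]_(q in ~` A) h k q.
  by apply: Rintegral_setU => //; apply: fS; exact: measurableU.
rewrite setUv in E; rewrite E lerDl.
by apply: fine_ge0; apply: integral_ge0 => q _; rewrite lee_fin.
Qed.

Let dev0 (A : set (R * R)) (K f : R * R -> R) (B : R) : measurable A -> measurable_fun setT K -> (forall q, `|K q| <= B) ->
  mu2.-integrable setT (EFin \o f) -> (forall q, 0 <= f q) ->
  `|\int[mu2]_(q in A) (K q * f q)| <= B * \int[mu2]_(q in A) f q.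
Proof.
move=> mA mK KB fi f0.
have fA : mu2.-integrable A (EFin \o f) by apply: (integrable_cellS mA measurableT).
have mKA : measurable_fun A K by apply: measurable_funTS.
have H : `|\int[mu2]_(q in A) (K q * f q) - 0 * \int[mu2]_(q in A) f q| <= B * \int[mu2]_(q in A) f q.
  apply: (@weighted_dev _ _ _ mu2 A K f B) => // q _; by rewrite subr0.
by rewrite mul0r subr0 in H.
Qed.

(** Quantifying over every limit [l] along [U] avoids presupposing that the limit exists at [x]; one
    value [g] serves all pairs [i], [j]. *)
Definition ultra_nt_limit (p : R * R) : Prop := exists g : R, forall i j e, 0 < e ->
  exists2 dl : R, 0 < dl & forall x, Gamma (sph p) x -> enorm3 (x - sph p) < dl ->
  forall l : R, (fun k => \int[mu2]_(q in D) (Pe lam mu x (sph q) i j * h k q)) @ U --> l ->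
  `|l - (i == j)%:R * g| <= e.

(** At a Lebesgue point of the indicator of [T] outside [T], the set has density 0, so
    [pkernel_lpoint] makes the error in [kernel_compare] small. The main term is the integral
    against [G], settled by [Pe_lpoint]. *)
Lemma good_point (m : nat -> nat -> nat -> R) (s : R) (T : set (R * R)) (G : R * R -> R) p :
  (forall n i j, (fun k => \int[mu2]_(q in cell aa bb n i j) h k q) @ U --> m n i j) ->
  0 < s -> m 0 0 0 <= s * area aa bb 0 -> measurable T ->
  (forall n i j p, (i < 2 ^ n)%N -> (j < 2 ^ n)%N -> tcell aa bb n i j p -> ~ T p -> m n i j <= s * area aa bb n) ->
  measurable_fun setT G -> (forall q, 0 <= G q) -> mu2.-integrable setT (EFin \o G) ->
  (forall n i j, (i < 2 ^ n)%N -> (j < 2 ^ n)%N -> \int[mu2]_(q in cell aa bb n i j) G q = stopped aa bb m s n i j) ->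
  D p -> ~ T p -> lpoint aa bb G p -> lpoint aa bb (\1_T : R * R -> R) p -> lpoint aa bb (@sigma_jac R) p ->
  ultra_nt_limit p.
Proof.
move=> mlim s0 root_ok mT Tbad mG G0 Gi GE Dp nTp lG lT lj.
exists (G p / sigma_jac p) => i j e e0.
have [C C0 HC] := Pe_nt_bound mu0 lm0 Dp.
have e20 : 0 < e / 2 by rewrite divr_gt0.
have GiQ : mu2.-integrable Q0 (EFin \o G) by apply: (integrable_cellS (@mQpi R) measurableT).
have [dl1 dl10 H1] := Pe_lpoint mu0 lm0 mG GiQ Dp lG lj e20.
have tc0 : 0 <= tree_const s C by apply: tree_const_ge0 => //; exact: ltW.
have tc1 : 0 < tree_const s C + 1 by rewrite ltr_wpDl.
have m1T : measurable_fun setT (\1_T : R * R -> R) by exact: measurable_indic.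
have p1T q : 0 <= (\1_T q : R) by [].
have f1T : (\int[mu2]_(q in Q0) (\1_T q)%:E < +oo)%E.
  have [I1 I2] : mu2.-integrable Q0 (EFin \o (\1_T : R * R -> R)) /\ True.
    split => //; apply: (@integrable_bnd _ _ _ _ _ _ 1) => //;
    by [exact: mQpi|exact: leb2_Q0|exact: measurable_funTS|move=> q _; rewrite indicE; case: (q \in T); rewrite ?normr1 ?normr0].
  have /integrableP[_] := I1; apply: le_lt_trans; apply: ge0_le_integral => //.
  - exact: mQpi.
  - by apply/measurable_EFinP; exact: measurable_funTS.
  - by apply: measurableT_comp => //; apply/measurable_EFinP; exact: measurable_funTS.
  - by move=> q _; rewrite lee_fin; exact: ler_norm.
have lT' : forall e : R, 0 < e -> exists2 d : R, 0 < d & forall r, 0 < r -> r < d ->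
    (\int[mu2]_(q in bx p r `&` Q0) (\1_T q)%:E <= (e * r ^+ 2)%:E)%E.
  move=> e' e'0; have [d d0 Hd] := lT e' e'0; exists d => // r r0 rd.
  apply: le_trans (Hd r r0 rd); rewrite le_eqVlt; apply/orP; left; apply/eqP.
  apply: eq_integral => q _; congr EFin; rewrite (_ : \1_T p = 0) ?subr0 ?ger0_norm//.
  by rewrite indicE memNset.
have e3 : 0 < e / 2 / (tree_const s C + 1) by rewrite divr_gt0.
have [dl2 dl20 H2] := pkernel_lpoint m1T p1T f1T lT' e3.
exists (Num.min dl1 dl2); first by rewrite lt_min dl10.
move=> x Gx; rewrite lt_min => /andP[x1 x2] l Ll.
have [d0 dd] := Gamma_depth (enorm3_sph p) Gx x2.
have xb : enorm3 x < 1 by rewrite -subr_gt0.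
have [B B0 [mP bP]] := bmeas_Pe mu0 lm0 i j xb.
pose K (q : R * R) : R := Pe lam mu x (sph q) i j.
have mK : measurable_fun setT K by exact: mP.
have bK q : `|K q| <= B by exact: bP.
have Kih k : mu2.-integrable setT (EFin \o (fun q => K q * h k q)) by apply: (integrable_mul_bnd (K := B)).
have KiG : mu2.-integrable setT (EFin \o (fun q => K q * G q)) by apply: (integrable_mul_bnd (K := B)).
have Lex n' i' j' : exists l' : R, (fun k => \int[mu2]_(q in cell aa bb n' i' j') (K q * h k q)) @ U --> l'.
  apply: (@ultra_cvg R nat U UU _ (B * M)) => k.
  have mc : measurable (cell aa bb n' i' j') by exact: measurable_cell.
  have Hd : `|\int[mu2]_(q in cell aa bb n' i' j') (K q * h k q)| <= B * \int[mu2]_(q in cell aa bb n' i' j') h k q.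
    by apply: dev0.
  apply: (le_trans Hd); rewrite ler_wpM2l//.
  have : 0 <= \int[mu2]_(q in cell aa bb n' i' j') h k q <= M by exact: hAM.
  by case/andP.
pose L n' i' j' : R := projT1 (cid (Lex n' i' j')).
have Llim n' i' j' : (fun k => \int[mu2]_(q in cell aa bb n' i' j') (K q * h k q)) @ U --> L n' i' j'.
  by rewrite /L; case: cid.
have lE : l = L 0%N 0%N 0%N.
  apply: (ultra_lim_unique UU Ll).
  rewrite (_ : (fun k => _) = (fun k => \int[mu2]_(q in cell aa bb 0 0 0) (K q * h k q))); first exact: Llim.
  by apply/funext => k; rewrite -Rint_Q0_rect.
have KC q : Q0 q -> `|K q| <= C * pkernel (1 - enorm3 x) p q.
  move=> /(cell0P aa bb) [/andP[q1 q2] /andP[q3 q4]]; apply: HC => //.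
    by rewrite q1 ltW.
  by rewrite q3 ltW.
have ab : aa <= bb by rewrite ler_peMl ?ler1n// ltW.
have osc : forall e, 0 < e -> exists d0, forall n i j q q', (d0 <= n)%N -> (i < 2 ^ n)%N -> (j < 2 ^ n)%N ->
    cell aa bb n i j q -> cell aa bb n i j q' -> `|K q - K q'| <= e.
  by apply: cells_osc; exact: cvg_Pe.
have bb2 : bb <= 2 * aa by [].
have cmp : `|L 0%N 0%N 0%N - \int[mu2]_(q in Q0) (K q * G q)| <=
    tree_const s C * \int[mu2]_(q in Q0) (pkernel (1 - enorm3 x) p q * \1_T q).
  exact: (kernel_compare a0 b0 ab bb2 UU h0 hi mlim s0 root_ok mT Tbad G0 Gi GE mK bK C0 d0 KC nTp Llim osc).
rewrite -lE (Rint_Q0_rect KiG) in cmp.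
have h1 := H1 x i j Gx x1.
have h2 : \int[mu2]_(q in Q0) (pkernel (1 - enorm3 x) p q * \1_T q) <= e / 2 / (tree_const s C + 1).
  have := H2 _ d0 dd; rewrite -[X in (X <= _)%E]fineK ?lee_fin//.
  rewrite ge0_fin_numE; last by apply: integral_ge0 => q _; rewrite lee_fin mulr_ge0// pkernel_ge0// ltW.
  by apply: le_lt_trans (H2 _ d0 dd) _; rewrite ltry.
have h3 : tree_const s C * \int[mu2]_(q in Q0) (pkernel (1 - enorm3 x) p q * \1_T q) <= e / 2.
  apply: (@le_trans _ _ (tree_const s C * (e / 2 / (tree_const s C + 1)))); first by rewrite ler_wpM2l.
  by rewrite mulrCA ler_piMr ?(ltW e20)// ler_pdivrMr// mul1r lerDl.
have -> : l - (i == j)%:R * (G p / sigma_jac p) = (l - \int[mu2]_(q in D) (K q * G q)) +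
   (\int[mu2]_(q in D) (K q * G q) - (i == j)%:R * (G p / sigma_jac p)) by ring.
apply: (le_trans (ler_normD _ _)).
by apply: (le_trans (lerD (le_trans cmp h3) h1)); rewrite -splitr.
Qed.

(** For each threshold [s] the exceptional points lie in [T] up to a null set, and the area of [T]
    is at most [9 M / s]; letting [s] grow leaves a null set. *)
Lemma ae_ultra_nt_limit : {ae mu2, forall p, D p -> ultra_nt_limit p}.
Proof.
have mex n i j : exists l : R, (fun k => \int[mu2]_(q in cell aa bb n i j) h k q) @ U --> l.
  apply: (@ultra_cvg R nat U UU _ M) => k.
  have : 0 <= \int[mu2]_(q in cell aa bb n i j) h k q <= M by apply: hAM; exact: measurable_cell.
  by case/andP => k1 k2; rewrite ger0_norm.
pose m n i j : R := projT1 (cid (mex n i j)).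
have mlim n i j : (fun k => \int[mu2]_(q in cell aa bb n i j) h k q) @ U --> m n i j by rewrite /m; case: cid.
have m0 : forall n i j, 0 <= m n i j := limit_ge0 UU h0 mlim.
have madd : additive4 m := limit_additive a0 b0 UU hi mlim.
have mM : m 0%N 0%N 0%N <= M.
  have cM : (fun _ : nat => M) @ U --> M by exact: cvg_cst.
  apply: (@ultra_lim_le R nat U UU _ _ _ _ _ (mlim 0%N 0%N 0%N) cM) => k.
  have : 0 <= \int[mu2]_(q in cell aa bb 0 0 0) h k q <= M by apply: hAM; exact: measurable_cell.
  by case/andP.
have ar := area_gt0 a0 b0 0.
have M1 : 0 < M + 1 by rewrite ltr_wpDl.
apply: (@negligible_lim R _ (9 * area aa bb 0)) => n.
(* [M + 1] keeps the threshold positive and the root good; the factor [2^n] brings the area of [T]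
   below [9 area / 2^n]. *)
pose s := (M + 1) / area aa bb 0 * 2 ^+ n.
have p1 : 1 <= (2 : R) ^+ n by rewrite exprn_ege1// ler1n.
have p0 : 0 < (2 : R) ^+ n by rewrite exprn_gt0.
have s0 : 0 < s by rewrite mulr_gt0// divr_gt0.
have sE : s * area aa bb 0 = (M + 1) * 2 ^+ n by rewrite /s; field; rewrite gt_eqF.
have root_ok : m 0%N 0%N 0%N <= s * area aa bb 0.
  rewrite sE; apply: (le_trans mM); apply: (@le_trans _ _ (M + 1)); first by rewrite lerDl.
  by rewrite ler_peMr// ltW.
have [T [mT T1 Tbad]] := maximal_set a0 b0 m0 madd s0.
have [G [mG G0 Gi GE]] := stopped_density a0 b0 m0 madd s0 root_ok.
have GiQ : mu2.-integrable Q0 (EFin \o G) by apply: (integrable_cellS (@mQpi R) measurableT).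
have ae1 := @ae_lpoint_L1 R aa bb a0 b0 G mG GiQ.
have ae2 := @ae_lpoint_indic R aa bb a0 b0 T mT.
have [A [mA A0 sA]] := ae_and ae1 (ae_and ae2 (@ae_lpoint_jac R)).
exists (T `|` A); split; first exact: measurableU.
  move=> p np; have [Tp|nTp] := pselect (T p); [by left|right].
  apply: sA => /= -[q1 [q2 q3]]; apply: np => Dp; have Qp := param_rect_Q0 Dp.
  exact: (good_point mlim s0 root_ok mT Tbad mG G0 Gi GE Dp nTp (q1 Qp) (q2 Qp) (q3 Qp)).
apply: (@le_trans _ _ (mu2 T + mu2 A)%E); first exact: measureU2.
have -> : mu2 A = 0%E by exact: A0.
rewrite adde0; apply: (le_trans T1); rewrite lee_fin.
have -> : 9 / s * m 0%N 0%N 0%N = 9 * area aa bb 0 / 2 ^+ n * (m 0%N 0%N 0%N / (M + 1)).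
  by rewrite /s; field; rewrite !gt_eqF.
rewrite ler_piMr//.
  by rewrite divr_ge0 ?mulr_ge0// ltW.
by rewrite ler_pdivrMr// mul1r; apply: (le_trans mM); rewrite lerDl.
Qed.
End FatouFamily.

(** * Boundary limits of solutions in h^1 *)

Section FatouTheorem.
Context {R : realType}.
Notation V3 := 'rV[R]_3.
Notation mu2 := (@leb2 R).
Notation D := (@param_rect R).
Variables lam mu : R.
Hypotheses (mu0 : 0 < mu) (lm0 : 0 < 2 * mu + lam).

Lemma posneg (x : R) : x = Num.max x 0 - Num.max (- x) 0.
Proof. by rewrite /Num.max; case: ltP => h; case: ltP => h'; move: h h'; lra. Qed.

Section Boundary.
Variables (u : V3 -> V3) (M : R).
Hypothesis (uL : lame_solution lam mu u).
Hypothesis uM : forall r : R, 0 <= r < 1 -> (sint_e (fun eta => (enorm3 (u (r *: eta)) `^ 1)%R) <= M%:E)%E.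

(** [k + 2] keeps the radius positive at [k = 0]. *)
Definition radius (k : nat) : R := 1 - k.+2%:R^-1.

Lemma radius_bnd k : 0 < radius k < 1.
Proof.
rewrite /radius subr_gt0 invf_lt1 ?ltr0n// ltr1n /=.
by rewrite ltrBlDr ltrDl invr_gt0 ltr0n.
Qed.

Lemma radius_cvg : radius @ \oo --> (1 : R).
Proof.
have h : (fun k : nat => k.+2%:R^-1 : R) @ \oo --> (0 : R).
  apply: (squeeze_cvgr _ (cvg_cst 0) (@cvg_harmonic R)).
  by near=> k; rewrite invr_ge0 ler0n /= lef_pV2 ?posrE ?ltr0n// ler_nat.
have c1 : (fun _ : nat => 1 : R) @ \oo --> (1 : R) by exact: cvg_cst.
have FN : Filter (\oo : set_system nat) by exact: _.
have H := @cvg_lin R nat \oo FN _ _ _ _ 1 (-1) c1 h.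
rewrite mul1r mulr0 addr0 in H; apply: (@cvg_near_eq R nat \oo FN _ _ _ _ H).
by near=> k; rewrite /radius /= mulN1r.
Unshelve. all: by end_near. Qed.

Lemma bmeas_dilate k j : exists B, bmeas (fun eta => u (radius k *: eta) 0 j) B.
Proof.
have /andP[r0 r1] := radius_bnd k; have [uC _] := uL.
have h : CkB 2 (radius k)^-1 (fun x => u (radius k *: x) 0 j) by exact: (CkB_scale r0 (C2_ball_CkB j uC)).
by apply: (CkB_bmeas _ h); rewrite invf_gt1.
Qed.

(** For [sg = 1] and [sg = -1] these are the positive and negative parts of a component of [u] on
    the sphere of radius [radius k], times the Jacobian and extended by zero. *)
Definition trace (sg : R) (j : 'I_3) (k : nat) : R * R -> R :=
  patch (cst 0) D (fun q => Num.max (sg * u (radius k *: sph q) 0 j) 0 * sigma_jac q).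

Lemma trace_ge0 sg j k q : 0 <= trace sg j k q.
Proof.
rewrite /trace patchE; case: ifPn => // /set_mem Dq.
by rewrite mulr_ge0 ?le_max ?lexx ?orbT// ltW// sigma_jac_gt0.
Qed.

Lemma measurable_posp sg j k : measurable_fun setT (fun q : R * R => Num.max (sg * u (radius k *: sph q) 0 j) 0).
Proof.
have [B [mB bB]] := bmeas_dilate k j.
by apply: measurable_maxr => //; apply: measurable_funM.
Qed.

Lemma integrable_trace_rect sg j k :
  mu2.-integrable D (EFin \o (fun q => Num.max (sg * u (radius k *: sph q) 0 j) 0 * sigma_jac q)).
Proof.
have [B [mB bB]] := bmeas_dilate k j.
apply: (@integrable_sint R _ (`|sg| * B)); first exact: measurable_posp.
move=> q; apply: (@le_trans _ _ (`|sg * u (radius k *: sph q) 0 j|)).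
  by rewrite ger0_norm ?le_max ?lexx ?orbT// ge_max ler_norm normr_ge0.
by rewrite normrM ler_wpM2l.
Qed.

Lemma integrable_trace sg j k : mu2.-integrable setT (EFin \o trace sg j k).
Proof. by apply: integrable_patch; [exact: measurable_param_rect|exact: integrable_trace_rect]. Qed.

Lemma trace_rect sg j k q : D q -> trace sg j k q = Num.max (sg * u (radius k *: sph q) 0 j) 0 * sigma_jac q.
Proof. by move=> Dq; rewrite /trace patchE mem_set. Qed.

Lemma trace_mass sg j k : `|sg| = 1 -> \int[mu2]_q trace sg j k q <= M.
Proof.
move=> sg1; have /andP[r0 r1] := radius_bnd k; have mD := @measurable_param_rect R.
have -> : \int[mu2]_q trace sg j k q = \int[mu2]_(q in D) (Num.max (sg * u (radius k *: sph q) 0 j) 0 * sigma_jac q).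
  rewrite /Rintegral [in RHS]integral_mkcond; congr fine; apply: eq_integral => q _.
  by rewrite /trace !patchE; case: ifP.
have j0 p : D p -> 0 <= sigma_jac p by move=> Dp; exact: ltW (sigma_jac_gt0 Dp).
have mj : measurable_fun D (@sigma_jac R) by apply: measurable_funTS; exact: measurable_jac.
have mn : measurable_fun D (fun p => enorm3 (u (radius k *: sph p))).
  apply: (measurableT_comp (f := @Num.sqrt R)).
    by apply: continuous_measurable_fun; exact: sqrt_continuous.
  rewrite /dot3; apply: measurable_sum => i; have [B [mB _]] := bmeas_dilate k i.
  by apply: measurable_funM; exact: measurable_funTS.
have mpw : measurable_fun D (fun p => enorm3 (u (radius k *: sph p)) `^ 1).
  exact: (measurableT_comp (@measurable_powR R 1) mn).
have H : (\int[mu2]_(q in D) (Num.max (sg * u (radius k *: sph q) 0 j) 0 * sigma_jac q)%:E <= M%:E)%E.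
  have rb : 0 <= radius k < 1 by rewrite (ltW r0).
  have u1 := uM rb.
  apply: le_trans u1; apply: ge0_le_integral => //.
  - by move=> q Dq; rewrite lee_fin mulr_ge0 ?j0// le_max lexx orbT.
  - by apply/measurable_EFinP; apply: measurable_funM => //; apply: measurable_funTS; exact: measurable_posp.
  - by apply/measurable_EFinP; exact: measurable_funM.
  - move=> q Dq; rewrite lee_fin ler_wpM2r ?j0// powRr1 ?enorm3_ge0//.
    rewrite ge_max enorm3_ge0 andbT; apply: (le_trans (ler_norm _)).
    by rewrite normrM sg1 mul1r; exact: coord_le_enorm3.
have fin : (\int[mu2]_(q in D) (Num.max (sg * u (radius k *: sph q) 0 j) 0 * sigma_jac q)%:E)%E \is a fin_num.
  rewrite ge0_fin_numE; first by apply: le_lt_trans H _; rewrite ltry.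
  by apply: integral_ge0 => q Dq; rewrite lee_fin mulr_ge0 ?j0// le_max lexx orbT.
by rewrite -lee_fin /Rintegral fineK.
Qed.

Variables (U : set_system nat) (UU : UltraFilter U) (sU : (\oo : set_system nat) `<=` U).

Lemma dilate_rep k x i : enorm3 x < 1 -> u (radius k *: x) 0 i =
  \sum_j (\int[mu2]_(q in D) (Pe lam mu x (sph q) i j * trace 1 j k q) -
          \int[mu2]_(q in D) (Pe lam mu x (sph q) i j * trace (-1) j k q)).
Proof.
move=> x1; rewrite (lame_solution_rep mu0 lm0 uL (radius_bnd k) i x1).
apply: eq_bigr => j _.
have [B B0 [mP bP]] := bmeas_Pe mu0 lm0 i j x1; have mD := @measurable_param_rect R.
have it sg : mu2.-integrable D (EFin \o (fun q => Pe lam mu x (sph q) i j * trace sg j k q)).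
  apply: (@integrable_mul_bnd _ _ _ _ _ _ _ B) => //; first by apply: measurable_funTS.
  exact: (integrable_cellS mD measurableT _ (integrable_trace sg j k)).
rewrite -RintegralB//; apply: eq_Rintegral => q; rewrite inE => Dq.
rewrite !trace_rect// mul1r mulN1r {1}(posneg (u (radius k *: sph q) 0 j)); ring.
Qed.

Lemma dilate_cvg x i : enorm3 x < 1 -> (fun k => u (radius k *: x) 0 i) @ U --> u x 0 i.
Proof.
move=> x1; have [uC _] := uL; have cu := CkB_cont (C2_ball_CkB i uC) x1.
have h : (fun k => u (radius k *: x) 0 i) @ \oo --> u x 0 i.
  have c1 : (fun k => radius k *: x) @ \oo --> 1 *: x by apply: cvgZ; [exact: radius_cvg|exact: cvg_cst].
  by rewrite scale1r in c1; exact: (cvg_comp _ _ c1 cu).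
by move=> A nA; apply: sU; exact: h.
Qed.

(** [u x] is the limit of [u (radius k *: x)], and each of these is a kernel integral against
    traces. Splitting by component and sign leaves six limits, all controlled at [p], hence
    [e / 6]. *)
Lemma boundary_nt_limit (p : R * R) :
  (forall j, ultra_nt_limit U lam mu (trace 1 j) p) -> (forall j, ultra_nt_limit U lam mu (trace (-1) j) p) ->
  exists l, nt_limit u (sph p) l.
Proof.
move=> /choice[g1 H1] /choice[g2 H2].
exists (\row_i (g1 i - g2 i)); apply: nt_limitP => i e e0.
have e6 : 0 < e / 6 by rewrite divr_gt0.
have G (H : 'I_3 -> R -> Prop) : (forall j, exists2 d : R, 0 < d & forall d', d' <= d -> H j d') -> exists2 d, 0 < d & forall j, H j d.
  move=> h; have [d0 p0 k0] := h ord0; have [d1 p1 k1] := h (lift ord0 ord0); have [d2 p2 k2] := h (lift ord0 (lift ord0 ord0)).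
  exists (Num.min d0 (Num.min d1 d2)); first by rewrite !lt_min p0 p1.
  by apply: ord3P; [apply: k0|apply: k1|apply: k2]; rewrite !ge_min lexx ?orbT.
have [d1 d10 K1] := G (fun j d => forall x, Gamma (sph p) x -> enorm3 (x - sph p) < d -> forall l : R,
   (fun k => \int[mu2]_(q in D) (Pe lam mu x (sph q) i j * trace 1 j k q)) @ U --> l -> `|l - (i == j)%:R * g1 j| <= e / 6)
   (fun j => let: ex_intro2 d dp h := H1 j i j _ e6 in ex_intro2 _ _ d dp (fun d' dd x Gx xd => h x Gx (lt_le_trans xd dd))).
have [d2 d20 K2] := G (fun j d => forall x, Gamma (sph p) x -> enorm3 (x - sph p) < d -> forall l : R,
   (fun k => \int[mu2]_(q in D) (Pe lam mu x (sph q) i j * trace (-1) j k q)) @ U --> l -> `|l - (i == j)%:R * g2 j| <= e / 6)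
   (fun j => let: ex_intro2 d dp h := H2 j i j _ e6 in ex_intro2 _ _ d dp (fun d' dd x Gx xd => h x Gx (lt_le_trans xd dd))).
exists (Num.min d1 d2); first by rewrite lt_min d10.
move=> x Gx; rewrite lt_min => /andP[x1 x2]; rewrite mxE.
have xb : enorm3 x < 1 by case: Gx.
have lim_ex sg j : `|sg| = 1 -> exists l : R, (fun k => \int[mu2]_(q in D) (Pe lam mu x (sph q) i j * trace sg j k q)) @ U --> l.
  move=> sg1; have [B B0 [mP bP]] := bmeas_Pe mu0 lm0 i j xb; have mD := @measurable_param_rect R.
  apply: (@ultra_cvg R nat U UU _ (B * M)) => k.
  have iT := integrable_trace sg j k.
  have iD : mu2.-integrable D (EFin \o trace sg j k) by apply: (integrable_cellS mD measurableT).
  have mPD : measurable_fun D (fun q : R * R => Pe lam mu x (sph q) i j) by apply: measurable_funTS.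
  have W : `|\int[mu2]_(q in D) (Pe lam mu x (sph q) i j * trace sg j k q) - 0 * \int[mu2]_(q in D) trace sg j k q| <=
     B * \int[mu2]_(q in D) trace sg j k q.
    apply: (@weighted_dev _ _ _ mu2 D (fun q => Pe lam mu x (sph q) i j) (trace sg j k) B) => //; first exact: trace_ge0.
    by move=> q _; rewrite subr0.
  rewrite mul0r subr0 in W; apply: (le_trans W); rewrite ler_wpM2l//.
  rewrite (_ : \int[mu2]_(q in D) trace sg j k q = \int[mu2]_q trace sg j k q) ?trace_mass//.
  rewrite /Rintegral [in LHS]integral_mkcond; congr fine; apply: eq_integral => q _.
  by rewrite patchE /trace /= patchE; case: (q \in D).
have [l1 L1] := choice (fun j => lim_ex 1 j (normr1 _)).
have [l2 L2] := choice (fun j => lim_ex (-1) j ltac:(by rewrite normrN normr1)).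
have uE : u x 0 i = \sum_j (l1 j - l2 j).
  have dc : (fun k => u (radius k *: x) 0 i) @ U --> u x 0 i by exact: dilate_cvg.
  apply: (ultra_lim_unique UU dc).
  have FU : Filter U by exact: _.
  have C j := @cvg_lin R nat U FU _ _ _ _ 1 (-1) (L1 j) (L2 j).
  have C12 := @cvg_lin R nat U FU _ _ _ _ 1 1 (C (lift ord0 ord0)) (C (lift ord0 (lift ord0 ord0))).
  have C3 := @cvg_lin R nat U FU _ _ _ _ 1 1 (C ord0) C12.
  rewrite sum3E -addrA; rewrite !mul1r !mulN1r in C3.
  apply: (@cvg_near_eq R nat U FU _ _ _ _ C3).
  apply: (@filterS _ U FU setT); last exact: filterT.
  by move=> k _; rewrite dilate_rep// sum3E; ring.
have gE : g1 i - g2 i = \sum_j ((i == j)%:R * g1 j - (i == j)%:R * g2 j).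
  rewrite (bigD1 i)//= eqxx !mul1r big1 ?addr0// => j ji.
  by rewrite eq_sym (negPf ji) !mul0r subrr.
rewrite uE gE -sumrB; apply: (le_trans (ler_norm_sum _ _ _)).
apply: (@le_trans _ _ (\sum_(j < 3) (e / 3))); last by rewrite sum3E le_eqVlt; apply/orP; left; apply/eqP; field.
apply: ler_sum => j _.
have k1 := K1 j x Gx x1 _ (L1 j); have k2 := K2 j x Gx x2 _ (L2 j).
have -> : l1 j - l2 j - ((i == j)%:R * g1 j - (i == j)%:R * g2 j) =
   (l1 j - (i == j)%:R * g1 j) - (l2 j - (i == j)%:R * g2 j) by ring.
apply: (le_trans (ler_normB _ _)); move: k1 k2; lra.
Qed.
End Boundary.

Lemma nt_limit_h1 (u : V3 -> V3) : hpe lam mu 1%E u -> sigma_ae (fun xi => exists l, nt_limit u xi l).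
Proof.
move=> [uL [M uM]].
have [U [UU sU]] := @ultraFilterLemma nat \oo _.
have ae sg j : `|sg| = 1 -> {ae mu2, forall p, D p -> ultra_nt_limit U lam mu (trace u sg j) p}.
  move=> sg1; apply: (@ae_ultra_nt_limit R U UU sU lam mu mu0 lm0 _ M).
  - exact: trace_ge0.
  - by move=> k; exact: (integrable_trace uL).
  - by move=> k; exact: (trace_mass uL uM).
have n1 : `|1 : R| = 1 by exact: normr1.
have n2 : `|-1 : R| = 1 by rewrite normrN normr1.
have ae3 sg : `|sg| = 1 -> {ae mu2, forall p, D p -> forall j, ultra_nt_limit U lam mu (trace u sg j) p}.
  move=> sg1; apply: ae_imply (ae_and (ae sg ord0 sg1) (ae_and (ae sg (lift ord0 ord0) sg1) (ae sg (lift ord0 (lift ord0 ord0)) sg1))).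
  by move=> p [h0 [h1 h2]] Dp; apply: ord3P; [exact: h0|exact: h1|exact: h2].
apply: ae_sigma; apply: ae_imply (ae_and (ae3 1 n1) (ae3 (-1) n2)) => p [h1 h2] Dp.
exact: (boundary_nt_limit uL uM UU sU (h1 Dp) (h2 Dp)).
Qed.
End FatouTheorem.

Theorem mainTheorem6 (R : realType) (lam mu : R) :
  0 < mu -> 0 < 2 * mu + lam ->
  (* (1) Poisson integrals of L^1 data converge non-tangentially a.e. *)
  (forall f : 'rV[R]_3 -> 'rV[R]_3, L1S f ->
     sigma_ae (fun xi => nt_limit (Pe_int lam mu f) xi (f xi))) /\
  (* (2) in particular for u in h^p_e, 1 < p <= oo, u = P_e f, f in L^p *)
  (forall (p : \bar R) (u f : 'rV[R]_3 -> 'rV[R]_3),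
     (1 < p)%E -> hpe lam mu p u -> LpS p f ->
     (forall x, ball3 x -> u x = Pe_int lam mu f x) ->
     sigma_ae (fun xi => nt_limit u xi (f xi))) /\
  (* (3) every u in h^1_e has non-tangential limits a.e. *)
  (forall u : 'rV[R]_3 -> 'rV[R]_3, hpe lam mu 1%E u ->
     sigma_ae (fun xi => exists l, nt_limit u xi l)).
Proof.
move=> mu0 lm0; split; first exact: (nt_limit_L1 mu0 lm0).
split; last exact: (nt_limit_h1 mu0 lm0).
move=> p u f p1 _ fp uf.
apply: sigma_ae_imply (nt_limit_L1 mu0 lm0 (LpS_L1S p1 fp)) => xi.
exact: nt_limit_eq.
Qed.
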